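(* Let $N\ge2$, $T>0$, and $p\in(1,\infty)$ with conjugate exponent $q$. Let $W=(w^1,\dots,w^N)\in C^2(\mathbb{R}^N)^N$ and $M\in\mathbb{R}^{N\times N}$ be such that $$\big(x\mapsto W(x)-Mx\big)\in C^1_\sharp(Y_N)^N\quad\text{and}\quad\sigma:=\det(DW)>0\ \text{ in }\mathbb{R}^N,$$ and let $b\in C^1_\sharp(Y_N)^N$ be the periodic vector field defined by $$\sigma b:=R_\perp\nabla w^2\ \text{ if }N=2,\qquad \sigma b:=\nabla w^2\times\cdots\times\nabla w^N\ \text{ if }N\ge3.$$ Let $u_\varepsilon^0\in C^1(\mathbb{R}^N)$ be a bounded sequence in $L^p(\mathbb{R}^N)$. Define, for $\varepsilon>0$ and $x\in\mathbb{R}^N$, $$W_\varepsilon(x):=\varepsilon\,W\Big(\frac x\varepsilon\Big),\qquad b_\varepsilon(x):=b\Big(\frac x\varepsilon\Big),\qquad \sigma_\varepsilon(x):=\sigma\Big(\frac x\varepsilon\Big),$$ and write $W_\varepsilon=(w_\varepsilon^1,\dots,w_\varepsilon^N)$. Then the following hold. (1) $W_\varepsilon$, $b_\varepsilon$ (with $\sigma_\varepsilon$ and $u_\varepsilon^0$) satisfy all of the following conditions: (a) $W_\varepsilon\in C^1(\mathbb{R}^N)^N$, and for every compact $K\subset\mathbb{R}^N$ there is a compact $K'\subset\mathbb{R}^N$ with $W_\varepsilon^{-1}(K)\subset K'$ for every small enough $\varepsilon>0$; (b) there is $W_0\in C^1(\mathbb{R}^N)^N$ such that, as $\varepsilon\to0$,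 $W_\varepsilon\to W_0$ in $C^0_{\rm loc}(\mathbb{R}^N)^N$ and $W_\varepsilon\rightharpoonup W_0$ weakly in $W^{1,N}_{\rm loc}(\mathbb{R}^N)^N$; (c) $b_\varepsilon\in C^0_b(\mathbb{R}^N)^N\cap W^{1,q}_{\rm loc}(\mathbb{R}^N)^N$ has bounded divergence, $\sigma_\varepsilon\in C^0(\mathbb{R}^N)\cap W^{1,q}_{\rm loc}(\mathbb{R}^N)$, there is a constant $c>1$ independent of $\varepsilon$ with $c^{-1}\le\sigma_\varepsilon\le c$ in $\mathbb{R}^N$, and $\sigma_\varepsilon b_\varepsilon=R_\perp\nabla w_\varepsilon^2$ if $N=2$, $\sigma_\varepsilon b_\varepsilon=\nabla w_\varepsilon^2\times\cdots\times\nabla w_\varepsilon^N$ if $N\ge3$, in $\mathbb{R}^N$; (d) there is a positive function $\theta_0\in C^0(\mathbb{R}^N)$ such that $\theta_\varepsilon:=b_\varepsilon\cdot\nabla w_\varepsilon^1>0$ in $\mathbb{R}^N$ and $\theta_\varepsilon\to\theta_0$ strongly in $L^q_{\rm loc}(\mathbb{R}^N)$; (e) either $|\operatorname{div}b_\varepsilon|\le B$ a.e. in $\mathbb{R}^N$ for some constant $B>0$ independent of $\varepsilon$, or $b_\varepsilon\in C^1_b(\mathbb{R}^N)^N$, $\sigma_\varepsilon\in C^1(\mathbb{R}^N)$ and $u_\varepsilon^0\in C^1(\mathbb{R}^N)$. (2) Moreover, for any sequence $u_\varepsilon^0$ in $L^p(\mathbb{R}^N)$ such that $\sigma(x/\varepsilon)\,u_\varepsilon^0$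 converges weakly to $v^0$ in $L^p(\mathbb{R}^N)$, the solution $u_\varepsilon$ to $$\frac{\partial u_\varepsilon}{\partial t}-b_\varepsilon\cdot\nabla_xu_\varepsilon=0\ \text{ in }(0,T)\times\mathbb{R}^N,\qquad u_\varepsilon(0,\cdot)=u_\varepsilon^0\ \text{ in }\mathbb{R}^N,$$ is such that $\sigma(x/\varepsilon)\,u_\varepsilon$ converges weakly in $L^\infty(0,T;L^p(\mathbb{R}^N))$ to the solution $v$ to $$\frac{\partial v}{\partial t}-\xi_0\cdot\nabla_x\Big(\frac v{\sigma_0}\Big)=0\ \text{ in }(0,T)\times\mathbb{R}^N,\qquad v(0,\cdot)=v^0\ \text{ in }\mathbb{R}^N,$$ with $\sigma_0=\langle\sigma\rangle$ and $\xi_0=\langle\sigma b\rangle$.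
   Context: Notation: $Y_N:=[0,1)^N$; $C^k_\sharp(Y_N)$ is the space of $Y_N$-periodic functions in $C^k(\mathbb{R}^N)$; $\langle f\rangle$ is the average of $f$ over $Y_N$. $R_\perp$ is the clockwise $90^\circ$ rotation matrix in $\mathbb{R}^{2\times2}$, i.e. $R_\perp(x_1,x_2)^T=(x_2,-x_1)^T$. For $\xi^2,\dots,\xi^N\in\mathbb{R}^N$, the cross product $\xi^2\times\cdots\times\xi^N\in\mathbb{R}^N$ is defined by $\xi^1\cdot(\xi^2\times\cdots\times\xi^N)=\det(\xi^1,\xi^2,\dots,\xi^N)$ for all $\xi^1\in\mathbb{R}^N$. For a vector field $U=(U_1,\dots,U_N)$, $DU:=[\partial_{x_i}U_j]_{1\le i,j\le N}$. $C^k_b(\mathbb{R}^N)$ is the space of $C^k$ functions bounded in $\mathbb{R}^N$. Weak convergence in $L^\infty(0,T;L^p(\mathbb{R}^N))$ is weak-$\ast$ convergence, i.e. tested against $L^1(0,T;L^q(\mathbb{R}^N))$. Solutions are weak solutions. $u_\varepsilon\in L^\infty(0,T;L^p(\mathbb{R}^N))$ is the (unique, by DiPerna–Lions theory) function such that for all $\phi\in C^1_c([0,T)\times\mathbb{R}^N)$, $$\int_0^T\!\!\int_{\mathbb{R}^N}u_\varepsilon\,\partial_t\phi\,dx\,dt+\int_{\mathbb{R}^N}u_\varepsilon^0\,\phi(0,x)\,dx=\int_0^T\!\!\int_{\mathbb{R}^N}u_\varepsilon\operatorname{div}(\phi\,b_\varepsilon)\,dx\,dt,$$ and $v\in L^\infty(0,T;L^p(\mathbb{R}^N))$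 is the unique function such that for all $\varphi\in C^1_c([0,T)\times\mathbb{R}^N)$, $$\int_0^T\!\!\int_{\mathbb{R}^N}v\,\partial_t\varphi\,dx\,dt+\int_{\mathbb{R}^N}v^0\,\varphi(0,x)\,dx=\int_0^T\!\!\int_{\mathbb{R}^N}\frac{v}{\sigma_0}\,\xi_0\cdot\nabla_x\varphi\,dx\,dt.$$ *)

(* Defs.v *)
From HB Require Import structures.
From mathcomp Require Import all_boot all_order all_algebra.
From mathcomp Require Import all_classical all_reals all_analysis.
Set Implicit Arguments.
Unset Strict Implicit.
Unset Printing Implicit Defensive.
Import Order.TTheory GRing.Theory Num.Theory.
Import numFieldNormedType.Exports.
Local Open Scope classical_set_scope.
Local Open Scope ring_scope.

Definition rV_display : measure_display -> measure_display.
Proof. exact. Qed.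

Section rV_measurable.
Variables (R : realType) (n : nat).

Let coord (i : 'I_n) (x : 'rV[R]_n) : R := x ord0 i.

Let rV_set0 : g_sigma_preimage coord set0.
Proof. exact: sigma_algebra0. Qed.

Let rV_setC A : g_sigma_preimage coord A -> g_sigma_preimage coord (~` A).
Proof. exact: sigma_algebraC. Qed.

Let rV_bigcup (F : (set 'rV[R]_n)^nat) :
  (forall i, g_sigma_preimage coord (F i)) ->
  g_sigma_preimage coord (\bigcup_i (F i)).
Proof. exact: sigma_algebra_bigcup. Qed.

(* Product sigma-algebra of the Borel sets of R, i.e. the Borel sets of R^n. *)
HB.instance Definition _ := @isMeasurable.Build
  (rV_display default_measure_display) 'rV[R]_n (g_sigma_preimage coord) rV_set0 rV_setC rV_bigcup.

Lemma measurable_rV_coord i : measurable_fun [set: 'rV[R]_n] (coord i).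
Proof.
move=> _ Y mY; rewrite setTI; apply: sub_sigma_algebra => /=.
rewrite -bigcup_seq/=; exists i => /=; first by rewrite mem_index_enum.
by exists Y => //; rewrite setTI.
Qed.

Lemma measurable_fun_rVP d (T : measurableType d) (f : T -> 'rV[R]_n) :
  (forall i, measurable_fun [set: T] (fun t => f t ord0 i)) ->
  measurable_fun [set: T] f.
Proof.
move=> mf.
suff : g_sigma_preimage (fun i => coord i \o f) `<=` measurable.
  rewrite g_sigma_preimage_comp => fS _ A mA.
  by apply: fS; exists A.
apply: smallest_sub; first exact: sigma_algebra_measurable.
rewrite -bigcup_seq; apply: bigcup_sub => i _ A [B mB <-]; exact: mf.
Qed.

End rV_measurable.

Section rV_lebesgue.
Variable R : realType.
Local Open Scope ereal_scope.

Definition rV_cons n (z : measurableTypeR R * 'rV[R]_n) : 'rV[R]_n.+1 :=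
  \row_i (if unlift ord0 i is Some j then z.2 ord0 j else z.1).

Lemma measurable_rV_cons n : measurable_fun [set: measurableTypeR R * 'rV[R]_n] (@rV_cons n).
Proof.
apply: measurable_fun_rVP => i; rewrite /rV_cons.
under eq_fun do rewrite mxE.
case: (unlift ord0 i) => [j|]; last exact: measurable_fst.
exact: measurableT_comp (@measurable_rV_coord R n j) measurable_snd.
Qed.

HB.instance Definition _ n := isMeasurableFun.Build _ _ _ _ (@rV_cons n)
  (@measurable_rV_cons n).

Section step.
Variables (n : nat) (m : {sigma_finite_measure set 'rV[R]_n -> \bar R}).

Definition lebesgue_step : set 'rV[R]_n.+1 -> \bar R :=
  pushforward (lebesgue_measure \x m) (@rV_cons n).

Let step0 : lebesgue_step set0 = 0.
Proof. exact: measure0. Qed.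

Let step_ge0 A : 0 <= lebesgue_step A.
Proof. exact: measure_ge0. Qed.

Let step_sigma_additive : semi_sigma_additive lebesgue_step.
Proof. exact: measure_semi_sigma_additive. Qed.

HB.instance Definition _ := isMeasure.Build _ _ _ lebesgue_step
  step0 step_ge0 step_sigma_additive.

Lemma lebesgue_step_sigma_finite : sigma_finite setT lebesgue_step.
Proof.
have [E TE Eoo] : exists2 E : (set (measurableTypeR R * 'rV[R]_n))^nat,
    setT = \bigcup_k E k &
    forall k, measurable (E k) /\ (lebesgue_measure \x m) (E k) < +oo.
  have /sigma_finiteP[F [TF ndF Foo]] := sigma_finiteT (@lebesgue_measure R).
  have /sigma_finiteP[G [TG ndG Goo]] := sigma_finiteT m.
  exists (fun k => F k `*` G k).
    rewrite -setXTT TF TG predeqE => -[x y]; split.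
      move=> [/= [i _ Fx] [k _ Gy]]; exists (maxn i k) => //; split.
      - by move: x Fx; exact/subsetPset/ndF/leq_maxl.
      - by move: y Gy; exact/subsetPset/ndG/leq_maxr.
    by move=> [i _ []/= ? ?]; split; exists i.
  move=> k; have [? ?] := Foo k; have [? ?] := Goo k.
  split; first exact: measurableX.
  by rewrite product_measure1E// lte_mul_pinfty// ge0_fin_numE.
pose h (x : 'rV[R]_n.+1) : measurableTypeR R * 'rV[R]_n := (x ord0 ord0, \row_j x ord0 (lift ord0 j)).
have mh : measurable_fun setT h.
  apply/measurable_fun_pairP; split => /=; first exact: measurable_rV_coord.
  apply: measurable_fun_rVP => i; under eq_fun do rewrite /= mxE.
  exact: measurable_rV_coord.
have hK z : h (rV_cons z) = z.
  case: z => a x; rewrite /h /rV_cons mxE unlift_none/=; congr pair.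
  by apply/rowP => j; rewrite !mxE liftK.
exists (fun k => h @^-1` E k).
  by rewrite -preimage_bigcup -TE preimage_setT.
move=> k; have [mE Ek] := Eoo k; split.
  by rewrite -[_ @^-1` _]setTI; exact: mh.
rewrite /lebesgue_step /pushforward -comp_preimage (_ : h \o _ = id)//.
by apply/funext => z /=; rewrite hK.
Qed.

HB.instance Definition _ := Measure_isSigmaFinite.Build _ _ _ lebesgue_step
  lebesgue_step_sigma_finite.

End step.

Fixpoint lebesgueN n : {sigma_finite_measure set 'rV[R]_n -> \bar R} :=
  if n is k.+1 then lebesgue_step (lebesgueN k)
  else dirac (0%R : 'rV[R]_0).


Lemma lebesgueN_box n (A : 'I_n -> set R) : (forall i, measurable (A i)) ->
  lebesgueN n [set x | forall i, A i (x ord0 i)] =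
  \prod_(i < n) lebesgue_measure (A i).
Proof.
elim: n A => [|n IH] A mA.
  rewrite big_ord0 /= diracE mem_set//= => -[]//.
rewrite big_ord_recl -IH; last by move=> i; exact: mA.
rewrite /= /lebesgue_step /pushforward.
rewrite (_ : _ @^-1` _ = A ord0 `*`
    [set x : 'rV[R]_n | forall i, A (lift ord0 i) (x ord0 i)]).
  apply: product_measure1E; first exact: mA.
  rewrite (_ : [set _ | _] = \big[setI/setT]_(i < n)
      ((fun x : 'rV[R]_n => x ord0 i) @^-1` A (lift ord0 i))).
    apply: bigsetI_measurable => i _.
    by rewrite -[_ @^-1` _]setTI; apply: measurable_rV_coord => //; exact: mA.
  rewrite -bigcap_seq; apply/seteqP; split=> x /= h.
    by move=> i _; exact: h.
  by move=> i; apply: (h i); rewrite /= mem_index_enum.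
apply/seteqP; split=> -[a x] /=.
  move=> h; split=> [|i].
    by have := h ord0; rewrite mxE unlift_none.
  by have := h (lift ord0 i); rewrite mxE liftK.
move=> [h0 h] i; rewrite mxE.
by case: unliftP => [j|] ->.
Qed.

End rV_lebesgue.

Section differential_operators.
Variables (R : realType) (N : nat).
Implicit Types (f : 'rV[R]_N -> R) (U : 'rV[R]_N -> 'rV[R]_N).

Definition comp_of U (j : 'I_N) : 'rV[R]_N -> R := fun x => U x ord0 j.

Definition evec (i : 'I_N) : 'rV[R]_N := delta_mx ord0 i.

Definition partial (i : 'I_N) f (x : 'rV[R]_N) : R := 'D_(evec i) f x.

Definition grad f (x : 'rV[R]_N) : 'rV[R]_N := \row_i partial i f x.

Definition divergence U (x : 'rV[R]_N) : R :=
  \sum_(i < N) partial i (comp_of U i) x.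

Definition Dmx U (x : 'rV[R]_N) : 'M[R]_N :=
  \matrix_(i, j) partial i (comp_of U j) x.

Definition dotv (u v : 'rV[R]_N) : R := \sum_(i < N) u ord0 i * v ord0 i.

Fixpoint Cn (k : nat) f : Prop :=
  continuous f /\
  (if k is l.+1 then
     forall i, (forall x, derivable f x (evec i)) /\ Cn l (partial i f)
   else True).

Definition Cnv (k : nat) U : Prop := forall j, Cn k (comp_of U j).

Definition periodic f : Prop := forall i x, f (x + evec i) = f x.

Definition Cn_per (k : nat) f : Prop := Cn k f /\ periodic f.

Definition Cnv_per (k : nat) U : Prop := forall j, Cn_per k (comp_of U j).

Definition bounded_field U : Prop := exists C : R, forall x, `|U x| <= C.

Definition test_function f : Prop :=
  (forall k, Cn k f) /\
  exists2 K : set 'rV[R]_N, compact K & forall x, ~ K x -> f x = 0.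

End differential_operators.

Section cross_product.
Variable R : realType.

(* The matrix with columns xi1, xi 0, ..., xi (m - 1). *)
Definition cross_mx m (xi1 : 'rV[R]_m.+1) (xi : 'I_m -> 'rV[R]_m.+1) :
    'M[R]_m.+1 :=
  \matrix_(a, c) (if unlift ord0 c is Some i then xi i else xi1) ord0 a.

Definition cross m (xi : 'I_m -> 'rV[R]_m.+1) : 'rV[R]_m.+1 :=
  \row_j \det (cross_mx (evec R j) xi).

Lemma crossP m (xi1 : 'rV[R]_m.+1) (xi : 'I_m -> 'rV[R]_m.+1) :
  dotv xi1 (cross xi) = \det (cross_mx xi1 xi).
Proof.
have cof a zeta : cofactor (cross_mx zeta xi) a ord0 =
    cofactor (cross_mx xi1 xi) a ord0.
  rewrite /cofactor; congr (_ * \det _).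
  by apply/matrixP => i j; rewrite !mxE liftK.
rewrite (expand_det_col _ ord0) /dotv; apply: eq_bigr => a _.
rewrite !mxE unlift_none; congr (_ * _).
rewrite (expand_det_col _ ord0) (bigD1 a)//= big1 ?addr0.
  by rewrite !mxE unlift_none /evec mxE !eqxx mul1r cof.
by move=> b /negPf ba; rewrite !mxE unlift_none /evec mxE ba andbF mul0r.
Qed.

Definition Rperp : 'M[R]_2 :=
  \matrix_(i, j) (if i == j then 0 else if i == ord0 then 1 else -1).

(* Right-hand side of the definition of sigma b, as a function of W.
   In dimension N = n.+2 components are numbered from 0, so that w^1 has index
   ord0 and w^2, ..., w^N have indices lift ord0 i. *)
Definition sigma_b n :
    ('rV[R]_n.+2 -> 'rV[R]_n.+2) -> 'rV[R]_n.+2 -> 'rV[R]_n.+2 :=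
  match n with
  | 0%N => fun W x => (Rperp *m (grad (comp_of W (lift ord0 ord0)) x)^T)^T
  | k.+1 => fun W x => cross (fun i => grad (comp_of W (lift ord0 i)) x)
  end.

End cross_product.

Section function_spaces.
Variables (R : realType) (N : nat).
Local Notation V := 'rV[R]_N.
Local Notation mu := (lebesgueN R N).
Implicit Types (f g : V -> R) (U : V -> V) (p : R).

Definition unit_cell : set V := [set x | forall i, x ord0 i \in `[0, 1[ ].

(* unit_cell has measure 1, see lebesgueN_box. *)
Definition average f : R := \int[mu]_(x in unit_cell) f x.

Definition average_field U : V := \row_j average (comp_of U j).

Definition Lp_loc p f : Prop := forall K : set V, compact K ->
  (fun x => f x * \1_K x) \in Lfun mu p%:E.

Definition weak_partial (i : 'I_N) f g : Prop :=
  [/\ Lp_loc 1 f, Lp_loc 1 g & forall phi, test_function phi ->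
    \int[mu]_x (f x * partial i phi x) = - \int[mu]_x (g x * phi x)].

Definition weak_divergence U (d : V -> R) : Prop :=
  [/\ forall j, Lp_loc 1 (comp_of U j), Lp_loc 1 d &
    forall phi, test_function phi ->
    \int[mu]_x dotv (U x) (grad phi x) = - \int[mu]_x (d x * phi x)].

Definition W1p_loc p f : Prop :=
  Lp_loc p f /\ forall i, exists2 g, Lp_loc p g & weak_partial i f g.

(* Families indexed by e : R are only considered for e > 0, as e tends to 0. *)
Definition weak_cvg_Lp p (f_ : R -> V -> R) f : Prop :=
  forall g, g \in Lfun mu (hoelder_conjugate p%:E) ->
  \int[mu]_x (f_ e x * g x) @[e --> 0^'+] --> \int[mu]_x (f x * g x).

Definition weak_cvg_Lp_loc p (f_ : R -> V -> R) f : Prop :=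
  forall K : set V, compact K ->
  forall g, g \in Lfun mu (hoelder_conjugate p%:E) ->
  \int[mu]_(x in K) (f_ e x * g x) @[e --> 0^'+] -->
  \int[mu]_(x in K) (f x * g x).

(* Functionals on W^{1,p} are represented by (N+1)-tuples of functions in
   L^{p'}, so weak convergence is tested on the function and its gradient. *)
Definition weak_cvg_W1p_loc p (f_ : R -> V -> R) f : Prop :=
  [/\ forall e : R, 0 < e -> W1p_loc p (f_ e), W1p_loc p f,
      weak_cvg_Lp_loc p f_ f &
      forall i, exists (g_ : R -> V -> R) g,
        [/\ forall e : R, 0 < e -> weak_partial i (f_ e) (g_ e),
            weak_partial i f g & weak_cvg_Lp_loc p g_ g]].

Definition strong_cvg_Lp_loc p (f_ : R -> V -> R) f : Prop :=
  [/\ forall e : R, 0 < e -> Lp_loc p (f_ e), Lp_loc p f &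
      forall K : set V, compact K ->
      Lnorm mu p%:E (fun x => ((f_ e x - f x) * \1_K x)%:E) @[e --> 0^'+]
      --> 0%E].

End function_spaces.

Section evolution.
Variables (R : realType) (N : nat).
Local Notation V := 'rV[R]_N.
Local Notation mu := (lebesgueN R N).
Implicit Types (T p q : R) (u v phi psi : R -> V -> R).

Definition int_tx T u : R :=
  \int[lebesgue_measure]_(t in `]0, T[) \int[mu]_x u t x.

(* Since L^p is separable for p < +oo, elements of L^r(0,T;L^p) are represented
   by jointly measurable functions of (t, x) in (0,T) x R^N. *)
Definition measurable_tx T u : Prop :=
  measurable_fun (`]0, T[%classic `*` [set: V])
    (fun z : measurableTypeR R * V => u z.1 z.2).

Definition Linfty_Lp T p u : Prop :=
  measurable_tx T u /\
  exists C : R, \forall t \ae lebesgue_measure, t \in `]0, T[ ->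
    ('N[mu]_(p%:E)[EFin \o u t] <= C%:E)%E.

Definition L1_Lp T (r : \bar R) u : Prop :=
  measurable_tx T u /\
  (\int[lebesgue_measure]_(t in `]0%R, T[) 'N[mu]_r[EFin \o u t] < +oo)%E.

Definition weakstar_cvg T p (u_ : R -> R -> V -> R) u : Prop :=
  forall psi, L1_Lp T (hoelder_conjugate p%:E) psi ->
  int_tx T (fun t x => u_ e t x * psi t x) @[e --> 0^'+] -->
  int_tx T (fun t x => u t x * psi t x).

Definition dt phi (t : R) (x : V) : R := derive1 (fun s => phi s x) t.

(* C^1_c([0,T) x R^N): restrictions to t >= 0 of C^1 functions on R x R^N
   with compact support contained in (-oo,T) x R^N. *)
Definition C1c_tx T phi : Prop :=
  [/\ continuous (fun z : R * V => phi z.1 z.2),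
      (forall t x, derivable (fun s => phi s x) t 1) /\
      continuous (fun z : R * V => dt phi z.1 z.2),
      forall i, (forall t x, derivable (phi t) x (evec R i)) /\
        continuous (fun z : R * V => partial i (phi z.1) z.2) &
      exists2 K : set (R * V), compact K &
        (forall t x, K (t, x) -> t < T) /\
        (forall t x, ~ K (t, x) -> phi t x = 0)].

Definition transport_solution T p (b : V -> V) (u0 : V -> R) u : Prop :=
  Linfty_Lp T p u /\
  forall phi, C1c_tx T phi ->
    int_tx T (fun t x => u t x * dt phi t x) + \int[mu]_x (u0 x * phi 0 x) =
    int_tx T (fun t x => u t x * divergence (fun y => phi t y *: b y) x).

Definition limit_solution T p (sigma0 : R) (xi0 : V) (v0 : V -> R) v : Prop :=
  Linfty_Lp T p v /\
  forall phi, C1c_tx T phi ->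
    int_tx T (fun t x => v t x * dt phi t x) + \int[mu]_x (v0 x * phi 0 x) =
    int_tx T (fun t x => v t x / sigma0 * dotv xi0 (grad (phi t) x)).

End evolution.

(* Main.v *)
From mathcomp Require Import all_boot all_order all_algebra fingroup perm.
From mathcomp Require Import all_classical all_reals all_analysis.
From mathcomp Require Import measurable_realfun ring lra.
Require Import Defs.
Set Implicit Arguments.
Unset Strict Implicit.
Unset Printing Implicit Defensive.
Import Order.TTheory GRing.Theory Num.Theory.
Import numFieldNormedType.Exports.
Local Open Scope classical_set_scope.
Local Open Scope ring_scope.

(** The fields S_e = sigma_e b_e are columns of cofactor matrices of DW_e, so they
    are divergence free (Piola), and S_e . grad w_e^j equals sigma_e for j = 1 and 0
    otherwise; in particular theta_e = 1. The matrix M is invertible, since otherwise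
    some nontrivial combination of the components of W would be periodic and have a
    critical point; hence W_e = M x + O(e) is proper, uniformly in e.

    In the coordinates y = W_e(x) the transport equation for v_e = sigma_e u_e is a
    translation: testing it with sigma_e(x) alpha(t) B(W_e(x) + t e_1) yields
      int v_e(t,x) F(t, W_e(x) + t e_1) dx dt = int v_e(0,x) F(t, W_e(x)) dx dt
    for every F such that both sides make sense. The limit problem has the same form
    with W_e replaced by x |-> M x, because M xi_0 = sigma_0 e_1. A proper map with
    positive Jacobian is injective, so F may be chosen with
    F(t, W_e + t e_1) = v_e |v_e|^(p-2); Hoelder's inequality then bounds v_e in
    L^oo(L^p) by its initial datum, which is bounded by the uniform boundedness
    principle. As W_e converges uniformly to M x, the identity passes to the limit for
    bump functions F, and the L^oo(L^p) bound extends the convergence to all test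
    functions in L^1(L^q) by density. *)

(** * Lebesgue measure and calculus on R^n *)

(** The dual choice of F is merely measurable, whereas the weak formulation accepts C^1 functions.
    One density theorem for functionals bounded by a seminorm closes this gap; it serves again for
    the oscillating gradients and for the final passage to the limit. The uniform bound has a second
    obstacle: F is prescribed at the shifted points W_e(x) + t e_1, but Hoelder's inequality
    involves its norm at the base points W_e(x). The constant 1 satisfies the weak identity too, so
    integrals weighted by sigma_e agree at both kinds of points. Trading sigma_e for 1 twice costs
    c^2 inside the q-norm, hence the constant c^(2(p-1)), since p/q = p-1. The bound contained in
    the notion of solution depends on e; it makes the integrals finite, so that the estimate may be
    divided by a power of its left-hand side. A positive Jacobian is a local condition and does not
    give injectivity by itself; properness enters through a mountain pass argument. In the limit
    problem the weight is 1 and the field is the constant xi_0 / sigma_0, so the same lemmas apply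
    to v itself. *)

Section rV_measure.
Variable R : realType.

Lemma rV_norm_coord n (x : 'rV[R]_n) i : `|x ord0 i| <= `|x|.
Proof.
have /mapP[j Hj ->] : `|x ord0 i| \in [seq `|x y.1 y.2| | y : 'I_1 * 'I_n].
  by apply/mapP; exists (ord0, i) => //=; rewrite mem_enum.
by rewrite [leRHS]/Num.norm /= mx_normrE; apply/bigmax_geP; right => /=; exists j.
Qed.

Lemma rV_norm_le n (x : 'rV[R]_n) (c : R) :
  0 <= c -> (forall i, `|x ord0 i| <= c) -> `|x| <= c.
Proof.
move=> c0 xc; rewrite [leLHS]/Num.norm /= mx_normrE; apply/bigmax_leP; split => //.
by move=> [i j] _ /=; rewrite ord1.
Qed.

Lemma measurable_rV_box n (A : 'I_n -> set R) : (forall i, measurable (A i)) ->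
  measurable [set x : 'rV[R]_n | forall i, A i (x ord0 i)].
Proof.
move=> mA; rewrite (_ : [set _ | _] = \big[setI/setT]_(i < n)
    ((fun x : 'rV[R]_n => x ord0 i) @^-1` A i)).
  apply: bigsetI_measurable => i _.
  by rewrite -[_ @^-1` _]setTI; apply: measurable_rV_coord.
rewrite -bigcap_seq; apply/seteqP; split=> x /= h.
  by move=> i _; exact: h.
by move=> i; apply: (h i); rewrite /= mem_index_enum.
Qed.

Lemma rV_ballE n (x : 'rV[R]_n) (r : R) : 0 < r ->
  ball x r = [set y | forall i, ball (x ord0 i) r (y ord0 i)].
Proof.
move=> r0; apply/seteqP; split => y /=.
  by move=> [_ h] i; exact: h.
by move=> h; split => // i j; rewrite ord1.
Qed.

Lemma measurable_rV_ball n (x : 'rV[R]_n) (r : R) : measurable (ball x r).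
Proof.
have [r0|r0] := ltP 0 r; last first.
  rewrite (_ : ball x r = set0); first exact: measurable0.
  by apply/seteqP; split => // y /= [] /=; rewrite ltNge r0.
by rewrite rV_ballE//; apply: (@measurable_rV_box n (fun i => ball (x ord0 i) r)) => i; apply: open_measurable; exact: ball_open.
Qed.

(** The sigma-algebra is generated by the coordinates, so open sets must be recovered from countably
    many boxes: balls with rational centre and rational radius. A radius in ]e/4, e/2[ keeps such a
    ball, once it contains x, inside [ball x e]. *)
Lemma open_measurable_rV n (A : set 'rV[R]_n) : open A -> measurable A.
Proof.
move=> oA.
pose c (q : 'rV[rat]_n) : 'rV[R]_n := \row_i ratr (q ord0 i).
pose F (z : 'rV[rat]_n * rat) : set 'rV[R]_n :=
  if `[< ball (c z.1) (ratr z.2) `<=` A >] then ball (c z.1) (ratr z.2) else set0.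
rewrite (_ : A = \bigcup_z F z).
  apply: countable_bigcupT_measurable; first exact: countableP.
  by move=> z; rewrite /F; case: ifPn => // _; exact: measurable_rV_ball.
apply/seteqP; split => [x Ax|x [z _]]; last first.
  by rewrite /F; case: ifPn => // /asboolP; exact.
have /nbhs_ballP[e /= e0 eA] : nbhs x A by exact: open_nbhs_nbhs.
have e40 : 0 < e / 4 by rewrite divr_gt0.
have e42 : e / 4 < e / 2 by lra.
have [r rI] := rat_in_itvoo e42.
move: rI; rewrite in_itv /= => /andP[r1 r2].
have r0 : 0 < ratr r :> R by rewrite (lt_trans e40).
have qP i : {q : rat | `|ratr q - x ord0 i| < ratr r}.
  apply: cid; have xr : x ord0 i - ratr r < x ord0 i + ratr r by rewrite ltrD2l gtrN.
  have [q] := rat_in_itvoo xr.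
  by rewrite in_itv /= => qr; exists q; rewrite ltr_distl.
exists (\row_i sval (qP i), r) => //; rewrite /F.
have Bx : ball (c (\row_i sval (qP i))) (ratr r) x.
  rewrite rV_ballE// => i /=; rewrite /ball /= !mxE.
  exact: (svalP (qP i)).
case: ifPn => // /asboolP; apply: contra_notP => _ y By; apply: eA.
have : ball x (ratr r + ratr r) y by apply: ball_triangle By; apply: ball_sym.
by apply: le_ball; lra.
Qed.

Lemma closed_measurable_rV n (A : set 'rV[R]_n) : closed A -> measurable A.
Proof.
by move=> cA; rewrite -[A]setCK; apply: measurableC; apply: open_measurable_rV; exact: closed_openC.
Qed.

Lemma compact_measurable_rV n (A : set 'rV[R]_n) : compact A -> measurable A.
Proof.
by move=> cA; apply: closed_measurable_rV; apply: compact_closed => //; exact: norm_hausdorff.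
Qed.

Lemma continuous_measurable_rV n (f : 'rV[R]_n -> R) :
  continuous f -> measurable_fun [set: 'rV[R]_n] f.
Proof.
move=> /continuousP cf; apply: (measurability _ (measurable_realfun.RGenOpens.measurableE R)).
move=> _ [_ [a [b ->] <-]]; rewrite setTI; apply: open_measurable_rV.
exact/cf/interval_open.
Qed.

Definition cube n (a b : R) : set 'rV[R]_n := [set x | forall i, x ord0 i \in `[a, b[].

Lemma measurable_cube n a b : measurable (@cube n a b).
Proof. by apply: (@measurable_rV_box n (fun=> [set` `[a, b[])) => i. Qed.

Lemma lebesgueN_cube_lty n a b : (lebesgueN R n (@cube n a b) < +oo)%E.
Proof.
rewrite /cube (@lebesgueN_box R n (fun=> [set` `[a, b[]))//.
suff : (\prod_(i < n) lebesgue_measure [set` `[a, b[])%E \is a fin_num.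
  by move/fin_numPlt => /andP[].
elim/big_ind: _ => // [x y|i _]; first exact: fin_numM.
by rewrite lebesgue_measure_itv /=; case: ifPn.
Qed.

Lemma bounded_cube n (A : set 'rV[R]_n) : bounded_set A ->
  exists2 k : R, 0 < k & A `<=` cube (- k) k.
Proof.
move=> [M0 [_ /(_ (M0 + 1) (ltr_pwDr ltr01 (lexx _)))]].
set M := M0 + 1 => AM.
exists (`|M| + 1); first by rewrite ltr_wpDl.
move=> x /AM xM i; rewrite in_itv/=.
have xi : `|x ord0 i| <= `|M|.
  by rewrite (le_trans (rV_norm_coord _ _))// (le_trans xM)// ler_norm.
move: xi; rewrite ler_norml => /andP[h1 h2]; apply/andP; split; lra.
Qed.

Lemma bounded_lebesgueN_lty n (A : set 'rV[R]_n) : measurable A -> bounded_set A ->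
  (lebesgueN R n A < +oo)%E.
Proof.
move=> mA /bounded_cube[k k0 Ak]; apply: le_lt_trans (lebesgueN_cube_lty n (- k) k).
by apply: le_measure; rewrite ?inE//; exact: measurable_cube.
Qed.

Lemma compact_lebesgueN_lty n (A : set 'rV[R]_n) : compact A ->
  (lebesgueN R n A < +oo)%E.
Proof.
move=> cA; apply: bounded_lebesgueN_lty; first exact: compact_measurable_rV.
exact: compact_bounded.
Qed.

End rV_measure.

(** * Directional derivatives along lines and the classes [Cn] *)

Section calculus.
Variable R : realType.
Section line.
Variable V : normedModType R.
Implicit Types (f g : V -> R) (x v : V).

(** The difference quotients are the same functions of h. This reduction to the real line
    [r |-> x + r *: v] gives access to the chain rule, the mean value theorem and the fundamental
    theorem of calculus. *)
Lemma is_derive_line f x v (s df : R) :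
  is_derive (x + s *: v) v f df -> is_derive s 1 (fun r => f (x + r *: v)) df.
Proof.
move=> [d1 d2].
have E : (fun h : R => h^-1 *: ((fun r : R => f (x + r *: v)) (h *: 1 + s) - f (x + s *: v)))
  = (fun h : R => h^-1 *: (f (h *: v + (x + s *: v)) - f (x + s *: v))).
  apply/funext => h; congr (_ *: (f _ - _)).
  by rewrite scalerDl scaler1 addrCA.
by split; [rewrite /derivable E | rewrite -d2 /derive E].
Qed.

Lemma is_derive_line0 f x v (df : R) :
  is_derive (0 : R) (1 : R) (fun r : R => f (x + r *: v)) df -> is_derive x v f df.
Proof.
move=> [d1 d2].
have E : (fun h : R => h^-1 *: ((fun r : R => f (x + r *: v)) (h *: 1 + 0) - f (x + 0 *: v)))
  = (fun h : R => h^-1 *: (f (h *: v + x) - f x)).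
  apply/funext => h; rewrite scale0r !addr0; congr (_ *: (f _ - _)).
  by rewrite scaler1 addrC.
by split; [rewrite /derivable -E | rewrite -d2 /derive E].
Qed.

Lemma is_derive_comp1 (h : R -> R) f x v (dh df : R) :
  is_derive (f x) 1 h dh -> is_derive x v f df -> is_derive x v (h \o f) (dh * df).
Proof.
move=> hh hf; apply: is_derive_line0.
have -> : (fun r : R => (h \o f) (x + r *: v)) = h \o (fun r : R => f (x + r *: v)).
  by [].
by apply: is_derive1_comp; [rewrite scale0r addr0|apply: is_derive_line; rewrite scale0r addr0].
Qed.

Lemma is_derive_scale_arg f (c : R) x v (df : R) : 
  is_derive (c *: x) v f df -> is_derive x v (fun y => f (c *: y)) (c * df).
Proof.
move=> h; apply: is_derive_line0.
have -> : (fun r : R => f (c *: (x + r *: v))) = (fun r => f (c *: x + r *: v)) \o (fun r => c * r).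
  by apply/funext => r /=; rewrite scalerDr scalerA.
rewrite mulrC; apply: is_derive1_comp.
  by rewrite mulr0; apply: is_derive_line; rewrite scale0r addr0.
have : is_derive (0 : R) (1 : R) (c *: (id : R -> R)) (c *: 1) by exact: is_deriveZ.
by rewrite [c *: 1]mulr1.
Qed.

Lemma line_continuous f x v : continuous f -> continuous (fun r : R => f (x + r *: v)).
Proof.
move=> cf r; apply: (@continuous_comp R V R (fun r : R => x + r *: v) f); last exact: cf.
apply: continuousD; first exact: cst_continuous.
exact: scalel_continuous.
Qed.

(** For t < 0 the mean value theorem is applied on [t, 0] and the signs are reversed; bounding [s]
    in absolute value covers both orientations. *)
Lemma MVT_line f x v (df : V -> R) (t : R) : continuous f ->
  (forall y, is_derive y v f (df y)) ->
  exists2 s : R, `|s| <= `|t| & f (x + t *: v) - f x = df (x + s *: v) * t.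
Proof.
move=> cf hf.
have cF : continuous (fun r : R => f (x + r *: v)) by exact: line_continuous.
have [t0|t0] := leP 0 t.
  have [||c cI cE] := @MVT_segment _ (fun r : R => f (x + r *: v)) (fun r => df (x + r *: v)) 0 t t0.
  - by move=> y _; exact: is_derive_line.
  - exact: continuous_subspaceT.
  move: cI; rewrite in_itv /= => /andP[c0 ct].
  exists c; first by rewrite !ger0_norm.
  by move: cE; rewrite /= scale0r addr0 subr0.
have [||c cI cE] := @MVT_segment _ (fun r : R => f (x + r *: v)) (fun r => df (x + r *: v)) t 0 (ltW t0).
- by move=> y _; exact: is_derive_line.
- exact: continuous_subspaceT.
move: cI; rewrite in_itv /= => /andP[ct c0].
exists c; first by rewrite !ler0_norm ?lerN2// ltW.
move: cE; rewrite /= scale0r addr0 sub0r mulrN => /eqP; rewrite -eqr_opp opprK opprB => /eqP.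
by [].
Qed.

End line.

Section Cn_theory.
Variable N : nat.
Implicit Types (f g : 'rV[R]_N -> R).

Lemma partialP i f x : derivable f x (evec R i) -> is_derive x (evec R i) f (partial i f x).
Proof. exact: derivableP. Qed.

Lemma is_derive_partial i f x df : is_derive x (evec R i) f df -> partial i f x = df.
Proof. by case. Qed.

Lemma Cn_continuous k f : Cn k f -> continuous f.
Proof. by case: k => [|k] []. Qed.

Lemma Cn_derivable k f i x : Cn k.+1 f -> derivable f x (evec R i).
Proof. by move=> [_ /(_ i)[]]. Qed.

Lemma Cn_partial k f i : Cn k.+1 f -> Cn k (partial i f).
Proof. by move=> [_ /(_ i)[]]. Qed.

Lemma Cn_is_derive k f i x : Cn k.+1 f -> is_derive x (evec R i) f (partial i f x).
Proof. by move=> /Cn_derivable h; apply: partialP. Qed.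

Lemma CnS k f : Cn k.+1 f -> Cn k f.
Proof.
elim: k f => [|k IH] f; first by move=> [].
move=> [cf hf]; split => // i; split; first by case: (hf i).
by apply: IH; case: (hf i).
Qed.

Lemma Cn_cst k (c : R) : Cn k (fun _ : 'rV[R]_N => c).
Proof.
elim: k c => [|k IH] c; split => //; try exact: cst_continuous.
move=> i; split=> [x|]; first exact: derivable_cst.
rewrite (_ : partial i _ = fun=> 0); first exact: IH.
by apply/funext => x; exact: derive_cst.
Qed.

Lemma CnD k f g : Cn k f -> Cn k g -> Cn k (fun x => f x + g x).
Proof.
elim: k f g => [|k IH] f g.
  by move=> [cf _] [cg _]; split => // x; apply: continuousD; [exact: cf|exact: cg].
move=> [cf hf] [cg hg]; split; first by move=> x; apply: continuousD; [exact: cf|exact: cg].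
move=> i; have [df pf] := hf i; have [dg pg] := hg i; split.
  by move=> x; apply: derivableD.
rewrite (_ : partial i _ = fun x => partial i f x + partial i g x); first exact: IH.
by apply/funext => x; rewrite /partial deriveD.
Qed.

Lemma CnM k f g : Cn k f -> Cn k g -> Cn k (fun x => f x * g x).
Proof.
elim: k f g => [|k IH] f g.
  by move=> [cf _] [cg _]; split => // x; apply: continuousM; [exact: cf|exact: cg].
move=> hf' hg'; have [cf hf] := hf'; have [cg hg] := hg'.
split; first by move=> x; apply: continuousM; [exact: cf|exact: cg].
move=> i; have [df pf] := hf i; have [dg pg] := hg i; split.
  by move=> x; apply: derivableM.
rewrite (_ : partial i _ = fun x => f x * partial i g x + g x * partial i f x).
  by apply: CnD; apply: IH => //; exact: CnS.
by apply/funext => x; rewrite /partial deriveM.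
Qed.

Lemma CnZ k (c : R) f : Cn k f -> Cn k (fun x => c * f x).
Proof. by move=> hf; apply: CnM => //; exact: Cn_cst. Qed.

Lemma Cn_sum k (I : Type) (r : seq I) (P : pred I) (F : I -> 'rV[R]_N -> R) :
  (forall i, P i -> Cn k (F i)) -> Cn k (fun x => \sum_(i <- r | P i) F i x).
Proof.
move=> hF; elim: r => [|a r IH].
  by under eq_fun do rewrite big_nil; exact: Cn_cst.
under eq_fun do rewrite big_cons; case: (boolP (P a)) => [Pa|_] //.
by apply: CnD => //; exact: hF.
Qed.

Lemma Cn_prod k (I : Type) (r : seq I) (P : pred I) (F : I -> 'rV[R]_N -> R) :
  (forall i, P i -> Cn k (F i)) -> Cn k (fun x => \prod_(i <- r | P i) F i x).
Proof.
move=> hF; elim: r => [|a r IH].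
  by under eq_fun do rewrite big_nil; exact: Cn_cst.
under eq_fun do rewrite big_cons; case: (boolP (P a)) => [Pa|_] //.
by apply: CnM => //; exact: hF.
Qed.

Lemma Cn_coord k j : Cn k (fun x : 'rV[R]_N => x ord0 j).
Proof.
have c : continuous (fun x : 'rV[R]_N => x ord0 j) by exact: coord_continuous.
have d i x : is_derive x (evec R i) (fun x : 'rV[R]_N => x ord0 j) (i == j)%:R.
  apply: is_derive_line0.
  have : is_derive (0 : R) (1 : R) (((i == j)%:R : R) *: (id : R -> R) + cst (x ord0 j))
      ((i == j)%:R *: 1 + 0) by exact: is_deriveD.
  rewrite addr0 [_ *: 1]mulr1; congr is_derive; apply/funext => r.
  by rewrite !mxE eqxx /= addrC eq_sym [in RHS]mulrC.
case: k => [|k]; split => // i; split; first by move=> x; case: (d i x).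
rewrite (_ : partial i _ = fun=> (i == j)%:R); first exact: Cn_cst.
by apply/funext => x; case: (d i x).
Qed.

Lemma scale_arg_continuous (c : R) f : continuous f -> continuous (fun x : 'rV[R]_N => f (c *: x)).
Proof.
move=> cf x; apply: (@continuous_comp 'rV[R]_N 'rV[R]_N R ( *:%R c) f); last exact: cf.
exact: scaler_continuous.
Qed.

Lemma partial_scale_arg i (c : R) f x : derivable f (c *: x) (evec R i) ->
  partial i (fun y => f (c *: y)) x = c * partial i f (c *: x).
Proof. by move=> h; apply: is_derive_partial; apply: is_derive_scale_arg; exact: partialP. Qed.

Lemma Cn_scale_arg k (c : R) f : Cn k f -> Cn k (fun x => f (c *: x)).
Proof.
elim: k f => [|k IH] f [cf hf]; split => //; try exact: scale_arg_continuous.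
move=> i; have [df pf] := hf i; split.
  by move=> x; have [] := @is_derive_scale_arg _ f c x (evec R i) _ (partialP (df (c *: x))).
rewrite (_ : partial i _ = fun x => c * partial i f (c *: x)).
  by apply: CnZ; exact: IH.
by apply/funext => x; rewrite partial_scale_arg.
Qed.

End Cn_theory.

End calculus.

Section integral_sum.
Context d (T : measurableType d) (R : realType) (mu : {measure set T -> \bar R}).

Lemma integrable_sum_seq (I : Type) (r : seq I) (F : I -> T -> R) (D : set T) :
  measurable D -> (forall i, mu.-integrable D (EFin \o F i)) ->
  mu.-integrable D (EFin \o (fun x => \sum_(i <- r) F i x)).
Proof.
move=> mD iF; elim: r => [|a r IH].
  rewrite (_ : _ \o _ = cst 0%E); first exact: integrable0.
  by apply/funext => x /=; rewrite big_nil.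
rewrite (_ : _ \o _ = ((EFin \o F a) \+ (EFin \o (fun x => (\sum_(i <- r) F i x)%R)))%E).
  exact: integrableD.
by apply/funext => x /=; rewrite big_cons.
Qed.

Lemma Rintegral_sum (I : Type) (r : seq I) (F : I -> T -> R) (D : set T) :
  measurable D -> (forall i, mu.-integrable D (EFin \o F i)) ->
  \int[mu]_(x in D) (\sum_(i <- r) F i x) =
  \sum_(i <- r) \int[mu]_(x in D) F i x.
Proof.
move=> mD iF; elim: r => [|a r IH].
  by rewrite big_nil; under eq_Rintegral do rewrite big_nil; rewrite Rintegral_cst// mul0r.
rewrite big_cons; under eq_Rintegral do rewrite big_cons.
by rewrite RintegralD// ?IH//; exact: integrable_sum_seq.
Qed.

End integral_sum.

(** * Integration of partial derivatives over cubes *)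

Section ibp.
Variable R : realType.

Lemma rV_cons0 n t (y : 'rV[R]_n) : rV_cons (t, y) ord0 ord0 = t.
Proof. by rewrite mxE unlift_none. Qed.

Lemma rV_consS n t (y : 'rV[R]_n) j : rV_cons (t, y) ord0 (lift ord0 j) = y ord0 j.
Proof. by rewrite mxE liftK. Qed.

Lemma rV_cons_lineS n t (y : 'rV[R]_n) j (s : R) :
  rV_cons (t, y + s *: evec R j) = rV_cons (t, y) + s *: evec R (lift ord0 j).
Proof.
apply/rowP => k; case: (unliftP ord0 k) => [l|] ->; rewrite !mxE ?liftK ?unlift_none /=.
  by rewrite !mxE (inj_eq lift_inj).
by rewrite mulr0 addr0.
Qed.

Lemma rV_cons_line0 n t (y : 'rV[R]_n) (s : R) :
  rV_cons (t + s, y) = rV_cons (t, y) + s *: evec R ord0.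
Proof.
apply/rowP => k; case: (unliftP ord0 k) => [l|] ->; rewrite !mxE ?liftK ?unlift_none /=.
  by rewrite mulr0 addr0.
by rewrite mulr1.
Qed.

Lemma continuous_rV (T : topologicalType) n (F : T -> 'rV[R]_n) :
  (forall k, continuous (fun y => F y ord0 k)) -> continuous F.
Proof.
move=> h y A /nbhs_ballP[e /= e0 eA].
have : \forall z \near y, forall k, ball (F y ord0 k) e (F z ord0 k).
  by apply: filter_forall => k; exact: (h k y _ (nbhsx_ballx _ _ e0)).
by apply: filterS => z hz; apply: eA; rewrite rV_ballE.
Qed.

Lemma rV_cons_continuousr n t : continuous (fun y : 'rV[R]_n => rV_cons (t, y)).
Proof.
apply: continuous_rV => k; case: (unliftP ord0 k) => [l|] ->.
  by under eq_fun do rewrite rV_consS; exact: coord_continuous.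
by under eq_fun do rewrite rV_cons0; exact: cst_continuous.
Qed.

Lemma rV_cons_continuousl n (y : 'rV[R]_n) : continuous (fun t : R => rV_cons (t, y)).
Proof.
apply: continuous_rV => k; case: (unliftP ord0 k) => [l|] ->.
  by under eq_fun do rewrite rV_consS; exact: cst_continuous.
by under eq_fun do rewrite rV_cons0; move=> t; exact: cvg_id.
Qed.

Lemma cube_cons n (a b : R) t (y : 'rV[R]_n) :
  cube a b (rV_cons (t, y)) <-> (t \in `[a, b[) /\ cube a b y.
Proof.
split=> [h|[h1 h2]].
  by split=> [|i]; [have := h ord0; rewrite rV_cons0|have := h (lift ord0 i); rewrite rV_consS].
by move=> i; case: (unliftP ord0 i) => [l|] ->; rewrite ?rV_consS ?rV_cons0.
Qed.

Lemma continuous_cube_bounded n (a b : R) (f : 'rV[R]_n -> R) : continuous f ->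
  exists M : R, forall x, cube a b x -> `|f x| <= M.
Proof.
move=> cf.
have cK : compact [set v : 'rV[R]_n | forall i, v ord0 i \in `[a, b]].
  by apply: (@rV_compact _ _ (fun=> `[a, b]%classic)) => _; apply: segment_compact.
have /compact_bounded[M0 [_ /(_ (M0 + 1) (ltr_pwDr ltr01 (lexx _)))]] :
    compact (f @` [set v : 'rV[R]_n | forall i, v ord0 i \in `[a, b]]).
  by apply: continuous_compact => //; exact: continuous_subspaceT.
set M := M0 + 1 => fM; exists M => x xab; apply: fM; exists x => // i.
by have := xab i; rewrite !in_itv /= => /andP[-> /ltW].
Qed.

Lemma continuous_cube_integrable n (a b : R) (f : 'rV[R]_n -> R) : continuous f ->
  (lebesgueN R n).-integrable (@cube R n a b) (EFin \o f).
Proof.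
move=> cf; apply: measurable_bounded_integrable.
- exact: measurable_cube.
- exact: lebesgueN_cube_lty.
- by apply: measurable_funTS; exact: continuous_measurable_rV.
have [M fM] := continuous_cube_bounded a b cf.
exists M; split; first exact: num_real.
by move=> y My x /= /fM h; rewrite (le_trans h)// ltW.
Qed.

(** Bridge to Fubini: [lebesgueN] in dimension n+1 is the image of a product measure under
    [rV_cons], and the indicator of the cube splits into an interval condition on t and a cube
    condition on y. *)
Lemma integral_cubeS n (a b : R) (g : 'rV[R]_n.+1 -> R) : continuous g ->
  let G (z : measurableTypeR R * 'rV[R]_n) := ((g \_ (cube a b)) (rV_cons z))%:E in
  [/\ (\int[lebesgueN R n.+1]_(x in cube a b) (g x)%:E =
       \int[lebesgue_measure \x lebesgueN R n]_z G z)%E,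
   (lebesgue_measure \x lebesgueN R n)%E.-integrable setT G &
   forall t y, G (t, y) = if `[< (t \in `[a, b[) /\ cube a b y >] then (g (rV_cons (t, y)))%:E else 0%E].
Proof.
move=> cg G.
have lab : lebesgue_measure ([set` `[a, b[] : set R) \is a fin_num.
  by rewrite lebesgue_measure_itv /=; case: ifPn.
have GE t y : G (t, y) = if `[< (t \in `[a, b[) /\ cube a b y >] then (g (rV_cons (t, y)))%:E else 0%E.
  rewrite /G patchE; case: asboolP => h.
    by rewrite mem_set//; apply/cube_cons.
  by rewrite memNset// => /cube_cons.
have mg : measurable_fun setT (g \_ (cube a b)).
  apply/(measurable_restrictT _ _).1; first exact: measurable_cube.
  by apply: measurable_funTS; exact: continuous_measurable_rV.
have mG : measurable_fun setT G.
  apply/measurable_EFinP; apply: (measurableT_comp mg).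
  exact: measurable_rV_cons.
have iG : (lebesgue_measure \x lebesgueN R n)%E.-integrable setT G.
  have [M fM] := continuous_cube_bounded a b cg.
  have mS : measurable ([set` `[a, b[] `*` @cube R n a b : set (measurableTypeR R * 'rV[R]_n)).
    by apply: measurableX => //; exact: measurable_cube.
  have GE2 : G = (fun z => (fine (G z))%:E) \_ ([set` `[a, b[] `*` @cube R n a b).
    apply/funext => -[t y]; rewrite patchE GE; case: asboolP => h.
      by rewrite mem_set.
    by rewrite memNset.
  rewrite GE2; apply/(integrable_mkcond _ _).1 => //.
  apply: measurable_bounded_integrable => //.
  - rewrite /= product_measure1E//; last exact: measurable_cube.
    apply: lte_mul_pinfty => //; last exact: lebesgueN_cube_lty.
  - by apply: measurable_funTS; exact: (measurableT_comp mg (@measurable_rV_cons R n)).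
  exists `|M|; split; first exact: num_real.
  move=> y My [t z] [/= h1 h2]; suff : `|fine (G (t, z))| <= y by [].
  rewrite GE; case: asboolP => // _ /=; last by rewrite normr0 (le_trans _ (ltW My)).
  by rewrite (le_trans (fM _ _)) ?(le_trans (ler_norm _) (ltW My))//; apply/cube_cons.
split => //.
rewrite integral_mkcond.
transitivity (\int[lebesgueN R n.+1]_x (EFin \o (g \_ (cube a b))) x)%E.
  by apply: eq_integral => x _; rewrite restrict_EFin.
rewrite /= (@integral_pushforward _ _ _ _ _ (@rV_cons R n) (@measurable_rV_cons R n) (lebesgue_measure \x lebesgueN R n)%E setT).
- by rewrite preimage_setT.
- exact/measurable_EFinP.
- by rewrite preimage_setT.
- exact: measurableT.
Qed.

(** Induction on the dimension. If i is not the first coordinate, t is frozen and the induction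
    hypothesis applies in y; otherwise the fundamental theorem of calculus applies in t. The
    hypothesis of equal values on opposite faces suits both periodic functions on the cell and
    compactly supported functions in a large cube. *)
Lemma integral_partial_cube n (i : 'I_n) (f : 'rV[R]_n -> R) (a b : R) : a < b ->
  continuous f -> (forall x, derivable f x (evec R i)) -> continuous (partial i f) ->
  (forall x y : 'rV[R]_n, x ord0 i = a -> y ord0 i = b -> (forall j, j != i -> x ord0 j = y ord0 j) ->
     f x = f y) ->
  (\int[lebesgueN R n]_(x in cube a b) (partial i f x)%:E = 0)%E.
Proof.
elim: n i f => [[] //|n IH] i f ab cf df cpf fab.
have [-> iG GE] := integral_cubeS a b cpf.
case: (unliftP ord0 i) => [j|] ij; subst i.
  rewrite -integral12_prod_meas1//= integral0_eq// => t _; rewrite /fubini_F.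
  under eq_integral do rewrite GE.
  have [tab|tab] := pselect (t \in `[a, b[); last first.
    by rewrite integral0_eq// => y _; case: asboolP => // -[].
  rewrite -[RHS](IH j (fun y => f (rV_cons (t, y))) ab).
  - rewrite [RHS]integral_mkcond; apply: eq_integral => y _; rewrite patchE.
    case: asboolP => [[_ h]|h].
      rewrite mem_set//; congr EFin; apply/esym/is_derive_partial.
      apply: is_derive_line0; under eq_fun do rewrite rV_cons_lineS.
      by apply: is_derive_line; rewrite scale0r addr0; exact: partialP.
    by rewrite memNset// => cy; apply: h.
  - move=> y; apply: (@continuous_comp _ _ _ (fun y => rV_cons (t, y)) f); last exact: cf.
    exact: rV_cons_continuousr.
  - move=> y. suff [] : is_derive y (evec R j) (fun y => f (rV_cons (t, y))) (partial (lift ord0 j) f (rV_cons (t, y))) by [].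
    apply: is_derive_line0; under eq_fun do rewrite rV_cons_lineS.
    by apply: is_derive_line; rewrite scale0r addr0; exact: partialP.
  - rewrite (_ : partial j _ = fun y => partial (lift ord0 j) f (rV_cons (t, y))).
      move=> y; apply: (@continuous_comp _ _ _ (fun y => rV_cons (t, y)) (partial (lift ord0 j) f)); last exact: cpf.
      exact: rV_cons_continuousr.
    apply/funext => y; apply: is_derive_partial.
    apply: is_derive_line0; under eq_fun do rewrite rV_cons_lineS.
    by apply: is_derive_line; rewrite scale0r addr0; exact: partialP.
  - move=> x y xa yb xy; apply: fab; rewrite ?rV_consS// => k.
    case: (unliftP ord0 k) => [l|] ->; rewrite ?rV_consS ?rV_cons0// => lj.
    by apply: xy; apply: contra lj => /eqP ->.
rewrite -integral21_prod_meas1//= integral0_eq// => y _; rewrite /fubini_G.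
under eq_integral do rewrite GE.
have [yab|yab] := pselect (cube a b y); last first.
  by rewrite integral0_eq// => t _; case: asboolP => // -[].
transitivity (\int[lebesgue_measure]_(t in `[a, b]) (partial ord0 f (rV_cons (t, y)))%:E)%E.
  have cpt : continuous (fun t : R => partial ord0 f (rV_cons (t, y))).
    move=> t; apply: (@continuous_comp _ _ _ (fun t : R => rV_cons (t, y)) (partial ord0 f)); last exact: cpf.
    exact: rV_cons_continuousl.
  rewrite -integral_itv_bndo_bndc; last first.
    by apply/measurable_EFinP/measurable_funTS; exact: continuous_measurable_fun.
  rewrite [RHS]integral_mkcond; apply: eq_integral => t _; rewrite patchE.
  case: asboolP => [[h _]|h]; first by rewrite mem_set.
  by rewrite memNset// => ct; apply: h.
have dF t : is_derive t (1:R) (fun t : R => f (rV_cons (t, y))) (partial ord0 f (rV_cons (t, y))).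
  have E s : f (rV_cons (s, y)) = f (rV_cons (0, y) + s *: evec R ord0).
    by rewrite -rV_cons_line0 add0r.
  under eq_fun do rewrite E.
  apply: is_derive_line; rewrite -rV_cons_line0 add0r; exact: partialP.
have cF : continuous (fun t : R => f (rV_cons (t, y))).
  move=> t; apply: (@continuous_comp _ _ _ (fun t : R => rV_cons (t, y)) f); last exact: cf.
  exact: rV_cons_continuousl.
rewrite (@continuous_FTC2 _ _ (fun t : R => f (rV_cons (t, y))) _ _ ab).
- rewrite (fab (rV_cons (a, y)) (rV_cons (b, y))) ?subee// ?rV_cons0// => j.
  by case: (unliftP ord0 j) => [l|] ->; rewrite ?eqxx// !rV_consS.
- apply: continuous_subspaceT => t; apply: (@continuous_comp _ _ _ (fun t : R => rV_cons (t, y)) (partial ord0 f)); last exact: cpf.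
  exact: rV_cons_continuousl.
- split.
  + by move=> t _; have [] := dF t.
  + by apply: cvg_at_right_filter; exact: cF.
  + by apply: cvg_at_left_filter; exact: cF.
- by move=> t _; rewrite derive1E; have [] := dF t.
Qed.

End ibp.

(** * Piola's identity *)

Section piola.
Variable R : realType.

Lemma norm_evec N (i : 'I_N) : `|evec R i| <= 1.
Proof.
apply: rV_norm_le => // j; rewrite mxE eqxx /=.
by case: (_ == _); rewrite ?normr1 ?normr0.
Qed.

Lemma dist_half_le (a b v e : R) :
  `|a - v| < e / 2 -> `|b - v| < e / 2 -> `|a - b| <= e.
Proof. by rewrite !ltr_norml ler_norml => /andP[? ?] /andP[? ?]; lra. Qed.

Section schwarz.
Variable N : nat.
Implicit Types (f : 'rV[R]_N -> R).

(** Two mean value theorems: one for the increment [y |-> f (y + h e_i) - f y] in direction j, one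
    for [partial j f] in direction i. *)
Lemma double_difference f (x : 'rV[R]_N) i j (h : R) : Cn 2 f ->
  exists s s' : R, [/\ `|s| <= `|h|, `|s'| <= `|h| &
   f (x + h *: evec R j + h *: evec R i) - f (x + h *: evec R j) - (f (x + h *: evec R i) - f x) =
   partial i (partial j f) (x + s *: evec R j + s' *: evec R i) * h * h].
Proof.
move=> f2.
pose g (y : 'rV[R]_N) := f (y + h *: evec R i) - f y.
have cf := Cn_continuous f2.
have cg : continuous g.
  move=> y; apply: continuousB; last exact: cf.
  apply: (@continuous_comp 'rV[R]_N 'rV[R]_N R (fun y : 'rV[R]_N => y + h *: evec R i) f); last exact: cf.
  by apply: continuousD; [exact: cvg_id|exact: cst_continuous].
have dg y : is_derive y (evec R j) g (partial j f (y + h *: evec R i) - partial j f y).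
  apply: is_deriveB; last exact: Cn_is_derive f2.
  apply: is_derive_line0.
  rewrite (_ : (fun r : R => _) = (fun r : R => f ((y + h *: evec R i) + r *: evec R j))); last first.
    by apply/funext => r; rewrite addrAC.
  by apply: is_derive_line; rewrite scale0r addr0; exact: Cn_is_derive f2.
have [s sh gE] := MVT_line x h cg dg.
have f1 : Cn 1 (partial j f) by exact: Cn_partial.
have [s' s'h pE] := @MVT_line R _ (partial j f) (x + s *: evec R j) (evec R i) (partial i (partial j f)) h
  (Cn_continuous f1) (fun y => Cn_is_derive i y f1).
exists s, s'; split => //.
by rewrite -pE -gE /g; congr (_ - (f _ - _)).
Qed.

(** The double difference is symmetric in i and j, so the two mixed derivatives take a common value
    at two points close to x; their continuity at x does the rest. *)
Lemma schwarz f x i j : Cn 2 f -> partial i (partial j f) x = partial j (partial i f) x.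
Proof.
move=> f2; apply/eqP; rewrite -subr_eq0 -normr_le0; apply/ler_addgt0Pr => e e0; rewrite add0r.
have e20 : 0 < e / 2 by rewrite divr_gt0.
have c1 : continuous (partial i (partial j f)).
  by apply: (@Cn_continuous R N 0); apply: Cn_partial; exact: Cn_partial.
have c2 : continuous (partial j (partial i f)).
  by apply: (@Cn_continuous R N 0); apply: Cn_partial; exact: Cn_partial.
have /cvgrPdist_lt/(_ _ e20)/nbhs_ballP[d1 /= d10 h1] := c1 x.
have /cvgrPdist_lt/(_ _ e20)/nbhs_ballP[d2 /= d20 h2] := c2 x.
(* Each of the two displacements has norm at most h, so the intermediate points stay within half of
   the smaller radius. *)
pose h := Num.min d1 d2 / 4.
have m0 : 0 < Num.min d1 d2 by rewrite lt_min d10.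
have h0 : 0 < h by rewrite divr_gt0.
have close k l (s s' d : R) : Num.min d1 d2 <= d -> `|s| <= `|h| -> `|s'| <= `|h| ->
    ball x d (x + s *: evec R k + s' *: evec R l).
  move=> dd; rewrite [`|h|]gtr0_norm// => sh s'h.
  rewrite -ball_normE /= -addrA opprD addrA subrr add0r normrN.
  rewrite (le_lt_trans (ler_normD _ _))// !normrZ.
  have le1 : `|s| * `|evec R k| <= h * 1 by apply: ler_pM => //; exact: norm_evec.
  have le2 : `|s'| * `|evec R l| <= h * 1 by apply: ler_pM => //; exact: norm_evec.
  rewrite /h in le1 le2; lra.
have [s [s' [sh s'h E1]]] := double_difference x i j h f2.
have [r [r' [rh r'h E2]]] := double_difference x j i h f2.
have EE : partial i (partial j f) (x + s *: evec R j + s' *: evec R i) =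
  partial j (partial i f) (x + r *: evec R i + r' *: evec R j).
  apply/(mulIf (lt0r_neq0 h0))/(mulIf (lt0r_neq0 h0)).
  have gen (a b c d : R) : a - b - (c - d) = a - c - (b - d) by ring.
  apply: (etrans (esym E1)); apply: (etrans _ E2).
  have -> : x + h *: evec R j + h *: evec R i = x + h *: evec R i + h *: evec R j by exact: addrAC.
  exact: gen.
have md1 : Num.min d1 d2 <= d1 by rewrite ge_min lexx.
have md2 : Num.min d1 d2 <= d2 by rewrite ge_min lexx orbT.
have := h1 _ (close j i s s' d1 md1 sh s'h); rewrite EE => H1.
have H2 := h2 _ (close i j r r' d2 md2 rh r'h).
set u := partial j (partial i f) (_ + _ + _) in H1 H2.
exact: dist_half_le H1 H2.
Qed.

End schwarz.

Lemma Cn_det N k m (A : 'rV[R]_N -> 'M[R]_m) :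
  (forall i j, Cn k (fun x => A x i j)) -> Cn k (fun x => \det (A x)).
Proof.
move=> hA; rewrite /determinant; apply: Cn_sum => s _; apply: CnZ.
by apply: Cn_prod => i _; exact: hA.
Qed.

Lemma is_derive_prod (V : normedModType R) (x v : V) m (F : 'I_m -> V -> R) (dF : 'I_m -> R) :
  (forall k, is_derive x v (F k) (dF k)) ->
  is_derive x v (fun y => \prod_k F k y) (\sum_k \prod_l (if l == k then dF l else F l x)).
Proof.
elim: m F dF => [|m IH] F dF hF.
  under eq_fun do rewrite big_ord0; rewrite big_ord0.
  exact: is_derive_cst.
under eq_fun do rewrite big_ord_recl.
have h1 := IH (fun k => F (lift ord0 k)) (fun k => dF (lift ord0 k)) (fun k => hF _).
have [d1 d2] := is_deriveM (hF ord0) h1; split; first exact: d1.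
rewrite [LHS]d2.
rewrite big_ord_recl addrC; congr (_ + _).
  rewrite big_ord_recl /= [LHS]mulrC; congr (_ * _).
rewrite [LHS]mulr_sumr; apply: eq_bigr => k _.
rewrite [RHS]big_ord_recl /=; congr (_ * _).
Qed.

Lemma is_derive_sum_seq (V : normedModType R) (x v : V) (I : Type) (r : seq I) (P : pred I)
    (F : I -> V -> R) (dF : I -> R) :
  (forall k, is_derive x v (F k) (dF k)) ->
  is_derive x v (fun y => \sum_(k <- r | P k) F k y) (\sum_(k <- r | P k) dF k).
Proof.
move=> hF; elim: r => [|a r IH].
  by under eq_fun do rewrite big_nil; rewrite big_nil; exact: is_derive_cst.
under eq_fun do rewrite big_cons; rewrite big_cons; case: (boolP (P a)) => // _.
exact: is_deriveD.
Qed.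

Variable m : nat.
Variable W : 'rV[R]_m.+1 -> 'rV[R]_m.+1.
Hypothesis hW : Cnv 2 W.
Let w k := comp_of W k.

Definition crossW (x : 'rV[R]_m.+1) := cross (fun i => grad (comp_of W (lift ord0 i)) x).

(** Leibniz formula for the transposed matrix: its first row is the i-th basis vector, so only the
    permutations sending 0 to i survive. *)
Lemma crossWE x i : crossW x ord0 i =
  \sum_(s : 'S_m.+1 | s ord0 == i) (-1) ^+ s *
    \prod_(k < m) partial (s (lift ord0 k)) (w (lift ord0 k)) x.
Proof.
rewrite mxE -det_tr /determinant (bigID (fun s : 'S_m.+1 => s ord0 == i)) /= addrC big1 ?add0r.
  apply: eq_bigr => s /eqP si; congr (_ * _); rewrite big_ord_recl !mxE unlift_none /= mxE si !eqxx mul1r.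
  by apply: eq_bigr => k _; rewrite !mxE liftK mxE.
by move=> s /negPf si; rewrite big_ord_recl !mxE unlift_none /= mxE si !(mul0r, mulr0).
Qed.

Lemma crossW_C1 : Cnv 1 crossW.
Proof.
move=> j; rewrite /comp_of; under eq_fun do rewrite crossWE.
apply: Cn_sum => s _; apply: CnZ; apply: Cn_prod => k _; apply: Cn_partial; exact: hW.
Qed.

(** Piola's identity. The divergence is a sum over permutations s and positions k of the
    differentiated factor. Composing s with the transposition of 0 and k+1 swaps the two indices of
    the second derivative, which Schwarz's theorem does not see, and flips the sign of s; for each k
    the sum equals its opposite. *)
Lemma div_crossW x : divergence crossW x = 0.
Proof.
pose T (s : 'S_m.+1) k := (-1) ^+ s * \prod_(l < m)
  (if l == k then partial (s ord0) (partial (s (lift ord0 l)) (w (lift ord0 l))) x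
   else partial (s (lift ord0 l)) (w (lift ord0 l)) x) : R.
have E i : partial i (comp_of crossW i) x = \sum_(s : 'S_m.+1 | s ord0 == i) \sum_k T s k.
  rewrite /comp_of; under eq_fun do rewrite crossWE.
  apply: is_derive_partial.
  have H (s : 'S_m.+1) : is_derive x (evec R i) (fun x => (-1) ^+ s *
      \prod_(k < m) partial (s (lift ord0 k)) (w (lift ord0 k)) x)
     ((-1) ^+ s * \sum_k \prod_l (if l == k then partial i (partial (s (lift ord0 l)) (w (lift ord0 l))) x else partial (s (lift ord0 l)) (w (lift ord0 l)) x)).
    apply: is_deriveZ; apply: is_derive_prod => k.
    by apply: (@Cn_is_derive R _ 0); apply: Cn_partial; exact: hW.
  rewrite (_ : \sum_(s | _) _ = \sum_(s : 'S_m.+1 | s ord0 == i) ((-1) ^+ s * \sum_k \prod_l (if l == k then partial i (partial (s (lift ord0 l)) (w (lift ord0 l))) x else partial (s (lift ord0 l)) (w (lift ord0 l)) x))).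
    exact: is_derive_sum_seq.
  by apply: eq_bigr => s /eqP si; rewrite mulr_sumr; apply: eq_bigr => k _; rewrite /T si.
rewrite /divergence (eq_bigr _ (fun i _ => E i)).
transitivity (\sum_(s : 'S_m.+1) \sum_k T s k).
  by apply/esym; rewrite (partition_big (fun s : 'S_m.+1 => s ord0) xpredT).
rewrite exchange_big /= big1// => k _.
suff : \sum_(s : 'S_m.+1) T s k = - \sum_(s : 'S_m.+1) T s k by move=> h; lra.
rewrite [LHS](reindex_inj (mulgI (tperm ord0 (lift ord0 k)))) /= -sumrN.
apply: eq_bigr => s _; rewrite /T odd_permM odd_tperm neq_lift /= -mulNr; congr (_ * _).
  by case: (odd_perm s); rewrite ?expr0 ?expr1 ?opprK.
apply: eq_bigr => l _; rewrite !permM tpermL.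
case: eqP => [->|/eqP lk]; first by rewrite tpermR schwarz//; exact: hW.
by rewrite tpermD ?neq_lift// (inj_eq lift_inj) eq_sym.
Qed.

(** By [crossP] this is the determinant whose first column is grad w^j and whose other columns are
    grad w^2, ..., grad w^N; for j other than the first index two columns coincide. *)
Lemma dotv_grad_crossW x j :
  dotv (grad (w j) x) (crossW x) = if j == ord0 then \det (Dmx W x) else 0.
Proof.
rewrite /crossW crossP; case: eqP => [->|/eqP j0].
  congr (\det _); apply/matrixP => a c; rewrite !mxE.
  by case: (unliftP ord0 c) => [l|] ->; rewrite ?liftK ?unlift_none mxE.
have [k jk] : exists k, j = lift ord0 k.
  by case: (unliftP ord0 j) j0 => [k ->|->]; [exists k|rewrite eqxx].
rewrite -det_tr; apply: (@determinant_alternate _ _ _ ord0 (lift ord0 k)); first exact: neq_lift.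
by move=> a; rewrite !mxE liftK unlift_none jk.
Qed.

End piola.

(** In dimension 2 the clockwise rotation is the cross product of a single vector, by expansion of
    2x2 determinants. From here on both branches of the definition are treated alike. *)
Lemma sigma_bE (R : realType) n (W : 'rV[R]_n.+2 -> 'rV[R]_n.+2) x : sigma_b W x = crossW W x.
Proof.
case: n W x => [|n] W x //.
apply/rowP => j; rewrite !mxE (expand_det_col _ ord0) !big_ord_recl !big_ord0 /cofactor !det_mx11 !mxE.
have E0 : lift (lift ord0 ord0) (0 : 'I_1) = ord0 :> 'I_2 by exact/val_inj.
have E1 : lift ord0 (0 : 'I_1) = lift ord0 ord0 :> 'I_2 by exact/val_inj.
case: j => [[|[|//]] hj] /=; rewrite !E0 !E1 !unlift_none !liftK !mxE /=; ring.
Qed.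

(** * Periodic functions and cell averages *)

Section periodic_functions.
Variables (R : realType) (N : nat).
Implicit Types (f : 'rV[R]_N -> R) (x : 'rV[R]_N).

Lemma periodic_int f i (k : int) x : periodic f -> f (x + k%:~R *: evec R i) = f x.
Proof.
move=> pf.
have nat_case (m : nat) y : f (y + m%:R *: evec R i) = f y.
  elim: m => [|m IH]; first by rewrite scale0r addr0.
  by rewrite mulrSr scalerDl scale1r addrA pf.
case: k => m; first exact: nat_case.
rewrite NegzE mulrNz -[in RHS](subrK (m.+1%:R *: evec R i) x) scaleNr nat_case.
by rewrite pmulrn.
Qed.

Lemma periodic_int_sum f (k : 'I_N -> int) (r : seq 'I_N) x : periodic f ->
  f (x + \sum_(i <- r) (k i)%:~R *: evec R i) = f x.
Proof.
move=> pf; elim: r => [|i r IH]; first by rewrite big_nil addr0.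
by rewrite big_cons addrCA addrC periodic_int.
Qed.

Lemma row_evec_sum x : x = \sum_i x ord0 i *: evec R i.
Proof. exact: row_sum_delta. Qed.

Definition cell_part x : 'rV[R]_N := x - \sum_i (Num.floor (x ord0 i))%:~R *: evec R i.

Lemma cell_part_cube x : cube 0 1 (cell_part x).
Proof.
move=> i; rewrite /cell_part {1}(row_evec_sum x) -sumrB.
under eq_bigr do rewrite -scalerBl.
rewrite summxE (bigD1 i)//= big1 ?addr0.
  rewrite !mxE !eqxx /= mulr1 in_itv /= subr_ge0 ltrBlDl; apply/andP; split.
    exact: floor_le_tmp.
  by rewrite -intrD1 floorD1_gt.
by move=> j /negPf ji; rewrite !mxE eqxx /= eq_sym ji mulr0.
Qed.

Lemma periodic_cell_part f x : periodic f -> f (cell_part x) = f x.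
Proof.
move=> pf; rewrite /cell_part -sumrN; under eq_bigr do rewrite -scaleNr -mulrNz.
exact: (periodic_int_sum (fun i => - Num.floor (x ord0 i))).
Qed.

Lemma periodic_bounded f : continuous f -> periodic f ->
  exists2 C : R, 0 < C & forall x, `|f x| <= C.
Proof.
move=> cf pf; have [M fM] := continuous_cube_bounded 0 1 cf.
exists (`|M| + 1); first by rewrite ltr_wpDl.
move=> x; rewrite -(periodic_cell_part x pf) (le_trans (fM _ (cell_part_cube x)))//.
by rewrite (le_trans (ler_norm _))// lerDl.
Qed.

Lemma periodic_min f : continuous f -> periodic f -> exists x0, forall x, f x0 <= f x.
Proof.
move=> cf pf.
have cK : compact [set v : 'rV[R]_N | forall i, v ord0 i \in `[(0 : R), 1]].
  by apply: (@rV_compact _ _ (fun=> `[(0 : R), 1]%classic)) => _; apply: segment_compact.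
have [||c cI cmin] := @EVT_min_rV R N f _ _ cK.
- by exists 0 => i; rewrite mxE in_itv /= lexx ler01.
- exact: continuous_subspaceT.
exists c => x; rewrite -(periodic_cell_part x pf); apply: cmin; rewrite inE => i.
by have := cell_part_cube x i; rewrite !in_itv /= => /andP[-> /ltW].
Qed.

Lemma partial_at_min f i x0 : (forall x, derivable f x (evec R i)) -> (forall x, f x0 <= f x) ->
  partial i f x0 = 0.
Proof.
move=> df fmin; apply: is_derive_partial; apply: is_derive_line0.
apply: (@derive1_at_min R _ (-1) 1).
- lra.
- move=> t _. have [] := is_derive_line (partialP (df (x0 + t *: evec R i))). by [].
- by rewrite in_itv /= ltrN10 ltr01.
- by move=> t _; rewrite scale0r addr0.
Qed.

Lemma periodic_partial f i : periodic f -> periodic (partial i f).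
Proof.
move=> pf k x; rewrite /partial /derive.
suff -> : (fun h : R => h^-1 *: (f (h *: evec R i + (x + evec R k)) - f (x + evec R k))) =
  (fun h : R => h^-1 *: (f (h *: evec R i + x) - f x)) by [].
by apply/funext => h; rewrite addrA !pf.
Qed.

Lemma periodicM f g : periodic f -> periodic g -> periodic (fun x => f x * g x).
Proof. by move=> pf pg i x; rewrite pf pg. Qed.

(** Points on opposite faces differ by the period [evec R i], which is the face condition of
    [integral_partial_cube]. *)
Lemma integral_partial_cell i f : Cn 1 f -> periodic f ->
  (\int[lebesgueN R N]_(x in @unit_cell R N) (partial i f x)%:E = 0)%E.
Proof.
move=> f1 pf; apply: integral_partial_cube => //.
- exact: Cn_continuous f1.
- by move=> x; exact: Cn_derivable f1.
- by apply: (@Cn_continuous R N 0); exact: Cn_partial.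
move=> x y xi yi xy; rewrite -(pf i x); congr f; apply/rowP => j; rewrite !mxE eqxx /=.
have [->|ji] := eqVneq j i; first by rewrite xi yi add0r.
by rewrite addr0 xy.
Qed.

End periodic_functions.

(** * Consequences of periodicity for W: bounds on sigma, invertibility of M, averages *)

Section cell.
Variables (R : realType) (n : nat).
Variables (W : 'rV[R]_n.+2 -> 'rV[R]_n.+2) (M : 'M[R]_n.+2).
Hypothesis hW : Cnv 2 W.
Hypothesis hWM : Cnv_per 1 (fun x => W x - x *m M^T).
Let P (x : 'rV[R]_n.+2) := W x - x *m M^T.
Let sigma x := \det (Dmx W x).
Hypothesis sigma0 : forall x, 0 < sigma x.

Lemma lin_coordE (x : 'rV[R]_n.+2) j : (x *m M^T) ord0 j = \sum_k M j k * x ord0 k.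
Proof. by rewrite mxE; apply: eq_bigr => k _; rewrite mxE mulrC. Qed.

Lemma Cn_lin k j : Cn k (fun x : 'rV[R]_n.+2 => (x *m M^T) ord0 j).
Proof.
under eq_fun do rewrite lin_coordE.
by apply: Cn_sum => i _; apply: CnZ; exact: Cn_coord.
Qed.

Lemma partial_lin i j x : partial i (fun x : 'rV[R]_n.+2 => (x *m M^T) ord0 j) x = M j i.
Proof.
apply: is_derive_partial; apply: is_derive_line0.
have h : is_derive (0 : R) (1 : R) ((M j i) *: (id : R -> R) + cst ((x *m M^T) ord0 j))
      (M j i *: 1 + 0) by exact: is_deriveD.
move: h; rewrite addr0 [_ *: 1]mulr1; congr is_derive; apply/funext => r.
have -> : ((x + r *: evec R i) *m M^T) ord0 j =
    (x *m M^T) ord0 j + r * (evec R i *m M^T) ord0 j.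
  by rewrite mulmxDl -scalemxAl [LHS]mxE [X in _ + X]mxE.
rewrite [RHS]addrC; congr (_ + _); rewrite [LHS]mulrC; congr (_ * _).
rewrite lin_coordE (bigD1 i)//= big1 ?addr0; first by rewrite mxE !eqxx mulr1.
by move=> k /negPf ki; rewrite mxE eqxx /= ki mulr0.
Qed.

Lemma compWE j x : comp_of W j x = (x *m M^T) ord0 j + comp_of P j x.
Proof. by rewrite /comp_of /P [X in _ = _ + X]mxE [X in _ = _ + (_ + X)]mxE addrC subrK. Qed.

Lemma partial_compW i j x : partial i (comp_of W j) x = M j i + partial i (comp_of P j) x.
Proof.
rewrite (_ : comp_of W j = fun x => (x *m M^T) ord0 j + comp_of P j x); last first.
  by apply/funext => y; rewrite compWE.
rewrite /partial deriveD; last 2 first.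
- exact: (Cn_derivable (Cn_lin 1 j)).
- exact: (Cn_derivable (hWM j).1).
by rewrite -/(partial i _ x) partial_lin.
Qed.

Lemma periodic_DW i j : periodic (partial i (comp_of W j)).
Proof.
by move=> k x; rewrite !partial_compW periodic_partial//; case: (hWM j).
Qed.

Lemma periodic_sigma : periodic sigma.
Proof.
move=> k x; congr (\det _); apply/matrixP => i j; rewrite !mxE; exact: periodic_DW.
Qed.

Lemma Cn_sigma : Cn 1 sigma.
Proof.
apply: Cn_det => i j; under eq_fun do rewrite mxE; apply: Cn_partial; exact: hW.
Qed.

Lemma periodic_crossW j : periodic (comp_of (crossW W) j).
Proof.
move=> k x; rewrite /comp_of /crossW !mxE; congr (\det _); apply/matrixP => a c; rewrite !mxE.
by case: (unlift _ _) => [i|//]; rewrite !mxE periodic_DW.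
Qed.

Lemma sigma_bounds : exists2 c : R, 1 < c & forall x, c^-1 <= sigma x <= c.
Proof.
have cs := Cn_continuous Cn_sigma.
have [C C0 sC] := periodic_bounded cs periodic_sigma.
have [x0 sx0] := periodic_min cs periodic_sigma.
have s0 := sigma0 x0.
(* The sum dominates the upper bound C and the inverse of the minimum at once, and the summand 1
   makes it exceed 1. *)
exists (1 + C + (sigma x0)^-1); first by rewrite -addrA ltrDl addr_gt0// invr_gt0.
move=> x; apply/andP; split.
  rewrite (le_trans _ (sx0 x))// -[leRHS]invrK lef_pV2 ?posrE ?invr_gt0//.
    by rewrite lerDr addr_ge0// ltW.
  by rewrite !addr_gt0// invr_gt0.
rewrite (le_trans (ler_norm _))// (le_trans (sC x))// -addrA addrCA lerDl addr_ge0//.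
by rewrite invr_ge0 ltW.
Qed.

Lemma M_unit : M \in unitmx.
Proof.
apply/negPn/negP => Mu.
have [u u0 uM] : exists2 u : 'rV[R]_n.+2, u != 0 & u *m M = 0.
  have : ~~ row_free M by rewrite row_free_unit.
  rewrite -kermx_eq0 => /rowV0Pn[u uk u0]; exists u => //; exact/sub_kermxP.
(* Since [u *m M = 0], this is also the combination of the components of W with coefficients u,
   although it is written with the periodic part P. *)
pose f x := \sum_j u ord0 j * comp_of P j x.
have f1 : Cn 1 f by apply: Cn_sum => j _; apply: CnZ; case: (hWM j).
have pf : periodic f.
  move=> k x; apply: eq_bigr => j _; congr (_ * _); exact: (hWM j).2.
have [x0 fx0] := periodic_min (Cn_continuous f1) pf.
have : \det (Dmx W x0) = 0.
  rewrite -det_tr; apply/eqP/det0P; exists u => //; apply/rowP => i; rewrite !mxE.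
  have := @partial_at_min R _ f i x0 (fun x => Cn_derivable f1) fx0.
  have -> : partial i f x0 = \sum_j u ord0 j * partial i (comp_of P j) x0.
    apply: is_derive_partial; apply: is_derive_sum_seq => j.
    by apply: is_deriveZ; apply: Cn_is_derive; exact: (hWM j).1.
  move=> h; rewrite -[RHS]h; transitivity (\sum_j (u ord0 j * M j i + u ord0 j * partial i (comp_of P j) x0)).
    by apply: eq_bigr => j _; rewrite !mxE partial_compW mulrDr.
  rewrite big_split /= -[RHS]add0r; congr (_ + _).
  by have := congr1 (fun v : 'rV[R]_n.+2 => v ord0 i) uM; rewrite !mxE.
by move=> h; have := sigma0 x0; rewrite /sigma h ltxx.
Qed.

Lemma P_bounded : exists2 C : R, 0 < C & forall x, `|P x| <= C.
Proof.
have h j : {C : R | forall x, `|P x ord0 j| <= C}.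
  apply: cid; have [C C0 hC] := periodic_bounded (Cn_continuous (hWM j).1) (hWM j).2.
  by exists C.
exists (1 + \sum_j `|sval (h j)|); first by rewrite ltr_wpDr// sumr_ge0.
move=> x; apply: rV_norm_le => [|j]; first by rewrite addr_ge0// sumr_ge0.
rewrite (le_trans (svalP (h j) x))// (le_trans (ler_norm _))// (bigD1 j)//= addrCA lerDl.
by rewrite addr_ge0// sumr_ge0.
Qed.

(** Write S for [crossW W]. Row j of M is grad w^j - grad P_j. The term S . grad w^j is sigma or 0,
    while S . grad P_j is the divergence of P_j S, because div S = 0, and the divergence of a
    periodic field has zero integral over the cell. In vector form: M xi_0 = sigma_0 e_1. *)
Lemma average_crossW j : \sum_i M j i * average (comp_of (crossW W) i) =
  if j == ord0 then average sigma else 0.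
Proof.
have S1 := crossW_C1 hW.
have PS1 i : Cn 1 (fun x => comp_of P j x * comp_of (crossW W) i x).
  by apply: CnM; [case: (hWM j)|exact: S1].
have mC : measurable (@unit_cell R n.+2) by exact: measurable_cube.
have intc f : continuous f -> (lebesgueN R n.+2).-integrable (@unit_cell R n.+2) (EFin \o f).
  exact: continuous_cube_integrable.
have E x : \sum_i (M j i * comp_of (crossW W) i x) +
    \sum_i partial i (fun x => comp_of P j x * comp_of (crossW W) i x) x =
    if j == ord0 then sigma x else 0.
  rewrite -(dotv_grad_crossW W x j) -big_split /=.
  transitivity (\sum_i (grad (comp_of W j) x ord0 i * crossW W x ord0 i +
     comp_of P j x * partial i (comp_of (crossW W) i) x)).
    apply: eq_bigr => i _; rewrite mxE partial_compW.
    have -> : partial i (fun x => comp_of P j x * comp_of (crossW W) i x) x =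
       comp_of P j x * partial i (comp_of (crossW W) i) x +
       comp_of (crossW W) i x * partial i (comp_of P j) x.
      rewrite /partial deriveM//; [exact: (Cn_derivable (hWM j).1)|exact: (Cn_derivable (S1 i))].
    have gen (a c p d k : R) : a * c + (p * d + c * k) = (a + k) * c + p * d by ring.
    exact: gen.
  by rewrite big_split /= -mulr_sumr -/(divergence (crossW W) x) div_crossW// mulr0 addr0.
have cS i : continuous (comp_of (crossW W) i) by exact: Cn_continuous (S1 i).
have cPS i : continuous (partial i (fun x => comp_of P j x * comp_of (crossW W) i x)).
  by apply: (@Cn_continuous R _ 0); exact: Cn_partial.
transitivity (\int[lebesgueN R n.+2]_(x in @unit_cell R n.+2)
   (\sum_i (M j i * comp_of (crossW W) i x) +
    \sum_i partial i (fun x => comp_of P j x * comp_of (crossW W) i x) x)).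
  rewrite RintegralD//; last 2 first.
  - apply: intc; apply: (@Cn_continuous _ _ 0); apply: Cn_sum => i _; apply: CnZ; split => //; exact: cS.
  - apply: intc; apply: (@Cn_continuous _ _ 0); apply: Cn_sum => i _; split => //; exact: cPS.
  rewrite !Rintegral_sum//; last 2 first.
  - by move=> i; apply: intc => x; apply: continuousM; [exact: cst_continuous|exact: cS].
  - by move=> i; apply: intc; exact: cPS.
  rewrite [X in _ = _ + X]big1 ?addr0.
    by apply: eq_bigr => i _; rewrite RintegralZl//; apply: intc; exact: cS.
  move=> i _; rewrite /Rintegral integral_partial_cell//.
  apply: periodicM; [exact: (hWM j).2|exact: periodic_crossW].
under eq_Rintegral do rewrite E.
by case: ifPn => // _; rewrite Rintegral_cst// mul0r.
Qed.

Lemma lebesgueN_unit_cell : lebesgueN R n.+2 (@unit_cell R n.+2) = 1%E.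
Proof.
rewrite /unit_cell (@lebesgueN_box R n.+2 (fun=> [set` `[0, 1[]))// big1// => i _.
by rewrite lebesgue_measure_itv /= lte_fin ltr01 sube0.
Qed.

Lemma average_sigma_gt0 : 0 < average sigma.
Proof.
have [c c1 sc] := sigma_bounds.
have c0 : 0 < c^-1 by rewrite invr_gt0 (lt_trans ltr01).
have mC : measurable (@unit_cell R n.+2) by exact: measurable_cube.
apply: (lt_le_trans c0); rewrite -[leLHS]mulr1 -[in leLHS](_ : fine (lebesgueN R n.+2 (@unit_cell R n.+2)) = 1).
  rewrite -Rintegral_cst//; apply: le_Rintegral => //.
  - by apply: continuous_cube_integrable; exact: cst_continuous.
  - by apply: continuous_cube_integrable; exact: Cn_continuous Cn_sigma.
  by move=> x _; case/andP: (sc x).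
by rewrite lebesgueN_unit_cell.
Qed.

End cell.

(** * Local integrability and weak derivatives *)

Section Lfun_bounded.
Context d (T : measurableType d) (R : realType) (mu : {measure set T -> \bar R}).

Lemma LfunE (p : \bar R) (f : T -> R) : f \in Lfun mu p <->
  measurable_fun setT f /\ ('N[mu]_p[EFin \o f] < +oo)%E.
Proof.
by rewrite inE; split => [/andP[]|[h1 h2]]; [|apply/andP; split]; rewrite !inE.
Qed.

Lemma bounded_support_Lfun (p : R) (g : T -> R) (A : set T) (C : R) : 0 < p ->
  measurable A -> (mu A < +oo)%E -> measurable_fun setT g ->
  (forall x, `|g x| <= C) -> (forall x, ~ A x -> g x = 0) -> g \in Lfun mu p%:E.
Proof.
move=> p0 mA Aoo mg gC g0; apply/LfunE; split => //.
rewrite unlock /Lnorm poweR_lty//.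

apply: (@le_lt_trans _ _ (\int[mu]_x (`|C| `^ p * \1_A x)%:E)%E).
  apply: ge0_le_integral => //.
  - by move=> x _; exact: poweR_ge0.
  - apply: (@measurableT_comp _ _ _ _ _ _ (@poweR R ^~ p)) => //=.
      exact: measurable_poweR.
    by apply/measurable_EFinP; apply: measurableT_comp.
  - by apply/measurable_EFinP; apply: measurable_funM => //; exact: measurable_indic.
  move=> x _ /=; rewrite lee_fin; have [Ax|Ax] := pselect (A x).
    rewrite indicE mem_set// mulr1; apply: ge0_ler_powR; rewrite ?nnegrE//; first exact: ltW.
    by rewrite (le_trans (gC x))// ler_norm.
  by rewrite g0// normr0 powR0 ?gt_eqF// mulr_ge0// powR_ge0.
under eq_integral do rewrite EFinM.
rewrite ge0_integralZl//.
- by rewrite integral_indic// setIT lte_mul_pinfty// ?lee_fin ?powR_ge0.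
- by apply/measurable_EFinP; exact: measurable_indic.
Qed.

End Lfun_bounded.

Section weak_derivatives.
Variables (R : realType) (N : nat).
Local Notation mu := (lebesgueN R N).
Implicit Types (f g : 'rV[R]_N -> R) (K : set 'rV[R]_N).

Lemma compact_continuous_bound f K : continuous f -> compact K ->
  exists2 C : R, 0 <= C & forall x, K x -> `|f x| <= C.
Proof.
move=> cf cK.
have /compact_bounded[M0 [_ /(_ (M0 + 1) (ltr_pwDr ltr01 (lexx _)))]] : compact (f @` K).
  by apply: continuous_compact => //; exact: continuous_subspaceT.
set M := M0 + 1 => fM; exists `|M| => // x Kx.
by rewrite (le_trans _ (ler_norm _))//; apply: fM; exists x.
Qed.

Lemma Lp_loc_continuous (p : R) f : 0 < p -> continuous f -> Lp_loc p f.
Proof.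
move=> p0 cf K cK; have [C C0 fC] := compact_continuous_bound cf cK.
apply: (@bounded_support_Lfun _ _ _ _ _ _ K C) => //.
- exact: compact_measurable_rV.
- exact: compact_lebesgueN_lty.
- apply: measurable_funM; first exact: continuous_measurable_rV.
  by apply: measurable_indic; exact: compact_measurable_rV.
- move=> x; rewrite indicE; have [/set_mem Kx|_] := boolP (x \in K).
    by rewrite mulr1 fC.
  by rewrite mulr0 normr0.
- by move=> x Kx; rewrite indicE memNset// mulr0.
Qed.

Lemma integrable_bounded_compact f K (C : R) : measurable_fun setT f -> compact K ->
  (forall x, `|f x| <= C) -> (forall x, ~ K x -> f x = 0) -> mu.-integrable setT (EFin \o f).
Proof.
move=> mf cK fC f0; apply/Lfun1_integrable.
apply: (@bounded_support_Lfun _ _ _ _ 1 f K C) => //.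
- exact: compact_measurable_rV.
- exact: compact_lebesgueN_lty.
Qed.

Lemma integrable_continuous_compact f K : continuous f -> compact K ->
  (forall x, ~ K x -> f x = 0) -> mu.-integrable setT (EFin \o f).
Proof.
move=> cf cK f0; have [C C0 fC] := compact_continuous_bound cf cK.
apply: (@integrable_bounded_compact f K C) => //; first exact: continuous_measurable_rV.
move=> x; have [Kx|Kx] := pselect (K x); first exact: fC.
by rewrite f0// normr0.
Qed.

Lemma partial_out f K i x : compact K -> (forall x, ~ K x -> f x = 0) -> ~ K x ->
  partial i f x = 0.
Proof.
move=> cK f0 Kx; rewrite /partial -(derive_cst (0 : R) x (evec R i)).
apply: near_eq_derive.
have : open (~` K) by apply: closed_openC; apply: compact_closed => //; exact: norm_hausdorff.
rewrite openE => /(_ x Kx) h; near=> y; rewrite f0//=.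
by near: y; exact: h.
Unshelve. all: by end_near. Qed.

Lemma integral_partial_compact f K i : Cn 1 f -> compact K ->
  (forall x, ~ K x -> f x = 0) -> \int[mu]_x partial i f x = 0.
Proof.
move=> f1 cK f0.
have [k k0 Kk] := bounded_cube (compact_bounded cK).
(* Enlarging the cube by 1 pushes its faces off K, so f vanishes on them and opposite faces
   match. *)
have notK (x : 'rV[R]_N) j : (x ord0 j = - (k + 1) \/ x ord0 j = k + 1) -> ~ K x.
  by move=> h /Kk /(_ j); rewrite in_itv /= => /andP[h1 h2]; case: h => h; lra.
rewrite /Rintegral.
rewrite (_ : (\int[mu]_x _)%E = (\int[mu]_(x in @cube R N (- (k + 1)) (k + 1)) (partial i f x)%:E)%E).
  rewrite integral_partial_cube//.
  - lra.
  - exact: Cn_continuous f1.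
  - by move=> x; exact: Cn_derivable f1.
  - by apply: (@Cn_continuous R N 0); exact: Cn_partial.
  - by move=> x y xa yb _; rewrite !f0//; apply: (notK _ i); [right|left].
rewrite [RHS]integral_mkcond; apply: eq_integral => x _; rewrite patchE.
case: ifPn => //; rewrite notin_setE => xc; congr EFin; apply: (@partial_out _ K) => // Kx.
apply: xc => j; have := Kk x Kx j; rewrite !in_itv /= => /andP[h1 h2]; apply/andP; split; lra.
Qed.

Lemma weak_partial_C1 f i : Cn 1 f -> weak_partial i f (partial i f).
Proof.
move=> f1.
have cf := Cn_continuous f1.
have cpf : continuous (partial i f) by apply: (@Cn_continuous R N 0); exact: Cn_partial.
split; [exact: Lp_loc_continuous|exact: Lp_loc_continuous|].
move=> phi [phiC [K cK phi0]].
have phi1 := phiC 1.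
have cphi := Cn_continuous phi1.
have cpphi : continuous (partial i phi) by apply: (@Cn_continuous R N 0); exact: Cn_partial.
have E : \int[mu]_x partial i (fun x => f x * phi x) x = 0.
  apply: (@integral_partial_compact _ K) => //; first exact: CnM.
  by move=> x Kx; rewrite phi0// mulr0.
apply/eqP; rewrite -addr_eq0 -E; apply/eqP.
rewrite -RintegralD//; last 2 first.
- apply: (@integrable_continuous_compact _ K) => //.
    by move=> x; apply: continuousM; [exact: cf|exact: cpphi].
  by move=> x Kx; rewrite (@partial_out _ K)// mulr0.
- apply: (@integrable_continuous_compact _ K) => //.
    by move=> x; apply: continuousM; [exact: cpf|exact: cphi].
  by move=> x Kx; rewrite phi0// mulr0.
apply: eq_Rintegral => x _; rewrite /partial deriveM//.
- by congr (_ + _); exact: mulrC.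
- exact: Cn_derivable f1.
- exact: Cn_derivable phi1.
Qed.

Lemma W1p_loc_C1 (p : R) f : 0 < p -> Cn 1 f -> W1p_loc p f.
Proof.
move=> p0 f1; split; first by apply: Lp_loc_continuous => //; exact: Cn_continuous f1.
move=> i; exists (partial i f); last exact: weak_partial_C1.
by apply: Lp_loc_continuous => //; apply: (@Cn_continuous R N 0); exact: Cn_partial.
Qed.

End weak_derivatives.

Section weak_div.
Variables (R : realType) (n : nat).
Local Notation mu := (lebesgueN R n).

Lemma weak_divergence_C1 (U : 'rV[R]_n -> 'rV[R]_n) : Cnv 1 U ->
  weak_divergence U (divergence U).
Proof.
move=> U1.
have cd i : continuous (partial i (comp_of U i)).
  by apply: (@Cn_continuous R n 0); exact: Cn_partial.
split.
- by move=> j; apply: Lp_loc_continuous => //; exact: Cn_continuous (U1 j).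
- apply: Lp_loc_continuous => //; apply: (@Cn_continuous R n 0); apply: Cn_sum => i _; split => //.
move=> phi [phiC [K cK phi0]].
have phi1 := phiC 1.
have cphi := Cn_continuous phi1.
have i1 i : mu.-integrable setT (EFin \o (fun x => U x ord0 i * partial i phi x)).
  apply: (@integrable_continuous_compact _ _ _ K) => //.
    move=> x; apply: continuousM; first exact: (Cn_continuous (U1 i)).
    by apply: (@Cn_continuous R n 0); exact: Cn_partial.
  by move=> x Kx; rewrite (@partial_out _ _ _ K)// mulr0.
have i2 i : mu.-integrable setT (EFin \o (fun x => partial i (comp_of U i) x * phi x)).
  apply: (@integrable_continuous_compact _ _ _ K) => //.
    by move=> x; apply: continuousM; [exact: cd|exact: cphi].
  by move=> x Kx; rewrite phi0// mulr0.
transitivity (\sum_i \int[mu]_x (U x ord0 i * partial i phi x)).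
  rewrite -Rintegral_sum//; apply: eq_Rintegral => x _; apply: eq_bigr => i _; by rewrite mxE.
transitivity (\sum_i - \int[mu]_x (partial i (comp_of U i) x * phi x)).
  apply: eq_bigr => i _; have [_ _ ->] := weak_partial_C1 i (U1 i) => //; by split => //; exists K.
rewrite sumrN -Rintegral_sum//; congr (- _); apply: eq_Rintegral => x _.
by rewrite mulr_suml.
Qed.

End weak_div.

(** * Density of boxes and bump functions *)

Section density.
Import HBNNSimple.
Context d (T : measurableType d) (R : realType).
Variables (Nm : (T -> R) -> \bar R) (L : R -> (T -> R) -> R).
Variables (G : set (set T)) (D : nat -> set T) (C e0 : R).

(** Frame of the density argument: [Nm] stands for an integral norm, possibly composed with a change
    of variables, and [L e] for linear functionals bounded by [C * Nm] with C independent of e in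
    ]0, e0[. [G] is a generating pi-system and [D] an exhaustion by members of [G]. Convergence of
    [L e] to 0 on indicators of [G] is to be extended to every h of finite norm. *)
Definition dom (h : T -> R) := measurable_fun setT h /\ (Nm h < +oo)%E.

Hypothesis e0_gt0 : 0 < e0.
Hypothesis C_ge0 : 0 <= C.
Hypothesis mG : measurable = <<s G >>.
Hypothesis GI : setI_closed G.
Hypothesis GD : forall k, G (D k).
Hypothesis Dcov : forall x, \forall k \near \oo, D k x.
Hypothesis Nm_ge0 : forall h, (0 <= Nm h)%E.
Hypothesis Nm_le : forall g h : T -> R, measurable_fun setT g -> measurable_fun setT h ->
  (forall x, `|g x| <= `|h x|) -> (Nm g <= Nm h)%E.
Hypothesis NmD : forall k (c : R), (Nm (fun x => (c * \1_(D k) x)%R) < +oo)%E.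
Hypothesis Nm_cvg : forall (h : T -> R) (h_ : nat -> T -> R), dom h ->
  (forall k, measurable_fun setT (h_ k)) -> (forall k x, `|h_ k x| <= `|h x|) ->
  (forall x, h_ k x @[k --> \oo] --> 0) -> Nm (h_ k) @[k --> \oo] --> 0%E.
Hypothesis LD : forall e g h, 0 < e < e0 -> dom g -> dom h ->
  L e (fun x => g x + h x) = L e g + L e h.
Hypothesis LZ : forall e c h, 0 < e < e0 -> dom h -> L e (fun x => c * h x) = c * L e h.
Hypothesis Lb : forall e h, 0 < e < e0 -> dom h -> (`|L e h|%:E <= C%:E * Nm h)%E.
Hypothesis Lbase : forall A k, G A -> A `<=` D k -> L e \1_A @[e --> 0^'+] --> 0.

Let mD k : measurable (D k). Proof. by rewrite mG; exact: sub_sigma_algebra. Qed.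

Let e_near : \forall e \near 0^'+, 0 < e < e0.
Proof.
near=> e; apply/andP; split; near: e; first exact: nbhs_right_gt.
exact: nbhs_right_lt.
Unshelve. all: by end_near. Qed.

Let dom_le (g h : T -> R) : measurable_fun setT g -> dom h -> (forall x, `|g x| <= `|h x|) -> dom g.
Proof.
by move=> mg [mh hoo] gh; split => //; apply: le_lt_trans hoo; exact: Nm_le.
Qed.

Let dom_bounded (g : T -> R) k (c : R) : measurable_fun setT g -> (forall x, `|g x| <= c) ->
  (forall x, ~ D k x -> g x = 0) -> dom g.
Proof.
move=> mg gc g0; apply: (@dom_le _ (fun x => c * \1_(D k) x)) => //.
  split; last exact: NmD.
  by apply: measurable_funM => //; exact: measurable_indic.
move=> x; rewrite indicE; have [Dx|Dx] := pselect (D k x).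
  by rewrite mem_set// mulr1 (le_trans (gc x))// ler_norm.
by rewrite g0// normr0.
Qed.

Let L_cvgD g h : dom g -> dom h -> L e g @[e --> 0^'+] --> 0 -> L e h @[e --> 0^'+] --> 0 ->
  L e (fun x => g x + h x) @[e --> 0^'+] --> 0.
Proof.
move=> dg dh cg ch; apply: cvg_trans (_ : L e g + L e h @[e --> 0^'+] --> 0).
  apply: near_eq_cvg; near=> e; rewrite LD//; near: e; exact: e_near.
by rewrite -[X in _ --> X](addr0 0); apply: cvgD.
Unshelve. all: by end_near. Qed.

Let L_cvgZ c h : dom h -> L e h @[e --> 0^'+] --> 0 ->
  L e (fun x => c * h x) @[e --> 0^'+] --> 0.
Proof.
move=> dh ch; apply: cvg_trans (_ : c * L e h @[e --> 0^'+] --> 0).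
  apply: near_eq_cvg; near=> e; rewrite LZ//; near: e; exact: e_near.
by rewrite -[X in _ --> X](mulr0 c); apply: cvgMr.
Unshelve. all: by end_near. Qed.

(** The functionals are bounded uniformly in e, so a single k with [Nm (h - h_ k)] small serves for
    all small e at once; g is the dominating function that makes this seminorm tend to 0. The radius
    is divided by C + 1 rather than C because C may vanish. *)
Lemma limit_cvg0 (h g : T -> R) (h_ : nat -> T -> R) : dom h -> dom g ->
  (forall k, dom (h_ k)) -> (forall k x, `|h x - h_ k x| <= `|g x|) ->
  (forall x, h_ k x @[k --> \oo] --> h x) ->
  (forall k, L e (h_ k) @[e --> 0^'+] --> 0) -> L e h @[e --> 0^'+] --> 0.
Proof.
move=> dh dg dh_ hg hcv Lh; apply/cvgrPdist_lt => /= eps eps0.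
have dB k : dom (fun x => h x - h_ k x).
  by apply: dom_le dg _ => //; apply: measurable_funB; [case: dh|case: (dh_ k)].
have : Nm (fun x => h x - h_ k x) @[k --> \oo] --> 0%E.
  apply: Nm_cvg dg _ _ _ => //; first by move=> k; case: (dB k).
  move=> x; rewrite -[X in _ --> X](subrr (h x)); apply: cvgB => //; exact: cvg_cst.
move=> /fine_cvgP[Nfin /cvgrPdist_lt].
have d0 : 0 < eps / 2 / (C + 1) by rewrite !divr_gt0// ltr_wpDl.
move=> /(_ _ d0) Nsmall.
have [k [/= Nk1 Nk2]] := filter_ex (filterI Nfin Nsmall).
have Nk : C * fine (Nm (fun x => h x - h_ k x)) < eps / 2.
  move: Nk2; rewrite sub0r normrN => /(le_lt_trans (ler_norm _)).
  rewrite ltr_pdivlMr ?ltr_wpDl// => h1; apply: le_lt_trans h1.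
  rewrite mulrC ler_wpM2l ?lerDl//; exact: fine_ge0.
have e20 : 0 < eps / 2 by rewrite divr_gt0.
near=> e.
have ee : 0 < e < e0 by near: e; exact: e_near.
have -> : L e h = L e (h_ k) + L e (fun x => h x - h_ k x).
  by rewrite -LD//; congr (L e _); apply/funext => x; rewrite addrC subrK.
rewrite sub0r normrN (splitr eps) (le_lt_trans (ler_normD _ _))// ltrD//.
  have -> : `|L e (h_ k)| = `|0 - L e (h_ k)| by rewrite sub0r normrN.
  by near: e; move: (Lh k) => /cvgrPdist_lt/(_ _ e20).
apply: le_lt_trans Nk; rewrite -lee_fin EFinM fineK//; exact: Lb.
Unshelve. all: by end_near. Qed.

Let dom_indic k (E : set T) : measurable E -> dom (\1_(E `&` D k) : T -> R).
Proof.
move=> mE; apply: (@dom_bounded _ k 1).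
- by apply: measurable_indic; exact: measurableI.
- by move=> x; rewrite indicE; case: (_ \in _); rewrite ?normr1 ?normr0.
- by move=> x Dx; rewrite indicE memNset// => -[].
Qed.

(** Dynkin's argument: for fixed k, the sets E for which the claim holds form a lambda-system
    containing the pi-system [G]. Complements are taken inside [D k]; a disjoint union is the limit
    of its finite unions through [limit_cvg0]. *)
Let L_cvg_set k (E : set T) : measurable E -> L e \1_(E `&` D k) @[e --> 0^'+] --> 0.
Proof.
pose S := [set E : set T | measurable E /\ L e \1_(E `&` D k) @[e --> 0^'+] --> 0].
suff : measurable `<=` S by move=> h mE; have [] := h E mE.
clear E.
rewrite [X in X `<=` _]mG -(setI_closed_g_dynkin_g_sigma_algebra GI); apply: smallest_sub.
  split => /=.
  - by split; [exact: measurableT|rewrite setTI; exact: (Lbase (GD k) (@subset_refl _ _))].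
  - move=> E [mE cE]; split; first exact: measurableC.
    rewrite (_ : \1_(~` E `&` D k) = fun x => \1_(D k) x + (-1) * \1_(E `&` D k) x); last first.
      apply/funext => x; rewrite !indicE !in_setI in_setC.
      by case: (x \in E); case: (x \in D k); rewrite /= ?mulr0 ?mulr1 ?addr0 ?subrr.
    apply: L_cvgD.
    + by rewrite -(setTI (D k)); apply: dom_indic; exact: measurableT.
    + apply: (@dom_bounded _ k 1).
      * apply: measurable_funM => //; apply: measurable_indic; exact: measurableI.
      * by move=> x; rewrite indicE; case: (_ \in _); rewrite ?mulr1 ?mulr0 ?normrN ?normr1 ?normr0.
      * by move=> x Dx; rewrite indicE memNset ?mulr0// => -[].
    + exact: (Lbase (GD k) (@subset_refl _ _)).
    + by apply: L_cvgZ => //; exact: dom_indic.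
  - move=> F tF SF; have mF n : measurable (F n) by case: (SF n).
    split; first exact: bigcupT_measurable.
    pose h_ n x : R := \1_((\bigcup_(i < n) F i) `&` D k) x.
    have mU n : measurable (\bigcup_(i < n) F i).
      by rewrite bigcup_mkord; apply: bigsetU_measurable.
    apply: (@limit_cvg0 _ (\1_((\bigcup_i F i) `&` D k)) h_).
    + by apply: dom_indic; exact: bigcupT_measurable.
    + by apply: dom_indic; exact: bigcupT_measurable.
    + by move=> n; apply: dom_indic.
    + move=> n x; rewrite /h_ !indicE.
      have [/set_mem[[i /= i_n Fi] Dx]|_] := boolP (x \in (\bigcup_(i < n) F i) `&` D k).
        by rewrite mem_set ?subrr ?normr0//; split => //; exists i.
      by rewrite subr0.
    + move=> x; rewrite /h_ indicE; have [/set_mem[[i _ Fi] Dx]|nx] := boolP (x \in (\bigcup_i F i) `&` D k).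
        apply: cvg_near_cst; near=> n.
        rewrite indicE mem_set//; split => //; exists i => //=.
        by near: n; exact: nbhs_infty_gt.
      apply: cvg_near_cst; near=> n.
      rewrite indicE memNset// => -[[i _ Fi] Dx]; move/negP: nx; apply.
      by apply/mem_set; split => //; exists i.
    + elim => [|n IH].
        rewrite /h_ bigcup_mkord big_ord0 set0I.
        have := L_cvgZ 0 (dom_indic k measurableT) (_ : L e \1_(setT `&` D k) @[e --> 0^'+] --> 0).
        rewrite setTI => /(_ (Lbase (GD k) (@subset_refl _ _))).
        by under eq_fun do under [X in L _ X]eq_fun do rewrite mul0r; rewrite indic0.
      have -> : h_ n.+1 = fun x => h_ n x + \1_(F n `&` D k) x.
        apply/funext => x; rewrite /h_ !bigcup_mkord big_ord_recr /= setIUl.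
        rewrite !indicE in_setU.
        have [/set_mem[Fn Dx]|_] := boolP (x \in F n `&` D k); last by rewrite orbF addr0.
        rewrite orbT memNset ?add0r// => -[+ _]; rewrite -bigcup_mkord => -[i /= i_n Fi].
        by have := tF i n I I (ex_intro _ x (conj Fi Fn)) => ii; rewrite ii ltnn in i_n.
      apply: L_cvgD; [exact: dom_indic|exact: dom_indic|exact: IH|by case: (SF n)].
move=> A GA /=; split; first by rewrite mG; exact: sub_sigma_algebra.
exact: (@Lbase _ k (GI GA (GD k)) (@subIsetr _ _ _)).
Unshelve. all: by end_near. Qed.

Let L_cvg_nnsfun k (s : {nnsfun T >-> R}) : L e (fun x => s x * \1_(D k) x) @[e --> 0^'+] --> 0.
Proof.
pose r : seq R := finmap.enum_fset (fset_set (range s)).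
have sE : (fun x => s x * \1_(D k) x) =
  fun x => \sum_(i < size r) (r`_i * \1_(s @^-1` [set r`_i] `&` D k) x).
  apply/funext => x; rewrite fimfunEord mulr_suml; apply: eq_bigr => i _.
  by rewrite -mulrA indicI.
rewrite sE.
have mi (i : nat) : measurable (s @^-1` [set r`_i]) by exact: measurable_funPTI.
have domi (i : nat) : dom (fun x => r`_i * \1_(s @^-1` [set r`_i] `&` D k) x).
  apply: (@dom_bounded _ k `|r`_i|).
  - by apply: measurable_funM => //; apply: measurable_indic; exact: measurableI.
  - move=> x; rewrite normrM ler_piMr// indicE; case: (_ \in _); by rewrite ?normr1 ?normr0.
  - by move=> x Dx; rewrite indicE memNset ?mulr0// => -[].
move: (size r) => m.
suff [] : dom (fun x => \sum_(i < m) r`_i * \1_(s @^-1` [set r`_i] `&` D k) x) /\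
   L e (fun x => \sum_(i < m) r`_i * \1_(s @^-1` [set r`_i] `&` D k) x) @[e --> 0^'+] --> 0 by [].
elim: m => [|m [IH1 IH2]].
  under eq_fun do rewrite big_ord0.
  have d0 : dom (fun=> 0) by apply: (@dom_bounded _ k 0) => // x; rewrite normr0.
  split => //.
  have := L_cvgZ 0 (dom_indic k measurableT) (L_cvg_set k measurableT).
  by under eq_fun do under [X in L _ X]eq_fun do rewrite mul0r.
under eq_fun do rewrite big_ord_recr /=.
split; last by apply: L_cvgD => //; apply: L_cvgZ; [exact: dom_indic|exact: L_cvg_set].
have dm := domi m.
apply: (@dom_bounded _ k (\sum_(i < m.+1) `|r`_i|)).
- apply: measurable_funD; [by case: IH1|by case: dm].
- move=> x; rewrite -(@big_ord_recr _ _ _ _ (fun i => r`_i * \1_(s @^-1` [set r`_i] `&` D k) x)).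
  apply: le_trans (ler_norm_sum _ _ _) _; apply: ler_sum => i _.
  by rewrite normrM ler_piMr// indicE; case: (_ \in _); rewrite ?normr1 ?normr0.
- move=> x Dx; rewrite big1 ?add0r => [|i _]; by rewrite indicE memNset ?mulr0// => -[].
Qed.

(** Approximation from below by simple functions, cut off by [D n]; all errors are dominated by h
    itself. *)
Let L_cvg_ge0 h : dom h -> (forall x, 0 <= h x) -> L e h @[e --> 0^'+] --> 0.
Proof.
move=> dh h0; have [mh hoo] := dh.
have meh : measurable_fun setT (EFin \o h) by exact/measurable_EFinP.
pose s := nnsfun_approx measurableT meh.
have s_le n x : s n x <= h x.
  by rewrite -lee_fin nnsfun_approxE; apply: le_approx => // y _; rewrite lee_fin.
apply: (@limit_cvg0 h h (fun n x => s n x * \1_(D n) x)) => //.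
- move=> n; apply: dom_le dh _.
    by apply: measurable_funM => //; exact: measurable_indic.
  move=> x; rewrite ger0_norm ?mulr_ge0// ger0_norm// indicE.
  by case: (_ \in _); rewrite ?mulr1 ?mulr0.
- move=> n x; rewrite indicE; case: (_ \in _); rewrite ?mulr1 ?mulr0 ?subr0//.
  by rewrite !ger0_norm ?subr_ge0// gerBl.
- move=> x; apply: cvg_trans (_ : s n x @[n --> \oo] --> h x).
    apply: near_eq_cvg; near=> n; rewrite indicE mem_set ?mulr1//; near: n; exact: Dcov.
  have h0' y : setT y -> (0 <= (EFin \o h) y)%E by rewrite /= lee_fin.
  have /fine_cvgP[_] := @cvg_nnsfun_approx _ _ _ _ measurableT _ meh h0' x I.
  exact.
Unshelve. all: by end_near. Qed.

Lemma density_cvg0 h : dom h -> L e h @[e --> 0^'+] --> 0.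
Proof.
move=> dh; have [mh hoo] := dh.
have dp : dom (h^\+).
  apply: dom_le dh _; first exact: measurable_funrpos.
  by move=> x; rewrite ger0_norm ?funrpos_ge0// /funrpos ge_max normr_ge0 ler_norm.
have dn : dom (h^\-).
  apply: dom_le dh _; first exact: measurable_funrneg.
  by move=> x; rewrite ger0_norm ?funrneg_ge0// /funrneg ge_max normr_ge0 -normrN ler_norm.
rewrite (_ : h = fun x => h^\+ x + (-1) * h^\- x); last first.
  by rewrite -{1}(funrposBneg h); apply/funext => x; rewrite mulN1r.
apply: L_cvgD => //.
- apply: (@dom_le _ (h^\-)) => // [|x]; last by rewrite mulN1r normrN.
  by apply: measurable_funM => //; case: dn.
- by apply: L_cvg_ge0 => // x; exact: funrpos_ge0.
- by apply: L_cvgZ => //; apply: L_cvg_ge0 => // x; exact: funrneg_ge0.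
Qed.

End density.

Section continuity.
Variables (R : realType) (T : topologicalType).
Implicit Types f g : T -> R.

Lemma contM f g : continuous f -> continuous g -> continuous (fun x => f x * g x).
Proof. by move=> cf cg x; apply: continuousM; [exact: cf|exact: cg]. Qed.

Lemma contD f g : continuous f -> continuous g -> continuous (fun x => f x + g x).
Proof. by move=> cf cg x; apply: continuousD; [exact: cf|exact: cg]. Qed.

Lemma contB f g : continuous f -> continuous g -> continuous (fun x => f x - g x).
Proof. by move=> cf cg x; apply: continuousB; [exact: cf|exact: cg]. Qed.

Lemma contN f : continuous f -> continuous (fun x => - f x).
Proof. by move=> cf x; apply: continuousN; exact: cf. Qed.

Lemma contC (c : R) : continuous (fun _ : T => c).
Proof. by move=> x; exact: cst_continuous. Qed.

Lemma contV f : continuous f -> (forall x, f x != 0) -> continuous (fun x => (f x)^-1).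
Proof. by move=> cf f0 x; apply: continuousV => //; exact: cf. Qed.

Lemma cont_comp (h : R -> R) f : continuous h -> continuous f -> continuous (fun x => h (f x)).
Proof. by move=> ch cf x; apply: continuous_comp; [exact: cf|exact: ch]. Qed.

Lemma cont_prod (I : Type) (r : seq I) (F : I -> T -> R) :
  (forall i, continuous (F i)) -> continuous (fun x => \prod_(i <- r) F i x).
Proof.
move=> hF; elim: r => [|a r IH].
  by under eq_fun do rewrite big_nil; exact: contC.
by under eq_fun do rewrite big_cons; apply: contM.
Qed.

Lemma is_derive_val_eq (V : normedModType R) (f : V -> R) (x v : V) (df df' : R) :
  is_derive x v f df -> df = df' -> is_derive x v f df'.
Proof. by move=> h <-. Qed.

End continuity.

Lemma cont_id (R : realType) : continuous (fun x : R => x).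
Proof. by move=> x; exact: cvg_id. Qed.

(** * Explicit C^1 bumps and time cut-offs *)

Section bumps.
Variable R : realType.

(** A quadratic error bound absorbs the corner of the positive part: it gives the derivative of
    [posq] at 0 and elsewhere by one case analysis. *)
Lemma is_derive_quad (f : R -> R) (x df c : R) :
  (forall h, `|f (h + x) - f x - h * df| <= c * h ^+ 2) -> is_derive x 1 f df.
Proof.
move=> H.
have cv : h^-1 *: (f (h *: 1 + x) - f x) @[h --> 0^'] --> df.
  apply/cvgrPdist_le => /= eps eps0; near=> h.
  have h0 : h != 0 by near: h; exact: nbhs_dnbhs_neq.
  have hn : 0 < `|h| by rewrite normr_gt0.
  rewrite [h *: 1]mulr1 -[_ *: _]/(h^-1 * _).
  rewrite -(ler_pM2l hn) -normrM mulrBr mulrA divff// mul1r distrC.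
  apply: le_trans (H h) _; rewrite -real_normK ?num_real// expr2 mulrA [leRHS]mulrC ler_wpM2r//.
  rewrite (@le_trans _ _ ((`|c| + 1) * `|h|))//.
    by rewrite ler_wpM2r// (le_trans (ler_norm _))// lerDl.
  rewrite -ler_pdivlMl ?ltr_wpDl//; near: h; apply: dnbhs0_le.
  by rewrite mulr_gt0// invr_gt0 ltr_wpDl.
by split; [apply/cvg_ex; exists df|exact/cvg_lim].
Unshelve. all: by end_near. Qed.

(** The square makes the positive part continuously differentiable, which is all that the test
    functions require. *)
Definition posq (x : R) : R := Num.max x 0 ^+ 2.

Lemma posq_ge0 x : 0 <= posq x. Proof. exact: sqr_ge0. Qed.

Lemma posq_le0 x : x <= 0 -> posq x = 0.
Proof. by move=> x0; rewrite /posq max_r// expr0n. Qed.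

Lemma posq_gt0 x : 0 < x -> 0 < posq x.
Proof. by move=> x0; rewrite /posq max_l ?ltW// exprn_gt0. Qed.

Lemma is_derive_posq (x : R) : is_derive x 1 posq (2 * Num.max x 0).
Proof.
apply: (@is_derive_quad _ _ _ 1) => h; rewrite mul1r /posq ler_norml.
have [h1|h1] := leP (h + x) 0; have [h2|h2] := leP x 0; apply/andP; split; nra.
Qed.

Lemma continuous_max0 : continuous (fun x : R => Num.max x 0).
Proof.
have -> : (fun x : R => Num.max x 0) = (fun x : R => (x + `|x|) / 2).
  by apply/funext => x; have [x0|x0] := leP x 0; [rewrite ler0_norm|rewrite gtr0_norm]; lra.
move=> x; apply: (@continuousM R R (fun x : R => x + `|x|) (fun=> 2^-1)); last exact: cst_continuous.
apply: (@continuousD R R R id (fun x : R => `|x|)); first exact: cvg_id.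
exact: norm_continuous.
Qed.

Lemma is_derive_continuous (f df : R -> R) : (forall x : R, is_derive x (1 : R) f (df x)) -> continuous f.
Proof.
by move=> h x; apply: differentiable_continuous; apply/derivable1_diffP; case: (h x).
Qed.

Lemma continuous_posq : continuous posq.
Proof. exact: is_derive_continuous is_derive_posq. Qed.

Let bg (a b x : R) := posq (x - a) * posq (b - x).
Let dbg (a b x : R) := posq (x - a) * (- (2 * Num.max (b - x) 0)) + posq (b - x) * (2 * Num.max (x - a) 0).

Let is_derive_bg a b (x : R) : is_derive x (1 : R) (bg a b) (dbg a b x).
Proof.
apply: is_deriveM.
  rewrite -[X in is_derive _ _ _ X]mulr1.
  apply: (@is_derive1_comp R posq (fun x => x - a)); first exact: is_derive_posq.
  rewrite -[X in is_derive _ _ _ X]subr0; exact: is_deriveB.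
rewrite -mulrN1; apply: (@is_derive1_comp R posq (fun x => b - x)); first exact: is_derive_posq.
rewrite -[X in is_derive _ _ _ X]sub0r; exact: is_deriveB.
Qed.

(** The map 1 - 1/(1 + k y) sends 0 to 0 and every y > 0 to values increasing to 1 with k. Composed
    with a C^1 function positive exactly on ]a, b[, it yields C^1 functions between 0 and 1,
    supported in the interval for every k and converging to its indicator pointwise. *)
Definition bump (a b : R) (k : nat) (x : R) : R := 1 - (1 + k%:R * bg a b x)^-1.
Definition dbump (a b : R) (k : nat) (x : R) : R :=
  k%:R * dbg a b x * (1 + k%:R * bg a b x) ^- 2.

Let bg_ge0 a b x : 0 <= bg a b x. Proof. by rewrite mulr_ge0// posq_ge0. Qed.
Let den_gt0 a b (k : nat) x : 0 < 1 + k%:R * bg a b x.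
Proof. by rewrite ltr_wpDr// mulr_ge0. Qed.

Lemma is_derive_bump a b k (x : R) : is_derive x (1 : R) (bump a b k) (dbump a b k x).
Proof.
have h : is_derive x 1 (fun x => 1 + k%:R * bg a b x) (k%:R * dbg a b x).
  rewrite -[X in is_derive _ _ _ X]add0r; apply: is_deriveD; exact: is_deriveZ.
have hne : 1 + k%:R * bg a b x != 0 by rewrite gt_eqF.
have [h1 h2] := h.
have hV : is_derive x 1 (fun x => (1 + k%:R * bg a b x)^-1) (- (1 + k%:R * bg a b x) ^- 2 *: (k%:R * dbg a b x)).
  by split; [exact: derivableV|rewrite deriveV// h2].
apply: (is_derive_val_eq (is_deriveB (is_derive_cst (1 : R) x (1 : R)) hV)).
rewrite sub0r; by rewrite /dbump scaleNr opprK [RHS]mulrC.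
Qed.

Lemma continuous_bump a b k : continuous (bump a b k).
Proof. exact: is_derive_continuous (is_derive_bump a b k). Qed.

Lemma continuous_dbump a b k : continuous (dbump a b k).
Proof.
have cbg : continuous (bg a b) := is_derive_continuous (is_derive_bg a b).
apply: contM; last first.
  apply: contV; last by move=> x; rewrite expf_neq0// gt_eqF.
  apply: (cont_comp (@exprn_continuous _ 2)); apply: contD; first exact: contC.
  by apply: contM => //; exact: contC.
have ca : continuous (fun x => x - a) by apply: contB; [exact: cont_id|exact: contC].
have cb : continuous (fun x => b - x) by apply: contB; [exact: contC|exact: cont_id].
apply: contM; first exact: contC.
apply: contD; apply: contM.
- exact: (cont_comp continuous_posq ca).
- by apply: contN; apply: contM; [exact: contC|exact: (cont_comp continuous_max0 cb)].
- exact: (cont_comp continuous_posq cb).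
- by apply: contM; [exact: contC|exact: (cont_comp continuous_max0 ca)].
Qed.

Lemma bump_itv01 a b k x : 0 <= bump a b k x <= 1.
Proof.
have h := den_gt0 a b k x; apply/andP; split.
  by rewrite subr_ge0 invf_le1// lerDl mulr_ge0.
by rewrite gerBl invr_ge0 ltW.
Qed.

Lemma bump_out a b k x : x \notin `]a, b[ -> bump a b k x = 0.
Proof.
rewrite in_itv /= negb_and -!leNgt => h; rewrite /bump /bg.
have -> : posq (x - a) * posq (b - x) = 0.
  by case/orP: h => h; [rewrite posq_le0 ?mul0r//|rewrite [X in _ * X]posq_le0 ?mulr0//]; rewrite subr_le0.
by rewrite mulr0 addr0 invr1 subrr.
Qed.

Lemma dbump_out a b k x : x \notin `]a, b[ -> dbump a b k x = 0.
Proof.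
rewrite in_itv /= negb_and -!leNgt => h; rewrite /dbump /dbg.
case/orP: h => h.
  by rewrite posq_le0 ?subr_le0// (@max_r _ _ (x - a)) ?subr_le0// mul0r !mulr0 addr0 mulr0 mul0r.
rewrite (@posq_le0 (b - x)) ?subr_le0// (@max_r _ _ (b - x)) ?subr_le0// mul0r addr0 mulr0 oppr0.
by rewrite !mulr0 mul0r.
Qed.

Lemma invSD_cvg0 (c : R) : 0 < c -> (1 + k%:R * c)^-1 @[k --> \oo] --> (0 : R).
Proof.
move=> c0; apply/cvgrPdist_lt => /= e e0; near=> k.
have h : 0 < 1 + k%:R * c by rewrite ltr_wpDr// mulr_ge0// ltW.
rewrite sub0r normrN ger0_norm ?invr_ge0 ?ltW// -[ltRHS]invrK ltf_pV2 ?posrE ?invr_gt0//.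
rewrite (@lt_trans _ _ (k%:R * c))// ?ltrDr// -ltr_pdivrMr//.
near: k; exact: nbhs_infty_gtr.
Unshelve. all: by end_near. Qed.

Lemma bump_cvg a b x : bump a b k x @[k --> \oo] --> (\1_[set` `]a, b[] x : R).
Proof.
rewrite indicE; have [xab|xab] := boolP (x \in `]a, b[).
  rewrite mem_set// /bump -[X in _ --> X]subr0; apply: cvgB; first exact: cvg_cst.
  apply: invSD_cvg0; move: xab; rewrite in_itv /= => /andP[h1 h2].
  by rewrite mulr_gt0// posq_gt0// subr_gt0.
rewrite memNset; last by move=> /= h; rewrite h in xab.
by under eq_fun do rewrite bump_out//; exact: cvg_cst.
Qed.

(* alpha k is C^1, vanishes outside of ]-1, s[, and its derivative on t > 0 tends to -1_{t<s} *)
Let eps (k : nat) : R := k.+1%:R^-1.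
(** A C^1 regularisation of the positive part of u. The positive [eps k] keeps the square root away
    from its singularity, subtracting it makes the function vanish for u <= 0, and the derivative
    stays between 0 and 1, which provides domination. *)
Let rho k (u : R) := Num.sqrt (posq u + eps k ^+ 2) - eps k.
Let drho k (u : R) := Num.max u 0 / Num.sqrt (posq u + eps k ^+ 2).
(** Equal to 1 for t >= 0 and to 0 for t <= -1: it makes the support compact on the left without
    affecting nonnegative times. *)
Let cut (t : R) := posq (1 - posq (- t)).

Let eps0 k : 0 < eps k. Proof. by rewrite invr_gt0. Qed.
Let rad_gt0 k u : 0 < posq u + eps k ^+ 2.
Proof. by rewrite ltr_wpDl ?posq_ge0// exprn_gt0. Qed.

Let is_derive_rho k (u : R) : is_derive u (1 : R) (rho k) (drho k u).
Proof.
have h : is_derive u 1 (fun u => posq u + eps k ^+ 2) (2 * Num.max u 0).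
  rewrite -[X in is_derive _ _ _ X]addr0; apply: is_deriveD; exact: is_derive_posq.
apply: (is_derive_val_eq (is_deriveB (@is_derive1_comp R Num.sqrt _ u _ _
  (is_derive1_sqrt (rad_gt0 k u)) h) (is_derive_cst (eps k) u (1 : R)))).
rewrite subr0 /drho invfM mulrACA mulVf ?mul1r 1?mulrC//.
Qed.

Let rho_le0 k u : u <= 0 -> rho k u = 0.
Proof. by move=> u0; rewrite /rho posq_le0// add0r sqrtr_sqr ger0_norm ?subrr// ltW. Qed.

Let drho_itv k u : 0 <= drho k u <= 1.
Proof.
apply/andP; split; first by rewrite divr_ge0// le_max lexx orbT.
rewrite ler_pdivrMr ?sqrtr_gt0// mul1r.
have m0 : 0 <= Num.max u 0 by rewrite le_max lexx orbT.
rewrite -[leLHS]ger0_norm// -sqrtr_sqr; apply: ler_wsqrtr.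
by rewrite /posq lerDl sqr_ge0.
Qed.

Let eps_cvg : eps k @[k --> \oo] --> (0 : R).
Proof. exact: (@cvg_harmonic R). Qed.

Let rad_cvg u : 0 < u -> Num.sqrt (posq u + eps k ^+ 2) @[k --> \oo] --> u.
Proof.
move=> u0.
have E : Num.sqrt (posq u + 0 ^+ 2) = u.
  by rewrite expr0n addr0 /posq max_l ?ltW// sqrtr_sqr ger0_norm ?ltW.
rewrite -[X in _ --> X]E.
apply: (@cvg_comp _ _ _ (fun k => posq u + eps k ^+ 2) Num.sqrt); last exact: sqrt_continuous.
apply: cvgD; first exact: cvg_cst.
by rewrite expr2; under eq_fun do rewrite expr2; apply: cvgM; exact: eps_cvg.
Qed.

Let is_derive_cut t : is_derive t (1 : R) cut
  ((2 * Num.max (1 - posq (- t)) 0) * (2 * Num.max (- t) 0)).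
Proof.
apply: (@is_derive1_comp R posq (fun t => 1 - posq (- t))); first exact: is_derive_posq.
have hN : is_derive t (1 : R) (fun t : R => - t) (-1) by exact: is_deriveN.
apply: (is_derive_val_eq (is_deriveB (is_derive_cst (1 : R) t (1 : R))
  (@is_derive1_comp R posq (fun t => - t) t _ _ (is_derive_posq (- t)) hN))).
by rewrite sub0r mulrN1 opprK.
Qed.

Definition alpha (s : R) k t := cut t * rho k (s - t).
Definition dalpha (s : R) k t := cut t * (- drho k (s - t)) +
  rho k (s - t) * ((2 * Num.max (1 - posq (- t)) 0) * (2 * Num.max (- t) 0)).

Lemma is_derive_alpha s k (t : R) : is_derive t (1 : R) (alpha s k) (dalpha s k t).
Proof.
have hs : is_derive t (1 : R) (fun t : R => s - t) (-1).
  by rewrite -[X in is_derive _ _ _ X]sub0r; exact: is_deriveB.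
apply: is_deriveM; first exact: is_derive_cut.
by apply: (is_derive_val_eq (@is_derive1_comp R (rho k) (fun t => s - t) t _ _ (is_derive_rho k (s - t)) hs)); rewrite mulrN1.
Qed.

Lemma continuous_alpha s k : continuous (alpha s k).
Proof. exact: is_derive_continuous (is_derive_alpha s k). Qed.

Lemma continuous_dalpha s k : continuous (dalpha s k).
Proof.
have cs : continuous (fun t : R => s - t) by apply: contB; [exact: contC|exact: cont_id].
have cN : continuous (fun t : R => - t) by apply: contN; exact: cont_id.
have cc : continuous cut := is_derive_continuous is_derive_cut.
have cr : continuous (rho k) := is_derive_continuous (is_derive_rho k).
have cdr : continuous (drho k).
  apply: contM; first exact: continuous_max0.
  apply: contV => [|x]; last by rewrite gt_eqF// sqrtr_gt0.
  apply: (cont_comp (@sqrt_continuous R)); apply: contD; [exact: continuous_posq|exact: contC].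
apply: contD; apply: contM => //.
- by apply: contN; exact: (cont_comp cdr cs).
- exact: (cont_comp cr cs).
apply: contM; apply: contM; try exact: contC; last exact: (cont_comp continuous_max0 cN).
apply: (cont_comp continuous_max0); apply: contB; first exact: contC.
exact: (cont_comp continuous_posq cN).
Qed.

Lemma alpha_out s k t : t <= -1 \/ s <= t -> alpha s k t = 0.
Proof.
rewrite /alpha; case=> h; last by rewrite rho_le0 ?mulr0// subr_le0.
rewrite /cut posq_le0 ?mul0r// subr_le0 /posq max_l; last lra.
by nra.
Qed.

Let cut_pos t : 0 <= t -> cut t = 1.
Proof. by move=> t0; rewrite /cut (@posq_le0 (- t)) ?oppr_le0// subr0 /posq max_l ?ler01// expr1n. Qed.

Lemma dalpha_pos s k t : 0 <= t -> dalpha s k t = - drho k (s - t).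
Proof.
move=> t0; rewrite /dalpha cut_pos// mul1r (@max_r _ _ (- t)) ?oppr_le0//.
by rewrite !mulr0 addr0.
Qed.

Lemma dalpha_norm s k t : 0 <= t -> `|dalpha s k t| <= 1.
Proof.
by move=> t0; rewrite dalpha_pos// normrN; have /andP[h1 h2] := drho_itv k (s - t); rewrite ger0_norm.
Qed.

Lemma dalpha_cvg s t : 0 <= t ->
  dalpha s k t @[k --> \oo] --> (- \1_[set` `]-oo, s[] t : R).
Proof.
move=> t0; under eq_fun do rewrite dalpha_pos//.
apply: cvgN; rewrite indicE; have [ts|ts] := boolP (t \in `]-oo, s[).
  rewrite mem_set//; move: ts; rewrite in_itv /= => ts.
  have st : 0 < s - t by rewrite subr_gt0.
  rewrite -[true%:R](@divff _ (s - t)) ?gt_eqF//.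
  apply: cvgM; first by rewrite max_l ?ltW//; exact: cvg_cst.
  by apply: cvgV; [rewrite gt_eqF|exact: rad_cvg].
rewrite memNset; last by move=> /= h; rewrite h in ts.
move: ts; rewrite in_itv /= -leNgt => ts.
under eq_fun do rewrite /drho max_r ?subr_le0// mul0r.
exact: cvg_cst.
Qed.

Lemma alpha0_cvg s : 0 < s -> alpha s k 0 @[k --> \oo] --> s.
Proof.
move=> s0; rewrite /alpha; under eq_fun do rewrite cut_pos// mul1r subr0.
have : rho k s @[k --> \oo] --> s - 0 by apply: cvgB; [exact: rad_cvg|exact: eps_cvg].
by rewrite subr0.
Qed.

End bumps.

(** * Pi-systems of boxes in space and in space-time *)

Section generators.
Variable R : realType.

Definition obox n (a b : 'I_n -> R) : set 'rV[R]_n := [set x | forall i, x ord0 i \in `]a i, b i[].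

Definition oboxes n : set (set 'rV[R]_n) := [set A | exists a b, A = obox a b].

Lemma obox_setI n : setI_closed (@oboxes n).
Proof.
move=> _ _ [a [b ->]] [c [e ->]].
exists (fun i => Num.max (a i) (c i)), (fun i => Num.min (b i) (e i)).
apply/seteqP; split => x /=.
  move=> [h1 h2] i; have := h1 i; have := h2 i; rewrite !in_itv /= gt_max lt_min.
  by move=> /andP[-> ->] /andP[-> ->].
move=> h; split => i; have := h i; rewrite !in_itv /= gt_max lt_min;
  by move=> /andP[/andP[? ?] /andP[? ?]]; apply/andP.
Qed.

Lemma measurable_obox n (a b : 'I_n -> R) : measurable (obox a b).
Proof. exact: (@measurable_rV_box R n (fun i => [set` `]a i, b i[])). Qed.

Lemma rV_eventually_obox n (x : 'rV[R]_n) :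
  \forall k \near \oo, obox (fun=> - k%:R) (fun=> k%:R) x.
Proof.
near=> k; move=> i; rewrite in_itv /= -ltr_norml.
apply: le_lt_trans (rV_norm_coord x i) _.
near: k; exact: nbhs_infty_gtr.
Unshelve. all: by end_near. Qed.

(** A slab ]a, b[ in one coordinate is the countable union over k of the boxes whose other sides are
    ]-k, k[. *)
Lemma rV_measurable_oboxes n : @measurable _ 'rV[R]_n = <<s @oboxes n >>.
Proof.
apply/seteqP; split; last first.
  apply: smallest_sub; first exact: sigma_algebra_measurable.
  by move=> _ [a [b ->]]; exact: measurable_obox.
apply: smallest_sub; first exact: smallest_sigma_algebra.
rewrite -bigcup_seq; apply: bigcup_sub => i _ A [B mB <-].
pose TG : measurableType _ := g_sigma_algebraType (@oboxes n).
suff mc : measurable_fun [set: TG] (fun x : TG => (x : 'rV[R]_n) ord0 i) by exact: mc.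
apply: (measurability _ (measurable_realfun.RGenOpens.measurableE R)).
move=> _ [_ [a [b ->] <-]]; rewrite setTI.
rewrite (_ : _ @^-1` _ = \bigcup_k (obox (fun j => if j == i then a else - k%:R)
   (fun j => if j == i then b else k%:R))).
  apply: (@bigcupT_measurable _ TG) => k; apply: sub_sigma_algebra.
  by exists (fun j => if j == i then a else - k%:R), (fun j => if j == i then b else k%:R).
apply/seteqP; split => x /=.
  move=> xi; have [k /= hk] := filter_ex (rV_eventually_obox x).
  by exists k => // j; case: eqP => [->//|_]; exact: hk.
by move=> [k _ /(_ i)]; rewrite eqxx.
Qed.

Local Notation RV n := (measurableTypeR R * 'rV[R]_n)%type.

(** Half-lines in time rather than intervals, because the derivatives of the cut-offs [alpha s k]
    tend, on t >= 0, to minus the indicator of ]-oo, s[. *)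
Definition tboxes n : set (set (RV n)) :=
  [set A | exists s a b, A = [set z | z.1 < s /\ obox a b z.2]].

Lemma tboxes_setI n : setI_closed (@tboxes n).
Proof.
move=> _ _ [s [a [b ->]]] [s' [c [e ->]]].
have [a' [b' E]] : oboxes (obox a b `&` obox c e) by apply: obox_setI; [exists a, b|exists c, e].
exists (Num.min s s'), a', b'; rewrite -E; apply/seteqP; split => -[t x] /=.
  by move=> [[h1 h2] [h3 h4]]; rewrite lt_min h1 h3.
by rewrite lt_min => -[/andP[h1 h3] [h2 h4]].
Qed.

Lemma RV_measurable_tboxes n : @measurable _ (RV n) = <<s @tboxes n >>.
Proof.
apply/seteqP; split; last first.
  apply: smallest_sub; first exact: sigma_algebra_measurable.
  move=> _ [s [a [b ->]]].
  rewrite (_ : [set _ | _] = [set` `]-oo, s[] `*` obox a b); last first.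
    by apply/seteqP; split => -[t x] /=; rewrite in_itv.
  by apply: measurableX => //; exact: measurable_obox.
apply: smallest_sub; first exact: smallest_sigma_algebra.
pose TG : measurableType _ := g_sigma_algebraType (@tboxes n).
(* Intersecting with bounded boxes turns preimages under the projections into members of [tboxes],
   which constrain time and space simultaneously. *)
have covt (A : set (RV n)) : (forall k : nat, <<s @tboxes n >>
     (A `&` [set z | z.1 < k%:R /\ obox (fun=> - k%:R) (fun=> k%:R) z.2])) ->  <<s @tboxes n >> A.
  move=> h; rewrite (_ : A = \bigcup_k (A `&` [set z | z.1 < k%:R /\ obox (fun=> - k%:R) (fun=> k%:R) z.2])).
    by apply: (@bigcupT_measurable _ TG) => k; exact: h.
  apply/seteqP; split; last by move=> z [k _ []].
  move=> [t x] Az; have h1 : \forall k \near \oo, t < k%:R by exact: nbhs_infty_gtr.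
  have [k [/= k1 k2]] := filter_ex (filterI h1 (rV_eventually_obox x)).
  by exists k.
rewrite subUset; split => A [B mB <-].
  suff mc : measurable_fun [set: TG] (fst : TG -> measurableTypeR R) by exact: mc.
  apply: (measurability _ (RGenInftyO.measurableE R)).
  move=> _ [_ [s ->] <-]; rewrite setTI; apply: covt => k.
  apply: sub_sigma_algebra; exists (Num.min s k%:R), (fun=> - k%:R), (fun=> k%:R).
  apply/seteqP; split => -[t x] /=; rewrite in_itv /= lt_min.
    by move=> [-> [-> ?]].
  by move=> [/andP[-> ->] ?].
suff mc : measurable_fun [set: TG] (snd : TG -> 'rV[R]_n) by exact: mc.
apply: (measurability _ (rV_measurable_oboxes n)).
move=> _ [_ [a [b ->] <-]]; rewrite setTI; apply: covt => k.
have [a' [b' E]] : oboxes (obox a b `&` obox (fun=> - k%:R) (fun=> k%:R)).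
  by apply: obox_setI; [exists a, b|exists (fun=> - k%:R), (fun=> k%:R)].
apply: sub_sigma_algebra; exists k%:R, a', b'; rewrite -E.
apply/seteqP; split => -[t x] /=; first by move=> [? [? ?]].
by move=> [? [? ?]].
Qed.

Lemma measurable_tbox n s (a b : 'I_n -> R) :
  measurable ([set z | z.1 < s /\ obox a b z.2] : set (RV n)).
Proof. by rewrite RV_measurable_tboxes; apply: sub_sigma_algebra; exists s, a, b. Qed.

End generators.

Section real_dominated_convergence.
Context d (T : measurableType d) (R : realType) (mu : {measure set T -> \bar R}).
Variables (f_ : nat -> T -> R) (f g : T -> R).
Hypothesis mf_ : forall n, measurable_fun setT (f_ n).
Hypothesis mf : measurable_fun setT f.
Hypothesis ig : mu.-integrable setT (EFin \o g).
Hypothesis f_g : forall n x, `|f_ n x| <= g x.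
Hypothesis f_f : forall x, f_ n x @[n --> \oo] --> f x.

Let dct := @dominated_convergence _ _ _ mu setT measurableT (fun n => EFin \o f_ n)
  (EFin \o f) (EFin \o g).

Let hyp1 n : measurable_fun setT (EFin \o f_ n). Proof. exact/measurable_EFinP. Qed.
Let hyp2 : measurable_fun setT (EFin \o f). Proof. exact/measurable_EFinP. Qed.
Let hyp3 : {ae mu, forall x, setT x -> (fun n => (EFin \o f_ n) x) @ \oo --> (EFin \o f) x}.
Proof.
apply/nearW => x _; apply/fine_cvgP; split; first exact: nearW.
exact: f_f.
Qed.
Let hyp4 : {ae mu, forall x n, setT x -> (`|(EFin \o f_ n) x| <= (EFin \o g) x)%E}.
Proof. by apply/nearW => x n _; rewrite lee_fin. Qed.

Lemma dct_integrable : mu.-integrable setT (EFin \o f).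
Proof. by have [] := dct hyp1 hyp2 hyp3 ig hyp4. Qed.

Lemma dct_dist : (\int[mu]_x (`|f_ n x - f x|)%:E)%E @[n --> \oo] --> 0%E.
Proof. by have [_ + _] := dct hyp1 hyp2 hyp3 ig hyp4. Qed.

Lemma dct_Rintegral : \int[mu]_x f_ n x @[n --> \oo] --> \int[mu]_x f x.
Proof.
have [_ _ h] := dct hyp1 hyp2 hyp3 ig hyp4.
apply: fine_cvg; rewrite fineK; last by apply: integrable_fin_num => //; exact: dct_integrable.
exact: h.
Qed.

End real_dominated_convergence.

Section C1_comp.
Variables (R : realType) (N : nat).
Implicit Types (f : 'rV[R]_N -> R).

Lemma partial_comp1 (h dh : R -> R) f i x : (forall y : R, is_derive y (1 : R) h (dh y)) ->
  Cn 1 f -> partial i (fun x => h (f x)) x = dh (f x) * partial i f x.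
Proof.
move=> hh f1; apply: is_derive_partial.
exact: (@is_derive_comp1 R _ h f x (evec R i) _ _ (hh _) (Cn_is_derive i x f1)).
Qed.

Lemma C1_comp1 (h dh : R -> R) f : (forall y : R, is_derive y (1 : R) h (dh y)) ->
  continuous dh -> Cn 1 f -> Cn 1 (fun x => h (f x)).
Proof.
move=> hh cdh f1; have cf := Cn_continuous f1.
split; first by apply: cont_comp => //; exact: is_derive_continuous hh.
move=> i; split.
  move=> x; have [] := @is_derive_comp1 R _ h f x (evec R i) _ _ (hh _) (Cn_is_derive i x f1).
  by [].
rewrite (_ : partial i _ = fun x => dh (f x) * partial i f x); last first.
  by apply/funext => x; exact: partial_comp1.
split => //; apply: contM; first exact: cont_comp.
by apply: (@Cn_continuous R N 0); exact: Cn_partial.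
Qed.

End C1_comp.

(** * Weak convergence of oscillating functions *)

Section oscillation.
Variables (R : realType) (N : nat).
Local Notation mu := (lebesgueN R N).

Definition pbump (a b : 'I_N -> R) k (x : 'rV[R]_N) : R := \prod_i bump (a i) (b i) k (x ord0 i).

Lemma pbump_C1 a b k : Cn 1 (pbump a b k).
Proof.
apply: Cn_prod => i _; apply: (C1_comp1 (is_derive_bump _ _ _)); last exact: Cn_coord.
exact: continuous_dbump.
Qed.

Lemma pbump_out a b k x : ~ obox a b x -> pbump a b k x = 0.
Proof.
move=> /existsNP[i] /negP h.
by rewrite /pbump (bigD1 i)//= bump_out// mul0r.
Qed.

Lemma pbump_itv a b k x : 0 <= pbump a b k x <= 1.
Proof.
rewrite /pbump; elim/big_ind: _ => [|u v /andP[u0 u1] /andP[v0 v1]|i _]; last exact: bump_itv01.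
  by rewrite ler01 lexx.
by rewrite mulr_ge0//= mulr_ile1.
Qed.

Lemma pbump_cvg a b x : pbump a b k x @[k --> \oo] --> (\1_(obox a b) x : R).
Proof.
have -> : \1_(obox a b) x = \prod_i (\1_[set` `]a i, b i[] (x ord0 i) : R).
  rewrite indicE; have [/set_mem h|] := boolP (x \in _).
    by rewrite big1// => i _; rewrite indicE mem_set//; exact: h.
  rewrite notin_setE => /existsNP[i h]; rewrite (bigD1 i)//= indicE memNset ?mul0r//.
apply: cvg_big => //; last by move=> i _; exact: bump_cvg.
  exact: mul_continuous.
Qed.

Lemma obox_compact a b : exists2 K : set 'rV[R]_N, compact K & obox a b `<=` K.
Proof.
exists [set v : 'rV[R]_N | forall i, v ord0 i \in `[a i, b i]].
  by apply: (@rV_compact _ _ (fun i => `[a i, b i]%classic)) => i; apply: segment_compact.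
by move=> x h i; have := h i; rewrite !in_itv /= => /andP[/ltW -> /ltW ->].
Qed.

Lemma obox_lty a b : (mu (obox a b) < +oo)%E.
Proof.
have [K cK sK] := obox_compact a b; apply: le_lt_trans (compact_lebesgueN_lty cK).
by apply: le_measure; rewrite ?inE//; [exact: measurable_obox|exact: compact_measurable_rV].
Qed.

Lemma integrable_obox a b : mu.-integrable setT (EFin \o (\1_(obox a b) : 'rV[R]_N -> R)).
Proof.
apply/Lfun1_integrable; apply: (@bounded_support_Lfun _ _ _ _ 1 _ (obox a b) 1) => //.
- exact: measurable_obox.
- exact: obox_lty.
- by apply: measurable_indic; exact: measurable_obox.
- by move=> x; rewrite indicE; case: (_ \in _); rewrite ?normr1 ?normr0.
- by move=> x h; rewrite indicE memNset.
Qed.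

Lemma integrableMr_bounded (h f : 'rV[R]_N -> R) (C : R) : measurable_fun setT f ->
  (forall x, `|f x| <= C) -> mu.-integrable setT (EFin \o h) ->
  mu.-integrable setT (EFin \o (fun x => f x * h x)).
Proof.
move=> mf fC ih; have mh : measurable_fun setT h by exact/measurable_EFinP/measurable_int/ih.
apply: (@le_integrable _ _ _ mu setT measurableT _ (fun x => (`|C| * h x)%:E)).
- by apply/measurable_EFinP; exact: measurable_funM.
- move=> x _; rewrite lee_fin !normrM normr_id ler_wpM2r//.
  by rewrite (le_trans (fC x))// ler_norm.
by under eq_fun do rewrite EFinM; apply: integrableZl.
Qed.

Variables (P : 'rV[R]_N -> R) (i : 'I_N).
Hypothesis P1 : Cn 1 P.
Hypothesis pP : periodic P.
Let f (e : R) (x : 'rV[R]_N) := partial i P (e^-1 *: x).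

Let cf e : continuous (f e).
Proof.
by apply: scale_arg_continuous; apply: (@Cn_continuous R N 0); exact: Cn_partial.
Qed.

Let mf e : measurable_fun setT (f e). Proof. exact: continuous_measurable_rV. Qed.

(** The function [partial i P (x / e)] is the derivative of e P(x / e), which is O(e) uniformly; one
    integration by parts moves the derivative onto chi. *)
Lemma osc_test (chi : 'rV[R]_N -> R) (K : set 'rV[R]_N) : Cn 1 chi -> compact K ->
  (forall x, ~ K x -> chi x = 0) ->
  \int[mu]_x (f e x * chi x) @[e --> 0^'+] --> (0 : R).
Proof.
move=> chi1 cK chi0.
have [C C0 PC] := periodic_bounded (Cn_continuous P1) pP.
have cchi := Cn_continuous chi1.
have cpchi : continuous (partial i chi) by apply: (@Cn_continuous R N 0); exact: Cn_partial.
have pchi0 x : ~ K x -> partial i chi x = 0 by exact: partial_out.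
have ipchi : mu.-integrable setT (EFin \o (fun x => `|partial i chi x|)).
  apply: (@integrable_continuous_compact _ _ _ K) => //.
    by move=> x; apply: continuous_comp; [exact: cpchi|exact: norm_continuous].
  by move=> x Kx; rewrite pchi0// normr0.
pose I := \int[mu]_x `|partial i chi x|.
have I0 : 0 <= I by apply: Rintegral_ge0.
have bound e : 0 < e -> `|\int[mu]_x (f e x * chi x)| <= e * (C * I).
  move=> e0.
  pose Q x := e * P (e^-1 *: x).
  have Q1 : Cn 1 Q by apply: CnZ; exact: Cn_scale_arg.
  have QE x : partial i Q x = f e x.
    rewrite (_ : partial i Q x = e * partial i (fun x => P (e^-1 *: x)) x).
      by rewrite partial_scale_arg ?mulrA ?divff ?gt_eqF ?mul1r//; exact: Cn_derivable P1.
    apply: is_derive_partial; apply: is_deriveZ; apply: (@Cn_is_derive R N 0); exact: Cn_scale_arg.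
  have cQ := Cn_continuous Q1.
  have E : \int[mu]_x partial i (fun x => Q x * chi x) x = 0.
    apply: (@integral_partial_compact _ _ _ K) => //; first exact: CnM.
    by move=> x Kx; rewrite chi0// mulr0.
  have i1 : mu.-integrable setT (EFin \o (fun x => Q x * partial i chi x)).
    apply: (@integrable_continuous_compact _ _ _ K) => //; first exact: contM.
    by move=> x Kx; rewrite pchi0// mulr0.
  have i2 : mu.-integrable setT (EFin \o (fun x => f e x * chi x)).
    apply: (@integrable_continuous_compact _ _ _ K) => //; first exact: contM.
    by move=> x Kx; rewrite chi0// mulr0.
  have -> : \int[mu]_x (f e x * chi x) = - \int[mu]_x (Q x * partial i chi x).
    apply/eqP; rewrite -addr_eq0 -RintegralD// -E; apply/eqP; apply: eq_Rintegral => x _.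
    rewrite [RHS](is_derive_partial (is_deriveM (Cn_is_derive i x Q1) (Cn_is_derive i x chi1))) QE.
    rewrite addrC; congr (_ + _); exact: mulrC.
  rewrite normrN (le_trans (le_normr_Rintegral _ i1))//.
  rewrite mulrA -RintegralZl//; apply: le_Rintegral => //.
  - rewrite (_ : EFin \o _ = abse \o (EFin \o (fun x => Q x * partial i chi x))); last exact/funext.
    exact: integrable_abse.
  - exact: (integrableZl measurableT (e * C) ipchi).
  - move=> x _; rewrite normrM ler_wpM2r// /Q normrM gtr0_norm// ler_wpM2l// ltW//.
apply/cvgrPdist_le => /= eps eps0.
have CI : 0 < C * I + 1 by rewrite ltr_wpDl// mulr_ge0// ltW.
have dd : 0 < eps / (C * I + 1) by exact: divr_gt0.
near=> e.
have e0 : 0 < e by near: e; exact: nbhs_right_gt.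
rewrite sub0r normrN (le_trans (bound e e0))//.
rewrite (@le_trans _ _ (e * (C * I + 1)))//; first by rewrite ler_wpM2l ?lerDl// ltW.
have ed : e < eps / (C * I + 1) by near: e; exact: nbhs_right_lt.
by move: ed; rewrite ltr_pdivlMr// => /ltW.
Unshelve. all: by end_near. Qed.

(** As the oscillating factor is bounded uniformly in e, the functionals are uniformly bounded on
    L^1 and the density theorem reduces h to the indicator of a box. That indicator is in turn an
    L^1 limit of the bumps handled by [osc_test]. *)
Lemma osc_weak (h : 'rV[R]_N -> R) : mu.-integrable setT (EFin \o h) ->
  \int[mu]_x (f e x * h x) @[e --> 0^'+] --> (0 : R).
Proof.
move=> ih.
have [C C0 fC'] := periodic_bounded (Cn_continuous (Cn_partial i P1)) (periodic_partial i pP).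
have fC e x : `|f e x| <= C by exact: fC'.
pose Nm (h : 'rV[R]_N -> R) := (\int[mu]_x (`|h x|)%:E)%E.
have domI g : dom Nm g -> mu.-integrable setT (EFin \o g).
  by move=> [mg goo]; apply/integrableP; split; [exact/measurable_EFinP|].
have bnd e g : dom Nm g -> (`|\int[mu]_x (f e x * g x)|%:E <= C%:E * Nm g)%E.
  move=> dg; have ig := domI g dg; have [mg goo] := dg.
  have ifg : mu.-integrable setT (EFin \o (fun x => f e x * g x)) by exact: integrableMr_bounded (fC e) ig.
  rewrite EFin_normr_Rintegral//; apply: le_trans (le_abse_integral _ _ _) _ => //.
    by case/integrableP: ifg.
  rewrite -ge0_integralZl//; last 2 first.
  - by apply/measurable_EFinP; apply: measurableT_comp.
  - by rewrite lee_fin ltW.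
  apply: ge0_le_integral => //.
  - by apply: measurableT_comp => //; case/integrableP: ifg.
  - by apply/measurable_EFinP; apply: measurable_funM => //; apply: measurableT_comp.
  by move=> x _; rewrite lee_fin normrM ler_wpM2r.
apply: (@density_cvg0 _ _ _ Nm (fun e h => \int[mu]_x (f e x * h x)) (@oboxes R N)
  (fun k => obox (fun=> - k%:R) (fun=> k%:R)) C 1) => //.
- exact: ltW.
- exact: rV_measurable_oboxes.
- exact: obox_setI.
- by move=> k; exists (fun=> - k%:R), (fun=> k%:R).
- exact: rV_eventually_obox.
- by move=> g; apply: integral_ge0.
- move=> g1 g2 m1 m2 g12; apply: ge0_le_integral => //.
  + by apply/measurable_EFinP; apply: measurableT_comp.
  + by apply/measurable_EFinP; apply: measurableT_comp.
  + by move=> x _; rewrite lee_fin.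
- move=> k c; have /integrableP[_] := integrable_obox (fun=> - k%:R) (fun=> k%:R) => h1.
  have := integrableZl measurableT c (integrable_obox (fun=> - k%:R) (fun=> k%:R)).
  by move=> /integrableP[_].
- move=> g g_ dg mg_ g_g g_0.
  have ig : mu.-integrable setT (EFin \o (fun x => `|g x|)).
    rewrite (_ : EFin \o _ = abse \o (EFin \o g)); last exact/funext.
    by apply: integrable_abse; exact: domI.
  have := @dct_dist _ _ _ mu g_ (cst 0) (fun x => `|g x|) mg_ _ ig g_g g_0.
  by under eq_fun do under eq_integral do rewrite subr0; apply.
- move=> e g1 g2 _ d1 d2; have i1 := domI _ d1; have i2 := domI _ d2.
  rewrite -RintegralD//; [|exact: integrableMr_bounded (fC e) i1|exact: integrableMr_bounded (fC e) i2].
  by apply: eq_Rintegral => x _; rewrite mulrDr.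
- move=> e c g _ dg; have ig := domI _ dg.
  rewrite -RintegralZl//; last exact: integrableMr_bounded (fC e) ig.
  by apply: eq_Rintegral => x _; rewrite mulrCA.
- by move=> e g _ dg; exact: bnd.
- move=> A k [a [b ->]] _.
  have [K cK sK] := obox_compact a b.
  have inK x : ~ K x -> ~ obox a b x by move=> h1 /sK.
  have mb j : measurable_fun setT (pbump a b j).
    by apply: continuous_measurable_rV; exact: Cn_continuous (pbump_C1 a b j).
  have pb1 j x : `|pbump a b j x| <= \1_(obox a b) x.
    have /andP[h0 h1] := pbump_itv a b j x; rewrite ger0_norm// indicE.
    have [//|] := boolP (x \in obox a b).
    by rewrite notin_setE => h2; rewrite pbump_out.
  have mI : measurable_fun setT (\1_(obox a b) : 'rV[R]_N -> R).
    by apply: measurable_indic; exact: measurable_obox.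
  have dist := @dct_dist _ _ _ mu (pbump a b) (\1_(obox a b)) (\1_(obox a b)) mb mI
    (integrable_obox a b) pb1 (fun x => @pbump_cvg a b x).
  apply/cvgrPdist_lt => /= eps eps0.
  (* A bump index j is fixed here, before e is sent to 0: the L^1 error times C takes one half of
     eps, the integration by parts the other. *)
  have d0 : 0 < eps / 2 / (C + 1) by rewrite !divr_gt0// addr_gt0.
  move: dist => /fine_cvgP[Nfin /cvgrPdist_lt/(_ _ d0) Nsmall].
  have [j [/= Nk1 Nk2]] := filter_ex (filterI Nfin Nsmall).
  pose g x := \1_(obox a b) x - pbump a b j x.
  have NgE : Nm g = (\int[mu]_x `|pbump a b j x - \1_(obox a b) x|%:E)%E.
    by apply: eq_integral => x _; rewrite distrC.
  have dg : dom Nm g.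
    by split; [exact: measurable_funB|rewrite NgE -ge0_fin_numE// integral_ge0].
  have Nk : C * fine (Nm g) < eps / 2.
    rewrite NgE; move: Nk2; rewrite sub0r normrN => /(le_lt_trans (ler_norm _)).
    rewrite ltr_pdivlMr ?addr_gt0// => h1; apply: le_lt_trans h1.
    by rewrite mulrC ler_wpM2l ?lerDl//; apply: fine_ge0; exact: integral_ge0.
  have ib : mu.-integrable setT (EFin \o pbump a b j).
    apply: (@integrable_continuous_compact _ _ _ K) => //; first exact: Cn_continuous (pbump_C1 a b j).
    by move=> x /inK; exact: pbump_out.
  near=> e.
  have -> : \int[mu]_x (f e x * \1_(obox a b) x) =
      \int[mu]_x (f e x * pbump a b j x) + \int[mu]_x (f e x * g x).
    rewrite -RintegralD//; [|exact: integrableMr_bounded (fC e) ib|exact: integrableMr_bounded (fC e) (domI _ dg)].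
    by apply: eq_Rintegral => x _; rewrite -mulrDr /g addrC subrK.
  rewrite sub0r normrN (splitr eps) (le_lt_trans (ler_normD _ _))// ltrD//.
    rewrite (_ : `|_| = `|0 - \int[mu]_x (f e x * pbump a b j x)|); last by rewrite sub0r normrN.
    near: e; have e20 : 0 < eps / 2 by rewrite divr_gt0.
    have := @osc_test (pbump a b j) K (pbump_C1 a b j) cK (fun x Kx => pbump_out j (inK x Kx)).
    by move=> /cvgrPdist_lt/(_ _ e20).
  apply: le_lt_trans Nk; rewrite -lee_fin EFinM fineK; first exact: bnd.
  by rewrite ge0_fin_numE; [case: dg|exact: integral_ge0].
by split; [exact/measurable_EFinP/measurable_int/ih|case/integrableP: ih].
Unshelve. all: by end_near. Qed.

End oscillation.

Section hoelder_real.
Variable R : realType.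

Lemma hoelder_conjugate_real (p : R) : 1 < p -> hoelder_conjugate p%:E = (p / (p - 1))%:E.
Proof.
move=> p1; rewrite /hoelder_conjugate /= eqe gt_eqF ?(lt_trans ltr01)//.
by rewrite -EFinD inver subr_eq0 gt_eqF// -EFinM.
Qed.

Lemma conj_ge1 (p : R) : 1 < p -> 1 <= p / (p - 1).
Proof. by move=> p1; rewrite ler_pdivlMr ?subr_gt0// mul1r gerBl. Qed.

Lemma conj_eq (p q : R) : 1 < p -> p^-1 + q^-1 = 1 -> q = p / (p - 1).
Proof.
move=> p1 h; have p0 : p != 0 by rewrite gt_eqF// (lt_trans ltr01).
have pn : p - 1 != 0 by rewrite subr_eq0 gt_eqF.
have -> : q = (1 - p^-1)^-1 by rewrite -h addrC addKr invrK.
have -> : 1 - p^-1 = (p - 1) / p by field.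
by rewrite invf_div.
Qed.

Lemma conj_mul (p q : R) : 1 < p -> p^-1 + q^-1 = 1 -> (p - 1) * q = p.
Proof.
by move=> p1 pq; rewrite (conj_eq p1 pq) mulrCA mulfV ?mulr1// subr_eq0 gt_eqF.
Qed.

(** The quantity y |y|^(p-2) is the derivative of |y|^p / p, that is, the dual element of y. The
    case y = 0 is separate since the exponent p - 2 may be negative. *)
Lemma norm_powR_pred2 (p y : R) : 1 < p -> `|y * `|y| `^ (p - 2)| = `|y| `^ (p - 1).
Proof.
move=> p1; rewrite normrM (ger0_norm (powR_ge0 _ _)); have [->|y0] := eqVneq y 0.
  by rewrite normr0 mul0r powR0// subr_eq0 gt_eqF.
rewrite -{1}(powRr1 (normr_ge0 y)) -powRD; last by apply/implyP; rewrite normr_eq0 y0.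
by congr (_ `^ _); rewrite addrCA (_ : 1 - 2 = -1 :> R)//; ring.
Qed.

Lemma mul_powR_pred2 (p y : R) : 1 < p -> y * (y * `|y| `^ (p - 2)) = `|y| `^ p.
Proof.
move=> p1; have p0 : 0 < p := lt_trans ltr01 p1.
rewrite mulrA -expr2 -real_normK ?num_real//.
have [->|y0] := eqVneq y 0; first by rewrite normr0 expr0n mul0r powR0// gt_eqF.
rewrite -powR_mulrn// -powRD; last by apply/implyP; rewrite normr_eq0 y0.
by rewrite addrCA subrr addr0.
Qed.

End hoelder_real.

Section Lfun_compact.
Context d (T : measurableType d) (R : realType) (mu : {measure set T -> \bar R}).

(** On A one has |g| <= |g|^r + 1: either |g| <= 1, or r >= 1 makes the power larger. *)
Lemma Lfun_integrable_finite (r : R) (g : T -> R) (A : set T) : 1 <= r -> g \in Lfun mu r%:E ->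
  measurable A -> (mu A < +oo)%E -> mu.-integrable setT (EFin \o (g \_ A)).
Proof.
move=> r1 gr mA Aoo; have ig := Lfun_integrable r1 gr.
have [mg _] := (LfunE mu r%:E g).1 gr.
apply: (@le_integrable _ _ _ mu setT measurableT _ (fun x => (`|g x| `^ r + \1_A x)%:E)).
- apply/measurable_EFinP; apply/(measurable_restrictT _ _).1 => //.
  exact: measurable_funTS.
- move=> x _; rewrite lee_fin patchE indicE; case: (boolP (x \in A)) => _; last first.
    by rewrite normr0.
  rewrite [leRHS]ger0_norm; last by rewrite addr_ge0// powR_ge0.
  have [g1|g1] := leP `|g x| 1; first by rewrite (le_trans g1)// lerDr powR_ge0.
  rewrite (@le_trans _ _ (`|g x| `^ r))// ?lerDl//.
  by rewrite -{1}(powRr1 (normr_ge0 (g x))) ler_powR// ltW.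
rewrite (_ : (fun x => _) = (fun x => (`|g x| `^ r)%:E) \+ (EFin \o \1_A))%E; last exact/funext.
apply: integrableD => //.
apply/Lfun1_integrable; apply: (@bounded_support_Lfun _ _ _ _ 1 _ A 1) => //.
- by move=> x; rewrite indicE; case: (_ \in _); rewrite ?normr1 ?normr0.
- by move=> x h; rewrite indicE memNset.
Qed.

End Lfun_compact.

Section rV_linear.
Variables (R : realType) (n : nat).

Lemma norm_mulmx_le (A : 'M[R]_n) (y : 'rV[R]_n) :
  `|y *m A| <= `|y| * \sum_i \sum_j `|A i j|.
Proof.
have S0 : 0 <= \sum_i \sum_j `|A i j| by apply: sumr_ge0 => i _; exact: sumr_ge0.
apply: rV_norm_le => [|j]; first exact: mulr_ge0.
rewrite mxE (le_trans (ler_norm_sum _ _ _))// mulr_sumr; apply: ler_sum => i _.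
rewrite normrM ler_pM ?rV_norm_coord// (bigD1 j)//= lerDl; exact: sumr_ge0.
Qed.

Lemma closed_ball_compact (r : R) : compact [set x : 'rV[R]_n | `|x| <= r].
Proof.
apply: bounded_closed_compact.
  exists r; split; first exact: num_real.
  by move=> s rs x /= xr; rewrite (le_trans xr)// ltW.
rewrite (_ : mkset _ = (fun x : 'rV[R]_n => `|x|) @^-1` [set y | y <= r]); last by [].
by apply: closed_comp; [move=> x _; exact: norm_continuous|exact: closed_le].
Qed.

End rV_linear.

(** * The rescaled fields *)

Section rescaling.
Variables (R : realType) (n : nat) (p q : R).
Hypotheses (hp : 1 < p) (hpq : p^-1 + q^-1 = 1).
Variables (W : 'rV[R]_n.+2 -> 'rV[R]_n.+2) (M : 'M[R]_n.+2).
Hypothesis hW : Cnv 2 W.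
Hypothesis hWM : Cnv_per 1 (fun x => W x - x *m M^T).
Variable sigma : 'rV[R]_n.+2 -> R.
Hypothesis hsigma : forall x, sigma x = \det (Dmx W x).
Hypothesis hsigma0 : forall x, 0 < sigma x.
Variable b : 'rV[R]_n.+2 -> 'rV[R]_n.+2.
Hypothesis hb : Cnv_per 1 b.
Hypothesis hsb : forall x, sigma x *: b x = sigma_b W x.

Local Notation mu := (lebesgueN R n.+2).
Let We (e : R) (x : 'rV[R]_n.+2) := e *: W (e^-1 *: x).
Let be (e : R) (x : 'rV[R]_n.+2) := b (e^-1 *: x).
Let se (e : R) (x : 'rV[R]_n.+2) := sigma (e^-1 *: x).
Let P (x : 'rV[R]_n.+2) := W x - x *m M^T.

Lemma q_gt1 : 1 < q.
Proof. by rewrite (conj_eq hp hpq) ltr_pdivlMr ?subr_gt0// mul1r gtrBl. Qed.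

Let q_gt0 : 0 < q. Proof. exact: lt_trans q_gt1. Qed.

Lemma sigmaE : sigma = fun x => \det (Dmx W x). Proof. exact/funext. Qed.

Let sigma0' x : 0 < \det (Dmx W x). Proof. by rewrite -hsigma. Qed.

Lemma We_lin e x : 0 < e -> We e x = x *m M^T + e *: P (e^-1 *: x).
Proof.
move=> e0; rewrite /We /P scalerBr -scalemxAl scalerA divff ?gt_eqF// scale1r addrC subrK//.
Qed.

Lemma comp_We e j : comp_of (We e) j = fun x => e * comp_of W j (e^-1 *: x).
Proof. by apply/funext => x; rewrite /comp_of /We mxE. Qed.

Lemma Cn_We k e j : (k <= 2)%N -> Cn k (comp_of (We e) j).
Proof.
move=> k2; rewrite comp_We; apply: CnZ; apply: Cn_scale_arg.
case: k k2 => [|[|[|//]]] _; [exact/CnS/CnS/hW|exact/CnS/hW|exact: hW].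
Qed.

Lemma partial_We e i j x : 0 < e ->
  partial i (comp_of (We e) j) x = partial i (comp_of W j) (e^-1 *: x).
Proof.
move=> e0; have h : is_derive (e^-1 *: x) (evec R i) (comp_of W j) (partial i (comp_of W j) (e^-1 *: x)).
  by apply: Cn_is_derive; exact: hW.
rewrite comp_We; apply: is_derive_partial.
apply: (is_derive_val_eq (is_deriveZ e (is_derive_scale_arg h))).
by rewrite -[_ *: _]/(_ * _) mulrA divff ?mul1r// gt_eqF.
Qed.

Lemma grad_We e j x : 0 < e -> grad (comp_of (We e) j) x = grad (comp_of W j) (e^-1 *: x).
Proof. by move=> e0; apply/rowP => i; rewrite !mxE partial_We. Qed.

Lemma Dmx_We e x : 0 < e -> Dmx (We e) x = Dmx W (e^-1 *: x).
Proof. by move=> e0; apply/matrixP => i j; rewrite !mxE partial_We. Qed.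

Lemma crossW_We e x : 0 < e -> crossW (We e) x = crossW W (e^-1 *: x).
Proof.
move=> e0; rewrite /crossW; congr cross; apply/funext => i; exact: grad_We.
Qed.

Lemma sigma_b_We e x : 0 < e -> se e x *: be e x = sigma_b (We e) x.
Proof. by move=> e0; rewrite /se /be hsb !sigma_bE crossW_We. Qed.

Lemma We_proper (r : R) : exists2 K' : set 'rV[R]_n.+2, compact K' &
  forall e x, 0 < e < 1 -> `|We e x| <= r -> K' x.
Proof.
have [C C0 PC] := P_bounded hWM.
pose A := invmx (M^T).
have AM : M^T *m A = 1%:M by rewrite mulmxV// unitmx_tr; exact: M_unit hWM sigma0'.
pose S := \sum_i \sum_j `|A i j|.
have S0 : 0 <= S by apply: sumr_ge0 => i _; exact: sumr_ge0.
(* Solving W_e(x) = M x + e P(x / e) for x: for e < 1 the vector M x has norm at most |r| + C, and S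
   bounds the effect of right multiplication by the inverse of M^T. *)
exists [set x | `|x| <= (`|r| + C) * S]; first exact: closed_ball_compact.
move=> e x /andP[e0 e1] xr /=.
have -> : x = (We e x - e *: P (e^-1 *: x)) *m A.
  by rewrite We_lin// addrK -mulmxA AM mulmx1.
rewrite (le_trans (norm_mulmx_le _ _))// ler_wpM2r//.
rewrite (le_trans (ler_normB _ _))// lerD//; first by rewrite (le_trans xr)// ler_norm.
rewrite normrZ gtr0_norm// -[leRHS]mul1r ler_pM// ?PC// ltW//.
Qed.

Lemma rescaled_proper : (forall e : R, 0 < e -> Cnv 1 (We e)) /\
  (forall K : set 'rV[R]_n.+2, compact K ->
    exists2 K' : set 'rV[R]_n.+2, compact K' & \forall e \near 0^'+, We e @^-1` K `<=` K').
Proof.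
split=> [e _ j|K cK]; first exact: Cn_We.
have [r [_ /(_ (r + 1) (ltr_pwDr ltr01 (lexx _))) Kr]] := compact_bounded cK.
have [K' cK' hK'] := We_proper (r + 1).
exists K' => //; near=> e => x /Kr h; apply: (hK' e) => //.
by apply/andP; split; near: e; [exact: nbhs_right_gt|exact: nbhs_right_lt].
Unshelve. all: by end_near. Qed.

Lemma rescaled_cvg : exists W0 : 'rV[R]_n.+2 -> 'rV[R]_n.+2,
        [/\ Cnv 1 W0,
            {family compact, We e @[e --> 0^'+] --> W0} &
            forall j, weak_cvg_W1p_loc n.+2%:R
              (fun e => comp_of (We e) j) (comp_of W0 j)].
Proof.
have [C C0 PC] := P_bounded hWM.
exists (fun x => x *m M^T); split.
- by move=> j; exact: Cn_lin.
- apply/fam_cvgP => K _ A /uniform_nbhs[E [entE sub]].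
  move: entE; rewrite -entourage_ballE => -[eps /= eps0 hE].
  near=> e; apply: sub => y _ /=; apply: hE => /=.
  have e0 : 0 < e by near: e; exact: nbhs_right_gt.
  rewrite -ball_normE /= We_lin// opprD addrA subrr add0r normrN normrZ gtr0_norm//.
  rewrite (@le_lt_trans _ _ (e * C))//; first by rewrite ler_wpM2l ?PC// ltW.
  by rewrite -ltr_pdivlMr//; near: e; apply: nbhs_right_lt; exact: divr_gt0.
- move=> j.
  have N1 : 1 < n.+2%:R :> R by rewrite ltr1n.
  have N0 : 0 < n.+2%:R :> R by rewrite ltr0n.
  have gint K (g : 'rV[R]_n.+2 -> R) : compact K -> g \in Lfun mu (hoelder_conjugate n.+2%:R%:E) ->
     mu.-integrable setT (EFin \o (g \_ K)).
    move=> cK; rewrite hoelder_conjugate_real// => /Lfun_integrable_finite; apply.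
    + exact: conj_ge1.
    + exact: compact_measurable_rV.
    + exact: compact_lebesgueN_lty.
  have mP k (f : 'rV[R]_n.+2 -> R) : measurable_fun setT f -> (forall x, `|f x| <= k) ->
     forall K g, compact K -> g \in Lfun mu (hoelder_conjugate n.+2%:R%:E) ->
     mu.-integrable setT (EFin \o (fun x => f x * (g \_ K) x)).
    by move=> mf fk K g cK hg; apply: integrableMr_bounded fk _ => //; exact: gint.
  have cint (F g : 'rV[R]_n.+2 -> R) K : continuous F -> compact K ->
     g \in Lfun mu (hoelder_conjugate n.+2%:R%:E) ->
     mu.-integrable setT (EFin \o (fun x => F x * (g \_ K) x)).
    move=> cF cK hg; have [B B0 FB] := compact_continuous_bound cF cK.
    have mK := compact_measurable_rV cK.
    have h := @mP B (fun x => F x * \1_K x) _ _ K g cK hg.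
    rewrite (_ : (fun x => F x * (g \_ K) x) = fun x => F x * \1_K x * (g \_ K) x).
      apply: h => [|x].
        apply: measurable_funM; first exact: continuous_measurable_rV.
        exact: measurable_indic.
      rewrite indicE; have [/set_mem Kx|_] := boolP (x \in K).
        by rewrite mulr1 FB.
      by rewrite mulr0 normr0.
    apply/funext => x; rewrite patchE indicE.
    by case: (boolP (x \in K)); rewrite ?mulr1 ?mulr0.
  (* Serves both for the functions and for their gradients: the family is a fixed continuous limit
     plus a remainder, and only the pairing of the remainder with g truncated to K has to vanish. *)
  have key (F_ r : R -> 'rV[R]_n.+2 -> R) (F g : 'rV[R]_n.+2 -> R) K : compact K ->
     g \in Lfun mu (hoelder_conjugate n.+2%:R%:E) -> continuous F -> (forall e, continuous (r e)) ->
     (forall e x, 0 < e -> F_ e x = F x + r e x) ->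
     \int[mu]_x (r e x * (g \_ K) x) @[e --> 0^'+] --> (0 : R) ->
     \int[mu]_(x in K) (F_ e x * g x) @[e --> 0^'+] --> \int[mu]_(x in K) (F x * g x).
    move=> cK hg cF cr FE cv.
    have E (H : 'rV[R]_n.+2 -> R) : \int[mu]_(x in K) (H x * g x) = \int[mu]_x (H x * (g \_ K) x).
      rewrite Rintegral_mkcond; apply: eq_Rintegral => x _; rewrite !patchE.
      by case: (boolP (x \in K)); rewrite ?mulr0.
    rewrite E -[X in _ --> X]addr0.
    apply: cvg_trans (_ : \int[mu]_x (F x * (g \_ K) x) + \int[mu]_x (r e x * (g \_ K) x) @[e --> 0^'+] -->
        \int[mu]_x (F x * (g \_ K) x) + 0); last by apply: cvgD => //; exact: cvg_cst.
    apply: near_eq_cvg; near=> e; rewrite E -RintegralD//; [|exact: cint|exact: cint].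
    apply: eq_Rintegral => x _; rewrite FE ?mulrDl//; near: e; exact: nbhs_right_gt.
  have cP : continuous (comp_of P j) := Cn_continuous (hWM j).1.
  split.
  + by move=> e e0; apply: W1p_loc_C1 => //; exact: Cn_We.
  + by apply: W1p_loc_C1 => //; exact: Cn_lin.
  + move=> K cK g hg.
    apply: (@key _ (fun e x => e * comp_of P j (e^-1 *: x))) => //.
    * by have := Cn_continuous (@Cn_lin R n M 1 j).
    * by move=> e; apply: contM; [exact: contC|exact: scale_arg_continuous].
    * by move=> e x e0; rewrite /comp_of We_lin// mxE [X in _ + X = _]mxE.
    have ig := gint K g cK hg.
    pose I := \int[mu]_x `|(g \_ K) x|.
    have I0 : 0 <= I by apply: Rintegral_ge0.
    have PjC x : `|comp_of P j x| <= C by rewrite (le_trans (rV_norm_coord _ _))// PC.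
    (* For the functions themselves the remainder e P_j(x / e) is uniformly small. *)
    have bound e : 0 < e -> `|\int[mu]_x (e * comp_of P j (e^-1 *: x) * (g \_ K) x)| <= e * (C * I).
      move=> e0.
      have b1 x : `|e * comp_of P j (e^-1 *: x)| <= e * C.
        by rewrite normrM gtr0_norm// ler_wpM2l// ltW.
      have m1 : measurable_fun setT (fun x : 'rV[R]_n.+2 => e * comp_of P j (e^-1 *: x)).
        by apply: continuous_measurable_rV; apply: contM; [exact: contC|exact: scale_arg_continuous].
      have i1 := mP _ _ m1 b1 K g cK hg.
      have ia : mu.-integrable setT (EFin \o (fun x => `|(g \_ K) x|)) by exact: integrable_abse ig.
      rewrite (le_trans (le_normr_Rintegral _ i1))// mulrA -RintegralZl//; apply: le_Rintegral => //.
      - exact: integrable_abse i1.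
      - exact: (integrableZl measurableT (e * C) ia).
      - by move=> x _; rewrite normrM ler_wpM2r.
    apply/cvgrPdist_le => /= eps eps0.
    have CI : 0 < C * I + 1 by rewrite ltr_wpDl// mulr_ge0// ltW.
    have dd : 0 < eps / (C * I + 1) by exact: divr_gt0.
    near=> e.
    have e0 : 0 < e by near: e; exact: nbhs_right_gt.
    rewrite sub0r normrN (le_trans (bound e e0))//.
    rewrite (@le_trans _ _ (e * (C * I + 1)))//; first by rewrite ler_wpM2l ?lerDl// ltW.
    have ed : e < eps / (C * I + 1) by near: e; exact: nbhs_right_lt.
    by move: ed; rewrite ltr_pdivlMr// => /ltW.
  + move=> i; exists (fun e => partial i (comp_of (We e) j)), (fun=> M j i); split.
    * by move=> e e0; apply: weak_partial_C1; exact: Cn_We.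
    * rewrite (_ : (fun=> M j i) = partial i (comp_of (fun x => x *m M^T) j)).
        by apply: weak_partial_C1; exact: Cn_lin.
      by apply/funext => x; rewrite /comp_of partial_lin.
    * move=> K cK g hg.
      apply: (@key _ (fun e x => partial i (comp_of P j) (e^-1 *: x))) => //.
      - exact: contC.
      - move=> e; apply: scale_arg_continuous.
        exact: (Cn_continuous (Cn_partial i (hWM j).1)).
      - by move=> e x e0; rewrite partial_We// (partial_compW hWM).
      (* For the gradients the remainder does not become small: it oscillates, and vanishes only
         weakly. *)
      - by apply: osc_weak; [exact: (hWM j).1|exact: (hWM j).2|exact: gint].
Unshelve. all: by end_near. Qed.

Lemma comp_be e j : comp_of (be e) j = fun x => comp_of b j (e^-1 *: x).
Proof. by []. Qed.

Lemma be_C1 e : Cnv 1 (be e).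
Proof. by move=> j; rewrite comp_be; apply: Cn_scale_arg; exact: (hb j).1. Qed.

Lemma b_bounded : bounded_field b.
Proof.
have h j : {C : R | forall x, `|b x ord0 j| <= C}.
  apply: cid; have [C C0 hC] := periodic_bounded (Cn_continuous (hb j).1) (hb j).2.
  by exists C.
exists (\sum_j `|sval (h j)|) => x; apply: rV_norm_le => [|j]; first by rewrite sumr_ge0.
rewrite (le_trans (svalP (h j) x))// (le_trans (ler_norm _))// (bigD1 j)//= lerDl.
by rewrite sumr_ge0.
Qed.

Lemma be_bounded e : bounded_field (be e).
Proof. by have [C hC] := b_bounded; exists C => x; exact: hC. Qed.

Lemma se_C1 e : Cn 1 (se e).
Proof. by apply: Cn_scale_arg; rewrite sigmaE; exact: Cn_sigma. Qed.

Lemma rescaled_regularity : [/\ forall e : R, 0 < e ->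
            [/\ Cnv 0 (be e), bounded_field (be e),
                forall j, W1p_loc q (comp_of (be e) j) &
                exists2 d, weak_divergence (be e) d &
                  exists B : R, \forall x \ae lebesgueN R n.+2, `|d x| <= B],
          forall e : R, 0 < e -> Cn 0 (se e) /\ W1p_loc q (se e),
          exists2 c : R, 1 < c &
            forall e : R, 0 < e -> forall x : 'rV[R]_n.+2,
              c^-1 <= se e x <= c &
          forall e : R, 0 < e -> forall x : 'rV[R]_n.+2,
            se e x *: be e x = sigma_b (We e) x].
Proof.
split.
- move=> e e0; split.
  + by move=> j; apply: CnS; exact: be_C1.
  + exact: be_bounded.
  + by move=> j; apply: W1p_loc_C1 => //; exact: be_C1.
  + exists (divergence (be e)); first by apply: weak_divergence_C1; exact: be_C1.
    have h i : {C : R | forall x, `|partial i (comp_of b i) x| <= C}.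
      apply: cid; have [C C0 hC] := periodic_bounded (Cn_continuous (Cn_partial i (hb i).1)) (periodic_partial i (hb i).2).
      by exists C.
    (* Rescaling the argument costs a factor 1/e; the required bound may depend on e. *)
    exists (\sum_i `|e^-1 * sval (h i)|); apply/nearW => x; rewrite /divergence.
    rewrite (le_trans (ler_norm_sum _ _ _))//; apply: ler_sum => i _.
    rewrite comp_be partial_scale_arg; last exact: (Cn_derivable (hb i).1).
    rewrite !normrM ler_wpM2l//; apply: le_trans (svalP (h i) _) (ler_norm _).
- move=> e e0; split; first exact/CnS/se_C1.
  by apply: W1p_loc_C1 => //; exact: se_C1.
- have [c c1 hc] := sigma_bounds hW hWM sigma0'.
  by exists c => // e e0 x; rewrite /se hsigma.
- by move=> e e0 x; exact: sigma_b_We.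
Qed.

Lemma theta_eq1 e x : 0 < e -> dotv (be e x) (grad (comp_of (We e) ord0) x) = 1.
Proof.
move=> e0; have s0 := hsigma0 (e^-1 *: x).
apply: (mulfI (lt0r_neq0 s0)); rewrite mulr1.
transitivity (dotv (grad (comp_of W ord0) (e^-1 *: x)) (crossW W (e^-1 *: x))).
  rewrite -sigma_bE -hsb grad_We// /dotv mulr_sumr; apply: eq_bigr => i _.
  by rewrite [X in _ = _ * X]mxE [X in _ * X = _]mulrC mulrCA.
by rewrite dotv_grad_crossW eqxx hsigma.
Qed.

Lemma transversality_cvg : exists theta0 : 'rV[R]_n.+2 -> R,
        let theta (e : R) (x : 'rV[R]_n.+2) :=
          dotv (be e x) (grad (comp_of (We e) ord0) x) in
        [/\ Cn 0 theta0, forall x, 0 < theta0 x,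
            forall e : R, 0 < e -> forall x : 'rV[R]_n.+2, 0 < theta e x &
            strong_cvg_Lp_loc q theta theta0].
Proof.
have L1 : Lp_loc q (fun _ : 'rV[R]_n.+2 => 1) by apply: Lp_loc_continuous => //; exact: contC.
exists (fun=> 1) => theta; split => //.
- exact: Cn_cst.
- by move=> e e0 x; rewrite /theta theta_eq1.
split => //.
  move=> e e0; rewrite (_ : theta e = fun=> 1)//.
  by apply/funext => x; rewrite /theta theta_eq1.
move=> K cK; apply: cvg_near_cst; near=> e.
have e0 : 0 < e by near: e; exact: nbhs_right_gt.
rewrite (_ : (fun x => _) = cst 0%E); first by apply: Lnorm0; rewrite eqe gt_eqF.
by apply/funext => x; rewrite /theta theta_eq1// subrr mul0r.
Unshelve. all: by end_near. Qed.

End rescaling.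

(** * Injectivity of proper maps with positive Jacobian *)

Section directional.
Variable R : realType.

(** The increment along u + c a is split: first a move along u, handled by the derivative there,
    then a move along a, which the mean value theorem expresses by [da] at a point tending to x.
    Continuity of [da] at x is what makes the two derivatives add up. *)
Lemma is_derive_add (V : normedModType R) (f : V -> R) (x u a : V) (du c : R) (da : V -> R) :
  continuous f -> is_derive x u f du -> (forall y, is_derive y a f (da y)) -> {for x, continuous da} ->
  is_derive x (u + c *: a) f (du + c * da x).
Proof.
move=> cf [d1 d2] ha cda.
have M (h : R) : {s : R | `|s| <= `|h * c| &
    f ((x + h *: u) + (h * c) *: a) - f (x + h *: u) = da ((x + h *: u) + s *: a) * (h * c)}.
  by apply: cid2; exact: MVT_line.
pose s h := s2val (M h).
have sh h : `|s h| <= `|h * c| := s2valP (M h).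
have fh h : f ((x + h *: u) + (h * c) *: a) - f (x + h *: u) = da ((x + h *: u) + s h *: a) * (h * c) := s2valP' (M h).
have c1 : h^-1 *: (f (h *: u + x) - f x) @[h --> 0^'] --> du by rewrite -d2; exact: d1.
have cs : s h @[h --> 0^'] --> (0 : R).
  apply/cvgrPdist_le => /= eps eps0; near=> h; rewrite sub0r normrN (le_trans (sh h))// normrM.
  have hh : `|h| <= eps / (`|c| + 1).
    near: h; apply: nbhs_dnbhs; exists (eps / (`|c| + 1)) => /=; first by rewrite divr_gt0// ltr_wpDl.
    by move=> z /=; rewrite sub0r normrN => /ltW.
  move: hh; rewrite ler_pdivlMr ?ltr_wpDl// => hh; apply: le_trans hh.
  by rewrite ler_wpM2l// lerDl.
have cx : (x + h *: u) + s h *: a @[h --> 0^'] --> x.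
  rewrite -[X in _ --> X](addr0 x); rewrite -{2}(addr0 x) -{1}(scale0r u) -(scale0r a).
  apply: cvgD; last by apply: cvgZr_tmp.
  apply: cvgD; first exact: cvg_cst.
  by apply: cvgZr_tmp; apply: cvg_trans (@nbhs_dnbhs R 0) _.
have cv : h^-1 *: (f (h *: (u + c *: a) + x) - f x) @[h --> 0^'] --> du + c * da x.
  apply: cvg_trans (_ : h^-1 *: (f (h *: u + x) - f x) + c * da ((x + h *: u) + s h *: a) @[h --> 0^'] --> _); last first.
    apply: cvgD => //; apply: cvgM; first exact: cvg_cst.
    exact: (cvg_comp _ _ cx cda).
  apply: near_eq_cvg; near=> h.
  have h0 : h != 0 by near: h; exact: nbhs_dnbhs_neq.
  have -> : h *: (u + c *: a) + x = (x + h *: u) + (h * c) *: a.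
    by rewrite scalerDr scalerA addrC addrA.
  have -> : f (x + h *: u + (h * c) *: a) = f (x + h *: u) + da ((x + h *: u) + s h *: a) * (h * c).
    by rewrite -fh [RHS]addrC subrK.
  rewrite [h *: u + x]addrC; set A := f _; set B := da _; set D := f x.
  have gen (a1 b1 d1' : R) : h^-1 * (a1 - d1') + c * b1 = h^-1 * (a1 + b1 * (h * c) - d1') by field.
  exact: gen.
have dd : derivable f x (u + c *: a) by apply/cvg_ex; exists (du + c * da x).
by split => //; apply/cvg_lim.
Unshelve. all: by end_near. Qed.

(** Basis directions are added one at a time with [is_derive_add], starting from the zero vector. *)
Lemma C1_is_derive N (f : 'rV[R]_N -> R) (x v : 'rV[R]_N) : Cn 1 f ->
  is_derive x v f (\sum_i v ord0 i * partial i f x).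
Proof.
move=> f1; have cf := Cn_continuous f1.
have gen (r : seq 'I_N) : is_derive x (\sum_(i <- r) v ord0 i *: evec R i) f (\sum_(i <- r) v ord0 i * partial i f x).
  elim: r => [|i r IH].
    rewrite !big_nil; apply: is_derive_line0.
    rewrite (_ : (fun r : R => _) = fun=> f x); first exact: is_derive_cst.
    by apply/funext => r; rewrite scaler0 addr0.
  rewrite !big_cons addrC [X in is_derive _ _ _ X]addrC; apply: is_derive_add => //.
    by move=> y; exact: Cn_is_derive f1.
  exact: (Cn_continuous (Cn_partial i f1)).
have -> : v = \sum_i v ord0 i *: evec R i; last first.
  rewrite (_ : \sum_(i < N) _ = \sum_i v ord0 i * partial i f x); first exact: gen.
  apply: eq_bigr => i _; congr (_ * _); rewrite summxE (bigD1 i)//= big1 ?addr0.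
    by rewrite !mxE !eqxx mulr1.
  by move=> j ji; rewrite !mxE eqxx /= eq_sym (negPf ji) mulr0.
exact: row_sum_delta.
Qed.

(** Compactness of K turns the neighbourhoods of t = 0 obtained for each x into a common one. *)
Lemma near0_compact (V : topologicalType) (H : R * V -> R) (K : set V) (a : R) : compact K -> continuous H ->
  (forall x, K x -> a < H (0, x)) -> \forall t \near (0 : R), forall x, K x -> a < H (t, x).
Proof.
move=> /compact_near_coveringP cK cH h0.
have := cK R (nbhs (0 : R)) (fun t x => a < H (t, x)) _; apply => x Kx.
have := cH (0, x); move=> /cvgrPdist_lt/(_ (H (0, x) - a)).
rewrite subr_gt0 => /(_ (h0 x Kx)) [[A B] /= [nA nB] AB].
exists (B, A) => //= -[y t] /= [By At]; have := AB (t, y) (conj At By) => /= hh.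
by have := le_lt_trans (ler_norm _) hh; rewrite ltrD2l ltrN2.
Qed.

End directional.

Section injectivity.
Variables (R : realType) (n : nat) (W : 'rV[R]_n -> 'rV[R]_n).
Hypothesis W1 : Cnv 1 W.
Hypothesis det_gt0 : forall x, 0 < \det (Dmx W x).
Hypothesis W_proper : forall r : R, exists2 K : set 'rV[R]_n, compact K & forall x, `|W x| <= r -> K x.

Let sum_abs (v : 'rV[R]_n) (e : R) (a : 'I_n -> R) : 0 <= e -> (forall i, `|a i| <= e) ->
  `|\sum_i v ord0 i * a i| <= `|v| * (n%:R * e).
Proof.
move=> e0 ae; rewrite (le_trans (ler_norm_sum _ _ _))//.
rewrite (@le_trans _ _ (\sum_(i < n) `|v| * e))//.
  by apply: ler_sum => i _; rewrite normrM ler_pM// rV_norm_coord.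
by rewrite sumr_const card_ord -mulrnAr mulr_natl.
Qed.

(** Local injectivity. Composed with the inverse of DW(x1), the map W has the identity as derivative
    at x1 and nearly so around it. If W(x) = W(x1), the mean value theorem in each coordinate bounds
    v = x - x1 by a fraction of its own norm, so v = 0. *)
Lemma isolated_preimage (x1 : 'rV[R]_n) :
  exists2 r : R, 0 < r & forall x, `|x - x1| < r -> W x = W x1 -> x = x1.
Proof.
pose A := invmx (Dmx W x1).
have DA : Dmx W x1 *m A = 1%:M by rewrite mulmxV// unitmxE unitfE gt_eqF.
pose G x := W x *m A.
have GE j : comp_of G j = fun x => \sum_k A k j * comp_of W k x.
  by apply/funext => x; rewrite /comp_of mxE; apply: eq_bigr => k _; rewrite mulrC.
have G1 j : Cn 1 (comp_of G j) by rewrite GE; apply: Cn_sum => k _; exact: CnZ.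
have pG i j : partial i (comp_of G j) x1 = (i == j)%:R.
  rewrite GE (is_derive_partial (is_derive_sum_seq _ _ (fun k => is_deriveZ (A k j) (Cn_is_derive i x1 (W1 k))))).
  move/matrixP: DA => /(_ i j); rewrite !mxE => <-; apply: eq_bigr => k _.
  by rewrite mxE mulrC.
(* Chosen so that n e < 1: the n entries of a column of the derivative each deviate from the
   identity by less than e. *)
pose e : R := (2 * (n%:R + 1))^-1.
have e0 : 0 < e by rewrite invr_gt0 mulr_gt0// ltr_wpDl.
have : \forall y \near x1, forall i j, `|partial i (comp_of G j) x1 - partial i (comp_of G j) y| < e.
  have fin (P : 'I_n -> 'rV[R]_n -> Prop) : (forall i, \forall y \near x1, P i y) -> \forall y \near x1, forall i, P i y.
    exact: (@mathcomp.classical.filter.filter_forall _ _ P (nbhs x1) _).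
  apply: (fin) => i; apply: (fin) => j.
  have cG : continuous (partial i (comp_of G j)) := Cn_continuous (Cn_partial i (G1 j)).
  by have := cG x1 => /cvgrPdist_lt/(_ e e0).
move=> /nbhs_ballP[r /= r0 hr]; exists r => // x xr Wx.
pose v := x - x1.
have vj j : `|v ord0 j| <= `|v| * (n%:R * e).
  have [s s1 Es] := MVT_line x1 1 (Cn_continuous (G1 j)) (fun y => C1_is_derive y v (G1 j)).
  have xv : x1 + v = x by rewrite /v addrC subrK.
  move: Es; rewrite scale1r mulr1 xv {1 2}/comp_of /G Wx subrr => Es.
  have -> : v ord0 j = \sum_i v ord0 i * (partial i (comp_of G j) x1 - partial i (comp_of G j) (x1 + s *: v)).
    under eq_bigr do rewrite mulrBr; rewrite sumrB -Es subr0.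
    rewrite (bigD1 j)//= big1 ?addr0 ?pG ?eqxx ?mulr1// => i ij.
    by rewrite pG (negPf ij) mulr0.
  apply: sum_abs; first exact: ltW.
  move=> i; apply: ltW; apply: hr; rewrite -ball_normE /= opprD addNKr normrN normrZ.
  by rewrite (le_lt_trans _ xr)// -[leRHS]mul1r ler_wpM2r// (le_trans s1)// normr1.
have : `|v| <= `|v| * (n%:R * e) by apply: rV_norm_le => //; rewrite mulr_ge0// mulr_ge0// ltW.
have ne : n%:R * e < 1.
  rewrite ltr_pdivrMr ?mulr_gt0 ?ltr_wpDl// mul1r.
  have : 0 <= n%:R :> R by []. 
  by set m := n%:R; move=> m0; lra.
have [v0 _|vn0] := eqVneq v 0; first by apply/eqP; rewrite -subr_eq0; apply/eqP.
by rewrite -{1}(mulr1 `|v|) ler_pM2l ?normr_gt0// leNgt ne.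
Qed.

(* Mountain pass: let c be the infimum of the levels at which two preimages of y are
   joined by a compact connected subset of {|W - y|^2 < c}. Moving along
   - (W - y) DW^-1, which fixes these preimages, lowers the level below c. *)
Lemma proper_injective : injective W.
Proof.
move=> x1 x2 W12; apply: contrapT => /eqP x12.
pose y := W x1.
pose g j x := comp_of W j x - y ord0 j.
have g1 j : Cn 1 (g j) by apply: CnD => //; exact: Cn_cst.
have pg i j x : partial i (g j) x = partial i (comp_of W j) x.
  rewrite (is_derive_partial (is_deriveB (Cn_is_derive i x (W1 j)) (is_derive_cst _ _ _))).
  by rewrite subr0.
pose f x := \sum_j g j x * g j x.
have f1 : Cn 1 f by apply: Cn_sum => j _; exact: CnM.
have cf := Cn_continuous f1.
have f_ge0 x : 0 <= f x by apply: sumr_ge0 => j _; exact: sqr_ge0.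
have pf i x : partial i f x = \sum_j 2 * g j x * partial i (comp_of W j) x.
  rewrite (is_derive_partial (is_derive_sum_seq _ _ (fun j => is_deriveM (Cn_is_derive i x (g1 j)) (Cn_is_derive i x (g1 j))))).
  apply: eq_bigr => j _; rewrite pg.
  have gen (a1 b1 : R) : a1 * b1 + a1 * b1 = 2 * a1 * b1 by ring.
  exact: gen.
have f_eq0 x : f x = 0 -> W x = y.
  move=> fx; apply/rowP => j; apply/eqP; rewrite -subr_eq0 -sqrf_eq0.
  have /psumr_eq0P : forall j, xpredT j -> 0 <= g j x * g j x by move=> ? _; exact: sqr_ge0.
  by move=> /(_ fx j isT) h; rewrite expr2; apply/eqP.
have fx1 : f x1 = 0 by apply: big1 => j _; rewrite /g subrr mul0r.
have fx2 : f x2 = 0 by apply: big1 => j _; rewrite /g /comp_of -W12 subrr mul0r.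
(* Newton direction: as [X x *m Dmx W x = W x - y], the derivative of f along X is 2 f, so moving
   along -X lowers f wherever f > 0, and X vanishes at x1 and x2. *)
pose X x := (W x - y) *m invmx (Dmx W x).
have DX x : X x *m Dmx W x = W x - y by rewrite -mulmxA mulVmx ?mulmx1// unitmxE unitfE gt_eqF.
have X1 : X x1 = 0 by rewrite /X subrr mul0mx.
have X2 : X x2 = 0 by rewrite /X -W12 subrr mul0mx.
have cX : continuous X.
  apply: continuous_rV => i.
  rewrite (_ : (fun x => _) = fun x => \sum_j g j x * ((\det (Dmx W x))^-1 * cofactor (Dmx W x) i j)).
    apply: (@Cn_continuous _ _ 0); apply: Cn_sum => j _; apply: CnM; first exact/CnS.
    have cnD a b : Cn 0 (fun x => Dmx W x a b).
      by under eq_fun do rewrite mxE; exact: Cn_partial (W1 b).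
    apply: CnM.
      split => //; apply: contV; last by move=> x; rewrite gt_eqF.
      by apply: (@Cn_continuous _ _ 0); exact: Cn_det.
    apply: CnZ; apply: Cn_det => a b.
    by under eq_fun do rewrite !mxE; exact: Cn_partial (W1 _).
  apply/funext => x; rewrite mxE; apply: eq_bigr => j _.
  by rewrite /invmx unitmxE unitfE gt_eqF// !mxE.
have dfX x : \sum_i X x ord0 i * partial i f x = 2 * f x.
  under eq_bigr do rewrite pf mulr_sumr.
  rewrite exchange_big /= mulr_sumr; apply: eq_bigr => j _.
  move/matrixP: (DX x) => /(_ ord0 j); rewrite !mxE => E.
  rewrite (_ : W x ord0 j - y ord0 j = g j x)// in E.
  rewrite -[X in _ = 2 * (_ * X)]E mulrA mulr_sumr; apply: eq_bigr => i _; rewrite [Dmx W x i j]mxE.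
  have gen (a1 b1 c1 : R) : a1 * (2 * b1 * c1) = 2 * b1 * (a1 * c1) by ring.
  exact: gen.
pose Dl (z : R * 'rV[R]_n) := z.2 - z.1 *: X z.2.
have cX2 : continuous (fun z : R * 'rV[R]_n => X z.2).
  by move=> z; apply: continuous_comp; [exact: cvg_snd|exact: cX].
have cDl : continuous Dl.
  move=> z; apply: continuousB; first exact: cvg_snd.
  by apply: cvgZ; [exact: cvg_fst|exact: cX2].
pose H (z : R * 'rV[R]_n) := \sum_i X z.2 ord0 i * partial i f (Dl z).
have cH : continuous H.
  rewrite /H; elim: (index_enum _) => [|i r IH]; first by under eq_fun do rewrite big_nil; exact: contC.
  under eq_fun do rewrite big_cons; apply: contD => //; apply: contM.
    by move=> z; apply: (@continuous_comp _ _ _ (fun z : R * 'rV[R]_n => X z.2) (fun v : 'rV[R]_n => v ord0 i)); [exact: cX2|exact: coord_continuous].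
  by move=> z; apply: continuous_comp; [exact: cDl|exact: (Cn_continuous (Cn_partial i f1))].
have fD t x : exists2 s : R, `|s| <= `|t| & f (Dl (t, x)) = f x - H (s, x) * t.
  have [s st Es] := MVT_line x t cf (fun z => C1_is_derive z (- X x) f1).
  exists s => //; move: Es; rewrite !scalerN -/(Dl (t, x)) => Es.
  rewrite -[LHS](subrK (f x)) {1}/Dl /= Es addrC; congr (_ + _); rewrite -mulNr; congr (_ * _).
  by rewrite /H /= -sumrN; apply: eq_bigr => i _; rewrite mxE mulNr.
have cpt c : compact [set x | f x <= c].
  have [K cK hK] := W_proper (`|y| + (1 + c)).
  apply: (subclosed_compact _ cK).
    rewrite (_ : mkset _ = f @^-1` [set z | z <= c]); last by [].
    by apply: preimage_closed; [move=> z _; exact: cf|exact: closed_le].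
  move=> x /= fc; apply: hK; rewrite -[W x](subrK y) addrC.
  rewrite (le_trans (ler_normD _ _))// lerD2l; have c0 : 0 <= c := le_trans (f_ge0 x) fc.
  apply: rV_norm_le => [|j]; first by rewrite addr_ge0.
  have gj : `|g j x| ^+ 2 <= c.
    apply: le_trans fc; rewrite real_normK ?num_real// expr2 /f (bigD1 j)//= lerDl.
    by apply: sumr_ge0 => i _; exact: sqr_ge0.
  rewrite mxE [X in `|_ + X|]mxE -/(g j x); move: (g j x) gj => a; set b := `|a|; have b0 : 0 <= b by exact: normr_ge0.
  by move=> h; nra.
pose G : set R := [set c | exists K : set 'rV[R]_n, [/\ connected K, K x1, K x2 & forall x, K x -> f x < c]].
have [r r0 hr] := isolated_preimage x1.
(* The sphere of this radius around x1 separates x1 from x2 and lies where x1 is the only preimage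
   of y. Every connected set joining x1 to x2 meets it, and the minimum of f on it is a positive
   lower bound for all levels in G. *)
pose rr := Num.min (r / 2) (`|x2 - x1| / 2).
have n0 : 0 < `|x2 - x1| by rewrite normr_gt0 subr_eq0 eq_sym.
have rr0 : 0 < rr by rewrite lt_min !divr_gt0.
have rrr : rr < r by rewrite gt_min; apply/orP; left; lra.
have rrn : rr < `|x2 - x1| by rewrite gt_min; apply/orP; right; lra.
pose S := [set x : 'rV[R]_n | `|x - x1| = rr].
have cn : continuous (fun x : 'rV[R]_n => `|x - x1|).
  move=> x; apply: (@continuous_comp _ _ _ (fun x : 'rV[R]_n => x - x1) (fun x => `|x|)); last exact: norm_continuous.
  exact: (cvgB cvg_id (cvg_cst _)).
have Gcross K : connected K -> K x1 -> K x2 -> exists2 x, K x & S x.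
  move=> cK K1 K2.
  have : connected ((fun x : 'rV[R]_n => `|x - x1|) @` K).
    by apply: connected_continuous_connected => //; apply: continuous_subspaceT; exact: cn.
  move=> /connected_intervalP/(_ 0 `|x2 - x1|)/(_ _ _ rr) [|||x Kx Sx].
  - by exists x1 => //; rewrite subrr normr0.
  - by exists x2.
  - by rewrite (ltW rr0) ltW.
  by exists x.
have [c0 c00 Gc0] : exists2 c0, 0 < c0 & forall c, G c -> c0 <= c.
  have cS : compact S.
    apply: bounded_closed_compact.
      exists (`|x1| + rr); split; first exact: num_real.
      move=> s rs x /= Sx; rewrite -[x](subrK x1) addrC (le_trans (ler_normD _ _))// Sx ltW//.
    rewrite (_ : S = (fun x : 'rV[R]_n => `|x - x1|) @^-1` [set z | z = rr]); last by [].
    by apply: preimage_closed; [move=> z _; exact: cn|exact: closed_eq].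
  have [[z Sz]|nS] := pselect (S !=set0); last first.
    exists 1 => // c [K [cK K1 K2 _]]; have [x _ Sx] := Gcross K cK K1 K2.
    by exfalso; apply: nS; exists x.
  have [z0 Sz0 min0] := @EVT_min_rV _ _ f S (ex_intro _ z Sz) cS (continuous_subspaceT cf).
  exists (f z0).
    rewrite lt_neqAle f_ge0 andbT eq_sym; apply/eqP => /f_eq0 E.
    have /hr : `|z0 - x1| < r by move: Sz0; rewrite inE => ->.
    move=> /(_ E) z01; move: Sz0; rewrite inE /S /= z01 subrr normr0 => /esym E0.
    by rewrite E0 ltxx in rr0.
  move=> c [K [cK K1 K2 Kc]]; have [x Kx Sx] := Gcross K cK K1 K2.
  by rewrite (le_trans _ (ltW (Kc x Kx)))// min0// inE.
(* The straight segment from x1 to x2 is a connected set on which f is bounded. *)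
have G0 : G !=set0.
  pose seg (t : R) : 'rV[R]_n := x1 + t *: (x2 - x1).
  have cseg : continuous seg.
    move=> t; apply: (@cvgD _ _ _ _ _ (fun=> x1) (fun t : R => t *: (x2 - x1))); first exact: cvg_cst.
    exact: scalel_continuous.
  have [t0 _ mx] := @EVT_max R (f \o seg) 0 1 ler01 (continuous_subspaceT (fun t => continuous_comp (cseg t) (cf _))).
  exists (f (seg t0) + 1), (seg @` `[0, 1]); split.
  - apply: connected_continuous_connected; first exact: segment_connected.
    by apply: continuous_subspaceT; exact: cseg.
  - by exists 0; rewrite /= ?in_itv /= ?lexx ?ler01// /seg scale0r addr0.
  - by exists 1; rewrite /= ?in_itv /= ?lexx ?ler01// /seg scale1r addrC subrK.
  - by move=> x [t t01 <-]; rewrite (le_lt_trans (mx t t01))// ltrDl.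
have Ginf : has_inf G by split => //; exists c0 => c; exact: Gc0.
pose cs := inf G.
have cs0 : 0 < cs by apply: lt_le_trans c00 _; apply: lb_le_inf.
have Gcs c : G c -> cs <= c by move=> Gc; apply: ge_inf => //; case: Ginf.
(* On the compact shell where cs/2 <= f <= cs + 1, the rate of decrease at time 0 is 2 f >= cs; for
   small times it still exceeds cs/2. *)
have N1 : \forall t \near (0 : R), forall x, [set x | f x <= cs + 1] x /\ cs / 2 <= f x -> cs / 2 < H (t, x).
  apply: (@near0_compact _ _ H [set x | [set x | f x <= cs + 1] x /\ cs / 2 <= f x]) => //.
    rewrite (_ : mkset _ = [set x | f x <= cs + 1] `&` f @^-1` [set z | cs / 2 <= z]); last by [].
    apply: compact_closedI; first exact: cpt.
    by apply: preimage_closed; [move=> z _; exact: cf|exact: closed_ge].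
  move=> x [_ xcs]; rewrite /H /Dl /= scale0r subr0 dfX.
  by move: (f x) xcs => a; lra.
(* On f <= cs/2 no decrease is required; it suffices that the deformation stays below 3/4 cs. *)
have N2 : \forall t \near (0 : R), forall x, [set x | f x <= cs / 2] x -> - (3 / 4 * cs) < - f (Dl (t, x)).
  apply: (@near0_compact _ _ (fun z => - f (Dl z)) [set x | f x <= cs / 2]) => //.
    by apply: contN => z; apply: continuous_comp; [exact: cDl|exact: cf].
  by move=> x /=; rewrite /Dl /= scale0r subr0 ltrN2; move: (f x) => a; lra.
move: N1 => /nbhs_ballP[d1 /= d10 hd1]; move: N2 => /nbhs_ballP[d2 /= d20 hd2].
pose d := Num.min d1 d2.
have d0 : 0 < d by rewrite lt_min; apply/andP; split.
have dd1 : d <= d1 by rewrite ge_min lexx.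
have dd2 : d <= d2 by rewrite ge_min lexx orbT.
pose t := Num.min (d / 2) 1.
have t0 : 0 < t by rewrite lt_min divr_gt0//=.
have t1 : t <= 1 by rewrite ge_min lexx orbT.
have td : t < d by rewrite gt_min; apply/orP; left; lra.
have inball1 s : `|s| <= t -> ball (0 : R) d1 s.
  by move=> st; rewrite -ball_normE /= sub0r normrN (le_lt_trans st)// (lt_le_trans td).
have inball2 s : `|s| <= t -> ball (0 : R) d2 s.
  by move=> st; rewrite -ball_normE /= sub0r normrN (le_lt_trans st)// (lt_le_trans td).
have tc : 0 < t * cs / 4 by rewrite !mulr_gt0.
have tc1 : Num.min (t * cs / 4) 1 > 0 by rewrite lt_min tc ltr01.
(* A nearly optimal set K, with excess below t cs/4. On the shell the deformation lowers f by more
   than t cs/2, and elsewhere f stays below 3/4 cs <= cs - t cs/4 because t <= 1. The image of K is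
   connected and still contains x1 and x2, so its level cs - t cs/4 contradicts the definition of
   cs. *)
have [c [K [cK K1 K2 Kc]] cc] := inf_adherent tc1 Ginf.
have cc1 : c < cs + t * cs / 4 by rewrite (lt_le_trans cc)// lerD2l ge_min lexx.
have cc2 : c < cs + 1 by rewrite (lt_le_trans cc)// lerD2l ge_min lexx orbT.
have : G (cs - t * cs / 4).
  exists ((fun x => Dl (t, x)) @` K); split.
  - apply: connected_continuous_connected => //; apply: continuous_subspaceT => x.
    have h : {for x, continuous (fun x => t *: X x)}.
      by apply: (@continuous_comp _ _ _ X ( *:%R t)); [exact: cX|exact: scaler_continuous].
    exact: (cvgB cvg_id h).
  - by exists x1 => //; rewrite /Dl /= X1 scaler0 subr0.
  - by exists x2 => //; rewrite /Dl /= X2 scaler0 subr0.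
  move=> _ [x Kx <-]; have fc := Kc x Kx.
  have [xs|xs] := leP (cs / 2) (f x).
    have [s st ->] := fD t x.
    have sb : `|s| <= t by rewrite (le_trans st)// gtr0_norm.
    have Hs := hd1 s (inball1 s sb) x (conj (ltW (lt_trans fc cc2)) xs).
    have h2 : cs / 2 * t < H (s, x) * t by rewrite ltr_pM2r.
    move: (f x) fc (H (s, x) * t) h2 => a ac m ma.
    rewrite (lt_trans (_ : _ < c - cs / 2 * t))//; first by rewrite ltrB.
    have gen (c' s' t' : R) : c' < s' + t' * s' / 4 -> c' - s' / 2 * t' < s' - t' * s' / 4.
      by rewrite (_ : s' / 2 * t' = t' * s' / 4 + t' * s' / 4); [move: (_ / 4) => z; lra|field].
    exact: gen.
  have := hd2 t (inball2 t _) x (ltW xs); rewrite gtr0_norm// lexx ltrN2 => /(_ isT) h2.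
  apply: lt_le_trans h2 _; have h3 : t * cs <= 1 * cs by rewrite ler_wpM2r// ltW.
  by move: (t * cs) h3 => z; lra.
by move=> /Gcs; rewrite leNgt gtrBl tc.
Qed.

End injectivity.

(** * Mixed norms *)

Section left_inverse.
Variables (R : realType) (n : nat) (w : 'rV[R]_n -> 'rV[R]_n).
Hypothesis cw : continuous w.
Hypothesis iw : injective w.

(** A closed set is a countable union of compact sets, and continuous images of compact sets are
    compact. *)
Lemma measurable_image_closed (A : set 'rV[R]_n) : closed A -> measurable (w @` A).
Proof.
move=> cA.
have -> : w @` A = \bigcup_k (w @` (A `&` [set x | `|x| <= k%:R])).
  apply/seteqP; split=> [_ [x Ax <-]|_ [k _ [x [Ax _] <-]]]; last by exists x.
  exists (Num.bound `|x|) => //; exists x => //; split => //=.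
  by apply: ltW; have := archi_boundP (normr_ge0 x).
apply: bigcupT_measurable => k; apply: compact_measurable_rV.
apply: continuous_compact; first by apply: continuous_subspaceT.
by rewrite setIC; apply: compact_closedI => //; exact: closed_ball_compact.
Qed.

(** The inverse is extended by 0 off the range. The preimage of a closed half-space under it is the
    image of that half-space under w, together with the complement of the range when the half-space
    contains 0. *)
Lemma measurable_left_inverse : exists g : 'rV[R]_n -> 'rV[R]_n,
  measurable_fun setT g /\ cancel w g.
Proof.
pose g y := if pselect (exists x, w x = y) is left h then sval (cid h) else 0.
exists g; split; last first.
  move=> x; rewrite /g; case: pselect => [h|[]]; last by exists x.
  by apply: iw; exact: svalP (cid h).
apply: measurable_fun_rVP => i.
apply: (measurability _ (measurable_realfun.RGenCInfty.measurableE R)) => _ [_ [a ->] <-].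
rewrite setTI.
pose A := [set x : 'rV[R]_n | a <= x ord0 i].
have cA : closed A.
  rewrite (_ : A = (fun x : 'rV[R]_n => x ord0 i) @^-1` [set z | a <= z]); last by [].
  by apply: preimage_closed; [move=> z _; exact: coord_continuous|exact: closed_ge].
have -> : (fun t => g t ord0 i) @^-1` [set` `[a, +oo[] =
    w @` A `|` (if a <= 0 then ~` (w @` setT) else set0).
  apply/seteqP; split=> y /=.
    rewrite in_itv /= andbT /g; case: pselect => [h ya|h].
      by left; exists (sval (cid h)) => //; exact: svalP (cid h).
    by rewrite mxE => a0; right; rewrite a0 => -[x _ wx]; apply: h; exists x.
  rewrite in_itv /= andbT /g => -[[x Ax wx]|].
    case: pselect => [h|[]]; last by exists x.
    by rewrite (_ : sval _ = x)//; apply: iw; rewrite wx; exact: svalP (cid h).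
  case: ifP => // a0; case: pselect => [[x wx] []|_ _]; first by exists x.
  by rewrite mxE.
apply: measurableU; first exact: measurable_image_closed.
case: ifP => // _; apply: measurableC; apply: measurable_image_closed; exact: closedT.
Qed.

End left_inverse.

Section power_cvg.
Variable R : realType.

Lemma powR_cvg (u : nat -> R) (r : R) : 0 < r -> (forall k, 0 <= u k) -> u k @[k --> \oo] --> 0 ->
  u k `^ r @[k --> \oo] --> 0.
Proof.
move=> r0 u0 cu; apply/cvgrPdist_lt => /= e e0.
have e'0 : 0 < e `^ r^-1 by rewrite powR_gt0.
move/cvgrPdist_lt: cu => /(_ _ e'0); apply: filterS => k.
rewrite !sub0r !normrN !ger0_norm ?powR_ge0// => h.
have -> : e = (e `^ r^-1) `^ r by rewrite -powRrM mulVf ?powRr1 ?gt_eqF// ltW.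
by apply: gt0_ltr_powR; rewrite // nnegrE// ltW.
Qed.

Lemma poweR_cvg (u : nat -> \bar R) (r : R) : 0 < r -> (forall k, (0 <= u k)%E) ->
  u k @[k --> \oo] --> 0%E -> (u k `^ r)%E @[k --> \oo] --> 0%E.
Proof.
move=> r0 u0 /fine_cvgP[fu cu]; apply/fine_cvgP; split.
  by apply: filterS fu => k; rewrite !ge0_fin_numE ?poweR_ge0//; exact: poweR_lty.
apply: cvg_trans (_ : fine (u k) `^ r @[k --> \oo] --> 0).
  apply: near_eq_cvg; by apply: nearW => k; rewrite /= fine_poweR.
by apply: powR_cvg => // k; exact: fine_ge0.
Qed.

End power_cvg.

Section mixed_norm.
Context d1 d2 (T1 : measurableType d1) (T2 : measurableType d2) (R : realType).
Variables (m1 : {sigma_finite_measure set T1 -> \bar R}) (m2 : {sigma_finite_measure set T2 -> \bar R}).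
Local Open Scope ereal_scope.

Let measurable_pow (q : R) d (T : measurableType d) (f : T -> R) : measurable_fun setT f ->
  measurable_fun setT (fun x => (`|f x| `^ q)%R%:E).
Proof.
move=> mf; apply/measurable_EFinP; apply: (@measurableT_comp _ _ _ _ _ _ (@powR R ^~ q)) => //.
exact: measurableT_comp.
Qed.

Let msec (f : T1 * T2 -> R) t : measurable_fun setT f -> measurable_fun setT (fun x => f (t, x)).
Proof. by move=> mf; exact: measurableT_comp. Qed.

Lemma LnormE (q : R) (f : T2 -> R) :
  'N[m2]_(q%:E)[EFin \o f] = (\int[m2]_x (`|f x| `^ q)%:E) `^ q^-1.
Proof. by rewrite unlock. Qed.

Lemma Lnorm_le (q : R) (f g : T2 -> R) : (0 < q)%R -> measurable_fun setT f -> measurable_fun setT g ->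
  (forall x, `|f x| <= `|g x|)%R -> 'N[m2]_(q%:E)[EFin \o f] <= 'N[m2]_(q%:E)[EFin \o g].
Proof.
move=> q0 mf mg fg; rewrite !LnormE.
apply: gt0_ler_poweR; rewrite ?in_itv /= ?leey ?andbT//.
- by rewrite invr_ge0 ltW.
- by apply: integral_ge0 => x _; rewrite lee_fin powR_ge0.
- by apply: integral_ge0 => x _; rewrite lee_fin powR_ge0.
apply: ge0_le_integral => //.
- exact: measurable_pow.
- exact: measurable_pow.
by move=> x _; rewrite lee_fin; apply: ge0_ler_powR; rewrite ?nnegrE//; exact: ltW.
Qed.

Lemma measurable_Lnorm_section (q : R) (h : T1 * T2 -> R) : measurable_fun setT h ->
  measurable_fun setT (fun t => 'N[m2]_(q%:E)[EFin \o (fun x => h (t, x))]).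
Proof.
move=> mh; under eq_fun do rewrite LnormE.
apply: (@measurableT_comp _ _ _ _ _ _ (fun x : \bar R => poweR x q^-1)); first exact: measurable_poweR.
apply: (@measurable_fun_fubini_tonelli_F _ _ _ _ _ m2 (fun z => (`|h z| `^ q)%:E)) => //.
exact: measurable_pow.
Qed.

Lemma Lnorm_dct (q : R) (h : T2 -> R) (h_ : nat -> T2 -> R) : (0 < q)%R -> measurable_fun setT h ->
  'N[m2]_(q%:E)[EFin \o h] < +oo -> (forall k, measurable_fun setT (h_ k)) ->
  (forall k x, `|h_ k x| <= `|h x|)%R -> (forall x, h_ k x @[k --> \oo] --> (0 : R)%R) ->
  'N[m2]_(q%:E)[EFin \o h_ k] @[k --> \oo] --> 0.
Proof.
move=> q0 mh hoo mh_ hh h0.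
have ig : m2.-integrable setT (EFin \o (fun x => `|h x| `^ q)%R).
  apply/integrableP; split; first exact: measurable_pow.
  under eq_integral do rewrite gee0_abs ?lee_fin ?powR_ge0//.
  move: hoo; rewrite LnormE.
  case E : (\int[m2]_x (`|h x| `^ q)%:E) => [r||//]; rewrite ?ltry//.
  by rewrite poweRyr// invr_neq0// gt_eqF.
have c1 := @dct_dist _ _ _ m2 (fun k x => `|h_ k x| `^ q)%R (cst 0%R) _ _ _ ig _ _.
have c2 : (\int[m2]_x (`|h_ k x| `^ q)%:E) @[k --> \oo] --> 0.
  apply: cvg_trans (c1 _ _ _ _) => //.
  - apply: near_eq_cvg; apply: nearW => k; apply: eq_integral => x _.
    by rewrite subr0 ger0_norm ?powR_ge0.
  - by move=> k; apply/measurable_EFinP; exact: measurable_pow.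
  - move=> k x /=; rewrite ger0_norm ?powR_ge0//; apply: ge0_ler_powR; rewrite ?nnegrE//; exact: ltW.
  - move=> x; apply: powR_cvg => //.
    by rewrite -(@normr0 _ R); apply: cvg_norm; exact: h0.
under eq_fun do rewrite LnormE.
apply: poweR_cvg => //; first by rewrite invr_gt0.
by move=> k; apply: integral_ge0 => x _; rewrite lee_fin powR_ge0.
Qed.

(** Dominated convergence twice: in x for almost every t, namely where the slice norm of h is
    finite, then in t with this slice norm as dominating function. *)
Lemma mixed_dct (A : set T1) (q : R) (h : T1 * T2 -> R) (h_ : nat -> T1 * T2 -> R) :
  measurable A -> (0 < q)%R -> measurable_fun setT h ->
  \int[m1]_(t in A) 'N[m2]_(q%:E)[EFin \o (fun x => h (t, x))] < +oo ->
  (forall k, measurable_fun setT (h_ k)) ->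
  (forall k z, `|h_ k z| <= `|h z|)%R -> (forall z, h_ k z @[k --> \oo] --> (0 : R)%R) ->
  \int[m1]_(t in A) 'N[m2]_(q%:E)[EFin \o (fun x => h_ k (t, x))] @[k --> \oo] --> 0.
Proof.
move=> mA q0 mh hoo mh_ hh h0.
pose g t := 'N[m2]_(q%:E)[EFin \o (fun x => h (t, x))].
have mg : measurable_fun A g by apply: measurable_funTS; exact: measurable_Lnorm_section.
have ig : m1.-integrable A g.
  apply/integrableP; split => //.
  by under eq_integral do rewrite gee0_abs ?Lnorm_ge0//.
have h1 k : measurable_fun A (fun t => 'N[m2]_(q%:E)[EFin \o (fun x => h_ k (t, x))]).
  by apply: measurable_funTS; exact: measurable_Lnorm_section.
have h2 : {ae m1, forall t, A t -> 'N[m2]_(q%:E)[EFin \o (fun x => h_ k (t, x))] @[k --> \oo] --> 0}.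
  have := integrable_ae mA ig; apply: filterS => t ht At.
  apply: (Lnorm_dct q0 (msec t mh)) => //; first by rewrite -ge0_fin_numE ?Lnorm_ge0//; exact: ht.
  by move=> k; exact: msec.
have h3 : {ae m1, forall t k, A t -> `|'N[m2]_(q%:E)[EFin \o (fun x => h_ k (t, x))]| <= g t}.
  apply/nearW => t k At; rewrite gee0_abs ?Lnorm_ge0//.
  by apply: Lnorm_le => //; exact: msec.
have [_ _] := dominated_convergence mA h1 (measurable_cst 0) h2 ig h3.
by rewrite integral0.
Qed.

(** Tonelli, then Hoelder's inequality on each slice; the bound C on the first factor is pulled out
    for almost every t. *)
Lemma hoelder_mixed (A : set T1) (p q C : R) (f g : T1 * T2 -> R) : measurable A ->
  (0 < p)%R -> (0 < q)%R -> (p^-1 + q^-1 = 1)%R -> measurable_fun setT f -> measurable_fun setT g ->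
  (0 <= C)%R ->
  (\forall t \ae m1, A t -> 'N[m2]_(p%:E)[EFin \o (fun x => f (t, x))] <= C%:E) ->
  \int[m1 \x m2]_z (`|f z * g z * \1_A z.1|)%:E <=
    C%:E * \int[m1]_(t in A) 'N[m2]_(q%:E)[EFin \o (fun x => g (t, x))].
Proof.
move=> mA p0 q0 pq mf mg C0 fC.
have mI : measurable_fun setT (fun z : T1 * T2 => \1_A z.1 : R).
  by apply: (@measurableT_comp _ _ _ _ _ _ (\1_A : T1 -> R)) => //; exact: measurable_indic.
have mF : measurable_fun setT (fun z => (`|f z * g z * \1_A z.1|)%:E).
  apply/measurable_EFinP; apply: measurableT_comp => //; apply: measurable_funM => //.
  exact: measurable_funM.
rewrite fubini_tonelli1//.
have mN : measurable_fun A (fun t => 'N[m2]_(q%:E)[EFin \o (fun x => g (t, x))]).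
  by apply: measurable_funTS; exact: measurable_Lnorm_section.
rewrite -ge0_integralZl//; last by move=> t _; exact: Lnorm_ge0.
have -> : \int[m1]_t fubini_F m2 (fun z => (`|f z * g z * \1_A z.1|)%:E) t =
    \int[m1]_(t in A) \int[m2]_x (`|f (t, x) * g (t, x)|)%:E.
  rewrite [RHS]integral_mkcond; apply: eq_integral => t _; rewrite patchE /fubini_F.
  case: ifPn => tA; first by apply: eq_integral => x _; rewrite indicE tA mulr1.
  by rewrite integral0_eq// => x _; rewrite indicE (negbTE tA) mulr0 normr0.
apply: ae_ge0_le_integral => //.
- by move=> t _; apply: integral_ge0 => x _; rewrite lee_fin.
- apply: measurable_funTS.
  apply: (@measurable_fun_fubini_tonelli_F _ _ _ _ _ m2 (fun z => (`|f z * g z|)%:E)) => //.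
  by apply/measurable_EFinP; apply: measurableT_comp => //; exact: measurable_funM.
- by move=> t _; rewrite mule_ge0// ?lee_fin// Lnorm_ge0.
- exact: measurable_funeM.
apply: filterS fC => t ht At.
have := @hoelder _ _ _ m2 (fun x => f (t, x)) (fun x => g (t, x)) p q (msec t mf) (msec t mg) p0 q0 pq.
rewrite Lnorm1 => /le_trans; apply.
by apply: lee_wpmul2r; [exact: Lnorm_ge0|exact: ht].
Qed.

End mixed_norm.

Section Lnorm_scale.
Context d (X : measurableType d) (R : realType) (mu : {sigma_finite_measure set X -> \bar R}).

Lemma Lnorm_scale (q c : R) (f : X -> R) : 0 < q -> 0 <= c -> measurable_fun setT f ->
  ('N[mu]_(q%:E)[EFin \o (fun x => c * f x)%R] = c%:E * 'N[mu]_(q%:E)[EFin \o f])%E.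
Proof.
move=> q0 c0 mf; rewrite !LnormE.
under eq_integral do rewrite normrM powRM// EFinM.
rewrite ge0_integralZl//; last first.
  apply/measurable_EFinP; apply: (@measurableT_comp _ _ _ _ _ _ (@powR R ^~ q)) => //; exact: measurableT_comp.
rewrite poweRM ?lee_fin ?powR_ge0//; last by apply: integral_ge0 => x _; rewrite lee_fin powR_ge0.
by rewrite poweR_EFin -powRrM mulfV ?gt_eqF// powRr1// ger0_norm.
Qed.

Lemma Lnorm_le_scale (q c : R) (f g : X -> R) : 0 < q -> 0 <= c -> measurable_fun setT f ->
  measurable_fun setT g -> (forall x, `|g x| <= c * `|f x|) ->
  ('N[mu]_(q%:E)[EFin \o g] <= c%:E * 'N[mu]_(q%:E)[EFin \o f])%E.
Proof.
move=> q0 c0 mf mg gf; rewrite -Lnorm_scale//.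
apply: Lnorm_le => // [|x]; first exact: measurable_funM.
by rewrite normrM (ger0_norm c0).
Qed.

End Lnorm_scale.

Section evolution_tools.
Variables (R : realType) (N : nat) (T : R).
Local Notation V := 'rV[R]_N.
Local Notation mu := (lebesgueN R N).
Local Notation leb := (@lebesgue_measure R).
Local Notation TV := (measurableTypeR R * V)%type.
Local Notation I := (`]0, T[%classic : set R).

(** Extension by zero outside ]0, T[, so that space-time integrals are taken over the whole product
    space and Fubini and the density theorem apply without restrictions of domain. *)
Definition extQ (u : R -> V -> R) (z : TV) : R := u z.1 z.2 * \1_I z.1.

Lemma measurable_indT : measurable_fun setT (fun z : TV => \1_I z.1 : R).
Proof.
apply: (@measurableT_comp _ _ _ _ _ _ (\1_I : R -> R)) => //.
Qed.

Lemma measurable_extQ u : measurable_tx T u -> measurable_fun setT (extQ u).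
Proof.
move=> mu_.
have -> : extQ u = (fun z : TV => u z.1 z.2) \_ (I `*` setT).
  apply/funext => z; rewrite patchE /extQ indicE.
  case: (boolP (z.1 \in I)) => h.
    by rewrite mulr1 mem_set//; split => //; exact: set_mem.
  by rewrite mulr0 memNset// => -[/mem_set h1 _]; rewrite h1 in h.
apply/(measurable_restrictT _ _).1 => //.
by apply: measurableX => //; exact: measurable_itv.
Qed.

(** [int_tx] iterates two real-valued integrals, each of which discards infinite values. Joint
    integrability makes almost every inner integral finite, so nothing is lost and Fubini
    applies. *)
Lemma int_txE (u : R -> V -> R) : ((leb \x mu)%E).-integrable setT (EFin \o extQ u) ->
  int_tx T u = \int[(leb \x mu)%E]_z extQ u z.
Proof.
move=> iu; rewrite /int_tx /Rintegral; congr fine.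
rewrite -integral12_prod_meas1// integral_mkcond.
pose F := fubini_F mu (EFin \o extQ u).
have E : (fun t => (fine (\int[mu]_x (u t x)%:E)%E)%:E) \_ I = EFin \o (fine \o F).
  apply/funext => t; rewrite patchE /F /fubini_F /=; case: ifPn => tI.
    congr (EFin (fine _)); apply: eq_integral => x _.
    by rewrite /extQ /= indicE tI mulr1.
  by rewrite integral0_eq// => x _; rewrite /extQ /= indicE (negbTE tI) mulr0.
rewrite E; have mF : measurable_fun setT F by exact: (measurable_fubini_F iu).
apply: ae_eq_integral => //.
  by apply/measurable_EFinP; apply: measurableT_comp.
have := ae_integrable1 iu; apply: filterS => t ht _ /=.
by rewrite fineK// /F /fubini_F integrable_fin_num.
Qed.

End evolution_tools.

(** * Straightening identities *)

Section integrable_real.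
Context d (X : measurableType d) (R : realType) (m : {measure set X -> \bar R}).

Lemma integrable_ler (f g : X -> R) : measurable_fun setT f -> (forall x, `|f x| <= `|g x|) ->
  m.-integrable setT (EFin \o g) -> m.-integrable setT (EFin \o f).
Proof.
move=> mf fg ig; apply: (@le_integrable _ _ _ m setT measurableT _ (EFin \o g)) => //.
- exact/measurable_EFinP.
- by move=> x _; rewrite lee_fin.
Qed.

Lemma integrable_lty (f : X -> R) : measurable_fun setT f -> m.-integrable setT (EFin \o f) <->
  (\int[m]_x (`|f x|)%:E < +oo)%E.
Proof.
move=> mf; split; first by move=> /integrableP[].
by move=> foo; apply/integrableP; split => //; exact/measurable_EFinP.
Qed.

Lemma dct_dist0 (f_ : nat -> X -> R) (g : X -> R) : (forall k, measurable_fun setT (f_ k)) ->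
  m.-integrable setT (EFin \o g) -> (forall k x, `|f_ k x| <= `|g x|) ->
  (forall x, f_ k x @[k --> \oo] --> (0 : R)) ->
  (\int[m]_x (`|f_ k x|)%:E)%E @[k --> \oo] --> 0%E.
Proof.
move=> mf ig fg f0.
have ig' : m.-integrable setT (EFin \o (fun x => `|g x|)) by exact: integrable_abse ig.
have := @dct_dist _ _ _ m f_ (cst 0) _ mf (measurable_cst _) ig' fg f0.
by under eq_fun do under eq_integral do rewrite subr0.
Qed.

End integrable_real.

Section signed_identity.
Context d d' (X : measurableType d) (Y : measurableType d') (R : realType).
Variables (m : {measure set X -> \bar R}) (Phi Phi0 : X -> Y) (f f0 : X -> R).
Variables (G : set (set Y)) (D : nat -> set Y).
Hypothesis mPhi : measurable_fun setT Phi.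
Hypothesis mPhi0 : measurable_fun setT Phi0.
Hypothesis mf : measurable_fun setT f.
Hypothesis mf0 : measurable_fun setT f0.
Hypothesis mG : measurable = <<s G >>.
Hypothesis GI : setI_closed G.
Hypothesis GD : forall k, G (D k).
Hypothesis Dcov : forall x, \forall k \near \oo, D k x.
Hypothesis fD : forall k, m.-integrable setT (EFin \o (fun x => f x * \1_(D k) (Phi x))).
Hypothesis f0D : forall k, m.-integrable setT (EFin \o (fun x => f0 x * \1_(D k) (Phi0 x))).
Hypothesis base : forall A k, G A -> A `<=` D k ->
  \int[m]_x (f x * \1_A (Phi x)) = \int[m]_x (f0 x * \1_A (Phi0 x)).

Let mfh (h : Y -> R) : measurable_fun setT h -> measurable_fun setT (fun x => f x * h (Phi x)).
Proof. by move=> mh; apply: measurable_funM => //; exact: measurableT_comp. Qed.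

Let mf0h (h : Y -> R) : measurable_fun setT h -> measurable_fun setT (fun x => f0 x * h (Phi0 x)).
Proof. by move=> mh; apply: measurable_funM => //; exact: measurableT_comp. Qed.

(** The density theorem is applied to the difference of the two sides, a functional that does not
    depend on e; converging to 0 then means being 0. The seminorm is the sum of the two weighted L^1
    norms, and the base case is an exact identity. *)
Lemma signed_identity (h : Y -> R) : measurable_fun setT h ->
  m.-integrable setT (EFin \o (fun x => f x * h (Phi x))) ->
  m.-integrable setT (EFin \o (fun x => f0 x * h (Phi0 x))) ->
  \int[m]_x (f x * h (Phi x)) = \int[m]_x (f0 x * h (Phi0 x)).
Proof.
move=> mh ih ih0.
pose Nm (h : Y -> R) := (\int[m]_x (`|f x * h (Phi x)|)%:E + \int[m]_x (`|f0 x * h (Phi0 x)|)%:E)%E.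
have n1 (g : Y -> R) : (0 <= \int[m]_x (`|f x * g (Phi x)|)%:E)%E by apply: integral_ge0 => x _; rewrite lee_fin.
have n2 (g : Y -> R) : (0 <= \int[m]_x (`|f0 x * g (Phi0 x)|)%:E)%E by apply: integral_ge0 => x _; rewrite lee_fin.
have domP g : dom Nm g <-> [/\ measurable_fun setT g,
    m.-integrable setT (EFin \o (fun x => f x * g (Phi x))) &
    m.-integrable setT (EFin \o (fun x => f0 x * g (Phi0 x)))].
  split=> [[mg goo]|[mg i1 i2]].
    split => //; apply/integrable_lty; rewrite ?mfh ?mf0h//; [exact: mfh| |exact: mf0h|].
    - by apply: le_lt_trans goo; rewrite /Nm leeDl.
    - by apply: le_lt_trans goo; rewrite /Nm leeDr.
  split => //; rewrite /Nm lte_add_pinfty//; first by case/integrableP: i1.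
  by case/integrableP: i2.
pose L (e : R) (g : Y -> R) := \int[m]_x (f x * g (Phi x)) - \int[m]_x (f0 x * g (Phi0 x)).
have : L e h @[e --> 0^'+] --> 0.
  apply: (@density_cvg0 _ _ _ Nm L G D 1 1) => //.
  - by move=> g; rewrite /Nm adde_ge0.
  - move=> g1 g2 m1 m2 g12; rewrite /Nm leeD//; apply: ge0_le_integral => //.
    + by apply/measurable_EFinP; apply: measurableT_comp => //; exact: mfh.
    + by apply/measurable_EFinP; apply: measurableT_comp => //; exact: mfh.
    + by move=> x _; rewrite lee_fin !normrM ler_wpM2l.
    + by apply/measurable_EFinP; apply: measurableT_comp => //; exact: mf0h.
    + by apply/measurable_EFinP; apply: measurableT_comp => //; exact: mf0h.
    + by move=> x _; rewrite lee_fin !normrM ler_wpM2l.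
  - move=> k c; rewrite /Nm lte_add_pinfty//.
    + have := integrableZl measurableT c (fD k); move=> /integrableP[_ h1].
      by under eq_integral do rewrite mulrCA; exact: h1.
    + have := integrableZl measurableT c (f0D k); move=> /integrableP[_ h1].
      by under eq_integral do rewrite mulrCA; exact: h1.
  - move=> g g_ /domP[mg i1 i2] mg_ g_g g_0.
    rewrite /Nm -(adde0 0%E); apply: cvgeD => //.
    + apply: (@dct_dist0 _ _ _ m (fun k x => f x * g_ k (Phi x)) (fun x => f x * g (Phi x))) => //.
      * by move=> k; exact: mfh.
      * by move=> k x; rewrite !normrM ler_wpM2l.
      * by move=> x; rewrite -[0](mulr0 (f x)); apply: cvgM; [exact: cvg_cst|exact: g_0].
    + apply: (@dct_dist0 _ _ _ m (fun k x => f0 x * g_ k (Phi0 x)) (fun x => f0 x * g (Phi0 x))) => //.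
      * by move=> k; exact: mf0h.
      * by move=> k x; rewrite !normrM ler_wpM2l.
      * by move=> x; rewrite -[0](mulr0 (f0 x)); apply: cvgM; [exact: cvg_cst|exact: g_0].
  - move=> e g1 g2 _ /domP[m1 i1 j1] /domP[m2 i2 j2]; rewrite /L addrACA -opprD -!RintegralD//.
    by congr (_ - _); apply: eq_Rintegral => x _; rewrite mulrDr.
  - move=> e c g _ /domP[mg i1 j1]; rewrite /L mulrBr -!RintegralZl//.
    by congr (_ - _); apply: eq_Rintegral => x _; rewrite mulrCA.
  - move=> e g _ dg; have /domP[mg i1 j1] := dg; rewrite mul1e /L /Nm.
    apply: (@le_trans _ _ (`|\int[m]_x (f x * g (Phi x))|%:E + `|\int[m]_x (f0 x * g (Phi0 x))|%:E)%E).
      by rewrite -EFinD lee_fin ler_normB.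
    rewrite !EFin_normr_Rintegral// leeD//; apply: le_abse_integral => //.
      exact/measurable_EFinP/mfh.
    exact/measurable_EFinP/mf0h.
  - by move=> A k GA AD; rewrite /L (base GA AD) subrr; exact: cvg_cst.
  - by apply/domP.
move=> /(cvg_unique (@norm_hausdorff _ _)) /(_ (cvg_cst _)) E.
by apply/eqP; rewrite -subr_eq0; apply/eqP; rewrite -[LHS]E.
Qed.

Hypothesis f_ge0 : forall x, 0 <= f x.
Hypothesis f0_ge0 : forall x, 0 <= f0 x.
Hypothesis ndD : forall j k, (j <= k)%N -> D j `<=` D k.

(** Nonnegative h of possibly infinite integral: the truncations min(h, k) on [D k] fall under
    [signed_identity], and monotone convergence passes to h on both sides. *)
Lemma ge0_identity (h : Y -> R) : measurable_fun setT h -> (forall y, 0 <= h y) ->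
  (\int[m]_x (f x * h (Phi x))%:E = \int[m]_x (f0 x * h (Phi0 x))%:E)%E.
Proof.
move=> mh h0.
have mD k : measurable (D k) by rewrite mG; exact: sub_sigma_algebra.
pose h_ (k : nat) y := Num.min (h y) k%:R * \1_(D k) y.
have mh_ k : measurable_fun setT (h_ k).
  apply: measurable_funM; last exact: measurable_indic.
  by apply: measurable_minr => //; exact: measurable_cst.
have h_0 k y : 0 <= h_ k y by rewrite mulr_ge0// le_min h0 /=.
have h_k k y : h_ k y <= k%:R * \1_(D k) y by rewrite ler_wpM2r// ge_min lexx orbT.
have ndh y : nondecreasing_seq (fun k => h_ k y).
  move=> j k jk; rewrite /h_; apply: ler_pM => //; first by rewrite le_min h0 /=.
    by rewrite le_min !ge_min lexx /= ler_nat jk orbT.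
  rewrite !indicE ler_nat; have [/set_mem Dj|//] := boolP (y \in D j).
  by rewrite mem_set//; exact: ndD jk _ Dj.
have h_h y : h_ k y @[k --> \oo] --> h y.
  apply: cvg_near_cst; near=> k; rewrite /h_ min_l; last first.
    by near: k; exact: nbhs_infty_ger.
  rewrite indicE mem_set ?mulr1//; near: k; exact: Dcov.
have gen (g : X -> R) (P : X -> Y) : measurable_fun setT g -> measurable_fun setT P -> (forall x, 0 <= g x) ->
    (\int[m]_x (g x * h_ k (P x))%:E)%E @[k --> \oo] --> (\int[m]_x (g x * h (P x))%:E)%E.
  move=> mg mP g0.
  have E x : limn (fun k => (g x * h_ k (P x))%:E) = (g x * h (P x))%:E.
    apply/cvg_lim => //; apply: cvg_EFin; first exact: nearW.
    by apply: cvgM; [exact: cvg_cst|exact: h_h].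
  under [X in _ --> X]eq_integral do rewrite -E.
  apply: cvg_monotone_convergence => //.
  - by move=> k; apply/measurable_EFinP; apply: measurable_funM => //; exact: measurableT_comp.
  - by move=> k x _; rewrite lee_fin mulr_ge0.
  - by move=> x _ j k jk; rewrite lee_fin ler_wpM2l//; exact: ndh.
have eqk k : (\int[m]_x (f x * h_ k (Phi x))%:E = \int[m]_x (f0 x * h_ k (Phi0 x))%:E)%E.
  have i1 : m.-integrable setT (EFin \o (fun x => f x * h_ k (Phi x))).
    apply: integrable_ler (integrableZl measurableT k%:R (fD k)); first exact: mfh.
    move=> x /=; rewrite [X in _ <= `|X|]mulrCA normrM [leRHS]normrM ler_wpM2l//.
    by rewrite ger0_norm// ger0_norm ?mulr_ge0.
  have i0 : m.-integrable setT (EFin \o (fun x => f0 x * h_ k (Phi0 x))).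
    apply: integrable_ler (integrableZl measurableT k%:R (f0D k)); first exact: mf0h.
    move=> x /=; rewrite [X in _ <= `|X|]mulrCA normrM [leRHS]normrM ler_wpM2l//.
    by rewrite ger0_norm// ger0_norm ?mulr_ge0.
  have F1 := integrable_fin_num measurableT i1; have F2 := integrable_fin_num measurableT i0.
  by rewrite -[LHS]fineK// -[RHS]fineK//; congr EFin; exact: signed_identity.
have c1 := gen f Phi mf mPhi f_ge0; have c2 := gen f0 Phi0 mf0 mPhi0 f0_ge0.
have : (\int[m]_x (f x * h_ k (Phi x))%:E)%E @[k --> \oo] --> (\int[m]_x (f0 x * h (Phi0 x))%:E)%E.
  by under eq_fun do rewrite eqk.
exact: (cvg_unique (@ereal_hausdorff R)) c1.
Unshelve. all: by end_near. Qed.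

End signed_identity.

Section separated.
Context d1 d2 (T1 : measurableType d1) (T2 : measurableType d2) (R : realType).
Variables (m1 : {sigma_finite_measure set T1 -> \bar R}) (m2 : {sigma_finite_measure set T2 -> \bar R}).
Variables (f : T1 -> R) (g : T2 -> R).
Hypothesis i_f : m1.-integrable setT (EFin \o f).
Hypothesis i_g : m2.-integrable setT (EFin \o g).

Let mf : measurable_fun setT f. Proof. exact/measurable_EFinP/measurable_int/i_f. Qed.
Let mg : measurable_fun setT g. Proof. exact/measurable_EFinP/measurable_int/i_g. Qed.

Lemma integrable_separated : ((m1 \x m2)%E).-integrable setT (EFin \o (fun z => f z.1 * g z.2)).
Proof.
have mfg : measurable_fun setT (fun z : T1 * T2 => f z.1 * g z.2).
  by apply: measurable_funM; apply: measurableT_comp.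
apply/integrable_lty => //.
rewrite fubini_tonelli1//; last by apply/measurable_EFinP; apply: measurableT_comp.
rewrite /fubini_F /=.
under eq_integral => t _.
  under eq_integral do rewrite normrM EFinM.
  rewrite ge0_integralZl//; last by apply/measurable_EFinP; apply: measurableT_comp.
  over.
have /integrableP[_ foo] := i_f; have /integrableP[_ goo] := i_g.
rewrite ge0_integralZr//.
- by rewrite lte_mul_pinfty// ?integral_ge0// ge0_fin_numE// integral_ge0.
- by apply/measurable_EFinP; apply: measurableT_comp.
- by apply: integral_ge0.
Qed.

Lemma Rintegral_separated : \int[(m1 \x m2)%E]_z (f z.1 * g z.2) = (\int[m1]_t f t) * (\int[m2]_x g x).
Proof.
rewrite /Rintegral -(integral12_prod_meas1 integrable_separated) /fubini_F /=.
under eq_integral do (under eq_integral do rewrite EFinM; rewrite integralZl//).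
have h := integrable_fin_num measurableT i_g.
rewrite -(fineK h); rewrite integralZr// fineM// ?integrable_fin_num//.
Qed.

End separated.

Section indicator_interval.
Variable R : realType.
Local Notation leb := (@lebesgue_measure R).
Local Notation J s := (`]0, s[%classic : set (measurableTypeR R)).

Lemma integrable_itv (s : R) : leb.-integrable setT (EFin \o (\1_(J s) : measurableTypeR R -> R)).
Proof.
apply/Lfun1_integrable; apply: (@bounded_support_Lfun _ _ _ _ 1 _ (J s) 1) => //.
- have := @lebesgue_measure_itv R `]0, s[; rewrite /= => ->.
  by case: ifP => // _; rewrite ?ltry.
- by move=> x; rewrite indicE; case: (_ \in _); rewrite ?normr1 ?normr0.
- by move=> x h; rewrite indicE memNset.
Qed.

Lemma Rintegral_itv (s : R) : 0 < s -> \int[leb]_t (\1_(J s) t : R) = s.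
Proof.
move=> s0; rewrite /Rintegral integral_indic// setIT.
have := @lebesgue_measure_itv R `]0, s[; rewrite /= => ->.
by rewrite lte_fin s0 -EFinB subr0.
Qed.

End indicator_interval.

Section straight.
Variables (R : realType) (n : nat) (T : R).
Local Notation V := 'rV[R]_n.+1.
Local Notation mu := (lebesgueN R n.+1).
Local Notation leb := (@lebesgue_measure R).
Local Notation TV := (measurableTypeR R * V)%type.
Local Notation I := (`]0, T[%classic : set R).
Local Notation m := ((leb \x mu)%E).

(** If X(t, x) is the characteristic of b_e starting at x, then W_e(X(t, x)) = W_e(x) + t e_1,
    because b_e . grad w_e^1 = 1 and b_e . grad w_e^j = 0 otherwise. For w = W_e the spatial part is
    therefore W_e at the end of the characteristic, while [baseW] takes it at the start. Keeping t
    as first component lets F depend on time. *)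
Definition shiftW (w : V -> V) (z : TV) : TV := (z.1, w z.2 + z.1 *: evec R ord0).
Definition baseW (w : V -> V) (z : TV) : TV := (z.1, w z.2).

Variable w : V -> V.
Hypothesis cw : continuous w.
Hypothesis pw : forall r : R, exists2 K : set V, compact K & forall x, `|w x| <= r -> K x.

Lemma measurable_continuous_field : measurable_fun setT w.
Proof.
apply: measurable_fun_rVP => i; apply: continuous_measurable_rV => x.
by apply: (@continuous_comp _ _ _ w (fun y : V => y ord0 i)); [exact: cw|exact: coord_continuous].
Qed.

Lemma measurable_baseW : measurable_fun setT (baseW w).
Proof.
apply/measurable_fun_pairP; split => /=; first exact: measurable_fst.
by apply: measurableT_comp measurable_snd; exact: measurable_continuous_field.
Qed.

Lemma measurable_shiftW : measurable_fun setT (shiftW w).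
Proof.
apply/measurable_fun_pairP; split => /=; first exact: measurable_fst.
apply: measurable_fun_rVP => i; under eq_fun do rewrite mxE [X in _ + X]mxE.
apply: measurable_funD; last first.
  by apply: measurable_funM => //; exact: measurable_fst.
apply: (@measurableT_comp _ _ _ _ _ _ (fun x : V => w x ord0 i)); last exact: measurable_snd.
by apply: (measurableT_comp (@measurable_rV_coord R _ i)); exact: measurable_continuous_field.
Qed.

Lemma shift_compact (r : R) (a b : 'I_n.+1 -> R) : exists2 K : set V, compact K &
  forall t x, `|t| <= r -> obox a b (w x + t *: evec R ord0) -> K x.
Proof.
have [B cB sB] := obox_compact a b.
have [q [_ /(_ (q + 1) (ltr_pwDr ltr01 (lexx _))) Bq]] := compact_bounded cB.
have [K cK hK] := pw (q + 1 + r).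
exists K => // t x tr /sB/Bq /= h; apply: hK.
rewrite -[w x](addrK (t *: evec R ord0)) (le_trans (ler_normB _ _))// lerD//.
by rewrite normrZ (le_trans _ tr)// -[leRHS]mulr1 ler_wpM2l// norm_evec.
Qed.

Lemma shiftW_compact (a b : 'I_n.+1 -> R) : exists2 K : set V, compact K &
  forall t x, t \in `[0, T] -> obox a b (w x + t *: evec R ord0) -> K x.
Proof.
have [K cK hK] := shift_compact T a b; exists K => // t x; rewrite in_itv /= => /andP[t0 tT].
by apply: hK; rewrite ger0_norm.
Qed.

Variables (v : R -> V -> R) (v0 : V -> R).
Hypothesis T0 : 0 < T.
Hypothesis mv : measurable_fun setT (extQ T v).
Hypothesis mv0 : measurable_fun setT v0.
Hypothesis locv : forall K : set V, compact K -> m.-integrable setT (EFin \o (fun z => extQ T v z * \1_K z.2)).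
Hypothesis loc0 : forall K : set V, compact K -> mu.-integrable setT (EFin \o (fun x => v0 x * \1_K x)).
Hypothesis weak : forall (s : R) k (a b : 'I_n.+1 -> R), 0 < s < T ->
  \int[m]_z (extQ T v z * (dalpha s k z.1 * pbump a b k (shiftW w z).2)) +
  alpha s k 0 * \int[mu]_x (v0 x * pbump a b k (w x)) = 0.

Lemma loc0_ext (K : set V) : compact K -> m.-integrable setT (EFin \o (fun z : TV => extQ T (fun=> v0) z * \1_K z.2)).
Proof.
move=> cK; rewrite (_ : EFin \o _ = EFin \o (fun z : TV => \1_I z.1 * (v0 z.2 * \1_K z.2))).
  by apply: (@integrable_separated _ _ _ _ _ leb mu (\1_I) (fun x => v0 x * \1_K x)); [exact: integrable_itv|exact: loc0].
by apply/funext => z /=; congr EFin; rewrite /extQ mulrAC mulrC.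
Qed.

Let extQ_out (u : R -> V -> R) t (x : V) : t \notin I -> extQ T u (t, x) = 0.
Proof. by move=> h; rewrite /extQ /= indicE (negbTE h) mulr0. Qed.

Let tbox s (a b : 'I_n.+1 -> R) : set TV := [set z | z.1 < s /\ obox a b z.2].

Let indic_itv s (a b : 'I_n.+1 -> R) z : (\1_(tbox s a b) z : R) = \1_(`]-oo, s[%classic) z.1 * \1_(obox a b) z.2.
Proof.
rewrite !indicE -natrM mulnb; congr (_%:R : R); congr nat_of_bool.
apply/idP/andP => [/set_mem[h1 h2]|[/set_mem h1 /set_mem h2]].
  by split; rewrite inE//= in_itv.
by rewrite inE; split => //; move: h1; rewrite /= in_itv.
Qed.

Let shift_dom (u : R -> V -> R) (K : set V) (a b : 'I_n.+1 -> R) :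
  (forall t x, t \in `[0, T] -> obox a b (w x + t *: evec R ord0) -> K x) ->
  forall (c : R) t (x : V), 0 <= c -> c <= 1 -> (obox a b (w x + t *: evec R ord0) \/ c = 0) ->
  `|extQ T u (t, x) * c| <= `|extQ T u (t, x) * \1_K x|.
Proof.
move=> hK c t x c0 c1 h; rewrite normrM [leRHS]normrM; have [tI|tI] := boolP (t \in I); last first.
  by rewrite extQ_out// normr0 !mul0r.
rewrite ler_wpM2l// ger0_norm// indicE; case: h => [h|->]; last by rewrite normr_ge0.
rewrite mem_set ?normr1//; apply: (hK t) => //.
by move: tI => /set_mem /=; rewrite !in_itv /= => /andP[/ltW -> /ltW ->].
Qed.

Let measurable_tind s (a b : 'I_n.+1 -> R) : measurable_fun setT (fun z : TV => \1_(tbox s a b) (shiftW w z) : R).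
Proof.
apply: (@measurableT_comp _ _ _ _ _ _ (\1_(tbox s a b) : TV -> R)); last exact: measurable_shiftW.
by apply: measurable_indic; exact: measurable_tbox.
Qed.

Let measurable_tind0 s (a b : 'I_n.+1 -> R) : measurable_fun setT (fun z : TV => \1_(tbox s a b) (baseW w z) : R).
Proof.
apply: (@measurableT_comp _ _ _ _ _ _ (\1_(tbox s a b) : TV -> R)); last exact: measurable_baseW.
by apply: measurable_indic; exact: measurable_tbox.
Qed.

Let measurable_ext0 : measurable_fun setT (extQ T (fun=> v0)).
Proof.
apply: measurable_funM; first exact: (measurableT_comp mv0).
exact: measurable_indT.
Qed.

Lemma integrable_shift_box s a b :
  m.-integrable setT (EFin \o (fun z => extQ T v z * \1_(tbox s a b) (shiftW w z))).
Proof.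
have [K cK hK] := shiftW_compact a b.
apply: integrable_ler (locv cK); first by apply: measurable_funM.
move=> [t x]; apply: (@shift_dom v K a b hK (\1_(tbox s a b) (shiftW w (t, x))) t x); rewrite indicE; [by case: (_ \in _)|by case: (_ \in _)|].
have [/set_mem[_ h]|_] := boolP (shiftW w (t, x) \in tbox s a b); [by left|by right].
Qed.

Lemma integrable_base_box s a b :
  m.-integrable setT (EFin \o (fun z => extQ T (fun=> v0) z * \1_(tbox s a b) (baseW w z))).
Proof.
have [K cK hK] := shiftW_compact a b.
apply: integrable_ler (loc0_ext cK); first by apply: measurable_funM.
move=> [t x] /=; rewrite normrM [leRHS]normrM ler_wpM2l// !indicE.
have [/set_mem[_ /= h]|_] := boolP (baseW w (t, x) \in tbox s a b); last by rewrite normr0.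
rewrite (_ : x \in K)// mem_set//; apply: (hK 0); first by rewrite in_itv /= lexx ltW.
by rewrite scale0r addr0.
Qed.

(** Limit of hypothesis [weak] as k tends to infinity: the time derivative tends to minus the
    indicator of t < s, the initial value of the cut-off to s, and the bumps to the box. Domination
    holds on the compact set that contains all x whose shifted image meets the box. *)
Let weak_box_lt s a b : 0 < s < T ->
  \int[m]_z (extQ T v z * \1_(tbox s a b) (shiftW w z)) = s * \int[mu]_x (v0 x * \1_(obox a b) (w x)).
Proof.
move=> sT; have /andP[s0 /ltW sT'] := sT.
have [K cK hK] := shiftW_compact a b.
have mK := compact_measurable_rV cK.
have KI := @shift_dom v K a b hK.
have mp k : measurable_fun setT (fun z : TV => pbump a b k (shiftW w z).2).
  apply: (@measurableT_comp _ _ _ _ _ _ (pbump a b k)).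
    by apply: continuous_measurable_rV; exact: Cn_continuous (pbump_C1 a b k).
  by apply: (measurableT_comp measurable_snd); exact: measurable_shiftW.
have md k : measurable_fun setT (fun z : TV => dalpha s k z.1).
  apply: (@measurableT_comp _ _ _ _ _ _ (dalpha s k)); last exact: measurable_fst.
  by apply: continuous_measurable_fun; exact: continuous_dalpha.
have c1 : \int[m]_z (extQ T v z * (dalpha s k z.1 * pbump a b k (shiftW w z).2)) @[k --> \oo] -->
    \int[m]_z (- (extQ T v z * \1_(tbox s a b) (shiftW w z))).
  apply: (@dct_Rintegral _ _ _ m _ _ (fun z => `|extQ T v z * \1_K z.2|)).
  - by move=> k; apply: measurable_funM => //; exact: measurable_funM.
  - by apply: measurableT_comp => //; apply: measurable_funM.
  - exact: integrable_abse (locv cK).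
  - move=> k [t x] /=; have [tI|tI] := boolP (t \in I); last first.
      by rewrite extQ_out// !mul0r normr0.
    have t0 : 0 <= t by move: tI => /set_mem /=; rewrite in_itv /= => /andP[/ltW].
    have /andP[p0 p1] := pbump_itv a b k (w x + t *: evec R ord0).
    apply: le_trans (_ : `|extQ T v (t, x) * pbump a b k (w x + t *: evec R ord0)| <= _).
      by rewrite normrM [leRHS]normrM ler_wpM2l// normrM -[leRHS]mul1r ler_wpM2r// dalpha_norm.
    apply: KI => //; have [h|h] := pselect (obox a b (w x + t *: evec R ord0)); first by left.
    by right; exact: pbump_out.
  - move=> [t x] /=; have [tI|tI] := boolP (t \in I); last first.
      rewrite extQ_out// mul0r oppr0.
      by under eq_fun do rewrite mul0r; exact: cvg_cst.
    have t0 : 0 <= t by move: tI => /set_mem /=; rewrite in_itv /= => /andP[/ltW].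
    rewrite -mulrN indic_itv -mulNr; apply: cvgM; first exact: cvg_cst.
    by apply: cvgM; [exact: dalpha_cvg|exact: pbump_cvg].
have mo : measurable_fun setT (fun x : V => \1_(obox a b) (w x) : R).
  apply: (@measurableT_comp _ _ _ _ _ _ (\1_(obox a b) : V -> R)); last exact: measurable_continuous_field.
  by apply: measurable_indic; exact: measurable_obox.
have c2 : alpha s k 0 * \int[mu]_x (v0 x * pbump a b k (w x)) @[k --> \oo] -->
    s * \int[mu]_x (v0 x * \1_(obox a b) (w x)).
  apply: cvgM; first exact: alpha0_cvg.
  apply: (@dct_Rintegral _ _ _ mu _ _ (fun x => `|v0 x * \1_K x|)).
  - move=> k; apply: measurable_funM => //; apply: (@measurableT_comp _ _ _ _ _ _ (pbump a b k)).
      by apply: continuous_measurable_rV; exact: Cn_continuous (pbump_C1 a b k).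
    exact: measurable_continuous_field.
  - exact: measurable_funM.
  - exact: integrable_abse (loc0 cK).
  - move=> k x; rewrite !normrM ler_wpM2l//.
    have /andP[p0 p1] := pbump_itv a b k (w x); rewrite ger0_norm//.
    have [h|h] := pselect (obox a b (w x)); last by rewrite pbump_out// normr_ge0.
    rewrite indicE mem_set ?normr1//; apply: (hK 0); rewrite ?in_itv /= ?lexx ?ltW//.
    by rewrite scale0r addr0.
  - by move=> x; apply: cvgM; [exact: cvg_cst|exact: pbump_cvg].
have c0 : (fun k => \int[m]_z (extQ T v z * (dalpha s k z.1 * pbump a b k (shiftW w z).2)) +
  alpha s k 0 * \int[mu]_x (v0 x * pbump a b k (w x))) = cst 0.
  by apply/funext => k; exact: weak.
have c3 : (cst 0 : nat -> R) k @[k --> \oo] -->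
    \int[m]_z (- (extQ T v z * \1_(tbox s a b) (shiftW w z))) + s * \int[mu]_x (v0 x * \1_(obox a b) (w x)).
  by rewrite -c0; exact: cvgD.
have E : 0 = \int[m]_z (- (extQ T v z * \1_(tbox s a b) (shiftW w z))) + s * \int[mu]_x (v0 x * \1_(obox a b) (w x)).
  apply: (cvg_unique (@norm_hausdorff _ _) _ c3); exact: cvg_cst.
have E2 : \int[m]_z (- (extQ T v z * \1_(tbox s a b) (shiftW w z))) =
   - \int[m]_z (extQ T v z * \1_(tbox s a b) (shiftW w z)).
  under eq_Rintegral do rewrite -mulN1r; rewrite RintegralZl ?mulN1r//.
  exact: integrable_shift_box.
by apply/eqP; rewrite eq_sym -subr_eq0 addrC -E2 -E.
Qed.

Lemma weak_box s a b : 0 < s <= T ->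
  \int[m]_z (extQ T v z * \1_(tbox s a b) (shiftW w z)) = s * \int[mu]_x (v0 x * \1_(obox a b) (w x)).
Proof.
case/andP=> s0; rewrite le_eqVlt => /orP[/eqP->|sT]; last by apply: weak_box_lt; rewrite s0 sT.
(* Test functions must be supported before T, so s = T is reached only as a limit; the offset 2
   keeps the first term positive. *)
pose s_ (j : nat) : R := T - T / j.+2%:R.
have s_T j : 0 < s_ j < T.
  rewrite gtrBl divr_gt0// andbT subr_gt0 ltr_pdivrMr// -[ltLHS]mulr1 ltr_pM2l// ltr1n//.
have s_cvg : s_ j @[j --> \oo] --> T.
  rewrite -[X in _ --> X]subr0; apply: cvgB; first exact: cvg_cst.
  rewrite -(mulr0 T); apply: cvgM; first exact: cvg_cst.
  have := @cvg_harmonic R; rewrite -(cvg_shiftn 1) /=; apply: cvg_trans.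
  by apply: near_eq_cvg; apply: nearW => j; rewrite /harmonic /= addn1.
have c1 : \int[m]_z (extQ T v z * \1_(tbox (s_ j) a b) (shiftW w z)) @[j --> \oo] -->
    \int[m]_z (extQ T v z * \1_(tbox T a b) (shiftW w z)).
  apply: (@dct_Rintegral _ _ _ m _ _ (fun z => `|extQ T v z * \1_(tbox T a b) (shiftW w z)|)).
  - by move=> j; apply: measurable_funM.
  - exact: measurable_funM.
  - exact: integrable_abse (integrable_shift_box T a b).
  - move=> j z; rewrite normrM [leRHS]normrM ler_wpM2l// !indicE.
    have [/set_mem[h1 h2]|_] := boolP (shiftW w z \in tbox (s_ j) a b); last by rewrite normr0.
    rewrite (_ : shiftW w z \in tbox T a b)// inE; split => //.
    by apply: lt_trans h1 _; have /andP[] := s_T j.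
  - move=> [t x]; have [tI|tI] := boolP (t \in I); last first.
      by rewrite extQ_out// mul0r; under eq_fun do rewrite mul0r; exact: cvg_cst.
    move: tI => /set_mem /=; rewrite in_itv /= => /andP[_ tT].
    apply: cvg_near_cst; near=> j; congr (_ * _); rewrite !indic_itv; congr (_ * _).
    rewrite !indicE; congr (_%:R); congr nat_of_bool.
    have ts : t < s_ j by near: j; exact: (cvgr_gt T).
    by rewrite !mem_set//= in_itv.
have c2 : s_ j * \int[mu]_x (v0 x * \1_(obox a b) (w x)) @[j --> \oo] --> T * \int[mu]_x (v0 x * \1_(obox a b) (w x)).
  by apply: cvgM => //; exact: cvg_cst.
apply: (cvg_unique (@norm_hausdorff _ _) c1) => /=.
by rewrite (_ : (fun j => _) = (fun j => s_ j * \int[mu]_x (v0 x * \1_(obox a b) (w x))))//; apply/funext => j; exact: weak_box_lt.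
Unshelve. all: by end_near. Qed.

(** The right-hand side separates into the length of ]0, min(s, T)[ times a spatial integral, which
    is the value found in [weak_box]. For s <= 0 both sides vanish, and times beyond T are invisible
    to the extension by zero. *)
Lemma base_box s a b : \int[m]_z (extQ T v z * \1_(tbox s a b) (shiftW w z)) =
  \int[m]_z (extQ T (fun=> v0) z * \1_(tbox s a b) (baseW w z)).
Proof.
have [s0|s0] := leP s 0.
  transitivity (\int[m]_z (cst 0 z : R)).
    apply: eq_Rintegral => -[t x] _; have [tI|tI] := boolP (t \in I); last by rewrite extQ_out// mul0r.
    rewrite indicE memNset ?mulr0// => -[/= ts _].
    by move: tI => /set_mem /=; rewrite in_itv /= => /andP[t0 _]; move: (lt_trans t0 ts); rewrite ltNge s0.
  apply/esym; apply: eq_Rintegral => -[t x] _; have [tI|tI] := boolP (t \in I); last by rewrite extQ_out// mul0r.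
  rewrite indicE memNset ?mulr0// => -[/= ts _].
  by move: tI => /set_mem /=; rewrite in_itv /= => /andP[t0 _]; move: (lt_trans t0 ts); rewrite ltNge s0.
pose s' := Num.min s T.
have s'T : 0 < s' <= T by rewrite lt_min s0 T0 ge_min lexx orbT.
have ss' (u : R -> V -> R) t x y : extQ T u (t, x) * \1_(tbox s a b) (t, y) = extQ T u (t, x) * \1_(tbox s' a b) (t, y).
  have [tI|tI] := boolP (t \in I); last by rewrite extQ_out// !mul0r.
  congr (_ * _); rewrite !indic_itv /= !indicE; congr (_%:R * _); congr nat_of_bool.
  move: tI => /set_mem /=; rewrite in_itv /= => /andP[_ tT].
  by apply/idP/idP => /set_mem /=; rewrite in_itv /= => h; rewrite inE /= in_itv /= ?lt_min ?h ?tT//; move: h; rewrite lt_min => /andP[].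
transitivity (\int[m]_z (extQ T v z * \1_(tbox s' a b) (shiftW w z))).
  by apply: eq_Rintegral => -[t x] _; exact: ss'.
rewrite weak_box//.
transitivity (\int[m]_z (extQ T (fun=> v0) z * \1_(tbox s' a b) (baseW w z))); last first.
  by apply: eq_Rintegral => -[t x] _; rewrite -ss'.
have [K cK hK] := shiftW_compact a b.
have /andP[s'0 s'T'] := s'T.
have i2 : mu.-integrable setT (EFin \o (fun x => v0 x * \1_(obox a b) (w x))).
  apply: integrable_ler (loc0 cK).
    apply: measurable_funM => //.
    apply: (@measurableT_comp _ _ _ _ _ _ (\1_(obox a b) : V -> R)); last exact: measurable_continuous_field.
    by apply: measurable_indic; exact: measurable_obox.
  move=> x; rewrite normrM [leRHS]normrM ler_wpM2l// !indicE.
  have [/set_mem h|_] := boolP (w x \in obox a b); last by rewrite normr0.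
  rewrite (_ : x \in K)// mem_set//; apply: (hK 0); first by rewrite in_itv /= lexx ltW.
  by rewrite scale0r addr0.
have := Rintegral_separated (integrable_itv s') i2; rewrite Rintegral_itv// => <-.
apply: eq_Rintegral => -[t x] _ /=; rewrite indic_itv /= /extQ /= !indicE.
rewrite [RHS]mulrAC -[RHS]mulrA; have gen (p1 p2 p3 p4 q : R) : q = p3 * p4 -> q * (p1 * p2) = p1 * (p4 * p2 * p3) by move=> ->; ring.
apply: gen; rewrite -natrM mulnb; congr (_%:R); congr nat_of_bool.
apply/idP/andP => [/set_mem /=|[/set_mem /= h1 /set_mem /= h2]].
  rewrite in_itv /= => /andP[t0 ts']; split; rewrite inE /= in_itv /= ?t0//.
  exact: lt_le_trans ts' s'T'.
by rewrite inE /=; move: h1 h2; rewrite !in_itv /= => /andP[-> _] ->.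
Qed.

Lemma straight_identity (h : TV -> R) : measurable_fun setT h ->
  m.-integrable setT (EFin \o (fun z => extQ T v z * h (shiftW w z))) ->
  m.-integrable setT (EFin \o (fun z => extQ T (fun=> v0) z * h (baseW w z))) ->
  \int[m]_z (extQ T v z * h (shiftW w z)) = \int[m]_z (extQ T (fun=> v0) z * h (baseW w z)).
Proof.
apply: (@signed_identity _ _ _ _ _ m (shiftW w) (baseW w) (extQ T v) (extQ T (fun=> v0)) (@tboxes R n.+1)
  (fun k => tbox k%:R (fun=> - k%:R) (fun=> k%:R))).
- exact: measurable_shiftW.
- exact: measurable_baseW.
- exact: mv.
- exact: measurable_ext0.
- exact: RV_measurable_tboxes.
- exact: tboxes_setI.
- by move=> k; exists k%:R, (fun=> - k%:R), (fun=> k%:R).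
- move=> z; near=> k; split; first by near: k; exact: nbhs_infty_gtr.
  by near: k; exact: rV_eventually_obox.
- by move=> k; exact: integrable_shift_box.
- by move=> k; exact: integrable_base_box.
- by move=> A k [s [a [b ->]]] _; exact: base_box.
Unshelve. all: by end_near. Qed.

Lemma straight_ge0 (h : TV -> R) : (forall t x, 0 <= v t x) -> (forall x, 0 <= v0 x) ->
  measurable_fun setT h -> (forall z, 0 <= h z) ->
  (\int[m]_z (extQ T v z * h (shiftW w z))%:E = \int[m]_z (extQ T (fun=> v0) z * h (baseW w z))%:E)%E.
Proof.
move=> v_ge0 v0_ge0.
apply: (@ge0_identity _ _ _ _ _ m (shiftW w) (baseW w) (extQ T v) (extQ T (fun=> v0)) (@tboxes R n.+1)
  (fun k => tbox k%:R (fun=> - k%:R) (fun=> k%:R))).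
- exact: measurable_shiftW.
- exact: measurable_baseW.
- exact: mv.
- exact: measurable_ext0.
- exact: RV_measurable_tboxes.
- exact: tboxes_setI.
- by move=> k; exists k%:R, (fun=> - k%:R), (fun=> k%:R).
- move=> z; near=> k; split; first by near: k; exact: nbhs_infty_gtr.
  by near: k; exact: rV_eventually_obox.
- by move=> k; exact: integrable_shift_box.
- by move=> k; exact: integrable_base_box.
- by move=> A k [s [a [b ->]]] _; exact: base_box.
- by move=> z; rewrite mulr_ge0.
- by move=> z; rewrite mulr_ge0.
- move=> j k jk z [z1 z2]; split; first by rewrite (lt_le_trans z1)// ler_nat.
  move=> i; have := z2 i; rewrite !in_itv /= => /andP[h1 h2].
  by rewrite (le_lt_trans _ h1) ?lerN2 ?ler_nat//= (lt_le_trans h2)// ler_nat.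
Unshelve. all: by end_near. Qed.

End straight.

(** * Test functions along the flow *)

Section test_functions.
Variables (R : realType) (n : nat) (T : R).
Local Notation V := 'rV[R]_n.+1.
Local Notation mu := (lebesgueN R n.+1).
Local Notation e1 := (evec R (@ord0 n)).

Definition dpbump (a b : 'I_n.+1 -> R) k (j : 'I_n.+1) (y : V) : R :=
  \prod_l (if l == j then dbump (a l) (b l) k (y ord0 l) else bump (a l) (b l) k (y ord0 l)).

Lemma is_derive_pbump (X : normedModType R) (F : X -> V) (dF : V) (x v : X) a b k :
  (forall l, is_derive x v (fun z => F z ord0 l) (dF ord0 l)) ->
  is_derive x v (fun z => pbump a b k (F z)) (\sum_j dF ord0 j * dpbump a b k j (F x)).
Proof.
move=> hF.
have h l : is_derive x v (fun z => bump (a l) (b l) k (F z ord0 l))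
    (dbump (a l) (b l) k (F x ord0 l) * dF ord0 l).
  exact: (@is_derive_comp1 _ _ (bump (a l) (b l) k) (fun z => F z ord0 l) x v _ _ (is_derive_bump _ _ _ _) (hF l)).
apply: (is_derive_val_eq (is_derive_prod h)); apply: eq_bigr => j _.
rewrite /dpbump (bigD1 j)//= [in RHS](bigD1 j)//= !eqxx mulrA; congr (_ * _); first exact: mulrC.
by apply: eq_bigr => l lj; rewrite (negPf lj).
Qed.

Variables (w : V -> V) (s : V -> R) (a b : 'I_n.+1 -> R) (k : nat) (tau : R).
Hypothesis w1 : Cnv 1 w.
Hypothesis s1 : Cn 1 s.
Hypothesis tauT : 0 < tau < T.
Hypothesis pw : forall r : R, exists2 K : set V, compact K & forall x, `|w x| <= r -> K x.

Let Y (z : R * V) : V := w z.2 + z.1 *: e1.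
Let al := alpha tau k.
Let dal := dalpha tau k.

(** The factor s turns [testf t y *: bb y] into a multiple of the divergence-free field S; the
    argument w(x) + t e_1 makes the time derivative of the bump cancel against its derivative along
    S. *)
Definition testf (t : R) (x : V) : R := s x * al t * pbump a b k (Y (t, x)).

Let cY l : continuous (fun z : R * V => Y z ord0 l).
Proof.
under eq_fun do rewrite /Y mxE [X in _ + X]mxE; apply: contD.
  move=> z; apply: (@continuous_comp _ _ _ (fun z : R * V => z.2) (comp_of w l)); first exact: cvg_snd.
  exact: (Cn_continuous (w1 l)).
by apply: contM; [move=> z; exact: cvg_fst|exact: contC].
Qed.

Let cpb : continuous (fun z : R * V => pbump a b k (Y z)).
Proof.
rewrite /pbump; apply: cont_prod => l; by move=> z; apply: (@continuous_comp _ _ _ (fun z : R * V => Y z ord0 l) (bump (a l) (b l) k)); [exact: cY|exact: continuous_bump].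
Qed.

Let cdpb j : continuous (fun z : R * V => dpbump a b k j (Y z)).
Proof.
rewrite /dpbump; apply: cont_prod => l; case: eqP => _.
  by move=> z; apply: (@continuous_comp _ _ _ (fun z : R * V => Y z ord0 l) (dbump (a l) (b l) k)); [exact: cY|exact: continuous_dbump].
by move=> z; apply: (@continuous_comp _ _ _ (fun z : R * V => Y z ord0 l) (bump (a l) (b l) k)); [exact: cY|exact: continuous_bump].
Qed.

Let cs2 (f : V -> R) : continuous f -> continuous (fun z : R * V => f z.2).
Proof.
by move=> cf z; apply: (@continuous_comp _ _ _ (fun z : R * V => z.2) f); [exact: cvg_snd|exact: cf].
Qed.

Let ct1 (f : R -> R) : continuous f -> continuous (fun z : R * V => f z.1).
Proof.
by move=> cf z; apply: (@continuous_comp _ _ _ (fun z : R * V => z.1) f); [exact: cvg_fst|exact: cf].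
Qed.

Let dpb_t t x : is_derive t (1 : R) (fun r => pbump a b k (Y (r, x))) (dpbump a b k ord0 (Y (t, x))).
Proof.
have h l : is_derive t (1 : R) (fun r => Y (r, x) ord0 l) (e1 ord0 l).
  under eq_fun do rewrite /Y mxE [X in _ + X]mxE /=.
  rewrite -[X in is_derive _ _ _ X]add0r; apply: is_deriveD.
  apply: (is_derive_val_eq (is_deriveM (is_derive_id _ _) (is_derive_cst _ _ _))).
  by rewrite scaler0 add0r -[_ *: _]/(_ * _) mulr1.
apply: (is_derive_val_eq (is_derive_pbump a b k h)).
rewrite (bigD1 ord0)//= big1 ?addr0; first by rewrite mxE !eqxx mul1r.
by move=> j j0; rewrite mxE (negPf j0) andbF mul0r.
Qed.

Let dpb_x i t x : is_derive x (evec R i) (fun y => pbump a b k (Y (t, y)))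
  (\sum_j partial i (comp_of w j) x * dpbump a b k j (Y (t, x))).
Proof.
have h l : is_derive x (evec R i) (fun y => Y (t, y) ord0 l) ((\row_j partial i (comp_of w j) x) ord0 l).
  under eq_fun do rewrite /Y mxE /=; rewrite mxE.
  rewrite -[X in is_derive _ _ _ X]addr0; apply: is_deriveD; exact: (Cn_is_derive i x (w1 l)).
apply: (is_derive_val_eq (is_derive_pbump a b k h)); apply: eq_bigr => j _; by rewrite mxE.
Qed.

Let dtest_t t x : is_derive t (1 : R) (fun r => testf r x)
  (s x * (dal t * pbump a b k (Y (t, x)) + al t * dpbump a b k ord0 (Y (t, x)))).
Proof.
have h1 := is_deriveM (is_deriveZ (s x) (is_derive_alpha tau k t)) (dpb_t t x).
apply: (is_derive_val_eq h1); rewrite -!/(_ * _).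
have gen (x1 x2 x3 x4 x5 : R) : x1 * x2 * x3 + x4 * (x1 * x5) = x1 * (x5 * x4 + x2 * x3) by ring.
exact: gen.
Qed.

Lemma dt_testf t x : dt testf t x =
  s x * (dal t * pbump a b k (Y (t, x)) + al t * dpbump a b k ord0 (Y (t, x))).
Proof. by rewrite /dt derive1E; case: (dtest_t t x). Qed.

Let dtest_x i t x : is_derive x (evec R i) (testf t)
  (al t * (partial i s x * pbump a b k (Y (t, x)) +
    s x * \sum_j partial i (comp_of w j) x * dpbump a b k j (Y (t, x)))).
Proof.
have h1 := is_deriveM (is_deriveM (Cn_is_derive i x s1) (is_derive_cst (al t) x _)) (dpb_x i t x).
apply: (is_derive_val_eq h1); rewrite -!/(_ * _) scaler0 add0r.
set u := \sum_j _; have gen (x1 x2 x3 x4 x5 : R) : x1 * x2 * x5 + x3 * (x2 * x4) = x2 * (x4 * x3 + x1 * x5) by ring.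
exact: gen.
Qed.

Lemma partial_testf i t x : partial i (testf t) x =
  al t * (partial i s x * pbump a b k (Y (t, x)) +
    s x * \sum_j partial i (comp_of w j) x * dpbump a b k j (Y (t, x))).
Proof. exact: is_derive_partial. Qed.

Lemma testf_compact : exists2 K : set V, compact K & forall t x, ~ K x -> testf t x = 0.
Proof.
have [K cK hK] := shift_compact pw (1 + tau) a b.
exists K => // t x Kx; have [h|h] := pselect (obox a b (Y (t, x))); last by rewrite /testf pbump_out// mulr0.
have [h1|h1] := leP t (-1); first by rewrite /testf /al alpha_out ?mulr0 ?mul0r//; left.
have [h2|h2] := leP tau t; first by rewrite /testf /al alpha_out ?mulr0 ?mul0r//; right.
exfalso; apply: Kx; apply: (hK t) => //; case/andP: tauT => t0 _.
by rewrite ler_norml; apply/andP; split; lra.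
Qed.

Lemma testf_C1c : C1c_tx T testf.
Proof.
have ca : continuous al by exact: continuous_alpha.
have cda : continuous dal by exact: continuous_dalpha.
have cs := Cn_continuous s1.
have cpb' : continuous (fun z : R * V => pbump a b k (Y (z.1, z.2))) by move=> -[t x]; exact: cpb.
have cdpb' j : continuous (fun z : R * V => dpbump a b k j (Y (z.1, z.2))) by move=> -[t x]; exact: cdpb.
split.
- exact: (contM (contM (cs2 cs) (ct1 ca)) cpb').
- split; first by move=> t x; case: (dtest_t t x).
  under eq_fun do rewrite dt_testf.
  exact: (contM (cs2 cs) (contD (contM (ct1 cda) cpb') (contM (ct1 ca) (cdpb' ord0)))).
- move=> i; split; first by move=> t x; case: (dtest_x i t x).
  under eq_fun do rewrite partial_testf.
  have cps : continuous (partial i s) by exact: (Cn_continuous (Cn_partial i s1)).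
  have csum : continuous (fun z : R * V => \sum_j partial i (comp_of w j) z.2 * dpbump a b k j (Y (z.1, z.2))).
    elim: (index_enum _) => [|j r IH]; first by under eq_fun do rewrite big_nil; exact: contC.
    under eq_fun do rewrite big_cons.
    have cpw : continuous (partial i (comp_of w j)) by exact: (Cn_continuous (Cn_partial i (w1 j))).
    exact: (contD (contM (cs2 cpw) (cdpb' j)) IH).
  exact: (contM (ct1 ca) (contD (contM (cs2 cps) cpb') (contM (cs2 cs) csum))).
- have [K cK hK] := testf_compact.
  exists ([set` `[-1, tau]] `*` K); first by apply: compact_setX => //; exact: segment_compact.
  case/andP: tauT => t0 tT; split.
    by move=> t x [/=]; rewrite in_itv /= => /andP[_ /le_lt_trans + _]; apply.
  move=> t x h; have [Kx|Kx] := pselect (K x); last exact: hK.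
  have [h1|h1] := leP t (-1); first by rewrite /testf /al alpha_out ?mulr0 ?mul0r//; left.
  have [h2|h2] := leP tau t; first by rewrite /testf /al alpha_out ?mulr0 ?mul0r//; right.
  by exfalso; apply: h; split => //=; rewrite in_itv /= !ltW.
Qed.

Section divergence_free.
Variables (bb S : V -> V).
Hypothesis sb : forall x, s x *: bb x = S x.
Hypothesis S1 : Cnv 1 S.
Hypothesis divS : forall x, divergence S x = 0.
Hypothesis Sw : forall x j, dotv (grad (comp_of w j) x) (S x) = if j == ord0 then s x else 0.

Let comp_test t i : comp_of (fun y => testf t y *: bb y) i = fun y => al t * pbump a b k (Y (t, y)) * comp_of S i y.
Proof.
apply/funext => y; rewrite /comp_of -sb !mxE /testf.
have gen (x1 x2 x3 x4 : R) : x1 * x2 * x3 * x4 = x2 * x3 * (x1 * x4) by ring.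
exact: gen.
Qed.

Let comp_test_C1 t i : Cn 1 (comp_of (fun y => testf t y *: bb y) i).
Proof.
rewrite comp_test; apply: CnM; last exact: S1.
apply: CnZ; apply: Cn_prod => l _; apply: (C1_comp1 (is_derive_bump _ _ _)).
  exact: continuous_dbump.
under eq_fun do rewrite /Y mxE /=; apply: CnD; first exact: w1.
exact: Cn_cst.
Qed.

(** The derivative of S contributes its divergence, which is 0. The chain rule on the bump
    contributes S . grad w^j for each j, and only the first of these is nonzero, with value s. *)
Lemma div_testf t x : divergence (fun y => testf t y *: bb y) x = s x * al t * dpbump a b k ord0 (Y (t, x)).
Proof.
rewrite /divergence.
have E i : partial i (comp_of (fun y => testf t y *: bb y) i) x =
    al t * (pbump a b k (Y (t, x)) * partial i (comp_of S i) x) +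
    al t * \sum_j partial i (comp_of w j) x * S x ord0 i * dpbump a b k j (Y (t, x)).
  rewrite comp_test (is_derive_partial (is_deriveM (is_deriveZ (al t) (dpb_x i t x)) (Cn_is_derive i x (S1 i)))).
  rewrite (_ : \sum_j partial i (comp_of w j) x * S x ord0 i * dpbump a b k j (Y (t, x)) =
      comp_of S i x * \sum_j partial i (comp_of w j) x * dpbump a b k j (Y (t, x))).
    have gen (x1 x2 x3 x4 x5 : R) : (x1 * x2) * x3 + x4 * (x1 * x5) = x1 * (x2 * x3) + x1 * (x4 * x5) by ring.
    exact: gen.
  by rewrite mulr_sumr; apply: eq_bigr => j _; rewrite mulrA [comp_of S i x * _]mulrC.
rewrite (eq_bigr _ (fun i _ => E i)) big_split /= -!mulr_sumr.
rewrite (_ : \sum_i partial i (comp_of S i) x = 0) ?mulr0 ?add0r; last exact: divS.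
rewrite exchange_big /= (bigD1 ord0)//= [X in _ + X]big1 ?addr0.
  rewrite -mulr_suml mulrA [s x * _]mulrC; congr (_ * _ * _).
  have := Sw x ord0; rewrite eqxx => <-; rewrite /dotv; apply: eq_bigr => i _; by rewrite mxE.
move=> j j0; rewrite -mulr_suml; have := Sw x j; rewrite (negPf j0) /dotv => E0.
rewrite (_ : \sum_i _ = 0) ?mul0r// -[RHS]E0; apply: eq_bigr => i _; by rewrite mxE.
Qed.

Lemma integral_div_testf t : \int[mu]_x (s x * al t * dpbump a b k ord0 (Y (t, x))) = 0.
Proof.
have [K cK hK] := testf_compact.
have out i x : ~ K x -> comp_of (fun y => testf t y *: bb y) i x = 0.
  by move=> Kx; rewrite /comp_of mxE hK// mul0r.
under eq_Rintegral do rewrite -div_testf.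
rewrite Rintegral_sum//; last first.
  move=> i; apply: (@integrable_continuous_compact _ _ _ K) => //.
    exact: (Cn_continuous (Cn_partial i (comp_test_C1 t i))).
  by move=> x Kx; apply: (partial_out i cK) => // y Ky; exact: out.
by rewrite big1// => i _; apply: (@integral_partial_compact _ _ _ K) => //; exact: out.
Qed.

End divergence_free.

Lemma dpbump_out j y : ~ obox a b y -> dpbump a b k j y = 0.
Proof.
move=> /existsNP[i] /negP h; rewrite /dpbump (bigD1 i)//=.
by case: ifP => _; [rewrite dbump_out|rewrite bump_out]; rewrite ?mul0r.
Qed.

Variable u : R -> V -> R.
Local Notation leb := (@lebesgue_measure R).
Local Notation TV := (measurableTypeR R * V)%type.
Local Notation I := (`]0, T[%classic : set R).
Local Notation m := ((leb \x mu)%E).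
Hypothesis mu_ : measurable_fun setT (extQ T u).
Hypothesis locu : forall K : set V, compact K -> m.-integrable setT (EFin \o (fun z => extQ T u z * \1_K z.2)).

(** The product of R and R^(n+1) is read as R^(n+2) through [rV_cons], where continuous functions
    are already known to be measurable. *)
Lemma measurable_continuous_tx (g : R * V -> R) : continuous g -> measurable_fun setT (g : TV -> R).
Proof.
move=> cg.
pose f (y : 'rV[R]_n.+2) : R := g (y ord0 ord0, \row_j y ord0 (lift ord0 j)).
have cf : continuous f.
  move=> y; apply: (@continuous_comp _ _ _ (fun y : 'rV[R]_n.+2 => (y ord0 ord0, (\row_j y ord0 (lift ord0 j) : V))) g); last exact: cg.
  have h2 : continuous (fun y : 'rV[R]_n.+2 => \row_j y ord0 (lift ord0 j) : V).
    by apply: continuous_rV => j; under eq_fun do rewrite mxE; exact: coord_continuous.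
  exact: (cvg_pair (@coord_continuous _ _ _ ord0 ord0 y) (h2 y)).
have -> : (g : TV -> R) = f \o (@rV_cons R n.+1).
  apply/funext => -[t x]; rewrite /f /= mxE unlift_none /=; congr (g (_, _)).
  by apply/rowP => j; rewrite !mxE liftK.
by apply: measurableT_comp (@measurable_rV_cons R n.+1); exact: continuous_measurable_rV.
Qed.

Lemma integrable_ext_continuous (g : R * V -> R) (K : set V) : continuous g -> compact K ->
  (forall t x, t \in `[0, T] -> ~ K x -> g (t, x) = 0) ->
  m.-integrable setT (EFin \o extQ T (fun t x => u t x * g (t, x))).
Proof.
move=> cg cK g0.
have [C gC] : exists C : R, forall z, ([set` `[0, T]] `*` K) z -> `|g z| <= C.
  have cIK : compact ([set` `[0, T]] `*` K : set (R * V)) by apply: compact_setX => //; exact: segment_compact.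
  have /compact_bounded[C [_ hC]] : compact (g @` ([set` `[0, T]] `*` K)).
    by apply: continuous_compact => //; exact: continuous_subspaceT.
  exists (C + 1) => z zK; apply: (hC (C + 1)); first by rewrite ltrDl.
  by exists z.
rewrite (_ : extQ T _ = fun z : TV => extQ T u z * g z); last first.
  by apply/funext => -[t x]; rewrite /extQ /= mulrAC.
apply: integrable_ler (integrableZl measurableT C (locu cK)).
  by apply: measurable_funM => //; exact: measurable_continuous_tx.
move=> [t x] /=; rewrite [X in _ <= `|X|]mulrCA normrM [leRHS]normrM.
have [tI|tI] := boolP (t \in I); last by rewrite /extQ /= indicE (negbTE tI) !mulr0 normr0 !mul0r.
have tT : t \in `[0, T] by move: tI => /set_mem /=; rewrite !in_itv /= => /andP[/ltW -> /ltW ->].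
rewrite ler_wpM2l// indicE; have [Kx|Kx] := pselect (K x); last by rewrite g0// normr0.
by rewrite (mem_set Kx) mulr1 (le_trans (gC (t, x) (conj tT Kx)))// ler_norm.
Qed.

Let Y' (z : R * V) : Y (z.1, z.2) = Y z. Proof. by case: z. Qed.

(** The divergence term cancels the part of the time derivative that falls on the bump; only the
    derivative of [alpha] remains. The weak identity is a premise, for this one test function, so
    that the lemma also covers the constant 1. *)
Lemma testf_weak (u0 : V -> R) : measurable_fun setT u0 ->
  (forall K : set V, compact K -> mu.-integrable setT (EFin \o (fun x => u0 x * \1_K x))) ->
  int_tx T (fun t x => u t x * dt testf t x) + \int[mu]_x (u0 x * testf 0 x) =
  int_tx T (fun t x => u t x * (s x * al t * dpbump a b k ord0 (Y (t, x)))) ->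
  \int[m]_z (extQ T (fun t x => s x * u t x) z * (dalpha tau k z.1 * pbump a b k (shiftW w z).2)) +
  alpha tau k 0 * \int[mu]_x (s x * u0 x * pbump a b k (w x)) = 0.
Proof.
move=> mu0 loc0 H.
have ca : continuous al by exact: continuous_alpha.
have cda : continuous dal by exact: continuous_dalpha.
have cs := Cn_continuous s1.
have [K cK hK] := shiftW_compact T pw a b.
have out t x : t \in `[0, T] -> ~ K x -> ~ obox a b (Y (t, x)).
  by move=> tT Kx h; apply: Kx; apply: (hK t).
have i1 : m.-integrable setT (EFin \o extQ T (fun t x => u t x * dt testf t x)).
  apply: (@integrable_ext_continuous (fun z => dt testf z.1 z.2) K) => //.
    by have [_ [_ h] _ _] := testf_C1c.
  move=> t x tT Kx /=; rewrite dt_testf pbump_out ?dpbump_out; [by rewrite !mulr0 addr0 mulr0|exact: out|exact: out].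
have i2 : m.-integrable setT (EFin \o extQ T (fun t x => u t x * (s x * al t * dpbump a b k ord0 (Y (t, x))))).
  apply: (@integrable_ext_continuous (fun z => s z.2 * al z.1 * dpbump a b k ord0 (Y (z.1, z.2))) K) => //.
    have h : continuous (fun z : R * V => dpbump a b k ord0 (Y (z.1, z.2))) by move=> -[t x]; exact: cdpb.
    exact: (contM (contM (cs2 cs) (ct1 ca)) h).
  by move=> t x tT Kx /=; rewrite dpbump_out ?mulr0//; exact: out.
move: H; rewrite !int_txE// => H.
have E1 : \int[m]_z (extQ T (fun t x => s x * u t x) z * (dalpha tau k z.1 * pbump a b k (shiftW w z).2)) =
  \int[m]_z extQ T (fun t x => u t x * dt testf t x) z -
  \int[m]_z extQ T (fun t x => u t x * (s x * al t * dpbump a b k ord0 (Y (t, x)))) z.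
  rewrite -RintegralB//; apply: eq_Rintegral => -[t x] _; rewrite /extQ /= dt_testf.
  have gen (x1 x2 x3 x4 x5 x6 x7 : R) : x1 * x2 * x3 * (x4 * x5) = x2 * (x1 * (x4 * x5 + x6 * x7)) * x3 - x2 * (x1 * x6 * x7) * x3 by ring.
  exact: gen.
have E2 : \int[mu]_x (u0 x * testf 0 x) = alpha tau k 0 * \int[mu]_x (s x * u0 x * pbump a b k (w x)).
  have [C C0 sC] := compact_continuous_bound cs cK.
  have mw := measurable_continuous_field (continuous_rV (fun l => Cn_continuous (w1 l))).
  rewrite -RintegralZl//.
    apply: eq_Rintegral => x _; rewrite /testf /Y /= scale0r addr0 /al.
    have gen (x1 x2 x3 x4 : R) : x1 * (x2 * x3 * x4) = x3 * (x2 * x1 * x4) by ring.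
    exact: gen.
  apply: integrable_ler (integrableZl measurableT C (loc0 K cK)).
    apply: measurable_funM; last first.
      by apply: (measurableT_comp (continuous_measurable_rV (Cn_continuous (pbump_C1 a b k)))).
    by apply: measurable_funM => //; exact: continuous_measurable_rV.
  move=> x /=; rewrite -mulrA mulrCA [X in _ <= `|X|]mulrCA normrM [leRHS]normrM ler_wpM2l// indicE.
  have [Kx|Kx] := pselect (K x); last first.
    rewrite pbump_out ?mulr0 ?normr0//; have := out 0 x; rewrite /Y /= scale0r addr0; apply => //.
    by rewrite in_itv /= lexx ltW//; case/andP: tauT => h1 h2; exact: lt_trans h1 h2.
  have /andP[p0 p1] := pbump_itv a b k (w x).
  rewrite (mem_set Kx) mulr1 normrM (ger0_norm p0) (le_trans (_ : _ <= `|s x| * 1)) ?ler_wpM2l//.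
  by rewrite mulr1 (le_trans (sC x Kx))// ler_norm.
rewrite E1 -E2 -H; set A := \int[m]_z _; set B := \int[mu]_x _.
by rewrite opprD addrA subrr add0r addNr.
Qed.

End test_functions.

Section classical_solution.
Variables (R : realType) (n : nat) (T : R).
Local Notation V := 'rV[R]_n.+1.
Local Notation mu := (lebesgueN R n.+1).
Local Notation leb := (@lebesgue_measure R).
Local Notation TV := (measurableTypeR R * V)%type.
Local Notation I := (`]0, T[%classic : set R).
Local Notation m := ((leb \x mu)%E).
Variables (w : V -> V) (s : V -> R) (bb S : V -> V).
Hypothesis w1 : Cnv 1 w.
Hypothesis s1 : Cn 1 s.
Hypothesis pw : forall r : R, exists2 K : set V, compact K & forall x, `|w x| <= r -> K x.
Hypothesis sb : forall x, s x *: bb x = S x.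
Hypothesis S1 : Cnv 1 S.
Hypothesis divS : forall x, divergence S x = 0.
Hypothesis Sw : forall x j, dotv (grad (comp_of w j) x) (S x) = if j == ord0 then s x else 0.

Lemma loc_cst (K : set V) : compact K -> m.-integrable setT (EFin \o (fun z : TV => extQ T (fun _ _ => 1) z * \1_K z.2)).
Proof.
move=> cK; apply: (@loc0_ext _ _ T (fun=> 1)) => // K' cK'.
apply: (@integrable_bounded_compact _ _ _ K' 1) => //.
- by apply: measurable_funM => //; apply: measurable_indic; exact: compact_measurable_rV.
- by move=> x; rewrite mul1r indicE; case: (_ \in _); rewrite ?normr1 ?normr0.
- by move=> x Kx; rewrite indicE memNset ?mulr0.
Qed.

(** The constant 1 satisfies the weak identity although it is not in L^p: the divergence of a
    compactly supported field integrates to 0, and the time derivative integrates to minus the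
    initial value. *)
Lemma testf_classical a b k tau : 0 < tau < T ->
  int_tx T (fun t x => 1 * dt (testf w s a b k tau) t x) + \int[mu]_x (1 * testf w s a b k tau 0 x) =
  int_tx T (fun t x => 1 * (s x * alpha tau k t * dpbump a b k ord0 (w x + t *: evec R ord0))).
Proof.
move=> tauT; have [c0 [dt1 dt2] _ _] := testf_C1c a b k w1 s1 tauT pw.
have T0 : 0 < T by case/andP: tauT; exact: lt_trans.
have [K cK hK] := testf_compact s a b k tauT pw.
have m1 : measurable_fun setT (extQ T (fun (_ : R) (_ : V) => 1)).
  by apply: measurable_funM => //; exact: measurable_indT.
have i1 : m.-integrable setT (EFin \o extQ T (fun t x => 1 * dt (testf w s a b k tau) t x)).
  apply: (@integrable_ext_continuous _ _ _ _ m1 loc_cst (fun z => dt (testf w s a b k tau) z.1 z.2) K) => //.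
  move=> t x _ Kx /=; rewrite /dt (_ : (fun s0 => _) = cst 0) ?derive1_cst//.
  by apply/funext => r; rewrite hK.
rewrite int_txE// [RHS](_ : _ = 0); last first.
  have Z t : \int[mu]_x (1 * (s x * alpha tau k t * dpbump a b k ord0 (w x + t *: evec R ord0))) = 0.
    have Z' := integral_div_testf a b k w1 tauT pw sb S1 divS Sw t.
    by rewrite -[RHS]Z'; apply: eq_Rintegral => x _; rewrite mul1r.
  by rewrite /int_tx; under eq_Rintegral do rewrite Z; rewrite /Rintegral integral0.
apply/eqP; rewrite addr_eq0; apply/eqP.
have E x : (\int[leb]_t (extQ T (fun t x => 1 * dt (testf w s a b k tau) t x) (t, x))%:E =
   (- (1 * testf w s a b k tau 0 x))%:E)%E.
  have cpair t : {for t, continuous (fun t : R => (t, x))} by exact: (cvg_pair cvg_id (cvg_cst _)).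
  have cdt : continuous (fun t => dt (testf w s a b k tau) t x).
    move=> t; apply: (@continuous_comp _ _ _ (fun t : R => (t, x)) (fun z : R * V => dt (testf w s a b k tau) z.1 z.2)).
      exact: cpair.
    exact: dt2.
  have cte : continuous (fun t => testf w s a b k tau t x).
    move=> t; apply: (@continuous_comp _ _ _ (fun t : R => (t, x)) (fun z : R * V => testf w s a b k tau z.1 z.2)).
      exact: cpair.
    exact: c0.
  have mdt (D : set R) : measurable_fun D (fun t => (dt (testf w s a b k tau) t x)%:E).
    by apply/measurable_EFinP; apply: measurable_funTS; exact: continuous_measurable_fun.
  transitivity (\int[leb]_(t in `[0%R, T]) (dt (testf w s a b k tau) t x)%:E)%E.
    rewrite -integral_itv_bndo_bndc// -integral_itv_obnd_cbnd// [RHS]integral_mkcond.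
    apply: eq_integral => t _; rewrite patchE /extQ /= indicE mul1r.
    by case: ifP => _; rewrite ?mulr1 ?mulr0.
  rewrite (@continuous_FTC2 _ _ (fun t => testf w s a b k tau t x))//.
  - rewrite [X in (X%:E - _)%E](_ : _ = 0) ?sub0e ?mul1r//.
    by rewrite /testf alpha_out ?mulr0 ?mul0r//; right; case/andP: tauT => _ /ltW.
  - exact: continuous_subspaceT.
  - split; first by move=> t _; exact: dt1.
      exact: (cvg_at_right_filter (cte 0)).
    exact: (cvg_at_left_filter (cte T)).
rewrite /Rintegral -(integral21_prod_meas1 i1) /fubini_G /=.
under eq_integral do rewrite E.
have i0 : mu.-integrable setT (EFin \o (fun x => 1 * testf w s a b k tau 0 x)).
  apply: (@integrable_continuous_compact _ _ _ K) => //; last by move=> x Kx; rewrite hK// mulr0.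
  apply: contM; first exact: contC.
  move=> x; apply: (@continuous_comp _ _ _ (fun x : V => (0 : R, x)) (fun z : R * V => testf w s a b k tau z.1 z.2)).
    have h1 : continuous (fun _ : V => 0 : R) by exact: contC.
    have h2 : continuous (id : V -> V) by move=> y; exact: cvg_id.
    exact: (cvg_pair (h1 x) (h2 x)).
  exact: c0.
by rewrite -fineN; congr fine; rewrite -integralN//; exact: integrable_add_def.
Qed.

End classical_solution.

(** * Uniform bounds *)

Section conserved_power.
Context d (X : measurableType d) (R : realType) (m : {measure set X -> \bar R}).
Variables (p q c : R) (Phi Phi0 : X -> X) (f f0 sQ chi J F : X -> R).
Hypothesis p1 : 1 < p.
Hypothesis pq : p^-1 + q^-1 = 1.
Hypothesis c1 : 1 < c.
Hypothesis mPhi : measurable_fun setT Phi.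
Hypothesis mPhi0 : measurable_fun setT Phi0.
Hypothesis mf : measurable_fun setT f.
Hypothesis mf0 : measurable_fun setT f0.
Hypothesis ms : measurable_fun setT sQ.
Hypothesis mchi : measurable_fun setT chi.
Hypothesis mJ : measurable_fun setT J.
Hypothesis mF : measurable_fun setT F.
Hypothesis chi01 : forall x, chi x = 0 \/ chi x = 1.
Hypothesis J01 : forall x, J x = 0 \/ J x = 1.
Hypothesis f0J : forall x, f0 x * J x = f0 x.
Hypothesis sJ : forall x, c^-1 * J x <= sQ x <= c * J x.
Hypothesis F_Phi : forall x, f x * F (Phi x) = chi x * `|f x| `^ p.
Hypothesis F_Phi_q : forall x, `|F (Phi x)| `^ q = chi x * `|f x| `^ p.
Hypothesis F_Phi0 : forall x, F (Phi0 x) = chi x * F (Phi0 x).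
Hypothesis invariant : forall h : X -> R, measurable_fun setT h -> (forall z, 0 <= h z) ->
  (\int[m]_z (sQ z * h (Phi z))%:E = \int[m]_z (sQ z * h (Phi0 z))%:E)%E.
Hypothesis identity : forall h : X -> R, measurable_fun setT h ->
  m.-integrable setT (EFin \o (fun z => f z * h (Phi z))) ->
  m.-integrable setT (EFin \o (fun z => f0 z * h (Phi0 z))) ->
  \int[m]_z (f z * h (Phi z)) = \int[m]_z (f0 z * h (Phi0 z)).

Let p0 : 0 < p. Proof. exact: lt_trans p1. Qed.
Let q1 : 1 < q. Proof. exact: q_gt1 p1 pq. Qed.
Let q0 : 0 < q. Proof. exact: lt_trans q1. Qed.
Let c0 : 0 < c. Proof. exact: lt_trans c1. Qed.
Let J_ge0 x : 0 <= J x. Proof. by case: (J01 x) => ->. Qed.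
Let J_le1 x : J x <= 1. Proof. by case: (J01 x) => ->. Qed.
Let chi_ge0 x : 0 <= chi x. Proof. by case: (chi01 x) => ->. Qed.

(** Division by A^(1/q), legitimate for finite A > 0, followed by the p-th power; the exponent of c
    is 2 p / q = 2 (p - 1). *)
Let power_step (A B : R) : 0 <= A -> 0 <= B -> A <= B `^ p^-1 * (c ^+ 2 * A) `^ q^-1 ->
  A <= c `^ (2 * (p - 1)) * B.
Proof.
move=> A0 B0; have [->|An0] := eqVneq A 0; first by move=> _; rewrite mulr_ge0// powR_ge0.
have Agt : 0 < A by rewrite lt_neqAle eq_sym An0.
rewrite powRM ?exprn_ge0 ?(ltW c0)// => h.
have Aq : 0 < A `^ q^-1 by rewrite powR_gt0.
have AE : A = A `^ p^-1 * A `^ q^-1 by rewrite -powRD ?pq ?powRr1//; apply/implyP; rewrite An0.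
have h2 : A `^ p^-1 <= B `^ p^-1 * (c ^+ 2) `^ q^-1.
  by rewrite -(ler_pM2r Aq) -AE -mulrA.
have h3 : (A `^ p^-1) `^ p <= (B `^ p^-1 * (c ^+ 2) `^ q^-1) `^ p.
  by apply: ge0_ler_powR => //; rewrite ?nnegrE ?mulr_ge0 ?powR_ge0// ltW.
move: h3; rewrite powRM ?powR_ge0// -!powRrM mulVf ?gt_eqF// !powRr1// mulrC.
rewrite -powR_mulrn ?(ltW c0)// -powRrM.
rewrite (_ : 2 * (q^-1 * p) = 2 * (p - 1))//; congr (_ * _).
by rewrite (_ : q^-1 = 1 - p^-1) ?mulrBl ?mul1r ?mulVf ?gt_eqF// -pq addrC addKr.
Qed.

Let mpow (r : R) (h : X -> R) : measurable_fun setT h -> measurable_fun setT (fun z => `|h z| `^ r).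
Proof.
move=> mh; apply: (@measurableT_comp _ _ _ _ _ _ (@powR R ^~ r)) => //; exact: measurableT_comp.
Qed.

Variables A B : R.
Hypothesis AE : (\int[m]_z (chi z * `|f z| `^ p)%:E)%E = A%:E.
Hypothesis BE : (\int[m]_z (chi z * `|f0 z| `^ p)%:E)%E = B%:E.

Let A0 : 0 <= A.
Proof. by rewrite -lee_fin -AE; apply: integral_ge0 => z _; rewrite lee_fin mulr_ge0// powR_ge0. Qed.

Let B0 : 0 <= B.
Proof. by rewrite -lee_fin -BE; apply: integral_ge0 => z _; rewrite lee_fin mulr_ge0// powR_ge0. Qed.

Let i1 : m.-integrable setT (EFin \o (fun z => f z * F (Phi z))).
Proof.
apply/integrable_lty; first by apply: measurable_funM => //; exact: measurableT_comp.
under eq_integral do rewrite F_Phi ger0_norm ?mulr_ge0 ?powR_ge0//.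
by rewrite AE ltry.
Qed.

(** One factor c passes from J to the weight [sQ], for which base and shifted points are
    interchangeable; a second one removes the weight at the shifted points, where |F|^q equals chi
    |f|^p. *)
Let D0 : (\int[m]_z (`|J z * F (Phi0 z)| `^ q)%:E <= (c ^+ 2 * A)%:E)%E.
Proof.
pose h z := `|F z| `^ q.
have h_ge0 z : 0 <= h z by exact: powR_ge0.
have mh : measurable_fun setT h by exact: mpow.
have ci : 0 < c^-1 by rewrite invr_gt0.
have s0 x : 0 <= sQ x by have /andP[h1 _] := sJ x; apply: le_trans h1; rewrite mulr_ge0// ltW.
have mhb : measurable_fun setT (fun z => h (Phi0 z)) by exact: measurableT_comp.
have mhs : measurable_fun setT (fun z => h (Phi z)) by exact: measurableT_comp.
have msb : measurable_fun setT (fun z => (sQ z * h (Phi0 z))%:E).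
  by apply/measurable_EFinP; exact: measurable_funM.
apply: (@le_trans _ _ (c%:E * \int[m]_z (sQ z * h (Phi0 z))%:E)%E).
  rewrite -ge0_integralZl//; last 2 first.
  - by move=> z _; rewrite lee_fin mulr_ge0.
  - by rewrite lee_fin ltW.
  apply: ge0_le_integral => //.
  - apply/measurable_EFinP; apply: mpow.
    by apply: measurable_funM => //; exact: measurableT_comp.
  - exact: measurable_funeM.
  move=> z _; rewrite -EFinM lee_fin normrM powRM// ger0_norm//.
  rewrite mulrA ler_wpM2r//; have /andP[+ _] := sJ z; case: (J01 z) => ->.
    by rewrite powR0 ?gt_eqF// mulr0 => sz; rewrite mulr_ge0// ltW.
  by rewrite powR1 mulr1 => sz; rewrite -(divff (lt0r_neq0 c0)) ler_pM2l.
rewrite -invariant// expr2 -mulrA EFinM; apply: lee_wpmul2l; first by rewrite lee_fin ltW.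
have ma : measurable_fun setT (fun z => (chi z * `|f z| `^ p)%:E).
  by apply/measurable_EFinP; apply: measurable_funM => //; exact: mpow.
rewrite EFinM -AE -ge0_integralZl//; last 2 first.
- by move=> z _; rewrite lee_fin mulr_ge0// powR_ge0.
- by rewrite lee_fin ltW.
apply: ge0_le_integral => //.
- by move=> z _; rewrite lee_fin mulr_ge0.
- by apply/measurable_EFinP; exact: measurable_funM.
- exact: measurable_funeM.
move=> z _; rewrite -EFinM lee_fin /h F_Phi_q; apply: ler_wpM2r; first by rewrite mulr_ge0// powR_ge0.
have /andP[_ h2] := sJ z; apply: le_trans h2 _; by rewrite -[leRHS]mulr1 ler_pM2l.
Qed.

(** A is the integral of f F(Phi), hence of f0 F(Phi0). Hoelder's inequality bounds it by B^(1/p)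
    times the q-norm of F at the base points, which [D0] controls by A itself. *)
Lemma conserved_power : A <= c `^ (2 * (p - 1)) * B.
Proof.
apply: power_step => //.
have mJF : measurable_fun setT (fun z => J z * F (Phi0 z)).
  by apply: measurable_funM => //; exact: measurableT_comp.
have mcf : measurable_fun setT (fun z => chi z * f0 z) by exact: measurable_funM.
have hh := @hoelder _ _ _ m _ _ p q mcf mJF p0 q0 pq.
have E z : chi z * f0 z * (J z * F (Phi0 z)) = f0 z * F (Phi0 z).
  rewrite [in RHS]F_Phi0 -[in RHS](f0J z).
  have gen (x1 x2 x3 x4 : R) : x1 * x2 * (x3 * x4) = x2 * x3 * (x1 * x4) by ring.
  exact: gen.
have N1 : ('N[m]_1[EFin \o (fun z => f0 z * F (Phi0 z))%R] <= (B `^ p^-1 * (c ^+ 2 * A) `^ q^-1)%:E)%E.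
  rewrite (_ : (fun z => f0 z * F (Phi0 z)) = ((fun z => chi z * f0 z) \* (fun z => J z * F (Phi0 z)))); last first.
    by apply/funext => z /=; rewrite E.
  apply: (le_trans hh); rewrite EFinM !unlock /Lnorm; apply: lee_pmul; rewrite ?poweR_ge0//.
    rewrite -poweR_EFin; apply: gt0_ler_poweR; rewrite ?in_itv /= ?leey ?andbT ?lee_fin// ?invr_ge0 ?(ltW p0)//.
      by apply: integral_ge0 => z _; rewrite lee_fin powR_ge0.
    rewrite -BE le_eqVlt; apply/orP; left; apply/eqP; apply: eq_integral => z _ /=.
    by congr EFin; case: (chi01 z) => ->; rewrite ?mul0r ?normr0 ?powR0 ?gt_eqF// !mul1r.
  rewrite -poweR_EFin; apply: gt0_ler_poweR; rewrite ?in_itv /= ?leey ?andbT ?lee_fin// ?invr_ge0 ?(ltW q0)//.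
    by apply: integral_ge0 => z _; rewrite lee_fin powR_ge0.
  by rewrite mulr_ge0// sqr_ge0.
have i0 : m.-integrable setT (EFin \o (fun z => f0 z * F (Phi0 z))).
  apply/integrable_lty; first by apply: measurable_funM => //; exact: measurableT_comp.
  by move: N1; rewrite Lnorm1 => /le_lt_trans; apply; rewrite ltry.
have EA : A = \int[m]_z (f z * F (Phi z)).
  rewrite /Rintegral (_ : (\int[m]_z (f z * F (Phi z))%:E)%E = A%:E)//.
  by rewrite -AE; apply: eq_integral => z _; rewrite F_Phi.
rewrite [leLHS]EA (identity mF i1 i0) (le_trans (ler_norm _))//.
rewrite -lee_fin; apply: le_trans N1; rewrite Lnorm1 EFin_normr_Rintegral//.
by apply: le_abse_integral => //; case/integrableP: i0.
Qed.

End conserved_power.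

Section dual_test.
Variables (R : realType) (n : nat) (p q : R).
Local Notation V := 'rV[R]_n.+1.
Local Notation TV := (measurableTypeR R * V)%type.
Variables (w g : V -> V) (f : TV -> R) (E : set (measurableTypeR R)).
Hypothesis p1 : 1 < p.
Hypothesis pq : p^-1 + q^-1 = 1.
Hypothesis mg : measurable_fun setT g.
Hypothesis wK : cancel w g.
Hypothesis mf : measurable_fun setT f.
Hypothesis mE : measurable E.

Let psi (z : TV) : R := \1_E z.1 * (f z * `|f z| `^ (p - 2)).
(** The function F of the duality argument: w(x) + t e_1 is sent back to x by undoing the shift and
    applying the left inverse g. The factor [\1_E] restricts it to a set of times. *)
Definition dual_test (z : TV) : R := psi (z.1, g (z.2 - z.1 *: evec R ord0)).

Let q0 : 0 < q. Proof. exact: lt_trans (q_gt1 p1 pq). Qed.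
Let p0 : 0 < p. Proof. exact: lt_trans p1. Qed.

Let dual_shift z : dual_test (shiftW w z) = psi z.
Proof. by case: z => t x; rewrite /dual_test /shiftW /= addrK wK. Qed.

Lemma dual_test_shift_pow z : `|dual_test (shiftW w z)| `^ q = \1_E z.1 * `|f z| `^ p.
Proof.
rewrite dual_shift /psi normrM norm_powR_pred2// indicE; case: (_ \in E); last by rewrite normr0 !mul0r powR0// gt_eqF.
by rewrite normr1 !mul1r -powRrM (conj_mul p1 pq).
Qed.

Lemma dual_test_shift z : f z * dual_test (shiftW w z) = \1_E z.1 * `|f z| `^ p.
Proof.
by rewrite dual_shift /psi mulrCA mul_powR_pred2.
Qed.

Lemma dual_test_base z : dual_test (baseW w z) = \1_E z.1 * dual_test (baseW w z).
Proof. by rewrite /dual_test /psi /= mulrA indicE; case: (_ \in E); rewrite ?mul1r ?mul0r. Qed.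

Lemma measurable_fstind : measurable_fun setT (fun z : TV => \1_E z.1 : R).
Proof.
apply: (@measurableT_comp _ _ _ _ _ _ (\1_E : measurableTypeR R -> R)); last exact: measurable_fst.
exact: measurable_indic.
Qed.

Lemma measurable_dual_test : measurable_fun setT dual_test.
Proof.
have mpsi : measurable_fun setT psi.
  apply: measurable_funM; first exact: measurable_fstind.
  apply: measurable_funM => //; apply: (@measurableT_comp _ _ _ _ _ _ (@powR R ^~ (p - 2))) => //.
  exact: measurableT_comp.
apply: (@measurableT_comp _ _ _ _ _ _ psi) => //.
apply/measurable_fun_pairP; split; first exact: measurable_fst.
apply: (measurableT_comp mg); apply: measurable_fun_rVP => i.
under eq_fun do rewrite mxE [X in _ + X]mxE [X in _ - X]mxE.
apply: measurable_funB; last by apply: measurable_funM => //; exact: measurable_fst.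
exact: (measurableT_comp (@measurable_rV_coord R _ i) measurable_snd).
Qed.

End dual_test.

Section uniform_bound.
Variables (R : realType) (n : nat) (T p q c : R).
Local Notation V := 'rV[R]_n.+1.
Local Notation mu := (lebesgueN R n.+1).
Local Notation leb := (@lebesgue_measure R).
Local Notation TV := (measurableTypeR R * V)%type.
Local Notation I := (`]0, T[%classic : set R).
Local Notation m := ((leb \x mu)%E).
Variables (w g : V -> V) (s : V -> R) (f : TV -> R) (v0 : V -> R) (Cv beta : R).
Hypothesis p1 : 1 < p.
Hypothesis pq : p^-1 + q^-1 = 1.
Hypothesis c1 : 1 < c.
Hypothesis mw : measurable_fun setT w.
Hypothesis mg : measurable_fun setT g.
Hypothesis wK : cancel w g.
Hypothesis ms : measurable_fun setT s.
Hypothesis sc : forall x, c^-1 <= s x <= c.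
Hypothesis mf : measurable_fun setT f.
Hypothesis f_out : forall t x, ~ I t -> f (t, x) = 0.
Hypothesis mv0 : measurable_fun setT v0.
Hypothesis v0beta : (\int[mu]_x (`|v0 x| `^ p)%:E <= beta%:E)%E.
Hypothesis fC : \forall t \ae leb, I t -> ('N[mu]_(p%:E)[EFin \o (fun x => f (t, x))] <= Cv%:E)%E.
Hypothesis invariant : forall h : TV -> R, measurable_fun setT h -> (forall z, 0 <= h z) ->
  (\int[m]_z (extQ T (fun=> s) z * h (shiftW w z))%:E = \int[m]_z (extQ T (fun=> s) z * h (baseW w z))%:E)%E.
Hypothesis identity : forall h : TV -> R, measurable_fun setT h ->
  m.-integrable setT (EFin \o (fun z => f z * h (shiftW w z))) ->
  m.-integrable setT (EFin \o (fun z => extQ T (fun=> v0) z * h (baseW w z))) ->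
  \int[m]_z (f z * h (shiftW w z)) = \int[m]_z (extQ T (fun=> v0) z * h (baseW w z)).

Let p0 : 0 < p. Proof. exact: lt_trans p1. Qed.
Let G (t : measurableTypeR R) : \bar R := (\int[mu]_x (`|f (t, x)| `^ p)%:E)%E.

Let mpow d (X : measurableType d) (h : X -> R) : measurable_fun setT h -> measurable_fun setT (fun z => `|h z| `^ p).
Proof.
move=> mh; apply: (@measurableT_comp _ _ _ _ _ _ (@powR R ^~ p)) => //; exact: measurableT_comp.
Qed.

Let mG : measurable_fun setT G.
Proof.
apply: (@measurable_fun_fubini_tonelli_F _ _ _ _ _ mu (fun z : TV => (`|f z| `^ p)%:E)) => //.
by apply/measurable_EFinP; exact: mpow.
Qed.

Let G_ge0 t : (0 <= G t)%E.
Proof. by apply: integral_ge0 => x _; rewrite lee_fin powR_ge0. Qed.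

Let beta0 : 0 <= beta.
Proof.
by rewrite -lee_fin; apply: le_trans v0beta; apply: integral_ge0 => x _; rewrite lee_fin powR_ge0.
Qed.

Let kap : R := c `^ (2 * (p - 1)) * beta.
Let kap0 : 0 <= kap. Proof. by rewrite mulr_ge0// powR_ge0. Qed.

Let G_out t : ~ I t -> G t = 0%E.
Proof.
by move=> It; apply: integral0_eq => x _; rewrite f_out// normr0 powR0// gt_eqF.
Qed.

(** The exceptional times, where the p-th power of the slice norm exceeds the claimed bound. This
    set lies in ]0, T[ and so has finite measure. *)
Let E := [set t | (kap%:E < G t)%E] : set (measurableTypeR R).

Let mE : measurable E.
Proof. by rewrite -[E]setTI; apply: emeasurable_fun_o_infty. Qed.

Let EI : E `<=` I.
Proof.
move=> t Et; apply: contrapT => /G_out h; move: Et; rewrite /E /= h lte_fin ltNge kap0//.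
Qed.

Let lE : (leb E < +oo)%E.
Proof.
apply: (@le_lt_trans _ _ (leb I)); first by apply: le_measure; rewrite ?inE.
by have := @lebesgue_measure_itv R `]0, T[; rewrite /= => ->; case: ifP => // _; rewrite ?ltry.
Qed.

Let int_sep (h : TV -> R) : measurable_fun setT h -> (forall z, 0 <= h z) ->
  (\int[m]_z (\1_E z.1 * h z)%:E = \int[leb]_(t in E) \int[mu]_x (h (t, x))%:E)%E.
Proof.
move=> mh h0; rewrite fubini_tonelli1; last 2 first.
- by apply/measurable_EFinP; apply: measurable_funM => //; exact: measurable_fstind.
- by move=> z; rewrite lee_fin mulr_ge0.
rewrite [RHS]integral_mkcond; apply: eq_integral => t _; rewrite patchE /fubini_F /=.
case: ifPn => tE; first by apply: eq_integral => x _; rewrite indicE tE mul1r.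
by apply: integral0_eq => x _; rewrite indicE (negbTE tE) mul0r.
Qed.

Let A_E : (\int[m]_z (\1_E z.1 * `|f z| `^ p)%:E = \int[leb]_(t in E) G t)%E.
Proof. by apply: int_sep; [exact: mpow|move=> z; exact: powR_ge0]. Qed.

Let G_N t : G t = ('N[mu]_(p%:E)[EFin \o (fun x => f (t, x))] `^ p)%E.
Proof. by rewrite poweR_Lnorm// gt_eqF. Qed.

Let A_fin : (\int[leb]_(t in E) G t < +oo)%E.
Proof.
apply: (@le_lt_trans _ _ (\int[leb]_(t in E) (cst (`|Cv| `^ p)%:E t))%E); last first.
  by rewrite integral_cst// lte_mul_pinfty// lee_fin powR_ge0.
apply: ae_ge0_le_integral => //.
- exact: measurable_funTS.
- by move=> t _; rewrite lee_fin powR_ge0.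
have FF : Filter (almost_everywhere leb) by exact: ae_filter_ringOfSetsType.
move: fC; apply: (@filterS _ _ FF) => t ht Et; rewrite G_N.
rewrite /cst -poweR_EFin; apply: gt0_ler_poweR; rewrite ?in_itv /= ?leey ?andbT ?lee_fin//; first exact: ltW.
  exact: Lnorm_ge0.
by rewrite (le_trans (ht (EI Et)))// lee_fin ler_norm.
Qed.

Let B_le : (\int[m]_z (\1_E z.1 * `|extQ T (fun=> v0) z| `^ p)%:E <= beta%:E * leb E)%E.
Proof.
have m0 : measurable_fun setT (extQ T (fun=> v0)).
  by apply: measurable_funM; [exact: (measurableT_comp mv0)|exact: measurable_indT].
rewrite int_sep; [|exact: mpow|by move=> z; exact: powR_ge0].
rewrite -(integral_cst leb mE); apply: ge0_le_integral.
- exact: mE.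
- by move=> t _; apply: integral_ge0 => x _; rewrite lee_fin powR_ge0.
- apply: measurable_funTS.
  apply: (@measurable_fun_fubini_tonelli_F _ _ _ _ _ mu (fun z : TV => (`|extQ T (fun=> v0) z| `^ p)%:E)) => //.
  by apply/measurable_EFinP; exact: mpow.
- exact: measurable_cst.
move=> t Et; apply: le_trans v0beta; rewrite le_eqVlt; apply/orP; left; apply/eqP; apply: eq_integral => x _.
by rewrite /extQ /= indicE (mem_set (EI Et)) mulr1.
Qed.

Let AB : (\int[leb]_(t in E) G t <= kap%:E * leb E)%E.
Proof.
have Bfin : (\int[m]_z (\1_E z.1 * `|extQ T (fun=> v0) z| `^ p)%:E < +oo)%E.
  by apply: le_lt_trans B_le _; rewrite lte_mul_pinfty// lee_fin.
have B0 : (0 <= \int[m]_z (\1_E z.1 * `|extQ T (fun=> v0) z| `^ p)%:E)%E.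
  by apply: integral_ge0 => z _; rewrite lee_fin mulr_ge0// powR_ge0.
have A0 : (0 <= \int[leb]_(t in E) G t)%E by apply: integral_ge0.
have HB : (\int[m]_z (\1_E z.1 * `|extQ T (fun=> v0) z| `^ p)%:E)%E \is a fin_num by rewrite ge0_fin_numE.
have HA : (\int[leb]_(t in E) G t)%E \is a fin_num by rewrite ge0_fin_numE.
have K := @conserved_power _ TV R m p q c (shiftW w) (baseW w) f (extQ T (fun=> v0)) (extQ T (fun=> s))
  (fun z => \1_E z.1) (fun z => \1_I z.1) (dual_test p g f E) p1 pq c1.
rewrite -(fineK HA) /kap EFinM -muleA.
apply: (@le_trans _ _ ((c `^ (2 * (p - 1)))%:E *
  (fine (\int[m]_z (\1_E z.1 * `|extQ T (fun=> v0) z| `^ p)%:E)%E)%:E)%E); last first.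
  by apply: lee_wpmul2l; [rewrite lee_fin powR_ge0|rewrite fineK//; exact: B_le].
rewrite -EFinM lee_fin; apply: K.
- apply/measurable_fun_pairP; split; first exact: measurable_fst.
  apply: measurable_fun_rVP => i; under eq_fun do rewrite mxE [X in _ + X]mxE.
  apply: measurable_funD; last by apply: measurable_funM => //; exact: measurable_fst.
  by apply: (measurableT_comp (@measurable_rV_coord R _ i)); exact: (measurableT_comp mw measurable_snd).
- apply/measurable_fun_pairP; split; first exact: measurable_fst.
  exact: (measurableT_comp mw measurable_snd).
- exact: mf.
- by apply: measurable_funM; [exact: (measurableT_comp mv0)|exact: measurable_indT].
- by apply: measurable_funM; [exact: (measurableT_comp ms)|exact: measurable_indT].
- exact: measurable_fstind.
- exact: measurable_indT.
- exact: measurable_dual_test.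
- by move=> z; rewrite indicE; case: (_ \in E); [right|left].
- by move=> z; rewrite indicE; case: (_ \in _); [right|left].
- by move=> z; rewrite /extQ !indicE; case: (_ \in _); rewrite ?mulr1 ?mulr0.
- move=> z; rewrite /extQ indicE; case: (_ \in _); rewrite ?mulr1 ?mulr0 ?lexx//; exact: sc.
- by move=> z; exact: dual_test_shift.
- by move=> z; exact: dual_test_shift_pow.
- by move=> z; exact: dual_test_base.
- exact: invariant.
- exact: identity.
- by rewrite fineK//; exact: A_E.
- by rewrite fineK.
Qed.

(** Localising [conserved_power] to E shows that the integral of G over E is at most kap |E|,
    whereas G > kap throughout E; hence G - kap vanishes almost everywhere on E, and E is
    negligible. The a priori constant [Cv] only ensures finiteness and leaves no trace in the
    bound. *)
Lemma uniform_bound : \forall t \ae leb, I t ->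
  ('N[mu]_(p%:E)[EFin \o (fun x => f (t, x))] <= ((c `^ (2 * (p - 1)) * beta) `^ p^-1)%:E)%E.
Proof.
have FF : Filter (almost_everywhere leb) by exact: ae_filter_ringOfSetsType.
pose h t := (G t - kap%:E)%E.
have mh : measurable_fun E h by apply: emeasurable_funB => //; exact: measurable_funTS.
have iG : leb.-integrable E G.
  apply/integrableP; split; first exact: measurable_funTS.
  by under eq_integral do rewrite gee0_abs//.
have ik : leb.-integrable E (cst kap%:E).
  apply/integrableP; split => //; under eq_integral do rewrite gee0_abs ?lee_fin//.
  by rewrite integral_cst// lte_mul_pinfty// lee_fin.
have h0 : (\int[leb]_(t in E) `|h t| = 0)%E.
  apply/eqP; rewrite eq_le; apply/andP; split; last exact: integral_ge0.
  under eq_integral => t Et.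
    rewrite gee0_abs; last by move: Et; rewrite inE /E /= => /ltW kt; rewrite /h sube_ge0.
    over.
  by rewrite /h integralB//= integral_cst// sube_le0 AB.
have /ae_eq_integral_abs := h0; move=> /(_ mE mh) ae0.
move: ae0; apply: (@filterS _ _ FF) => t ht It.
have [Et|] := boolP ((kap%:E < G t)%E).
  have : (0 < h t)%E by rewrite /h sube_gt0.
  by rewrite (ht Et) ltxx.
rewrite -leNgt G_N => Gk.
set Nt := Lnorm mu p%:E _ in Gk *.
have -> : Nt = ((Nt `^ p) `^ p^-1)%E by rewrite -poweRrM mulfV ?gt_eqF// poweRe1// Lnorm_ge0.
rewrite -poweR_EFin; apply: gt0_ler_poweR; rewrite ?in_itv /= ?leey ?andbT ?lee_fin//.
- by rewrite invr_ge0 ltW.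
- exact: poweR_ge0.
Qed.

End uniform_bound.

(** * Uniform boundedness principle in L^q *)

Section hoelder_pairing.
Context d (X : measurableType d) (R : realType) (mu : {measure set X -> \bar R}).
Variables (p q : R).
Hypothesis p1 : 1 < p.
Hypothesis pq : p^-1 + q^-1 = 1.
Let p0 : 0 < p. Proof. exact: lt_trans p1. Qed.
Let q1 : 1 < q. Proof. exact: q_gt1 p1 pq. Qed.
Let q0 : 0 < q. Proof. exact: lt_trans q1. Qed.

Lemma hoelder_lty (f g : X -> R) : f \in Lfun mu p%:E -> g \in Lfun mu q%:E ->
  mu.-integrable setT (EFin \o (fun x => f x * g x)).
Proof.
move=> /LfunE[mf foo] /LfunE[mg goo]; apply/integrable_lty; first exact: measurable_funM.
have := @hoelder _ _ _ mu f g p q mf mg p0 q0 pq; rewrite Lnorm1 => /le_lt_trans; apply.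
by rewrite lte_mul_pinfty ?Lnorm_ge0// ge0_fin_numE ?Lnorm_ge0.
Qed.

Lemma hoelder_pairing (f g : X -> R) (a b : R) : f \in Lfun mu p%:E -> g \in Lfun mu q%:E ->
  ('N[mu]_(p%:E)[EFin \o f] <= a%:E)%E -> ('N[mu]_(q%:E)[EFin \o g] <= b%:E)%E ->
  `|\int[mu]_x (f x * g x)| <= a * b.
Proof.
move=> fp gq fa gb; have i := hoelder_lty fp gq.
have [mf _] := (LfunE _ _ _).1 fp; have [mg _] := (LfunE _ _ _).1 gq.
rewrite -lee_fin EFin_normr_Rintegral//.
apply: (@le_trans _ _ (\int[mu]_x (`|f x * g x|)%:E)%E).
  by apply: le_abse_integral => //; case/integrableP: i.
have := @hoelder _ _ _ mu f g p q mf mg p0 q0 pq; rewrite Lnorm1 => /le_trans; apply.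
by rewrite EFinM; apply: lee_pmul => //; exact: Lnorm_ge0.
Qed.

(** The normalised dual element f |f|^(p-2) / a^(p-1), where a is the norm of f, attains that
    norm. *)
Lemma dual_element (f : X -> R) (a : R) : f \in Lfun mu p%:E -> 0 < a ->
  (\int[mu]_x (`|f x| `^ p)%:E)%E = (a `^ p)%:E ->
  exists xi, [/\ xi \in Lfun mu q%:E, ('N[mu]_(q%:E)[EFin \o xi] <= 1%:E)%E &
    \int[mu]_x (f x * xi x) = a].
Proof.
move=> fp a0 fa; have [mf _] := (LfunE _ _ _).1 fp.
have ap : 0 < a `^ (p - 1) by rewrite powR_gt0.
pose xi x := f x * `|f x| `^ (p - 2) / a `^ (p - 1).
have mxi : measurable_fun setT xi.
  apply: measurable_funM => //; apply: measurable_funM => //.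
  by apply: (@measurableT_comp _ _ _ _ _ _ (@powR R ^~ (p - 2))) => //; exact: measurableT_comp.
have mfp : measurable_fun setT (fun x => (`|f x| `^ p)%:E).
  apply/measurable_EFinP; apply: (@measurableT_comp _ _ _ _ _ _ (@powR R ^~ p)) => //; exact: measurableT_comp.
have N1 : 'N[mu]_(q%:E)[EFin \o xi]%E = 1%:E.
  rewrite unlock /Lnorm (_ : (\int[mu]_x _)%E = 1%:E) ?poweR1r//.
  transitivity (((a `^ p)^-1)%:E * \int[mu]_x (`|f x| `^ p)%:E)%E.
    rewrite -ge0_integralZl//; last by rewrite lee_fin invr_ge0 powR_ge0.
    apply: eq_integral => x _; rewrite -EFinM /= /xi; congr EFin.
    rewrite normrM powRM// norm_powR_pred2// -powRrM (conj_mul p1 pq) mulrC; congr (_ * _).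
    by rewrite ger0_norm ?invr_ge0 ?powR_ge0// -powRN -powRrM mulNr (conj_mul p1 pq) powRN.
  by rewrite fa -EFinM mulVf// gt_eqF// powR_gt0.
exists xi; split.
- by apply/LfunE; split => //; rewrite N1 ltry.
- by rewrite N1.
- have E x : f x * xi x = (a `^ (p - 1))^-1 * `|f x| `^ p.
    by rewrite /xi mulrA mulrC mul_powR_pred2.
  rewrite /Rintegral; under eq_integral do rewrite E EFinM.
  rewrite ge0_integralZl//; last by rewrite lee_fin invr_ge0 ltW.
  have aE : a `^ p = a `^ (p - 1) * a.
    by rewrite -{3}(powRr1 (ltW a0)) -powRD ?subrK//; apply/implyP; rewrite gt_eqF.
  by rewrite fa -EFinM /= aE mulrA mulVf ?gt_eqF// mul1r.
Qed.

End hoelder_pairing.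

Section gliding_hump.
Context d (X : measurableType d) (R : realType) (mu : {sigma_finite_measure set X -> \bar R}).
Variables (p q : R) (f xi : nat -> X -> R) (a : nat -> R).
Hypothesis p1 : 1 < p.
Hypothesis pq : p^-1 + q^-1 = 1.
Hypothesis fp : forall k, f k \in Lfun mu p%:E.
Hypothesis fa : forall k, ('N[mu]_(p%:E)[EFin \o f k] <= (a k)%:E)%E.
Hypothesis xiq : forall k, xi k \in Lfun mu q%:E.
Hypothesis xi1 : forall k, ('N[mu]_(q%:E)[EFin \o xi k] <= 1%:E)%E.
Hypothesis fxi : forall k, \int[mu]_x (f k x * xi k x) = a k.

Let p0 : 0 < p. Proof. exact: lt_trans p1. Qed.
Let q1 : 1 < q. Proof. exact: q_gt1 p1 pq. Qed.
Let q0 : 0 < q. Proof. exact: lt_trans q1. Qed.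
Let mxi k : measurable_fun setT (xi k). Proof. by have [] := (LfunE _ _ _).1 (xiq k). Qed.
Let mf k : measurable_fun setT (f k). Proof. by have [] := (LfunE _ _ _).1 (fp k). Qed.
(** With ratio 3 the sum of all weights after k is half of [r k], so the tail cannot cancel the k-th
    term. *)
Let r (k : nat) : R := 3 ^- k.
Let r0 k : 0 < r k. Proof. by rewrite invr_gt0 exprn_gt0. Qed.
Let rS k : r k.+1 = r k / 3. Proof. by rewrite /r exprS invfM mulrC. Qed.

(* The sign at each step is chosen so that the new term does not decrease the pairing with f k. *)
Fixpoint hump (k : nat) : X -> R :=
  if k is j.+1 then
    fun x => hump j x + (if r j * a j <= `|\int[mu]_x (f j x * (hump j x + r j * xi j x))| then 1 else -1) * (r j * xi j x)
  else fun=> 0.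

Let sgn j : R := if r j * a j <= `|\int[mu]_x (f j x * (hump j x + r j * xi j x))| then 1 else -1.
Let humpS j : hump j.+1 = fun x => hump j x + sgn j * (r j * xi j x). Proof. by []. Qed.
Let sgn1 j : `|sgn j| = 1. Proof. by rewrite /sgn; case: ifP => _; rewrite ?normr1 ?normrN1. Qed.

Let H (k : nat) (x : X) : R := \sum_(j < k) r j * `|xi j x|.

Let hump_H k x : `|hump k x| <= H k x.
Proof.
elim: k => [|k IH]; first by rewrite /H big_ord0 normr0.
rewrite humpS /H big_ord_recr /= (le_trans (ler_normD _ _))// lerD//.
by rewrite normrM sgn1 mul1r normrM gtr0_norm.
Qed.

Let mH k : measurable_fun setT (H k).
Proof.
by apply: measurable_sum => j; apply: measurable_funM => //; exact: measurableT_comp.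
Qed.

Let mhump k : measurable_fun setT (hump k).
Proof.
elim: k => [|k IH]; first exact: measurable_cst.
by rewrite humpS; apply: measurable_funD => //; apply: measurable_funM => //; exact: measurable_funM.
Qed.

(** By Minkowski's inequality; 3/2 is the sum of the geometric series, and the induction carries the
    exact partial sums. *)
Let H_norm k : ('N[mu]_(q%:E)[EFin \o H k] <= (3 / 2)%:E)%E.
Proof.
suff h : ('N[mu]_(q%:E)[EFin \o H k] <= (3 / 2 - 3 / 2 * r k)%:E)%E.
  by apply: le_trans h _; rewrite lee_fin gerBl mulr_ge0// ltW.
elim: k => [|k IH].
  rewrite (_ : H 0 = cst 0); last by apply/funext => x; rewrite /H big_ord0.
  by rewrite Lnorm0 ?eqe ?gt_eqF// lee_fin /r expr0 invr1 mulr1 subrr.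
have -> : H k.+1 = (H k \+ (fun x => r k * `|xi k x|)).
  by apply/funext => x; rewrite /H big_ord_recr.
apply: le_trans (minkowski_EFin _ _ _ _) _; [exact: mH| |exact: ltW|].
  by apply: measurable_funM => //; exact: measurableT_comp.
rewrite [leRHS](_ : _ = (3 / 2 - 3 / 2 * r k)%:E + (r k)%:E)%E; last first.
  by rewrite -EFinD rS; congr EFin; field.
apply: leeD => //.
apply: (@le_trans _ _ ((r k)%:E * 'N[mu]_(q%:E)[EFin \o xi k])%E).
  apply: Lnorm_le_scale => // [||x]; first exact: ltW.
    by apply: measurable_funM => //; exact: measurableT_comp.
  by rewrite normrM normr_id gtr0_norm.
rewrite -[leRHS]mule1; apply: lee_wpmul2l; first by rewrite lee_fin ltW.
exact: xi1.
Qed.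

Let Lfun_hump k : hump k \in Lfun mu q%:E.
Proof.
apply/LfunE; split => //; apply: le_lt_trans (ltry (3 / 2)); apply: le_trans (H_norm k).
by apply: (Lnorm_le mu q0 (mhump k) (mH k)) => x; rewrite (le_trans (hump_H k x))// ler_norm.
Qed.

Let pair_add k m c : \int[mu]_x (f k x * (hump m x + c * xi m x)) =
  \int[mu]_x (f k x * hump m x) + c * \int[mu]_x (f k x * xi m x).
Proof.
rewrite -RintegralZl//; last exact: (hoelder_lty p1 pq (fp k) (xiq m)).
rewrite -RintegralD//.
- by apply: eq_Rintegral => x _; rewrite mulrDr mulrCA.
- exact: (hoelder_lty p1 pq (fp k) (Lfun_hump m)).
- have := integrableZl measurableT c (hoelder_lty p1 pq (fp k) (xiq m)).
  by apply: eq_integrable => // x _; rewrite -EFinM.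
Qed.

Let a0 k : 0 <= a k.
Proof. by rewrite -lee_fin; apply: le_trans (fa k); exact: Lnorm_ge0. Qed.

(** For real A and B >= 0, one of |A + B| and |A - B| is at least B; the sign in [hump] selects
    it. *)
Let pair_large k : r k * a k <= `|\int[mu]_x (f k x * hump k.+1 x)|.
Proof.
have E : \int[mu]_x (f k x * hump k.+1 x) = \int[mu]_x (f k x * hump k x) + sgn k * r k * a k.
  rewrite -[in RHS](fxi k) -pair_add; apply: eq_Rintegral => x _; by rewrite humpS mulrA.
rewrite E /sgn; case: ifPn => [h|].
  by rewrite mul1r; move: h; rewrite pair_add fxi.
rewrite -ltNge pair_add fxi; set A := \int[mu]_x _; set B := r k * a k => h.
have B0 : 0 <= B by rewrite mulr_ge0// ltW.
rewrite mulN1r mulNr -/B; move: h; rewrite ltr_norml => /andP[h1 h2].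
by rewrite ler0_norm; lra.
Qed.

Let pair_tail k m : `|\int[mu]_x (f k x * hump (k.+1 + m)%N x) - \int[mu]_x (f k x * hump k.+1 x)| <=
  a k * (r k / 2 - r (k + m)%N / 2).
Proof.
elim: m => [|m IH]; first by rewrite !addn0 !subrr normr0 mulr0.
rewrite addnS humpS.
under eq_Rintegral do rewrite [sgn _ * _]mulrA.
rewrite pair_add addrAC (le_trans (ler_normD _ _))//.
rewrite [leRHS](_ : _ = a k * (r k / 2 - r (k + m)%N / 2) + r (k.+1 + m)%N * a k); last first.
  by rewrite addnS addSn rS; field.
rewrite lerD// normrM normrM sgn1 mul1r gtr0_norm// ler_pM2l//.
by have := hoelder_pairing p1 pq (fp k) (xiq (k.+1 + m)%N) (fa k) (xi1 _); rewrite mulr1.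
Qed.

(** Supremum of the q-th powers of the partial sums of r j |xi j|. By monotone convergence it is
    integrable, so almost everywhere finite: this yields both the absolute convergence of [hump] on
    D and a dominating function in L^q. *)
Let E2 (x : X) : \bar R := ereal_sup (range (fun k => (H k x `^ q)%:E)).

Let H_ge0 k x : 0 <= H k x.
Proof. by apply: sumr_ge0 => j _; rewrite mulr_ge0// ltW. Qed.

Let H_nd x : {homo H ^~ x : m k / (m <= k)%N >-> m <= k}.
Proof.
move=> m k mk; rewrite -(subnKC mk); elim: (k - m)%N => [|j IH]; first by rewrite addn0.
by rewrite addnS /H big_ord_recr /= (le_trans IH)// lerDl mulr_ge0// ltW.
Qed.

Let Hq_nd x : {homo (fun k => (H k x `^ q)%:E) : m k / (m <= k)%N >-> (m <= k)%E}.
Proof. by move=> m k mk; rewrite lee_fin ge0_ler_powR ?nnegrE ?H_nd// ltW. Qed.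

Let Hq_cvg x : (fun k => (H k x `^ q)%:E) @ \oo --> E2 x.
Proof. by apply: ereal_nondecreasing_cvgn; exact: Hq_nd. Qed.

Let mHq k : measurable_fun setT (fun x => (H k x `^ q)%:E).
Proof. by apply/measurable_EFinP; apply: (@measurableT_comp _ _ _ _ _ _ (@powR R ^~ q)). Qed.

Let mE2 : measurable_fun setT E2.
Proof. by apply: (emeasurable_fun_cvg (fun k x => (H k x `^ q)%:E)) => // x _; exact: Hq_cvg. Qed.

Let Hq_E2 k x : ((H k x `^ q)%:E <= E2 x)%E.
Proof. by apply: ereal_sup_ubound; exists k. Qed.

Let E2_ge0 x : (0 <= E2 x)%E.
Proof. by apply: le_trans (Hq_E2 0 x); rewrite lee_fin powR_ge0. Qed.

Let int_Hq k : (\int[mu]_x (H k x `^ q)%:E <= ((3 / 2) `^ q)%:E)%E.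
Proof.
have := H_norm k; rewrite unlock /Lnorm /=.
under eq_integral do rewrite ger0_norm//.
move=> h; rewrite -(@poweRe1 _ (\int[mu]_x (H k x `^ q)%:E)%E); last by apply: integral_ge0 => x _; rewrite lee_fin powR_ge0.
rewrite -[X in (_ `^ X)%E](@mulVf _ q) ?gt_eqF// poweRrM.
rewrite -poweR_EFin; apply: gt0_ler_poweR => //; rewrite ?in_itv/= ?lexx ?andbT ?leey ?poweR_ge0 ?lee_fin//.
  exact: ltW.
by rewrite andbT.
Qed.

Let int_E2 : (\int[mu]_x E2 x < +oo)%E.
Proof.
apply: (@le_lt_trans _ _ ((3 / 2) `^ q)%:E); last exact: ltry.
have c : (\int[mu]_x (H k x `^ q)%:E)%E @[k --> \oo] --> (\int[mu]_x E2 x)%E.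
  under [X in _ --> X]eq_integral do rewrite -(cvg_lim (@ereal_hausdorff R) (@Hq_cvg _)).
  apply: cvg_monotone_convergence => //.
  by move=> k x _; rewrite lee_fin powR_ge0.
rewrite -(cvg_lim (@ereal_hausdorff R) c); apply: lime_le; first by apply: cvgP; exact: c.
by apply: nearW => k; exact: int_Hq.
Qed.

Let D : set X := [set x | (E2 x < +oo)%E].

Let mD : measurable D.
Proof. by have := emeasurable_fun_infty_o measurableT mE2 +oo%E; rewrite setTI. Qed.

Let HD k x : D x -> H k x <= (fine (E2 x)) `^ q^-1.
Proof.
move=> Dx; rewrite -[leLHS](powRr1 (H_ge0 k x)) -(@mulfV _ q) ?gt_eqF// powRrM.
apply: ge0_ler_powR; rewrite ?nnegrE ?powR_ge0 ?invr_ge0 ?fine_ge0 ?E2_ge0//; first exact: ltW.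
by rewrite -lee_fin fineK ?Hq_E2// ge0_fin_numE.
Qed.

Let hump_cvg x : D x -> cvgn (hump ^~ x).
Proof.
move=> Dx; have -> : hump ^~ x = series (fun j => sgn j * (r j * xi j x)).
  apply/funext; elim => [|k IH]; first by rewrite /series /= big_geq.
  by rewrite humpS IH seriesSr.
apply: normed_cvg; have -> : [normed series (fun j => sgn j * (r j * xi j x))] = H ^~ x.
  apply/funext => k; rewrite [LHS]big_mkord /H; apply: eq_bigr => j _ /=.
  by rewrite normrM sgn1 mul1r normrM gtr0_norm.
by apply: (nondecreasing_is_cvgn (H_nd x)); exists ((fine (E2 x)) `^ q^-1) => _ [k _ <-]; exact: HD.
Qed.

Let y x : R := limn (fun k => hump k x * \1_D x).

Let y_cvg x : (fun k => hump k x * \1_D x) @ \oo --> y x.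
Proof.
rewrite /y indicE; case: (boolP (x \in D)) => [|xD].
  by rewrite inE => Dx; under eq_fun do rewrite mulr1; exact: hump_cvg.
by under eq_fun do rewrite mulr0; exact: is_cvg_cst.
Qed.

Let my : measurable_fun setT y.
Proof.
apply: (measurable_fun_cvg _ (fun x _ => @y_cvg x)) => k.
by apply: measurable_funM => //.
Qed.

Let G x : R := (fine (E2 x)) `^ q^-1 * \1_D x.

Let hump_G k x : `|hump k x * \1_D x| <= G x.
Proof.
rewrite normrM /G indicE; case: (boolP (x \in D)) => [|xD]; last by rewrite normr0 !mulr0.
by rewrite inE normr1 !mulr1 => Dx; exact: le_trans (hump_H _ _) (HD _ Dx).
Qed.

Let mG : measurable_fun setT G.
Proof.
apply: measurable_funM; last exact: measurable_indic.
by apply: (@measurableT_comp _ _ _ _ _ _ (@powR R ^~ q^-1)) => //; exact: (measurableT_comp (@fine_measurable _ _ measurableT)).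
Qed.

Let G_ge0 x : 0 <= G x.
Proof. by rewrite mulr_ge0 ?powR_ge0// indicE. Qed.

Let LG : G \in Lfun mu q%:E.
Proof.
apply/LfunE; split => //; rewrite unlock /Lnorm; apply: poweR_lty; apply: le_lt_trans int_E2.
apply: ge0_le_integral => //.
- by move=> x _; rewrite lee_fin powR_ge0.
- by apply/measurable_EFinP; apply: (@measurableT_comp _ _ _ _ _ _ (@powR R ^~ q)) => //; exact: measurableT_comp.
move=> x _ /=; rewrite ger0_norm// /G indicE; case: (boolP (x \in D)) => [|xD].
  rewrite inE mulr1 => Dx; rewrite -powRrM mulVf ?gt_eqF// powRr1 ?fine_ge0//.
  by rewrite fineK// ge0_fin_numE.
by rewrite mulr0 powR0 ?gt_eqF//.
Qed.

Let y_G x : `|y x| <= G x.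
Proof.
have c : `|hump k x * \1_D x| @[k --> \oo] --> `|y x| by exact: cvg_norm.
 rewrite -(cvg_lim (@Rhausdorff R) c).
by apply: limr_le; [exact: cvgP c|apply: nearW => k; exact: hump_G].
Qed.

Let Ly : y \in Lfun mu q%:E.
Proof.
apply/LfunE; split => //; have [_] := (LfunE _ _ _).1 LG; apply: le_lt_trans.
by apply: (Lnorm_le mu q0 my mG) => x; rewrite (le_trans (y_G x))// ler_norm.
Qed.

Let muD : mu (~` D) = 0%E.
Proof.
have i : mu.-integrable setT E2.
  apply/integrableP; split => //; apply: le_lt_trans int_E2.
  by rewrite le_eqVlt; apply/orP; left; apply/eqP; apply: eq_integral => x _; rewrite gee0_abs.
have [B [mB muB sB]] := integrable_ae measurableT i.
apply/eqP; rewrite eq_le measure_ge0 andbT -muB; apply: le_measure; rewrite ?inE//; first exact: measurableC.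
move=> x Dx; apply: sB => /= /(_ I) h; apply: Dx; rewrite /D/= -ge0_fin_numE//.
Qed.

Let pair_lim k : \int[mu]_x (f k x * hump m x) @[m --> \oo] --> \int[mu]_x (f k x * y x).
Proof.
have E m : \int[mu]_x (f k x * hump m x) = \int[mu]_x (f k x * (hump m x * \1_D x)).
  congr fine; apply: ae_eq_integral => //.
  - by apply/measurable_EFinP; exact: measurable_funM.
  - apply/measurable_EFinP; apply: measurable_funM => //; exact: measurable_funM.
  - exists (~` D); split; [exact: measurableC|exact: muD|move=> x /= h Dx; apply: h => _].
    by rewrite indicE mem_set// mulr1.
under eq_fun do rewrite E.
have iG : mu.-integrable setT (EFin \o (fun x => `|f k x| * G x)).
  have := hoelder_lty p1 pq (fp k) LG => /integrable_norm.
  by apply: eq_integrable => // x _ /=; rewrite normrM (ger0_norm (G_ge0 x)).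
have mm m : measurable_fun setT (fun x => f k x * (hump m x * \1_D x)).
  apply: measurable_funM => //; exact: measurable_funM.
have [|||||_ _ c] := @dominated_convergence _ X R mu setT measurableT
  (fun m x => (f k x * (hump m x * \1_D x))%:E) (fun x => (f k x * y x)%:E) (fun x => (`|f k x| * G x)%:E).
- by move=> m; apply/measurable_EFinP.
- by apply/measurable_EFinP; exact: measurable_funM.
- apply: aeW => x _; apply/fine_cvgP; split; first exact: nearW.
  exact: (cvgM (cvg_cst _) (@y_cvg x)).
- exact: iG.
- by apply: aeW => x m _ /=; rewrite lee_fin normrM ler_wpM2l.
- apply: fine_cvg; rewrite fineK//.
  by apply: integrable_fin_num => //; exact: (hoelder_lty p1 pq (fp k) Ly).
Qed.

(** The element y is the almost everywhere limit of [hump]. Its partial sum through index k pairs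
    with f k to at least 3^-k a_k, and the remaining terms contribute at most half of that. *)
Lemma gliding_hump : exists2 y, y \in Lfun mu q%:E &
  forall k, 3 ^- k * a k / 2 <= `|\int[mu]_x (f k x * y x)|.
Proof.
exists y => // k; have c : `|\int[mu]_x (f k x * hump m x)| @[m --> \oo] --> `|\int[mu]_x (f k x * y x)|.
  exact: cvg_norm.
 rewrite -(cvg_lim (@Rhausdorff R) c).
apply: limr_ge; first exact: cvgP c.
exists k.+1 => // m /= km; rewrite -(subnKC km).
have := pair_tail k (m - k.+1); have := pair_large k.
set A := \int[mu]_x _; set B := \int[mu]_x _ => h1 h2.
have h3 := lerB_dist A B; rewrite distrC in h2.
have : 0 <= a k * (r (k + (m - k.+1)) / 2) by rewrite mulr_ge0// divr_ge0// ltW.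
have gen (u v : R) : u * (v / 2) = v * u / 2 by rewrite mulrCA mulrA.
move: h2; rewrite mulrBr (gen _ (r k)) -/(r k).
move: (r k * a k) (a k * (r (k + _) / 2)) `|A| `|B| `|A - B| h1 h3 => e1 e2 e3 e4 e5; lra.
Qed.

End gliding_hump.

Section bounded.
Context d (X : measurableType d) (R : realType) (mu : {sigma_finite_measure set X -> \bar R}).
Variables (p q : R).
Hypothesis p1 : 1 < p.
Hypothesis pq : p^-1 + q^-1 = 1.

(** Uniform boundedness by a gliding hump. If the norms were unbounded near 0, a sequence e_k -> 0
    with fast growing norms and a single y would make the pairings unbounded along it, against their
    convergence. Since e ranges over reals, boundedness is obtained only on some ]0, e0[. *)
Lemma weak_cvg_bounded (f : R -> X -> R) (l : (X -> R) -> R) :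
  (forall e, 0 < e -> f e \in Lfun mu p%:E) ->
  (forall g, g \in Lfun mu q%:E -> \int[mu]_x (f e x * g x) @[e --> 0^'+] --> l g) ->
  exists e0 beta : R, 0 < e0 /\
    forall e, 0 < e < e0 -> (\int[mu]_x (`|f e x| `^ p)%:E <= beta%:E)%E.
Proof.
move=> fp fl; have p0 : 0 < p := lt_trans ltr01 p1.
apply: contrapT => no.
(* The threshold 2 k 3^k compensates the factor 3^-k / 2 of [gliding_hump] and leaves pairings at
   least k. *)
have sel (k : nat) : exists e : R, 0 < e < k.+1%:R^-1 /\
    (((2 * k%:R * 3 ^+ k) `^ p)%:E < \int[mu]_x (`|f e x| `^ p)%:E)%E.
  apply: contrapT => nok; apply: no; exists k.+1%:R^-1, ((2 * k%:R * 3 ^+ k) `^ p).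
  split; first by rewrite invr_gt0.
  by move=> e he; rewrite leNgt; apply/negP => lt; apply: nok; exists e.
have {sel}[e he] := choice sel.
have e0 k : 0 < e k by have [/andP[]] := he k.
pose J k := fine (\int[mu]_x (`|f (e k) x| `^ p)%:E)%E.
have IE k : (\int[mu]_x (`|f (e k) x| `^ p)%:E)%E = (J k)%:E.
  rewrite fineK// ge0_fin_numE; last by apply: integral_ge0 => x _; rewrite lee_fin powR_ge0.
  have [mf] := (LfunE _ _ _).1 (fp _ (e0 k)); rewrite unlock /Lnorm => h.
  by apply: contrapT => /negP; rewrite -leNgt leye_eq => /eqP E; move: h; rewrite E poweRyr// gt_eqF ?invr_gt0.
pose a k := J k `^ p^-1.
have Ia k : J k = a k `^ p by rewrite /a -powRrM mulVf ?gt_eqF// powRr1// -lee_fin -IE; apply: integral_ge0 => x _; rewrite lee_fin powR_ge0.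
have ak k : 2 * k%:R * 3 ^+ k < a k.
  have [_] := he k; rewrite IE lte_fin Ia => h; rewrite ltNge; apply/negP => ka.
  move: h; rewrite ltNge => /negP; apply; apply: ge0_ler_powR; rewrite ?nnegrE ?powR_ge0//; exact: ltW.
have a0 k : 0 < a k by apply: le_lt_trans (ak k); rewrite !mulr_ge0// exprn_ge0.
have [xi hxi] := choice (fun k => dual_element p1 pq (fp _ (e0 k)) (a0 k) (etrans (IE k) (congr1 EFin (Ia k)))).
have [|||||y Ly hy] := @gliding_hump _ X R mu p q (fun k => f (e k)) xi a p1 pq.
- by move=> k; exact: fp.
- by move=> k; rewrite unlock /Lnorm IE poweR_EFin lee_fin.
- by move=> k; have [] := hxi k.
- by move=> k; have [] := hxi k.
- by move=> k; have [] := hxi k.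
have ec : e @ \oo --> 0^'+.
  move=> A [r /= r0 rA].
  have [m _ hm] := near_infty_natSinv_lt (PosNum r0).
  exists m => // k /= mk; apply: rA; last exact: e0.
  have [/andP[_ h] _] := he k; rewrite /= sub0r normrN gtr0_norm//.
  by apply: lt_trans h _; exact: hm.
have c := cvg_comp _ _ ec (fl y Ly).
have /cvg_seq_bounded[B [_ hB]] : cvgn ((fun e => \int[mu]_x (f e x * y x)) \o e) by apply: cvgP; exact: c.
have hb k : k%:R <= `|B| + 1.
  have := hB (`|B| + 1); rewrite (le_lt_trans (ler_norm B)) ?ltrDl// => /(_ isT k I) /=.
  apply: le_trans; apply: le_trans (hy k); rewrite ler_pdivlMr//.
  by rewrite ler_pdivlMl ?exprn_gt0// mulrC [k%:R * 2]mulrC ltW// ak.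
have := hb (Num.bound (`|B| + 1)).
by rewrite leNgt => /negP; apply; apply: archi_boundP; rewrite addr_ge0.
Qed.

End bounded.

(** * Convergence *)

Section mixed_seminorm.
Variables (R : realType) (n : nat) (T p q : R).
Local Notation V := 'rV[R]_n.+1.
Local Notation mu := (lebesgueN R n.+1).
Local Notation leb := (@lebesgue_measure R).
Local Notation TV := (measurableTypeR R * V)%type.
Local Notation I := (`]0, T[%classic : set R).
Local Notation m := ((leb \x mu)%E).
Hypothesis T0 : 0 < T.
Hypothesis p1 : 1 < p.
Hypothesis pq : p^-1 + q^-1 = 1.
Let p0 : 0 < p. Proof. exact: lt_trans p1. Qed.
Let q1 : 1 < q. Proof. exact: q_gt1 p1 pq. Qed.
Let q0 : 0 < q. Proof. exact: lt_trans q1. Qed.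
Let mI : measurable (I : set (measurableTypeR R)). Proof. exact: measurable_itv. Qed.

(** Norm of L^1(0,T;L^q), the predual norm for the bounds in L^oo(0,T;L^p). *)
Definition Nmix (g : TV -> R) : \bar R :=
  (\int[leb]_(t in I) 'N[mu]_(q%:E)[EFin \o (fun x => g (t, x))%R])%E.

Lemma Nmix_ge0 g : (0 <= Nmix g)%E.
Proof. by apply: integral_ge0 => t _; exact: Lnorm_ge0. Qed.

Lemma Nmix_le (g h : TV -> R) : measurable_fun setT g -> measurable_fun setT h ->
  (forall t x, I t -> `|g (t, x)| <= `|h (t, x)|) -> (Nmix g <= Nmix h)%E.
Proof.
move=> mg mh gh; apply: ge0_le_integral => //.
- by move=> t _; exact: Lnorm_ge0.
- by apply: measurable_funTS; exact: measurable_Lnorm_section.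
- by apply: measurable_funTS; exact: measurable_Lnorm_section.
- move=> t It; apply: Lnorm_le => // [||x]; [exact: measurableT_comp|exact: measurableT_comp|exact: gh].
Qed.

Lemma Nmix_dct (h : TV -> R) (h_ : nat -> TV -> R) : measurable_fun setT h -> (Nmix h < +oo)%E ->
  (forall k, measurable_fun setT (h_ k)) ->
  (forall k t x, I t -> `|h_ k (t, x)| <= `|h (t, x)|) ->
  (forall t x, I t -> h_ k (t, x) @[k --> \oo] --> 0) ->
  Nmix (h_ k) @[k --> \oo] --> 0%E.
Proof.
move=> mh hoo mh_ hh h0.
have mi (g : TV -> R) : measurable_fun setT g -> measurable_fun setT (fun z : TV => g z * \1_I z.1).
  by move=> mg; apply: measurable_funM => //; exact: measurable_indT.
have c := @mixed_dct _ _ _ _ R leb mu I q h (fun k z => h_ k z * \1_I z.1) mI q0 mh hoo (fun k => mi _ (mh_ k)).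
have E k : Nmix (h_ k) = (\int[leb]_(t in I) 'N[mu]_(q%:E)[EFin \o (fun x => h_ k (t, x) * \1_I t)%R])%E.
  apply: eq_integral => t tI; congr ('N[mu]_(q%:E)[_])%E; apply/funext => x /=.
  by rewrite indicE tI mulr1.
under eq_fun do rewrite E.
apply: c => [k [t x]|[t x]] /=.
  rewrite normrM indicE; case: (boolP (t \in I)) => [/set_mem tI|_]; last by rewrite normr0 mulr0.
  by rewrite normr1 mulr1; exact: hh.
rewrite indicE; case: (boolP (t \in I)) => [/set_mem tI|_].
  by under eq_fun do rewrite mulr1; exact: h0.
by under eq_fun do rewrite mulr0; exact: cvg_cst.
Qed.

Lemma Nmix_compact (K : set V) (c : R) : measurable K -> (mu K < +oo)%E ->
  (Nmix (fun z => c * \1_K z.2)%R < +oo)%E.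
Proof.
move=> mK muK; rewrite /Nmix /=.
rewrite integral_cst//.
have /= -> := @lebesgue_measure_itv R `]0, T[; rewrite lte_fin T0 sube0.
rewrite lte_mul_pinfty// ?Lnorm_ge0// ?ltry//.
rewrite ge0_fin_numE ?Lnorm_ge0// LnormE; apply: poweR_lty.
rewrite (_ : (fun x : V => _) = (fun x => (`|c| `^ q * \1_K x)%:E)); last first.
  apply/funext => x; rewrite indicE; case: (x \in K); first by rewrite !mulr1.
  by rewrite !mulr0 normr0 powR0// gt_eqF.
under eq_integral do rewrite EFinM.
rewrite ge0_integralZl//; last by apply/measurable_EFinP; exact: measurable_indic.
by rewrite integral_indic// setIT lte_mul_pinfty// ?lee_fin ?powR_ge0.
Qed.

Lemma mixed_integrable (C : R) (f g : TV -> R) : 0 <= C -> measurable_fun setT f ->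
  (forall t x, ~ I t -> f (t, x) = 0) -> measurable_fun setT g ->
  (\forall t \ae leb, I t -> ('N[mu]_(p%:E)[EFin \o (fun x => f (t, x))] <= C%:E)%E) ->
  (Nmix g < +oo)%E -> m.-integrable setT (EFin \o (fun z => f z * g z)).
Proof.
move=> C0 mf f0 mg fC goo; apply/integrable_lty; first exact: measurable_funM.
have := @hoelder_mixed _ _ _ _ R leb mu I p q C f g mI p0 q0 pq mf mg C0 fC.
rewrite (_ : (\int[m]_z (`|f z * g z * \1_I z.1|)%:E)%E = (\int[m]_z (`|f z * g z|)%:E)%E).
  by move=> /le_lt_trans; apply; rewrite lte_mul_pinfty// ge0_fin_numE ?Nmix_ge0.
apply: eq_integral => -[t x] _ /=; rewrite indicE; case: (boolP (t \in I)) => tI; first by rewrite mulr1.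
by rewrite f0 ?mul0r// => /mem_set h; rewrite h in tI.
Qed.

Lemma mixed_pairing (C : R) (f g : TV -> R) : 0 <= C -> measurable_fun setT f ->
  (forall t x, ~ I t -> f (t, x) = 0) -> measurable_fun setT g ->
  (\forall t \ae leb, I t -> ('N[mu]_(p%:E)[EFin \o (fun x => f (t, x))] <= C%:E)%E) ->
  (Nmix g < +oo)%E -> (`|\int[m]_z (f z * g z)|%:E <= C%:E * Nmix g)%E.
Proof.
move=> C0 mf f0 mg fC goo; have i := mixed_integrable C0 mf f0 mg fC goo.
rewrite EFin_normr_Rintegral//.
apply: (@le_trans _ _ (\int[m]_z (`|f z * g z|)%:E)%E).
  by apply: le_abse_integral => //; case/integrableP: i.
apply: le_trans (@hoelder_mixed _ _ _ _ R leb mu I p q C f g mI p0 q0 pq mf mg C0 fC).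
rewrite le_eqVlt; apply/orP; left; apply/eqP.
apply: eq_integral => -[t x] _ /=; rewrite indicE; case: (boolP (t \in I)) => tI; first by rewrite mulr1.
by rewrite f0 ?mul0r// => /mem_set h; rewrite h in tI.
Qed.

End mixed_seminorm.

(** * Identity and bound for a solution of the transport equation *)

Section transported.
Variables (R : realType) (n : nat) (T p q c : R).
Local Notation V := 'rV[R]_n.+1.
Local Notation mu := (lebesgueN R n.+1).
Local Notation leb := (@lebesgue_measure R).
Local Notation TV := (measurableTypeR R * V)%type.
Local Notation I := (`]0, T[%classic : set R).
Local Notation m := ((leb \x mu)%E).
Variables (w : V -> V) (s : V -> R) (bb S : V -> V) (u : R -> V -> R) (u0 : V -> R).
Hypothesis T0 : 0 < T.
Hypothesis p1 : 1 < p.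
Hypothesis pq : p^-1 + q^-1 = 1.
Hypothesis w1 : Cnv 1 w.
Hypothesis s1 : Cn 1 s.
Hypothesis pw : forall r : R, exists2 K : set V, compact K & forall x, `|w x| <= r -> K x.
Hypothesis sb : forall x, s x *: bb x = S x.
Hypothesis S1 : Cnv 1 S.
Hypothesis divS : forall x, divergence S x = 0.
Hypothesis Sw : forall x j, dotv (grad (comp_of w j) x) (S x) = if j == ord0 then s x else 0.
Hypothesis sc : forall x, `|s x| <= c.

Let ms : measurable_fun setT s.
Proof. by apply: continuous_measurable_rV; exact: Cn_continuous s1. Qed.

Let cw : continuous w.
Proof. by apply: continuous_rV => j; exact: Cn_continuous (w1 j). Qed.

Let mscale (f : R -> V -> R) : measurable_fun setT (extQ T f) ->
  measurable_fun setT (extQ T (fun t x => s x * f t x)).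
Proof.
move=> mf; rewrite (_ : extQ T _ = fun z => s z.2 * extQ T f z).
  by apply: measurable_funM => //; exact: measurableT_comp.
by apply/funext => z; rewrite /extQ mulrA.
Qed.

Let locscale (f : R -> V -> R) (K : set V) : measurable_fun setT (extQ T f) -> compact K ->
  m.-integrable setT (EFin \o (fun z => extQ T f z * \1_K z.2)) ->
  m.-integrable setT (EFin \o (fun z => extQ T (fun t x => s x * f t x) z * \1_K z.2)).
Proof.
move=> mf cK i.
have mK : measurable_fun setT (fun z : TV => \1_K z.2 : R).
  by apply: (@measurableT_comp _ _ _ _ _ _ (\1_K : V -> R)) => //; apply: measurable_indic; exact: compact_measurable_rV.
have i' : m.-integrable setT (EFin \o (fun z => c * (extQ T f z * \1_K z.2))).
  have := integrableZl measurableT c i.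
  by apply: eq_integrable => // z _; rewrite /= EFinM.
apply: integrable_ler i'; first by apply: measurable_funM => //; exact: mscale.
move=> z; rewrite /extQ; have gen (a b d e : R) : a * b * d * e = a * (b * d * e) by ring.
by rewrite gen normrM [leRHS]normrM ler_wpM2r// (le_trans (sc _))// ler_norm.
Qed.

Let loc0scale (f : V -> R) (K : set V) : measurable_fun setT f -> compact K ->
  mu.-integrable setT (EFin \o (fun x => f x * \1_K x)) ->
  mu.-integrable setT (EFin \o (fun x => s x * f x * \1_K x)).
Proof.
move=> mf cK i; have mK := compact_measurable_rV cK.
have i' : mu.-integrable setT (EFin \o (fun x => c * (f x * \1_K x))).
  have := integrableZl measurableT c i.
  by apply: eq_integrable => // z _; rewrite /= EFinM.
apply: integrable_ler i'.
  by apply: measurable_funM; [exact: measurable_funM|exact: measurable_indic].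
by move=> x; rewrite -mulrA normrM [leRHS]normrM ler_wpM2r// (le_trans (sc _))// ler_norm.
Qed.

(** The straightening identity for the solution 1, whose weighted form is s itself at all times.
    Nonnegativity of s allows h of infinite integral. *)
Lemma sigma_invariant (h : TV -> R) : (forall x, 0 <= s x) -> measurable_fun setT h -> (forall z, 0 <= h z) ->
  (\int[m]_z (extQ T (fun=> s) z * h (shiftW w z))%:E = \int[m]_z (extQ T (fun=> s) z * h (baseW w z))%:E)%E.
Proof.
move=> s0 mh h0; have E : s = (fun x => s x * 1) by apply/funext => x; rewrite mulr1.
have m1 : measurable_fun setT (extQ T (fun _ (_ : V) => 1)).
  by apply: measurable_funM => //; exact: measurable_indT.
have l1 := @loc_cst R n T.
have l0 (K : set V) : compact K -> mu.-integrable setT (EFin \o (fun x => 1 * \1_K x)).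
  move=> cK; apply: (@eq_integrable _ _ _ mu setT _ (EFin \o \1_K)) => //; first by move=> x _ /=; rewrite mul1r.
  apply: (@integrable_bounded_compact _ _ _ K 1) => //.
  - exact: measurable_indic (compact_measurable_rV cK).
  - by move=> x; rewrite indicE; case: (_ \in _); rewrite ?normr1 ?normr0.
  - by move=> x Kx; rewrite indicE memNset.
rewrite E; apply: straight_ge0 => //.
- exact: mscale.
- by apply: measurable_funM.
- by move=> K cK; apply: locscale => //; exact: l1.
- by move=> K cK; apply: (loc0scale _ cK (l0 K cK)); exact: measurable_cst.
- move=> tau k a b tauT; apply: (@testf_weak _ _ T) => //.
  exact: (testf_classical _ _ _ sb).
- by move=> t x; rewrite mulr1.
- by move=> x; rewrite mulr1.
Qed.

Hypothesis u0p : u0 \in Lfun mu p%:E.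
Hypothesis sol : transport_solution T p bb u0 u.

Lemma Linfty_Lp_ext (v : R -> V -> R) : Linfty_Lp T p v -> measurable_fun setT (extQ T v) /\
  exists2 C : R, 0 <= C & \forall t \ae leb, I t -> ('N[mu]_(p%:E)[EFin \o (fun x => extQ T v (t, x))] <= C%:E)%E.
Proof.
move=> [mv [C hC]]; split; first exact: measurable_extQ.
exists `|C| => //; have FF : Filter (almost_everywhere leb) by exact: ae_filter_ringOfSetsType.
move: hC; apply: (@filterS _ _ FF) => t h It.
rewrite (_ : (fun x => extQ T v (t, x)) = v t).
  by apply: le_trans (h It) _; rewrite lee_fin ler_norm.
by apply/funext => x; rewrite /extQ /= indicE mem_set ?mulr1.
Qed.

Lemma extQ_out (v : R -> V -> R) t x : ~ I t -> extQ T v (t, x) = 0.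
Proof. by move=> It; rewrite /extQ indicE memNset ?mulr0. Qed.

Let muq : measurable_fun setT (extQ T u). Proof. by have [] := Linfty_Lp_ext sol.1. Qed.

Let locu (K : set V) : compact K -> m.-integrable setT (EFin \o (fun z => extQ T u z * \1_K z.2)).
Proof.
move=> cK; have [_ [C C0 hC]] := Linfty_Lp_ext sol.1; have mK := compact_measurable_rV cK.
have mK2 : measurable_fun setT (fun z : TV => \1_K z.2 : R).
  by apply: (@measurableT_comp _ _ _ _ _ _ (\1_K : V -> R)) => //; exact: measurable_indic.
have Nk := Nmix_compact T0 p1 pq 1 mK (compact_lebesgueN_lty cK).
have E1 : (fun z : TV => 1 * \1_K z.2 : R) = (fun z : TV => \1_K z.2).
  by apply/funext => z; rewrite mul1r.
by rewrite E1 in Nk; exact: (mixed_integrable p1 pq C0 muq (@extQ_out u) mK2 hC Nk).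
Qed.

Let mu0 : measurable_fun setT u0. Proof. by have [] := (LfunE _ _ _).1 u0p. Qed.

Let locu0 (K : set V) : compact K -> mu.-integrable setT (EFin \o (fun x => u0 x * \1_K x)).
Proof.
move=> cK; have mK := compact_measurable_rV cK.
have := Lfun_integrable_finite (ltW p1) u0p mK (compact_lebesgueN_lty cK).
by rewrite patch_indic.
Qed.

(** The weak formulation of u is tested with [testf], whose divergence term is computed in
    [div_testf]; [straight_identity] extends the outcome to measurable h. *)
Lemma transport_identity (h : TV -> R) : measurable_fun setT h ->
  m.-integrable setT (EFin \o (fun z => extQ T (fun t x => s x * u t x) z * h (shiftW w z))) ->
  m.-integrable setT (EFin \o (fun z => extQ T (fun=> (fun x => s x * u0 x)) z * h (baseW w z))) ->
  \int[m]_z (extQ T (fun t x => s x * u t x) z * h (shiftW w z)) =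
  \int[m]_z (extQ T (fun=> (fun x => s x * u0 x)) z * h (baseW w z)).
Proof.
apply: straight_identity => //.
- exact: mscale.
- exact: measurable_funM.
- by move=> K cK; apply: locscale => //; exact: locu.
- by move=> K cK; apply: loc0scale => //; exact: locu0.
- move=> tau k a b tauT; apply: (@testf_weak _ _ T) => //.
  rewrite sol.2; last exact: testf_C1c.
  congr (int_tx T _); apply/funext => t; apply/funext => x; congr (_ * _).
  exact: (div_testf a b k tau w1 sb S1 divS Sw).
Qed.

Lemma Lfun_scale : (fun x => s x * u0 x) \in Lfun mu p%:E.
Proof.
have [_ h] := (LfunE _ _ _).1 u0p.
have c0 : 0 <= c := le_trans (normr_ge0 _) (sc 0).
apply/LfunE; split; first exact: measurable_funM.
apply: (@le_lt_trans _ _ (c%:E * 'N[mu]_(p%:E)[EFin \o u0])%E); last first.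
  by rewrite lte_mul_pinfty// ge0_fin_numE ?Lnorm_ge0.
apply: Lnorm_le_scale => // [||x]; [exact: lt_trans p1|exact: measurable_funM|].
by rewrite normrM ler_wpM2r.
Qed.

Variables (g : V -> V) (beta : R).
Hypothesis mg : measurable_fun setT g.
Hypothesis wK : cancel w g.
Hypothesis c1 : 1 < c.
Hypothesis sV : forall x, c^-1 <= s x.
Hypothesis v0beta : (\int[mu]_x (`|s x * u0 x| `^ p)%:E <= beta%:E)%E.

Lemma transport_bound : \forall t \ae leb, I t ->
  ('N[mu]_(p%:E)[EFin \o (fun x => extQ T (fun t x => s x * u t x) (t, x))%R] <=
   ((c `^ (2 * (p - 1)) * beta) `^ p^-1)%:E)%E.
Proof.
have s0 x : 0 <= s x by apply: le_trans (sV x); rewrite invr_ge0 (le_trans ler01)// ltW.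
have [_ [C C0 hC]] := Linfty_Lp_ext sol.1.
apply: (@uniform_bound _ _ T p q c w g s (extQ T (fun t x => s x * u t x)) (fun x => s x * u0 x) (c * C) beta) => //.
- exact: measurable_continuous_field.
- by move=> x; rewrite sV -(ger0_norm (s0 x)) sc.
- exact: mscale.
- exact: extQ_out.
- exact: measurable_funM.
- have FF : Filter (almost_everywhere leb) by exact: ae_filter_ringOfSetsType.
  move: hC; apply: (@filterS _ _ FF) => t h It.
  have c0 : 0 <= c := le_trans (normr_ge0 _) (sc 0).
  apply: (@le_trans _ _ (c%:E * 'N[mu]_(p%:E)[EFin \o (fun x => extQ T u (t, x))])%E).
    apply: Lnorm_le_scale => // [|||x].
    + exact: lt_trans p1.
    + exact: (measurableT_comp muq).
    + by apply: (measurableT_comp (mscale muq)).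
    + by rewrite /extQ -mulrA normrM ler_wpM2r.
  by rewrite EFinM; apply: lee_wpmul2l; rewrite ?lee_fin//; exact: h.
- by move=> h mh h0; apply: sigma_invariant.
- by move=> h mh i1 i2; apply: transport_identity.
Qed.

End transported.

Section convergence.
Variables (R : realType) (n : nat) (T p q : R).
Local Notation V := 'rV[R]_n.+1.
Local Notation mu := (lebesgueN R n.+1).
Local Notation leb := (@lebesgue_measure R).
Local Notation TV := (measurableTypeR R * V)%type.
Local Notation I := (`]0, T[%classic : set R).
Local Notation m := ((leb \x mu)%E).
Variables (wl : V -> V) (w_ : R -> V -> V) (v_ : R -> R -> V -> R) (v0_ : R -> V -> R).
Variables (v : R -> V -> R) (v0 : V -> R) (C0 C e0 : R).
Hypothesis T0 : 0 < T.
Hypothesis p1 : 1 < p.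
Hypothesis pq : p^-1 + q^-1 = 1.
Hypothesis e0_gt0 : 0 < e0.
Hypothesis cwl : continuous wl.
Hypothesis cw : forall e, 0 < e < e0 -> continuous (w_ e).
Hypothesis w_cvg : forall x, w_ e x @[e --> 0^'+] --> wl x.
Hypothesis pw : forall r : R, exists2 K : set V, compact K &
  forall x, `|wl x| <= r \/ (exists2 e, 0 < e < e0 & `|w_ e x| <= r) -> K x.
Hypothesis C_ge0 : 0 <= C.
Hypothesis C0_ge0 : 0 <= C0.
Hypothesis mv_ : forall e, 0 < e < e0 -> measurable_fun setT (extQ T (v_ e)).
Hypothesis mv : measurable_fun setT (extQ T v).
Hypothesis v_C : forall e, 0 < e < e0 -> \forall t \ae leb, I t ->
  ('N[mu]_(p%:E)[EFin \o (fun x => extQ T (v_ e) (t, x))%R] <= C%:E)%E.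
Hypothesis v_bound : \forall t \ae leb, I t ->
  ('N[mu]_(p%:E)[EFin \o (fun x => extQ T v (t, x))%R] <= C%:E)%E.
Hypothesis mv0_ : forall e, 0 < e < e0 -> measurable_fun setT (v0_ e).
Hypothesis mv0 : measurable_fun setT v0.
Hypothesis v0_C : forall e, 0 < e < e0 -> ('N[mu]_(p%:E)[EFin \o v0_ e] <= C0%:E)%E.
Hypothesis v0_bound : ('N[mu]_(p%:E)[EFin \o v0] <= C0%:E)%E.
Hypothesis v0_weak : forall h, h \in Lfun mu q%:E ->
  \int[mu]_x (v0_ e x * h x) @[e --> 0^'+] --> \int[mu]_x (v0 x * h x).
Hypothesis identity_ : forall e, 0 < e < e0 -> forall h : TV -> R, measurable_fun setT h ->
  m.-integrable setT (EFin \o (fun z => extQ T (v_ e) z * h (shiftW (w_ e) z))) ->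
  m.-integrable setT (EFin \o (fun z => extQ T (fun=> v0_ e) z * h (baseW (w_ e) z))) ->
  \int[m]_z (extQ T (v_ e) z * h (shiftW (w_ e) z)) = \int[m]_z (extQ T (fun=> v0_ e) z * h (baseW (w_ e) z)).
Hypothesis identity : forall h : TV -> R, measurable_fun setT h ->
  m.-integrable setT (EFin \o (fun z => extQ T v z * h (shiftW wl z))) ->
  m.-integrable setT (EFin \o (fun z => extQ T (fun=> v0) z * h (baseW wl z))) ->
  \int[m]_z (extQ T v z * h (shiftW wl z)) = \int[m]_z (extQ T (fun=> v0) z * h (baseW wl z)).

Let p0 : 0 < p. Proof. exact: lt_trans p1. Qed.
Let q1 : 1 < q. Proof. exact: q_gt1 p1 pq. Qed.
Let q0 : 0 < q. Proof. exact: lt_trans q1. Qed.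
Local Notation Nm := (Nmix T q).

Let pair_C e h : 0 < e < e0 -> measurable_fun setT h -> (Nm h < +oo)%E ->
  m.-integrable setT (EFin \o (fun z => extQ T (v_ e) z * h z)) /\
  (`|\int[m]_z (extQ T (v_ e) z * h z)|%:E <= C%:E * Nm h)%E.
Proof.
move=> ee mh hoo; split.
- exact: (mixed_integrable p1 pq C_ge0 (mv_ ee) (@extQ_out _ _ _ _) mh (v_C ee) hoo).
- exact: (mixed_pairing p1 pq C_ge0 (mv_ ee) (@extQ_out _ _ _ _) mh (v_C ee) hoo).
Qed.

Let pair_v h : measurable_fun setT h -> (Nm h < +oo)%E ->
  m.-integrable setT (EFin \o (fun z => extQ T v z * h z)) /\
  (`|\int[m]_z (extQ T v z * h z)|%:E <= C%:E * Nm h)%E.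
Proof.
move=> mh hoo; split.
- exact: (mixed_integrable p1 pq C_ge0 mv (@extQ_out _ _ _ _) mh v_bound hoo).
- exact: (mixed_pairing p1 pq C_ge0 mv (@extQ_out _ _ _ _) mh v_bound hoo).
Qed.

Let pair_cst (f : V -> R) h : measurable_fun setT f -> ('N[mu]_(p%:E)[EFin \o f] <= C0%:E)%E ->
  measurable_fun setT h -> (Nm h < +oo)%E ->
  m.-integrable setT (EFin \o (fun z => extQ T (fun=> f) z * h z)) /\
  (`|\int[m]_z (extQ T (fun=> f) z * h z)|%:E <= C0%:E * Nm h)%E.
Proof.
move=> mf fC mh hoo.
have mF : measurable_fun setT (extQ T (fun=> f)).
  by apply: measurable_funM; [exact: measurableT_comp|exact: measurable_indT].
have FC : \forall t \ae leb, I t -> ('N[mu]_(p%:E)[EFin \o (fun x => extQ T (fun=> f) (t, x))%R] <= C0%:E)%E.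
  apply: aeW => t It; rewrite (_ : (fun x => extQ T (fun=> f) (t, x)) = f)//.
  by apply/funext => x; rewrite /extQ /= indicE mem_set ?mulr1.
split.
- exact: (mixed_integrable p1 pq C0_ge0 mF (@extQ_out _ _ _ _) mh FC hoo).
- exact: (mixed_pairing p1 pq C0_ge0 mF (@extQ_out _ _ _ _) mh FC hoo).
Qed.

Let nm_squeeze (Y : nat -> R) (F : nat -> TV -> R) (B : R) : 0 <= B ->
  (forall j, (`|Y j|%:E <= B%:E * Nm (F j))%E) -> Nm (F j) @[j --> \oo] --> 0%E -> Y @ \oo --> 0.
Proof.
move=> B0 YF Fc; apply: norm_cvg0.
have c : (B%:E * Nm (F j))%E @[j --> \oo] --> 0%E.
  by rewrite -(mule0 B%:E); apply: cvgeZl.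
have c' : (`|Y j|%:E)%E @[j --> \oo] --> 0%E.
  by apply: (squeeze_cvge _ (cvg_cst 0%E) c); apply: nearW => j; rewrite YF lee_fin normr_ge0.
exact: (fine_cvg c').
Qed.

Section bump_test.
Variables (s : R) (a b : 'I_n.+1 -> R) (k : nat).

(** Continuity in space is what counts, since only the spatial argument changes when w_e is replaced
    by its limit; in time a sharp indicator is kept, which [tboxes] calls for. *)
Let G (z : TV) : R := \1_(`]-oo, s[%classic) z.1 * pbump a b k z.2.

Let mG : measurable_fun setT G.
Proof.
apply: measurable_funM.
  apply: (@measurableT_comp _ _ _ _ _ _ (\1_(`]-oo, s[%classic) : measurableTypeR R -> R)) => //.
apply: (@measurableT_comp _ _ _ _ _ _ (pbump a b k)) => //.
by apply: continuous_measurable_rV; exact: Cn_continuous (pbump_C1 a b k).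
Qed.

Let G01 z : 0 <= G z <= 1.
Proof.
rewrite /G; have /andP[h0 h1] := pbump_itv a b k z.2; rewrite indicE.
by case: (_ \in _); rewrite ?mul1r ?mul0r ?h0 ?h1// lexx ler01.
Qed.

Let support : exists K : set V, [/\ compact K, forall t x, I t -> ~ K x -> G (shiftW wl (t, x)) = 0 /\ G (baseW wl (t, x)) = 0 &
  forall e t x, 0 < e < e0 -> I t -> ~ K x -> G (shiftW (w_ e) (t, x)) = 0 /\ G (baseW (w_ e) (t, x)) = 0].
Proof.
have [B cB sB] := obox_compact a b.
have [r [_ /(_ (r + 1) (ltr_pwDr ltr01 (lexx _))) Bq]] := compact_bounded cB.
have [K cK hK] := pw (r + 1 + T).
have key (y : V) (t t' : R) : 0 <= t <= T -> r + 1 + T < `|y| -> G (t', y + t *: evec R ord0) = 0.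
  move=> /andP[t0 tT] yr; rewrite /G pbump_out ?mulr0// => /sB /Bq /= h.
  move: yr; rewrite ltNge => /negP; apply.
  rewrite -[y](addrK (t *: evec R ord0)) (le_trans (ler_normB _ _))// lerD//.
  by rewrite normrZ ger0_norm// (le_trans _ tT)// -[leRHS]mulr1 ler_wpM2l// norm_evec.
exists K; split => //.
- move=> t x; rewrite /= in_itv /= => /andP[t0 tT] Kx.
  have yr : r + 1 + T < `|wl x| by rewrite ltNge; apply/negP => h; apply: Kx; apply: hK; left.
  split; first by apply: key; rewrite // !ltW.
  by have := key _ 0 t _ yr; rewrite scale0r addr0; apply; rewrite lexx ltW.
- move=> e t x ee; rewrite /= in_itv /= => /andP[t0 tT] Kx.
  have yr : r + 1 + T < `|w_ e x| by rewrite ltNge; apply/negP => h; apply: Kx; apply: hK; right; exists e.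
  split; first by apply: key; rewrite // !ltW.
  by have := key _ 0 t _ yr; rewrite scale0r addr0; apply; rewrite lexx ltW.
Qed.

Let mphi (P : TV -> TV) : measurable_fun setT P -> measurable_fun setT (fun z => G (P z)).
Proof. by move=> mP; exact: measurableT_comp. Qed.

Let Noo (P : TV -> TV) (K : set V) : measurable_fun setT P -> compact K ->
  (forall t x, I t -> ~ K x -> G (P (t, x)) = 0) -> (Nm (fun z => G (P z)) < +oo)%E.
Proof.
move=> mP cK off; have mK := compact_measurable_rV cK.
apply: le_lt_trans (Nmix_compact T0 p1 pq 1 mK (compact_lebesgueN_lty cK)).
apply: (@Nmix_le R n T p q p1 pq) => //; first exact: mphi.
  by apply: measurable_funM => //; apply: (@measurableT_comp _ _ _ _ _ _ (\1_K : V -> R)).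
move=> t x It /=; rewrite indicE; have [Kx|Kx] := pselect (K x); last by rewrite off// normr0.
by rewrite mem_set// mulr1 normr1; have /andP[h0 h1] := G01 (P (t, x)); rewrite ger0_norm.
Qed.

Let Gsub (P P' : TV -> TV) (K : set V) : (forall t x, I t -> ~ K x -> G (P (t, x)) = 0) ->
  (forall t x, I t -> ~ K x -> G (P' (t, x)) = 0) -> forall t x, I t ->
  `|G (P (t, x)) - G (P' (t, x))| <= `|1 * \1_K x|.
Proof.
move=> off off_ t x It; rewrite indicE; have [Kx|Kx] := pselect (K x); last first.
  by rewrite off// off_// subrr normr0.
rewrite mem_set// mulr1 normr1.
have := G01 (P (t, x)); have := G01 (P' (t, x)); move: (G _) (G _) => g1 g2 /andP[? ?] /andP[? ?].
by rewrite ler_norml; apply/andP; split; lra.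
Qed.

Let Nsub_oo (P P' : TV -> TV) (K : set V) : measurable_fun setT P -> measurable_fun setT P' -> compact K ->
  (forall t x, I t -> ~ K x -> G (P (t, x)) = 0) -> (forall t x, I t -> ~ K x -> G (P' (t, x)) = 0) ->
  (Nm (fun z => G (P z) - G (P' z))%R < +oo)%E.
Proof.
move=> mP mP' cK off off'; have mK := compact_measurable_rV cK.
apply: le_lt_trans (Nmix_compact T0 p1 pq 1 mK (compact_lebesgueN_lty cK)).
apply: (@Nmix_le R n T p q p1 pq) => //; first by apply: measurable_funB; exact: mphi.
  by apply: measurable_funM => //; apply: (@measurableT_comp _ _ _ _ _ _ (\1_K : V -> R)).
exact: Gsub.
Qed.

Let Nsub_cvg (P_ : nat -> TV -> TV) (P : TV -> TV) (K : set V) :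
  (forall j, measurable_fun setT (P_ j)) -> measurable_fun setT P -> compact K ->
  (forall t x, I t -> ~ K x -> G (P (t, x)) = 0) ->
  (forall j t x, I t -> ~ K x -> G (P_ j (t, x)) = 0) ->
  (forall t x, G (P_ j (t, x)) @[j --> \oo] --> G (P (t, x))) ->
  Nm (fun z => G (P z) - G (P_ j z)) @[j --> \oo] --> 0%E.
Proof.
move=> mP_ mP cK off off_ cv; have mK := compact_measurable_rV cK.
apply: (@Nmix_dct R n T p q p1 pq (fun z => 1 * \1_K z.2)).
- by apply: measurable_funM => //; apply: (@measurableT_comp _ _ _ _ _ _ (\1_K : V -> R)).
- exact: (Nmix_compact T0 p1 pq 1 mK (compact_lebesgueN_lty cK)).
- by move=> j; apply: measurable_funB; exact: mphi.
- by move=> j; apply: Gsub => //; exact: off_.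
- by move=> t x It /=; rewrite -[X in _ --> X](subrr (G (P (t, x)))); apply: cvgB => //; exact: cvg_cst.
Qed.

Let G_cvg (y_ : nat -> V) (y : V) t : y_ @ \oo --> y -> G (t, y_ j) @[j --> \oo] --> G (t, y).
Proof.
move=> yc; have h : pbump a b k (y_ j) @[j --> \oo] --> pbump a b k y.
  by apply: (cvg_comp _ _ yc); exact: (Cn_continuous (pbump_C1 a b k)).
exact: (cvgM (cvg_cst _) h).
Qed.

Let pb_Lfun : (fun x => pbump a b k (wl x)) \in Lfun mu q%:E.
Proof.
have [B cB sB] := obox_compact a b.
have [r [_ /(_ (r + 1) (ltr_pwDr ltr01 (lexx _))) Bq]] := compact_bounded cB.
have [K cK hK] := pw (r + 1).
have mK := compact_measurable_rV cK.
apply: (@bounded_support_Lfun _ _ _ _ q _ K 1) => //.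
- exact: compact_lebesgueN_lty.
- apply: measurableT_comp; last exact: measurable_continuous_field.
  by apply: continuous_measurable_rV; exact: Cn_continuous (pbump_C1 a b k).
- by move=> x; have /andP[h0 h1] := pbump_itv a b k (wl x); rewrite ger0_norm.
- by move=> x Kx; apply: pbump_out => /sB/Bq /= h; apply: Kx; apply: hK; left.
Qed.

Let int_base (f : V -> R) : f \in Lfun mu p%:E ->
  \int[m]_z (extQ T (fun=> f) z * G (baseW wl z)) =
  (\int[leb]_t (\1_I t * \1_(`]-oo, s[%classic) t)) * \int[mu]_x (f x * pbump a b k (wl x)).
Proof.
move=> fp.
have ip := pb_Lfun.
rewrite -(@Rintegral_separated _ _ _ _ R leb mu (fun t => \1_I t * \1_(`]-oo, s[%classic) t) (fun x => f x * pbump a b k (wl x))).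
- by apply: eq_Rintegral => -[t x] _; rewrite /extQ /G /=; ring.
- apply: integrable_ler (integrable_itv T) => [|t]; first exact: measurable_funM.
  by rewrite normrM ler_piMr// indicE; case: (_ \in _); rewrite ?normr1 ?normr0.
- exact: (hoelder_lty p1 pq fp ip).
Qed.

Let LG e := \int[m]_z (extQ T (v_ e) z * G (shiftW wl z)) - \int[m]_z (extQ T v z * G (shiftW wl z)).

Let X1 e := \int[m]_z (extQ T (v_ e) z * (G (shiftW wl z) - G (shiftW (w_ e) z))).
Let X0 e := \int[m]_z (extQ T (fun=> v0_ e) z * (G (baseW wl z) - G (baseW (w_ e) z))).
Let X2 e := \int[m]_z (extQ T (fun=> v0_ e) z * G (baseW wl z)) - \int[m]_z (extQ T (fun=> v0) z * G (baseW wl z)).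

Let Lfun0 : v0 \in Lfun mu p%:E.
Proof. by apply/LfunE; split => //; exact: le_lt_trans v0_bound (ltry _). Qed.

Let Lfun0_ e : 0 < e < e0 -> v0_ e \in Lfun mu p%:E.
Proof. by move=> ee; apply/LfunE; split; [exact: mv0_|exact: le_lt_trans (v0_C ee) (ltry _)]. Qed.

Let mshift w : continuous w -> measurable_fun setT (shiftW w : TV -> TV).
Proof. exact: measurable_shiftW. Qed.

Let mbase w : continuous w -> measurable_fun setT (baseW w : TV -> TV).
Proof. exact: measurable_baseW. Qed.

(** Starting from v_e tested at the limit shift: move to the shift of w_e at the price X1, apply the
    identity of w_e, move the base points back to the limit map at the price X0, replace the initial
    datum at the price X2, and apply the identity of the limit problem. *)
Let LGE e : 0 < e < e0 -> LG e = X1 e - X0 e + X2 e.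
Proof.
move=> ee; have [K [cK off off_]] := support.
have N1 := Noo (mshift cwl) cK (fun t x It Kx => (off t x It Kx).1).
have N2 := Noo (mbase cwl) cK (fun t x It Kx => (off t x It Kx).2).
have N3 := Noo (mshift (cw ee)) cK (fun t x It Kx => (off_ e t x ee It Kx).1).
have N4 := Noo (mbase (cw ee)) cK (fun t x It Kx => (off_ e t x ee It Kx).2).
have [i1 _] := pair_C ee (mphi (mshift cwl)) N1.
have [i3 _] := pair_C ee (mphi (mshift (cw ee))) N3.
have [i2 _] := pair_cst (mv0_ ee) (v0_C ee) (mphi (mbase cwl)) N2.
have [i4 _] := pair_cst (mv0_ ee) (v0_C ee) (mphi (mbase (cw ee))) N4.
have [i5 _] := pair_v (mphi (mshift cwl)) N1.
have [i6 _] := pair_cst mv0 v0_bound (mphi (mbase cwl)) N2.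
have E1 : X1 e = \int[m]_z (extQ T (v_ e) z * G (shiftW wl z)) - \int[m]_z (extQ T (v_ e) z * G (shiftW (w_ e) z)).
  by rewrite -RintegralB//; apply: eq_Rintegral => z _; rewrite mulrBr.
have E0 : X0 e = \int[m]_z (extQ T (fun=> v0_ e) z * G (baseW wl z)) - \int[m]_z (extQ T (fun=> v0_ e) z * G (baseW (w_ e) z)).
  by rewrite -RintegralB//; apply: eq_Rintegral => z _; rewrite mulrBr.
have I1 := identity_ ee mG i3 i4; have I2 := identity mG i5 i6.
rewrite E1 E0 /X2 /LG I1 I2.
have gen (a1 a2 a3 a4 : R) : a1 - a2 = a1 - a3 - (a4 - a3) + (a4 - a2) by ring.
exact: gen.
Qed.

(** X1 and X0 pair uniformly bounded functions with differences that tend to 0 in [Nmix], by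
    continuity of the bump and a common compact support. X2 factors into a time integral and the
    pairing of the initial data with a fixed function of L^q, where weak convergence applies. *)
Lemma bump_test_cvg : LG e @[e --> 0^'+] --> 0.
Proof.
(* Dominated convergence works along sequences, so e is replaced by an arbitrary sequence decreasing
   the problem to indices where all its terms lie in ]0, e0[. *)
apply/cvg_at_rightP => u [u0 uc].
have [N _ hN] : \forall j \near \oo, u j < e0 by apply: cvgr_lt uc _ e0_gt0.
rewrite -(cvg_shiftn N).
pose e j := u (j + N)%N.
have ue j : 0 < e j < e0 by rewrite u0 hN//= leq_addl.
have ur : e @ \oo --> 0^'+.
  move=> A [r /= r0 rA]; have [k0 _ hk] : \forall j \near \oo, u j < r by apply: cvgr_lt uc _ r0.
  exists k0 => // j /= kj; apply: rA; last exact: u0.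
  by rewrite /= sub0r normrN gtr0_norm ?u0// /e hk//= (leq_trans kj)// leq_addr.
have wc x : w_ (e j) x @[j --> \oo] --> wl x by exact: (cvg_comp _ _ ur (@w_cvg x)).
have [K [cK off off_]] := support.
have c1 : X1 (e j) @[j --> \oo] --> 0.
  have mP j := mshift (cw (ue j)).
  have Nc := Nsub_cvg mP (mshift cwl) cK (fun t x It Kx => (off t x It Kx).1)
    (fun j t x It Kx => (off_ (e j) t x (ue j) It Kx).1) (fun t x => @G_cvg _ _ t (cvgD (wc x) (cvg_cst _))).
  apply: (@nm_squeeze (fun j => X1 (e j)) (fun j z => G (shiftW wl z) - G (shiftW (w_ (e j)) z)) C C_ge0); last exact: Nc.
  move=> j.
  have mm : measurable_fun setT (fun z => G (shiftW wl z) - G (shiftW (w_ (e j)) z)).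
    exact: (measurable_funB (mphi (mshift cwl)) (mphi (mP j))).
  have oo := Nsub_oo (mshift cwl) (mP j) cK (fun t x It Kx => (off t x It Kx).1)
    (fun t x It Kx => (off_ (e j) t x (ue j) It Kx).1).
  exact: (pair_C (ue j) mm oo).2.
have c0 : X0 (e j) @[j --> \oo] --> 0.
  have mP j := mbase (cw (ue j)).
  have Nc := Nsub_cvg mP (mbase cwl) cK (fun t x It Kx => (off t x It Kx).2)
    (fun j t x It Kx => (off_ (e j) t x (ue j) It Kx).2) (fun t x => @G_cvg _ _ t (wc x)).
  apply: (@nm_squeeze (fun j => X0 (e j)) (fun j z => G (baseW wl z) - G (baseW (w_ (e j)) z)) C0 C0_ge0); last exact: Nc.
  move=> j.
  have mm : measurable_fun setT (fun z => G (baseW wl z) - G (baseW (w_ (e j)) z)).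
    exact: (measurable_funB (mphi (mbase cwl)) (mphi (mP j))).
  have oo := Nsub_oo (mbase cwl) (mP j) cK (fun t x It Kx => (off t x It Kx).2)
    (fun t x It Kx => (off_ (e j) t x (ue j) It Kx).2).
  exact: (pair_cst (mv0_ (ue j)) (v0_C (ue j)) mm oo).2.
have c2 : X2 (e j) @[j --> \oo] --> 0.
  have c := cvg_comp _ _ ur (v0_weak pb_Lfun).
  set S := \int[leb]_t (\1_I t * \1_(`]-oo, s[%classic) t).
  pose B := S * \int[mu]_x (v0 x * pbump a b k (wl x)).
  have c3 : S * \int[mu]_x (v0_ (e j) x * pbump a b k (wl x)) - B @[j --> \oo] --> B - B.
    by apply: cvgB; [apply: cvgMr; exact: c|exact: cvg_cst].
  move: c3; rewrite subrr; apply: cvg_trans; apply: near_eq_cvg; apply: nearW => j.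
  by rewrite /X2 !int_base// Lfun0_.
have c4 : X1 (e j) - X0 (e j) + X2 (e j) @[j --> \oo] --> (0 - 0 + 0 : R).
  by apply: cvgD => //; exact: cvgB.
move: c4; rewrite subr0 addr0; apply: cvg_trans; apply: near_eq_cvg; apply: nearW => j.
by rewrite -LGE.
Qed.

End bump_test.

Let L e (F : TV -> R) := \int[m]_z (extQ T (v_ e) z * F (shiftW wl z)) - \int[m]_z (extQ T v z * F (shiftW wl z)).
Let Nl (F : TV -> R) := Nm (fun z => F (shiftW wl z)).
Let D (k : nat) : set TV := [set z | z.1 < k%:R /\ obox (fun=> - k%:R) (fun=> k%:R) z.2].

Let mF (F : TV -> R) : measurable_fun setT F -> measurable_fun setT (fun z => F (shiftW wl z)).
Proof. by move=> mF; apply: measurableT_comp => //; exact: measurable_shiftW. Qed.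

Let box_shift (a b : 'I_n.+1 -> R) : exists2 K : set V, compact K &
  forall t x, I t -> obox a b (wl x + t *: evec R ord0) -> K x.
Proof.
have pwl (r : R) : exists2 K : set V, compact K & forall x, `|wl x| <= r -> K x.
  by have [K cK hK] := pw r; exists K => // x h; apply: hK; left.
have [K cK hK] := shiftW_compact T pwl a b; exists K => // t x It; apply: hK.
by move: It; rewrite /= !in_itv /= => /andP[t0 tT]; rewrite !ltW.
Qed.

Let Nl_box (F : TV -> R) (c : R) (a b : 'I_n.+1 -> R) : measurable_fun setT F -> (forall z, `|F z| <= `|c|) ->
  (forall z, ~ obox a b z.2 -> F z = 0) -> (Nl F < +oo)%E.
Proof.
move=> mF_ Fc off; have [K cK hK] := box_shift a b; have mK := compact_measurable_rV cK.
apply: le_lt_trans (Nmix_compact T0 p1 pq c mK (compact_lebesgueN_lty cK)).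
apply: (@Nmix_le R n T p q p1 pq); first exact: mF.
  by apply: measurable_funM => //; apply: (@measurableT_comp _ _ _ _ _ _ (\1_K : V -> R)).
move=> t x It; rewrite indicE; have [Kx|Kx] := pselect (K x); last first.
  by rewrite off ?normr0//= => h; apply: Kx; exact: hK h.
by rewrite mem_set// mulr1.
Qed.

Let L_bound e F : 0 < e < e0 -> measurable_fun setT F -> (Nl F < +oo)%E ->
  (`|L e F|%:E <= (C + C)%:E * Nl F)%E.
Proof.
move=> ee mF_ Foo; have [_ h1] := pair_C ee (mF mF_) Foo; have [_ h2] := pair_v (mF mF_) Foo.
apply: (@le_trans _ _ (`|\int[m]_z (extQ T (v_ e) z * F (shiftW wl z))|%:E +
  `|\int[m]_z (extQ T v z * F (shiftW wl z))|%:E)%E); first by rewrite -EFinD lee_fin; exact: ler_normB.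
by rewrite EFinD ge0_muleDl ?lee_fin//; exact: leeD.
Qed.

Let LDe e F F' : 0 < e < e0 -> measurable_fun setT F -> (Nl F < +oo)%E -> measurable_fun setT F' -> (Nl F' < +oo)%E ->
  L e (fun z => F z + F' z) = L e F + L e F'.
Proof.
move=> ee mF_ Foo mF' Foo'.
have [i1 _] := pair_C ee (mF mF_) Foo; have [i2 _] := pair_v (mF mF_) Foo.
have [i3 _] := pair_C ee (mF mF') Foo'; have [i4 _] := pair_v (mF mF') Foo'.
rewrite /L; under eq_Rintegral do rewrite mulrDr; rewrite RintegralD//.
under [X in _ - X = _]eq_Rintegral do rewrite mulrDr; rewrite RintegralD//.
by rewrite opprD addrACA.
Qed.

Let LZe e c F : 0 < e < e0 -> measurable_fun setT F -> (Nl F < +oo)%E ->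
  L e (fun z => c * F z) = c * L e F.
Proof.
move=> ee mF_ Foo.
have [i1 _] := pair_C ee (mF mF_) Foo; have [i2 _] := pair_v (mF mF_) Foo.
rewrite /L; under eq_Rintegral do rewrite mulrCA; rewrite RintegralZl//.
under [X in _ - X = _]eq_Rintegral do rewrite mulrCA; rewrite RintegralZl//.
by rewrite mulrBr.
Qed.

Let Nl_cvg (h : TV -> R) (h_ : nat -> TV -> R) : dom Nl h -> (forall k, measurable_fun setT (h_ k)) ->
  (forall k x, `|h_ k x| <= `|h x|) -> (forall x, h_ k x @[k --> \oo] --> 0) -> Nl (h_ k) @[k --> \oo] --> 0%E.
Proof.
move=> [mh hoo] mh_ hh h0; apply: (@Nmix_dct R n T p q p1 pq (fun z => h (shiftW wl z))) => //.
- exact: mF.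
- by move=> k; exact: mF.
Qed.

Let Nl_le (g h : TV -> R) : measurable_fun setT g -> measurable_fun setT h ->
  (forall x, `|g x| <= `|h x|) -> (Nl g <= Nl h)%E.
Proof. by move=> mg mh gh; apply: (@Nmix_le R n T p q p1 pq) => //; exact: mF. Qed.

Let Cge0 : 0 <= C + C. Proof. exact: addr_ge0. Qed.

(** Bumps approximate the box from inside, so the indicator of the box itself is the dominating
    function in [limit_cvg0]. *)
Let box_cvg s (a b : 'I_n.+1 -> R) : L e \1_[set z : TV | z.1 < s /\ obox a b z.2] @[e --> 0^'+] --> 0.
Proof.
pose A := [set z : TV | z.1 < s /\ obox a b z.2]; rewrite -/A.
have mA : measurable_fun setT (\1_A : TV -> R) by apply: measurable_indic; exact: measurable_tbox.
pose G_ k (z : TV) : R := \1_(`]-oo, s[%classic) z.1 * pbump a b k z.2.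
have mG k : measurable_fun setT (G_ k).
  apply: measurable_funM.
    by apply: (@measurableT_comp _ _ _ _ _ _ (\1_(`]-oo, s[%classic) : measurableTypeR R -> R)).
  apply: (@measurableT_comp _ _ _ _ _ _ (pbump a b k)) => //.
  by apply: continuous_measurable_rV; exact: Cn_continuous (pbump_C1 a b k).
have AE z : (\1_A z : R) = \1_(`]-oo, s[%classic) z.1 * \1_(obox a b) z.2.
  rewrite !indicE -natrM mulnb; congr (nat_of_bool _)%:R.
  apply/idP/andP => [/set_mem[h1 h2]|[/set_mem /= h1 /set_mem h2]].
    by split; apply/mem_set => //=; rewrite in_itv.
  by apply/mem_set; split => //; move: h1; rewrite in_itv.
have dA : dom Nl \1_A.
  split => //; apply: (@Nl_box _ 1 a b) => // z.
    by rewrite normr1 indicE; case: (_ \in _); rewrite ?normr1 ?normr0.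
  by move=> h; rewrite indicE memNset// => -[].
have dG k : dom Nl (G_ k).
  split => //; apply: (@Nl_box _ 1 a b) => // z.
    rewrite normr1 normrM; have /andP[h0 h1] := pbump_itv a b k z.2; rewrite (ger0_norm h0) indicE.
    by case: (_ \in _); rewrite ?normr1 ?normr0 ?mul1r ?mul0r.
  by move=> h; rewrite /G_ pbump_out// mulr0.
apply: (@limit_cvg0 _ _ R Nl L (C + C) e0 e0_gt0 Cge0 _ _ _ _ _ _ (\1_A) G_) => //.
- by move=> h; exact: Nmix_ge0.
- by move=> e g h ee [mg goo] [mh hoo]; exact: LDe.
- by move=> e h ee [mh hoo]; exact: L_bound.
- move=> k z; rewrite AE /G_ -mulrBr !normrM.
  have /andP[h0 h1] := pbump_itv a b k z.2.
  apply: ler_wpM2l => //; rewrite indicE.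
  case: (boolP (z.2 \in obox a b)) => [zo|/negP zo]; last first.
    by rewrite pbump_out ?subrr// => /mem_set.
  by rewrite ger0_norm ?subr_ge0// normr1 gerBl.
- move=> z; rewrite AE; exact: (cvgM (cvg_cst _) (@pbump_cvg _ _ a b z.2)).
- by move=> k; exact: bump_test_cvg.
Qed.

(** The density theorem on space-time, with the norm of L^1(0,T;L^q) read through the limit shift;
    the functionals are bounded by the sum of the bounds for v_e and v. *)
Lemma shifted_cvg (F : TV -> R) : measurable_fun setT F -> (Nm (fun z => F (shiftW wl z)) < +oo)%E ->
  \int[m]_z (extQ T (v_ e) z * F (shiftW wl z)) @[e --> 0^'+] --> \int[m]_z (extQ T v z * F (shiftW wl z)).
Proof.
move=> mF_ Foo.
have : L e F @[e --> 0^'+] --> 0.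
  apply: (@density_cvg0 _ _ R Nl L (@tboxes R n.+1) D (C + C) e0) => //.
  - exact: RV_measurable_tboxes.
  - exact: tboxes_setI.
  - by move=> k; exists k%:R, (fun=> - k%:R), (fun=> k%:R).
  - move=> z; near=> k; split; first by near: k; exact: nbhs_infty_gtr.
    by near: k; exact: rV_eventually_obox.
  - by move=> h; exact: Nmix_ge0.
  - move=> k c; apply: (@Nl_box _ c (fun=> - k%:R) (fun=> k%:R)).
    + apply: measurable_funM => //; apply: measurable_indic; exact: measurable_tbox.
    + by move=> z; rewrite normrM ler_piMr// indicE; case: (_ \in _); rewrite ?normr1 ?normr0.
    + by move=> z h; rewrite indicE memNset ?mulr0// => -[].
  - by move=> e g h ee [mg goo] [mh hoo]; exact: LDe.
  - by move=> e c h ee [mh hoo]; exact: LZe.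
  - by move=> e h ee [mh hoo]; exact: L_bound.
  - by move=> A k [s [a [b ->]]] _; exact: box_cvg.
move=> c; set B := \int[m]_z (extQ T v z * F (shiftW wl z)).
have c2 : L e F + B @[e --> 0^'+] --> 0 + B by apply: cvgD => //; exact: cvg_cst.
move: c2; rewrite add0r; apply: cvg_trans; apply: near_eq_cvg; apply: nearW => e /=.
by rewrite /L subrK.
Unshelve. all: by end_near. Qed.

End convergence.

(** * The limit problem, with linear map and constant field *)

Section linear_flow.
Variables (R : realType) (n : nat) (M : 'M[R]_n.+1).
Local Notation V := 'rV[R]_n.+1.
Local Notation TV := (measurableTypeR R * V)%type.
Hypothesis Mu : M \in unitmx.
Let wl (x : V) : V := x *m M^T.

Lemma continuous_mulmx (A : 'M[R]_n.+1) : continuous (fun x : V => x *m A).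
Proof.
apply: continuous_rV => j; apply: (@Cn_continuous _ _ 0); under eq_fun do rewrite mxE.
by apply: Cn_sum => i _; under eq_fun do rewrite mulrC; apply: CnZ; exact: Cn_coord.
Qed.

(** For the linear map the shift has an explicit measurable inverse, through which any test function
    becomes a function of the shifted point. *)
Definition unshift (z : TV) : TV := (z.1, (z.2 - z.1 *: evec R ord0) *m invmx M^T).

Lemma unshiftK z : unshift (shiftW wl z) = z.
Proof. by case: z => t x; rewrite /unshift /shiftW /= addrK /wl mulmxK ?unitmx_tr. Qed.

Lemma measurable_unshift : measurable_fun setT unshift.
Proof.
apply/measurable_fun_pairP; split => /=; first exact: measurable_fst.
apply: (@measurableT_comp _ _ _ _ _ _ (fun x : V => x *m invmx M^T)).
  by apply: measurable_continuous_field; exact: continuous_mulmx.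
apply: measurable_fun_rVP => i; under eq_fun do rewrite mxE [X in _ + X]mxE [X in _ - X]mxE.
apply: measurable_funB; first exact: (measurableT_comp (@measurable_rV_coord R n.+1 i) measurable_snd).
by apply: measurable_funM => //; exact: measurable_fst.
Qed.

End linear_flow.

Section limit_transport.
Variables (R : realType) (n : nat) (T p sigma0 : R) (xi0 : 'rV[R]_n.+2) (v0 : 'rV[R]_n.+2 -> R) (v : R -> 'rV[R]_n.+2 -> R).

(** The field xi_0 / sigma_0 is constant, so the divergence of phi times it is the derivative of phi
    along it, and the limit equation becomes a transport equation for v. *)
Lemma limit_transport : limit_solution T p sigma0 xi0 v0 v ->
  transport_solution T p (fun=> sigma0^-1 *: xi0) v0 v.
Proof.
move=> [vL vw]; split => // phi hphi; rewrite vw//.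
congr (int_tx T _); apply/funext => t; apply/funext => x; rewrite -mulrA; congr (_ * _).
rewrite /dotv mulr_sumr /divergence; apply: eq_bigr => i _.
have [_ _ /(_ i)[/(_ t x) d _] _] := hphi.
rewrite mxE; have /derivableP h := d.
rewrite (_ : comp_of _ i = fun y => (sigma0^-1 * xi0 ord0 i) *: phi t y); last first.
  by apply/funext => y; rewrite /comp_of !mxE mulrC.
rewrite (is_derive_partial (is_deriveZ _ h)).
by rewrite mulrA.
Qed.

End limit_transport.

(** * Assembly of the convergence result *)

Section homogenization.
Variables (R : realType) (n : nat) (T p q : R).
Hypothesis hT : 0 < T.
Hypotheses (hp : 1 < p) (hpq : p^-1 + q^-1 = 1).
Variables (W : 'rV[R]_n.+2 -> 'rV[R]_n.+2) (M : 'M[R]_n.+2).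
Hypothesis hW : Cnv 2 W.
Hypothesis hWM : Cnv_per 1 (fun x => W x - x *m M^T).
Variable sigma : 'rV[R]_n.+2 -> R.
Hypothesis hsigma : forall x, sigma x = \det (Dmx W x).
Hypothesis hsigma0 : forall x, 0 < sigma x.
Variable b : 'rV[R]_n.+2 -> 'rV[R]_n.+2.
Hypothesis hb : Cnv_per 1 b.
Hypothesis hsb : forall x, sigma x *: b x = sigma_b W x.

Local Notation V := 'rV[R]_n.+2.
Local Notation mu := (lebesgueN R n.+2).
Local Notation leb := (@lebesgue_measure R).
Local Notation TV := (measurableTypeR R * V)%type.
Local Notation I := (`]0, T[%classic : set R).
Local Notation m := ((leb \x mu)%E).
Let We (e : R) (x : V) := e *: W (e^-1 *: x).
Let be (e : R) (x : V) := b (e^-1 *: x).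
Let se (e : R) (x : V) := sigma (e^-1 *: x).
Let wl (x : V) : V := x *m M^T.

Let sigmaE : sigma = (fun x => \det (Dmx W x)). Proof. exact/funext. Qed.
Let det0 x : 0 < \det (Dmx W x). Proof. by rewrite -hsigma. Qed.

Let We_C2 e : Cnv 2 (We e). Proof. by move=> j; exact: Cn_We. Qed.
Let We_C1 e : Cnv 1 (We e). Proof. by move=> j; exact: Cn_We. Qed.
Let We_cont e : continuous (We e).
Proof. by apply: continuous_rV => j; exact: Cn_continuous (We_C1 e j). Qed.

Let We_pw e : 0 < e < 1 -> forall r : R, exists2 K : set V, compact K & forall x, `|We e x| <= r -> K x.
Proof.
by move=> ee r; have [K cK hK] := We_proper hWM hsigma hsigma0 r; exists K => // x; exact: hK.
Qed.

Let We_sb e : 0 < e -> forall x, se e x *: be e x = crossW (We e) x.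
Proof. by move=> e0 x; rewrite -sigma_bE; exact: (sigma_b_We hW hsb). Qed.

Let We_Sw e : 0 < e -> forall x j, dotv (grad (comp_of (We e) j) x) (crossW (We e) x) = if j == ord0 then se e x else 0.
Proof.
by move=> e0 x j; rewrite dotv_grad_crossW /se hsigma (Dmx_We hW).
Qed.

Let Mu : M \in unitmx. Proof. exact: (M_unit hWM det0). Qed.

Let wl_C1 : Cnv 1 wl. Proof. by move=> j; exact: Cn_lin. Qed.

Let w_cvg x : We e x @[e --> 0^'+] --> wl x.
Proof.
have [C C0 PC] := P_bounded hWM.
apply/cvgrPdist_lt => eps eps0; near=> e.
have e0 : 0 < e by near: e; exact: nbhs_right_gt.
rewrite /We (We_lin W M x e0) opprD addrA subrr sub0r normrN normrZ gtr0_norm//.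
rewrite (@le_lt_trans _ _ (e * (C + 1)))//.
  by apply: ler_wpM2l; [exact: ltW|apply: le_trans (PC _) _; rewrite lerDl].
have C1 : 0 < C + 1 by rewrite addr_gt0.
by rewrite -ltr_pdivlMr//; near: e; apply: nbhs_right_lt; rewrite divr_gt0// addr_gt0.
Unshelve. all: by end_near. Qed.

Let lin_proper (r : R) : exists2 K : set V, compact K &
  forall x, `|wl x| <= r \/ (exists2 e, 0 < e < 1 & `|We e x| <= r) -> K x.
Proof.
have [K cK hK] := We_proper hWM hsigma hsigma0 r.
exists (K `|` [set x | `|x| <= r * \sum_i \sum_j `|invmx M^T i j|]).
  by apply: compactU => //; exact: closed_ball_compact.
move=> x [wr|[e ee er]]; last by left; exact: hK er.
right; have -> : x = wl x *m invmx M^T by rewrite mulmxK ?unitmx_tr.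
rewrite /=.
by rewrite (le_trans (norm_mulmx_le _ _))// ler_wpM2r// sumr_ge0// => i _; rewrite sumr_ge0.
Qed.

Let sigma0 := average sigma.
Let xi0 := average_field (fun x => sigma x *: b x).

Let s0 : 0 < sigma0. Proof. by rewrite /sigma0 sigmaE; exact: (average_sigma_gt0 hW hWM det0). Qed.

(** The relation M xi_0 = sigma_0 e_1 of [average_crossW], divided by sigma_0: the limit field
    straightens along the linear map with weight 1. *)
Let wl_S x j : dotv (grad (comp_of wl j) x) (sigma0^-1 *: xi0) = if j == ord0 then 1 else 0.
Proof.
transitivity (sigma0^-1 * \sum_i M j i * average (comp_of (crossW W) i)).
  rewrite /dotv mulr_sumr; apply: eq_bigr => i _; rewrite !mxE partial_lin mulrCA; congr (_ * (_ * average _)).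
  by apply/funext => y; rewrite /comp_of hsb sigma_bE.
rewrite (average_crossW hW hWM); case: ifP => _; last by rewrite mulr0.
by rewrite /sigma0 sigmaE mulVf// gt_eqF// -sigmaE.
Qed.

Let div_cst (y : V) x : divergence (fun _ : V => y) x = 0.
Proof.
rewrite /divergence big1// => i _; apply: is_derive_partial; exact: is_derive_cst.
Qed.

Variables (u0 : R -> V -> R) (v0 : V -> R) (u : R -> R -> V -> R) (v : R -> V -> R).
Hypothesis hu0 : forall e : R, 0 < e -> u0 e \in Lfun mu p%:E.
Hypothesis hv0 : v0 \in Lfun mu p%:E.
Hypothesis hweak : weak_cvg_Lp p (fun e x => se e x * u0 e x) v0.
Hypothesis hu : forall e : R, 0 < e -> transport_solution T p (be e) (u0 e) (u e).
Hypothesis hv : limit_solution T p sigma0 xi0 v0 v.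

Let q_conj : hoelder_conjugate p%:E = q%:E.
Proof. by rewrite hoelder_conjugate_real// -(conj_eq hp hpq). Qed.

Let v_ e t x := se e x * u e t x.
Let v0_ e x := se e x * u0 e x.

Lemma weakstar_transport : weakstar_cvg T p v_ v.
Proof.
have [c c1 sc] := sigma_bounds hW hWM det0.
have sV e x : c^-1 <= se e x by rewrite /se hsigma; have /andP[] := sc (e^-1 *: x).
have sC e x : `|se e x| <= c.
  by rewrite /se gtr0_norm// hsigma; have /andP[] := sc (e^-1 *: x).
have sC1 e := se_C1 hW hsigma e.
have L0 e : 0 < e -> v0_ e \in Lfun mu p%:E.
  by move=> e0; exact: (Lfun_scale hp (sC1 e) (sC e) (hu0 e0)).
have weak h : h \in Lfun mu q%:E -> \int[mu]_x (v0_ e x * h x) @[e --> 0^'+] --> \int[mu]_x (v0 x * h x).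
  by move=> hq; apply: hweak; rewrite q_conj.
have [e1 [beta [e1_gt0 hbeta]]] := weak_cvg_bounded hp hpq L0 weak.
(* Below 1 the maps W_e are uniformly proper; below e1 the initial data are uniformly bounded. *)
pose e0 := Num.min 1 e1.
have e0_gt0 : 0 < e0 by rewrite lt_min ltr01.
have ee1 e : 0 < e < e0 -> 0 < e < 1 by move=> /andP[-> /=]; rewrite lt_min => /andP[].
have eeb e : 0 < e < e0 -> 0 < e < e1 by move=> /andP[-> /=]; rewrite lt_min => /andP[].
have ep e : 0 < e < e0 -> 0 < e by move=> /andP[].
have [mv [Cv Cv0 hCv]] := Linfty_Lp_ext hv.1.
pose A := (c `^ (2 * (p - 1)) * beta) `^ p^-1.
(* One constant for the family and its limit: A bounds every v_e independently of e, and Cv comes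
   with the solution v. *)
pose C := A + Cv; have A0 : 0 <= A by exact: powR_ge0.
have C_ge0 : 0 <= C by rewrite addr_ge0.
pose B := fine ('N[mu]_(p%:E)[EFin \o v0])%E.
have BE : ('N[mu]_(p%:E)[EFin \o v0])%E = B%:E.
  by rewrite fineK// ge0_fin_numE ?Lnorm_ge0//; have [] := (LfunE _ _ _).1 hv0.
have B0 : 0 <= B by rewrite -lee_fin -BE Lnorm_ge0.
pose C0 := beta `^ p^-1 + B; have C0_ge0 : 0 <= C0 by rewrite addr_ge0// powR_ge0.
have FF : Filter (almost_everywhere leb) by exact: ae_filter_ringOfSetsType.
have bound e : 0 < e < e0 -> \forall t \ae leb, I t ->
    ('N[mu]_(p%:E)[EFin \o (fun x => extQ T (v_ e) (t, x))%R] <= C%:E)%E.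
  (* Injectivity of W_e supplies the measurable left inverse with which the dual test function is
     built. *)
  move=> ee; have inj := proper_injective (We_C1 e) _ (We_pw (ee1 _ ee)).
  have [|g [mg gK]] := @measurable_left_inverse R n.+2 (We e) (@We_cont e).
    by apply: inj => x; rewrite (Dmx_We hW)// ep.
  have := transport_bound hT hp hpq (We_C1 e) (sC1 e) (We_pw (ee1 _ ee)) (We_sb (ep _ ee))
    (crossW_C1 (We_C2 e)) (div_crossW (We_C2 e)) (We_Sw (ep _ ee)) (sC e) (hu0 (ep _ ee)) (hu (ep _ ee))
    mg gK c1 (sV e) (hbeta _ (eeb _ ee)).
  apply: (@filterS _ _ FF) => t h It; apply: le_trans (h It) _.
  by rewrite lee_fin lerDl.
have boundv : \forall t \ae leb, I t -> ('N[mu]_(p%:E)[EFin \o (fun x => extQ T v (t, x))%R] <= C%:E)%E.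
  move: hCv; apply: (@filterS _ _ FF) => t h It; apply: le_trans (h It) _.
  by rewrite lee_fin lerDr.
have mv_ e : 0 < e < e0 -> measurable_fun setT (extQ T (v_ e)).
  move=> ee; rewrite (_ : extQ T _ = fun z => se e z.2 * extQ T (u e) z).
    apply: measurable_funM; last by have [] := Linfty_Lp_ext (hu (ep _ ee)).1.
    apply: measurableT_comp => //; apply: continuous_measurable_rV; exact: Cn_continuous (sC1 e).
  by apply/funext => z; rewrite /extQ mulrA.
have bound0 e : 0 < e < e0 -> ('N[mu]_(p%:E)[EFin \o v0_ e] <= C0%:E)%E.
  move=> ee; apply: (@le_trans _ _ (beta `^ p^-1)%:E); last by rewrite lee_fin lerDl.
  have ge0 : (0 <= \int[mu]_x (`|v0_ e x| `^ p)%:E)%E by apply: integral_ge0 => x _; rewrite lee_fin powR_ge0.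
  rewrite LnormE -poweR_EFin; apply: gt0_ler_poweR; rewrite ?in_itv/= ?ge0 ?leey//.
  - by rewrite invr_ge0 ltW// (lt_trans ltr01).
  - by rewrite (le_trans ge0)// hbeta// eeb.
  - by apply: hbeta; exact: eeb.
have boundv0 : ('N[mu]_(p%:E)[EFin \o v0] <= C0%:E)%E by rewrite BE lee_fin lerDr powR_ge0.
have cwl : continuous wl by exact: continuous_mulmx.
have proper (r : R) : exists2 K : set V, compact K &
    forall x, `|wl x| <= r \/ (exists2 e, 0 < e < e0 & `|We e x| <= r) -> K x.
  have [K cK hK] := lin_proper r; exists K => // x [h|[e ee h]]; apply: hK; [by left|right].
  by exists e => //; exact: ee1.
have id_ e (ee : 0 < e < e0) h := @transport_identity R n.+1 T p q c (We e) (se e) (be e) (crossW (We e)) (u e) (u0 e)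
  hT hp hpq (We_C1 e) (sC1 e) (We_pw (ee1 _ ee)) (We_sb (ep _ ee)) (crossW_C1 (We_C2 e)) (div_crossW (We_C2 e))
  (We_Sw (ep _ ee)) (sC e) (hu0 (ep _ ee)) (hu (ep _ ee)) h.
have E1 : (fun t x => 1 * v t x) = v by apply/funext => t; apply/funext => x; rewrite mul1r.
have E2 : (fun x => 1 * v0 x) = v0 by apply/funext => x; rewrite mul1r.
have pwl (r : R) : exists2 K : set V, compact K & forall x, `|wl x| <= r -> K x.
  by have [K cK hK] := lin_proper r; exists K => // x h; apply: hK; left.
have C1_1 : Cn 1 (fun _ : V => 1 : R) by exact: Cn_cst.
have S_C1 : Cnv 1 (fun _ : V => sigma0^-1 *: xi0) by move=> j; exact: Cn_cst.
have n1 (x : V) : `|1 : R| <= 1 by rewrite normr1.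
(* The limit identity is the same lemma with weight 1, so that v itself plays the part of sigma_e
   u_e. *)
have idl h := @transport_identity R n.+1 T p q 1 wl (fun=> 1) (fun=> sigma0^-1 *: xi0) (fun=> sigma0^-1 *: xi0) v v0
  hT hp hpq wl_C1 C1_1 pwl (fun x => scale1r _) S_C1 (div_cst _) wl_S n1 hv0 (limit_transport hv) h.
rewrite E1 E2 in idl.
have mv0_ e : 0 < e < e0 -> measurable_fun setT (v0_ e).
  by move=> ee; have [] := (LfunE _ _ _).1 (L0 _ (ep _ ee)).
have mv0 : measurable_fun setT v0 by have [] := (LfunE _ _ _).1 hv0.
have cvg (F : TV -> R) := @shifted_cvg R n.+1 T p q wl We v_ v0_ v v0 C0 C e0 hT hp hpq e0_gt0 cwl
  (fun e _ => @We_cont e) w_cvg proper C_ge0 C0_ge0 mv_ mv bound boundv mv0_ mv0 bound0 boundv0 weak id_ idl F.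
move=> psi; rewrite q_conj => -[mpsi psioo].
have mP := measurable_extQ mpsi.
have Noo : (Nmix T q (extQ T psi) < +oo)%E.
  apply: le_lt_trans psioo; rewrite le_eqVlt; apply/orP; left; apply/eqP.
  apply: eq_integral => t tI; congr ('N[mu]_(q%:E)[_])%E; apply/funext => x /=.
  by rewrite /extQ indicE tI mulr1.
(* Invertibility of the linear shift writes an arbitrary psi as F composed with it, the form treated
   in [shifted_cvg]. *)
pose F := extQ T psi \o unshift M.
have FE z : F (shiftW wl z) = extQ T psi z by rewrite /F /= unshiftK.
have mF : measurable_fun setT F by apply: measurableT_comp => //; exact: measurable_unshift.
have NF : (Nmix T q (fun z => F (shiftW wl z)) < +oo)%E by under eq_fun do rewrite FE.
have extM (f : R -> V -> R) : extQ T (fun t x => f t x * psi t x) = fun z => extQ T f z * F (shiftW wl z).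
  apply/funext => z; rewrite FE /extQ indicE mulrACA; case: (_ \in _); rewrite ?mulr1 ?mulr0 ?mul0r//.
have mFs : measurable_fun setT (fun z => F (shiftW wl z)).
  by under eq_fun do rewrite FE.
have il : int_tx T (fun t x => v t x * psi t x) = \int[m]_z (extQ T v z * F (shiftW wl z)).
  rewrite int_txE extM//.
  exact: (mixed_integrable hp hpq C_ge0 mv (@extQ_out _ _ _ _) mFs boundv NF).
rewrite il; have := cvg F mF NF; apply: cvg_trans; apply: near_eq_cvg; near=> e.
have ee : 0 < e < e0.
  by apply/andP; split; near: e; [exact: nbhs_right_gt|exact: nbhs_right_lt].
rewrite int_txE extM//.
exact: (mixed_integrable hp hpq C_ge0 (mv_ _ ee) (@extQ_out _ _ _ _) mFs (bound _ ee) NF).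
Unshelve. all: by end_near. Qed.

End homogenization.

(* The dimension is N = n.+2. *)
Theorem proposition3p1 (R : realType) (n : nat) (T p q : R)
  (hT : 0 < T) (hp : 1 < p) (hpq : p^-1 + q^-1 = 1)
  (W : 'rV[R]_n.+2 -> 'rV[R]_n.+2) (M : 'M[R]_n.+2)
  (hW : Cnv 2 W)
  (hWM : Cnv_per 1 (fun x => W x - x *m M^T))
  (sigma : 'rV[R]_n.+2 -> R)
  (hsigma : forall x, sigma x = \det (Dmx W x))
  (hsigma0 : forall x, 0 < sigma x)
  (b : 'rV[R]_n.+2 -> 'rV[R]_n.+2)
  (hb : Cnv_per 1 b)
  (hsb : forall x, sigma x *: b x = sigma_b W x)
  (u0 : R -> 'rV[R]_n.+2 -> R)
  (hu0 : forall e : R, 0 < e -> Cn 1 (u0 e))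
  (hu0p : forall e : R, 0 < e -> u0 e \in Lfun (lebesgueN R n.+2) p%:E)
  (hu0b : exists C : R, forall e : R, 0 < e ->
     ('N[lebesgueN R n.+2]_(p%:E)[EFin \o u0 e] <= C%:E)%E) :
  let We (e : R) (x : 'rV[R]_n.+2) := e *: W (e^-1 *: x) in
  let be (e : R) (x : 'rV[R]_n.+2) := b (e^-1 *: x) in
  let se (e : R) (x : 'rV[R]_n.+2) := sigma (e^-1 *: x) in
  [/\ (forall e : R, 0 < e -> Cnv 1 (We e)) /\
      (forall K : set 'rV[R]_n.+2, compact K ->
       exists2 K' : set 'rV[R]_n.+2, compact K' &
         \forall e \near 0^'+, We e @^-1` K `<=` K'),
      exists W0 : 'rV[R]_n.+2 -> 'rV[R]_n.+2,
        [/\ Cnv 1 W0,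
            {family compact, We e @[e --> 0^'+] --> W0} &
            forall j, weak_cvg_W1p_loc n.+2%:R
              (fun e => comp_of (We e) j) (comp_of W0 j)],
      [/\ forall e : R, 0 < e ->
            [/\ Cnv 0 (be e), bounded_field (be e),
                forall j, W1p_loc q (comp_of (be e) j) &
                exists2 d, weak_divergence (be e) d &
                  exists B : R, \forall x \ae lebesgueN R n.+2, `|d x| <= B],
          forall e : R, 0 < e -> Cn 0 (se e) /\ W1p_loc q (se e),
          exists2 c : R, 1 < c &
            forall e : R, 0 < e -> forall x : 'rV[R]_n.+2,
              c^-1 <= se e x <= c &
          forall e : R, 0 < e -> forall x : 'rV[R]_n.+2,
            se e x *: be e x = sigma_b (We e) x],
      exists theta0 : 'rV[R]_n.+2 -> R,
        let theta (e : R) (x : 'rV[R]_n.+2) :=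
          dotv (be e x) (grad (comp_of (We e) ord0) x) in
        [/\ Cn 0 theta0, forall x, 0 < theta0 x,
            forall e : R, 0 < e -> forall x : 'rV[R]_n.+2, 0 < theta e x &
            strong_cvg_Lp_loc q theta theta0] &
      (exists2 B : R, 0 < B & forall e : R, 0 < e ->
         exists2 d, weak_divergence (be e) d &
           \forall x \ae lebesgueN R n.+2, `|d x| <= B) \/
      (forall e : R, 0 < e ->
         [/\ Cnv 1 (be e), bounded_field (be e), Cn 1 (se e) & Cn 1 (u0 e)])]
  /\
  (forall (u0' : R -> 'rV[R]_n.+2 -> R) (v0 : 'rV[R]_n.+2 -> R)
          (u : R -> R -> 'rV[R]_n.+2 -> R) (v : R -> 'rV[R]_n.+2 -> R),
     (forall e : R, 0 < e -> u0' e \in Lfun (lebesgueN R n.+2) p%:E) ->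
     v0 \in Lfun (lebesgueN R n.+2) p%:E ->
     weak_cvg_Lp p (fun e x => se e x * u0' e x) v0 ->
     (forall e : R, 0 < e -> transport_solution T p (be e) (u0' e) (u e)) ->
     limit_solution T p (average sigma)
       (average_field (fun x => sigma x *: b x)) v0 v ->
     weakstar_cvg T p (fun e t x => se e x * u e t x) v).
Proof.
move=> We be se; split.
  split; [exact: (rescaled_proper hW hWM hsigma hsigma0)|exact: (rescaled_cvg hW hWM)|
    exact: (rescaled_regularity hp hpq hW hWM hsigma hsigma0 hb hsb)|exact: (transversality_cvg hp hpq hW hsigma hsigma0 hsb)|right].
  (* Of the two alternatives in (e) it is the smooth one that holds in general: the divergence of
     b_e carries a factor 1/e. *)
  move=> e e0; split; [exact: (be_C1 hb)|exact: (be_bounded hb)|exact: (se_C1 hW hsigma)|exact: hu0].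
move=> u0' v0 u v hu0' hv0 hweak hu hv.
exact: (weakstar_transport hT hp hpq hW hWM hsigma hsigma0 hsb hu0' hv0 hweak hu hv).
Qed.
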